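(* There exists a positive number $\tilde R<1$, depending only on $n$, such that the following holds. If $0<R_1<R_2<R_3\le R_0$ and $R_1/R_3<R_2/R_3<\tilde R$, then $$\int_{|x|<R_2}|U|^2\,dx\le C\left(\int_{|x|<R_1}|U|^2\,dx\right)^{\tau}\left(\int_{|x|<R_3}|U|^2\,dx\right)^{1-\tau}$$ for every $(u,p)\in (H^1(B_{R_0}))^{n+1}$ satisfying the Stokes system $$\Delta u+A(x)\cdot\nabla u+\nabla p=0,\qquad \operatorname{div}u=0$$ in $B_{R_0}$, where $U(x)=\left[|x|^4|\nabla p(x)|^2+|x|^2|p(x)|^2+|u(x)|^2\right]^{1/2}$. Here the constant $C$ depends only on $R_2/R_3$ and $n$, and the exponent $0<\tau<1$ depends only on $R_1/R_3$, $R_2/R_3$ and $n$. Moreover, for fixed $R_2$ and $R_3$, the exponent $\tau$ behaves like $1/(-\log R_1)$ when $R_1$ is sufficiently small (i.e. $\tau$ is bounded above and below by positive constants, independent of $R_1$, times $1/(-\log R_1)$).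
   Context: $n\ge 2$, and $\Omega\subset\mathbb{R}^n$ is a connected open set containing $0$. $B_r$ denotes the open ball of radius $r>0$ centered at the origin, and $0<R_0\le 1$ is such that $B_{R_0}\subset\Omega$. $A:\Omega\to\mathbb{R}^n$ is a measurable vector field satisfying $|A(x)|\le C_0\,|\log|x||^{-3}|x|^{-1}$ for all $x\in\Omega$, where $C_0>0$ is a constant fixed throughout (so dependence of constants on $C_0$ is not tracked). The unknowns are $u=(u_1,\dots,u_n)$ (vector valued) and $p$ (scalar), and $A\cdot\nabla u=(A\cdot\nabla u_1,\dots,A\cdot\nabla u_n)$. Solutions are understood in the weak (distributional) sense. *)

(* Defs.v *)
From HB Require Import structures.
From mathcomp Require Import all_boot all_order all_algebra.
From mathcomp Require Import all_classical all_reals all_analysis.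
Set Implicit Arguments.
Unset Strict Implicit.
Unset Printing Implicit Defensive.
Import Order.TTheory GRing.Theory Num.Theory.
Import numFieldNormedType.Exports.
Local Open Scope classical_set_scope.
Local Open Scope ring_scope.

(* The library has neither a sigma-algebra nor a Lebesgue measure on 'rV[R]_n.
   As for its tuples, the sigma-algebra is the one generated by the coordinates,
   i.e. the Borel sigma-algebra of R^n. *)
Definition measure_rV_display : measure_display -> measure_display.
Proof. exact. Qed.

Section measurable_rV.
Context {d} {T : measurableType d} (n : nat).

Let coord (i : 'I_n) (x : 'rV[T]_n) : T := x ord0 i.

Let rV_set0 : g_sigma_preimage coord set0.
Proof. exact: sigma_algebra0. Qed.

Let rV_setC A : g_sigma_preimage coord A -> g_sigma_preimage coord (~` A).
Proof. exact: sigma_algebraC. Qed.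

Let rV_bigcup (F : (set _)^nat) : (forall i, g_sigma_preimage coord (F i)) ->
  g_sigma_preimage coord (\bigcup_i (F i)).
Proof. exact: sigma_algebra_bigcup. Qed.

HB.instance Definition _ := @isMeasurable.Build (measure_rV_display d)
  'rV[T]_n (g_sigma_preimage coord) rV_set0 rV_setC rV_bigcup.

Lemma measurable_coord_rV (i : 'I_n) :
  measurable_fun [set: 'rV[T]_n] (fun x => x ord0 i).
Proof.
move=> _ Y mY; rewrite setTI; apply: sub_sigma_algebra => /=.
rewrite -bigcup_seq/=; exists i => /=; first by rewrite mem_index_enum.
by exists Y => //; rewrite setTI.
Qed.

Lemma measurable_fun_rVP d1 (T1 : measurableType d1) (f : T1 -> 'rV[T]_n) :
  (forall i, measurable_fun [set: T1] (fun x => f x ord0 i)) ->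
  measurable_fun [set: T1] f.
Proof.
move=> mf.
suff : g_sigma_preimage (fun i x => f x ord0 i) `<=` measurable.
  rewrite (g_sigma_preimage_comp coord f) => + _ A mA.
  by apply; exists A.
apply: smallest_sub; first exact: sigma_algebra_measurable.
move=> A; rewrite -bigcup_seq => -[i _ [B mB <-]].
exact: mf.
Qed.

End measurable_rV.

Section lebesgue_rV.
Context {R : realType}.
Local Open Scope ereal_scope.

Definition cons_rV n (x : R * 'rV[R]_n) : 'rV[R]_n.+1 :=
  \row_i oapp (x.2 ord0) x.1 (unlift ord0 i).

Definition uncons_rV n (x : 'rV[R]_n.+1) : R * 'rV[R]_n :=
  (x ord0 ord0, \row_j x ord0 (lift ord0 j)).

Lemma cons_rV0 n (x : R * 'rV[R]_n) : cons_rV x ord0 ord0 = x.1.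
Proof. by rewrite mxE unlift_none. Qed.

Lemma cons_rVS n (x : R * 'rV[R]_n) j :
  cons_rV x ord0 (lift ord0 j) = x.2 ord0 j.
Proof. by rewrite mxE liftK. Qed.

Lemma cons_rVK n : cancel (@cons_rV n) (@uncons_rV n).
Proof.
move=> [a x]; rewrite /uncons_rV cons_rV0; congr (_, _).
by apply/rowP => j; rewrite mxE cons_rVS.
Qed.

Lemma measurable_cons_rV n :
  measurable_fun [set: R * 'rV[R]_n] (@cons_rV n).
Proof.
apply: measurable_fun_rVP => i.
case: (unliftP ord0 i) => [j ->|->].
  under eq_fun do rewrite cons_rVS.
  exact: (measurableT_comp (measurable_coord_rV j) measurable_snd).
under eq_fun do rewrite cons_rV0.
exact: measurable_fst.
Qed.

Lemma measurable_uncons_rV n :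
  measurable_fun [set: 'rV[R]_n.+1] (@uncons_rV n).
Proof.
apply/measurable_fun_pairP; split; first exact: measurable_coord_rV.
apply: measurable_fun_rVP => i.
under eq_fun do rewrite mxE.
exact: measurable_coord_rV.
Qed.

Section step.
Context (n : nat) (mu : {sigma_finite_measure set 'rV[R]_n -> \bar R}).

Definition prod_lebesgue_rV (A : set 'rV[R]_n.+1) : \bar R :=
  pushforward (lebesgue_measure \x mu) (@cons_rV n) A.

Let m0 : prod_lebesgue_rV set0 = 0.
Proof. by rewrite /prod_lebesgue_rV /pushforward preimage_set0 measure0. Qed.

Let m_ge0 A : 0 <= prod_lebesgue_rV A.
Proof. by rewrite /prod_lebesgue_rV /pushforward measure_ge0. Qed.

Let m_sigma_additive : semi_sigma_additive prod_lebesgue_rV.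
Proof.
have mc A : measurable A -> measurable (@cons_rV n @^-1` A).
  by move=> mA; rewrite -[X in measurable X]setTI; exact: measurable_cons_rV.
move=> F mF tF mUF; rewrite /prod_lebesgue_rV /pushforward preimage_bigcup.
apply: measure_semi_sigma_additive.
- by move=> k; exact: mc.
- apply/trivIsetP => /= i j _ _ ij; rewrite -preimage_setI.
  by move/trivIsetP : tF => /(_ _ _ _ _ ij) ->//; rewrite preimage_set0.
- by rewrite -preimage_bigcup; exact: mc.
Qed.

HB.instance Definition _ := isMeasure.Build _ _ _
  prod_lebesgue_rV m0 m_ge0 m_sigma_additive.

Let m_sigma_finite : sigma_finite setT prod_lebesgue_rV.
Proof.
have /sigma_finiteP[F [TF ndF Foo]] := sigma_finiteT (@lebesgue_measure R).
have /sigma_finiteP[G [TG ndG Goo]] := sigma_finiteT mu.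
exists (fun k => @uncons_rV n @^-1` (F k `*` G k)).
  rewrite -preimage_bigcup (_ : \bigcup_k _ = setT) ?preimage_setT//.
  apply/seteqP; split => // -[x y] _.
  have [k _ Fkx] : (\bigcup_k F k) x by rewrite -TF.
  have [l _ Gly] : (\bigcup_k G k) y by rewrite -TG.
  exists (maxn k l) => //; split => /=.
  - by move: x Fkx; exact/subsetPset/ndF/leq_maxl.
  - by move: y Gly; exact/subsetPset/ndG/leq_maxr.
move=> k; have [mF Fk] := Foo k; have [mG Gk] := Goo k; split.
  rewrite -[X in measurable X]setTI; apply: measurable_uncons_rV => //.
  exact: measurableX.
rewrite /prod_lebesgue_rV /pushforward -comp_preimage.
rewrite (_ : _ \o _ = id); last by apply/funext => x /=; rewrite cons_rVK.
rewrite preimage_id product_measure1E// lte_mul_pinfty// ge0_fin_numE//.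
Qed.

HB.instance Definition _ := Measure_isSigmaFinite.Build _ _ _
  prod_lebesgue_rV m_sigma_finite.

End step.

(* Lebesgue measure on R^n: the n-fold product of the one-dimensional one. *)
Fixpoint lebesgue_rV n : {sigma_finite_measure set 'rV[R]_n -> \bar R} :=
  if n is m.+1 then prod_lebesgue_rV (lebesgue_rV m) else \d_(0%R : 'rV[R]_0).

Lemma lebesgue_rV_box n (a b : 'rV[R]_n) :
  (forall i, a ord0 i <= b ord0 i)%R ->
  lebesgue_rV n [set x | forall i, x ord0 i \in `[a ord0 i, b ord0 i]] =
  (\prod_i (b ord0 i - a ord0 i))%:E.
Proof.
elim: n a b => [|n IHn] a b ab.
  rewrite big_ord0 (_ : mkset _ = setT).
    by rewrite /= diracE in_setT.
  by apply/seteqP; split => // x _ [].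
pose I := `[a ord0 ord0, b ord0 ord0]%classic : set (measurableTypeR R).
pose A := [set x : 'rV[R]_n | forall i, x ord0 i \in
  `[(uncons_rV a).2 ord0 i, (uncons_rV b).2 ord0 i]].
have mA : measurable A.
  rewrite (_ : A = \bigcap_(i in [set: 'I_n]) ([set: 'rV[R]_n] `&`
    ((fun x : 'rV[R]_n => x ord0 i : measurableTypeR R) @^-1`
     `[(uncons_rV a).2 ord0 i, (uncons_rV b).2 ord0 i]))); last first.
    apply/seteqP; split=> x Ax i; first by move=> _; split => //; exact: Ax.
    by have [] := Ax i Logic.I.
  apply: fin_bigcap_measurable => // i _.
  by apply: measurable_coord_rV => //; exact: measurable_itv.
have E : @cons_rV n @^-1`
    [set x | forall i, x ord0 i \in `[a ord0 i, b ord0 i]] = I `*` A.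
  apply/seteqP; split=> -[c x] /=.
    move=> H; split; first by have := H ord0; rewrite cons_rV0.
    by move=> i; have := H (lift ord0 i); rewrite cons_rVS !mxE.
  move=> [/= Ic Ax] i.
  case: (unliftP ord0 i) => [j ->|->]; last by rewrite cons_rV0.
  by rewrite cons_rVS; have := Ax j; rewrite !mxE.
transitivity ((lebesgue_measure \x lebesgue_rV n) (I `*` A)); first by rewrite -E.
rewrite product_measure1E//; last exact: measurable_itv.
have HI : lebesgue_measure I = (b ord0 ord0 - a ord0 ord0)%:E.
  rewrite lebesgue_measure_itv/= lte_fin -EFinB.
  case: ltP => // ba; congr EFin; apply/esym/eqP.
  by rewrite subr_eq0 eq_le ba ab.
transitivity ((b ord0 ord0 - a ord0 ord0)%:E * lebesgue_rV n A).
  by rewrite -HI.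
rewrite IHn; last by move=> i; rewrite !mxE.
rewrite -EFinM big_ord_recl; congr (_ * _)%:E.
by apply: eq_bigr => i _; rewrite !mxE.
Qed.

End lebesgue_rV.

Section sobolev.
Context {R : realType} {n : nat}.
Implicit Types (D : set 'rV[R]_n) (f : 'rV[R]_n -> R).

(* `|x| on 'rV[R]_n is the sup norm. *)
Definition enorm (x : 'rV[R]_n) : R := Num.sqrt (\sum_i x ord0 i ^+ 2).

Definition eball (r : R) : set 'rV[R]_n := [set x | enorm x < r].

(* Measurability for the Lebesgue sigma-algebra, i.e. up to a null set. *)
Definition lebesgue_measurable D f :=
  exists2 g : 'rV[R]_n -> R, measurable_fun [set: 'rV[R]_n] g &
    {ae lebesgue_rV n, forall x, D x -> f x = g x}.

Definition L2 D f := lebesgue_measurable D f /\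
  (\int[lebesgue_rV n]_(x in D) (f x ^+ 2)%:E < +oo)%E.

Definition L1loc D f := lebesgue_measurable D f /\
  forall K, compact K -> K `<=` D ->
    (\int[lebesgue_rV n]_(x in K) `|f x|%:E < +oo)%E.

Definition partial (i : 'I_n) f : 'rV[R]_n -> R :=
  fun x => 'D_(delta_mx ord0 i) f x.

Definition laplacian f : 'rV[R]_n -> R :=
  fun x => \sum_i partial i (partial i f) x.

Definition smooth f := forall s : seq 'I_n,
  continuous (foldr partial f s) /\
  forall i x, derivable (foldr partial f s) x (delta_mx ord0 i).

Definition test_function D f := smooth f /\
  exists K, [/\ compact K, K `<=` D & forall x, ~ K x -> f x = 0].

Definition weak_gradient D f (g : 'rV[R]_n -> 'rV[R]_n) :=
  L1loc D f /\ forall i, L1loc D (fun x => g x ord0 i) /\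
    forall phi, test_function D phi ->
      \int[lebesgue_rV n]_(x in D) (f x * partial i phi x) =
      - \int[lebesgue_rV n]_(x in D) (g x ord0 i * phi x).

Definition H1 D f := L2 D f /\
  exists2 g, weak_gradient D f g & forall i, L2 D (fun x => g x ord0 i).

(* The distributional form of Delta u + A . grad u + grad p = 0, div u = 0 in D;
   row i of Du x is the weak gradient of the i-th component of u. *)
Definition stokes D (A u : 'rV[R]_n -> 'rV[R]_n) (p : 'rV[R]_n -> R) :=
  exists Du : 'rV[R]_n -> 'M[R]_n,
  [/\ forall i, weak_gradient D (fun x => u x ord0 i) (fun x => row i (Du x)),
      forall i phi, test_function D phi ->
        \int[lebesgue_rV n]_(x in D) (u x ord0 i * laplacian phi x
          + (\sum_j A x ord0 j * Du x i j) * phi x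
          - p x * partial i phi x) = 0 &
      forall phi, test_function D phi ->
        \int[lebesgue_rV n]_(x in D) (\sum_i u x ord0 i * partial i phi x) = 0].

(* Dp stands for the weak gradient of p. *)
Definition stokesU (u : 'rV[R]_n -> 'rV[R]_n) (p : 'rV[R]_n -> R)
    (Dp : 'rV[R]_n -> 'rV[R]_n) (x : 'rV[R]_n) : R :=
  Num.sqrt (enorm x ^+ 4 * enorm (Dp x) ^+ 2 + enorm x ^+ 2 * `|p x| ^+ 2
            + enorm (u x) ^+ 2).

End sobolev.

(* Main.v *)
(* A Carleman estimate for the Dirac operator D v = sum_i (d_i v) c_i, where the
   c_i are real symmetric matrices with c_i c_j + c_j c_i = 2 delta_ij: it follows
   from |X + Y|^2 >= 4 <X, Y> applied to the radial derivative X (skew-adjoint up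
   to the weight) and the tangential part Y (symmetric), the cross term of which
   only sees the derivatives of the weight.

   For a unit vector xi put b u = sum_i u_i xi c_i and q = D (b u) + p xi.  If
   div u = 0 then |q|^2 = |D (b u)|^2 + p^2 and |D q| = |A . grad u|, so that the
   estimate with weight (e^L / L)^(2 be), L = ln (R3 / |x|), used for b u and for
   q bounds u, p and grad p together.  Garding's inequality for D recovers grad u,
   hence |A . grad u| <= C0 L^-3 |x|^-1 |grad u| is absorbed where L is large.
   This is done for mollified solutions on an annulus; in the limit the terms
   created by the cut-offs near |x| = R1 and |x| ~ R3 are bounded by Caccioppoli's
   inequality, and the integrals I over the three balls satisfy
   I(R2) <= C (e^(8 be ln (R3 / R1)) I(R1) + e^(- be) I(R3)) for all be >= 2.
   Optimising over be yields tau = 1 / (8 ln (R3 / R1) + 1). *)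
Require Import Defs.
From mathcomp Require Import all_boot all_order all_algebra.
From mathcomp Require Import all_classical all_reals all_analysis.
From mathcomp Require Import measurable_realfun ring lra.
Set Implicit Arguments.
Unset Strict Implicit.
Unset Printing Implicit Defensive.
Import Order.TTheory GRing.Theory Num.Theory.
Import numFieldNormedType.Exports.
Local Open Scope classical_set_scope.
Local Open Scope ring_scope.

(** * Borel sets of R^n and Fubini's theorem *)

(** Taking the divergence of the equation to isolate p would put a derivative on A . grad u, with A
    only measurable; in the first-order form A . grad u appears undifferentiated, as D q. With the
    pure power weight e^(be L) the cross term of the Carleman identity is zero. The factor L^(- be)
    bends the weight just enough to produce a term be L^-2, and the loss of L^-2 decides the decay
    required of A. Used for b u and for q with weights one unit apart in both exponents, the
    estimate bounds |grad u|^2 with weight |x|^2 L^-2 by |A . grad u|^2 with weight |x|^4 L^2. As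
    |A|^2 <= C0^2 L^-6 |x|^-2, the absorption has exactly one factor C0^2 L^-2 to spare, which is
    small once L >= 8 C0: this fixes the admissible ratio of radii in terms of C0. Replacing |log
    |x|| by the smaller L is legitimate because R3 <= 1, and since the weight depends on |x| / R3 up
    to a constant factor, R3 disappears from the final constants. Radial functions are written in
    the variable t = |x|^2 throughout. *)

Section borel_rV.
Context {R : realType} {n : nat}.
Implicit Types (x y : 'rV[R]_n) (f g : 'rV[R]_n -> R) (A : set 'rV[R]_n).

Lemma ball_rVE x (e : R) : 0 < e ->
  ball x e = [set y | forall i, `|x ord0 i - y ord0 i| < e].
Proof.
move=> e0; apply/seteqP; split => [y [_ B] i|y B].
  exact: (B ord0 i).
by split => // i j; rewrite (ord1 i); exact: B.
Qed.

Lemma measurable_ball_rV x (e : R) : measurable (ball x e).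
Proof.
have [e0|e0] := ltP 0 e; last by rewrite le0_ball0.
rewrite ball_rVE//.
rewrite [X in measurable X](_ : _ = \bigcap_(i in [set: 'I_n]) ([set: 'rV[R]_n] `&`
    ((fun y : 'rV[R]_n => y ord0 i : measurableTypeR R) @^-1` ball (x ord0 i) e))).
  apply: fin_bigcap_measurable => // i _.
  apply: measurable_coord_rV => //.
  exact: measurable_ball.
apply/seteqP; split => [y B i _|y B i]; first by split => //; exact: B.
by have [] := B i Logic.I.
Qed.

(** The balls of rational centre and radius [k.+1%:R^-1] contained in [A] are countably many, and
    they cover [A]. *)
Lemma open_measurable_rV A : open A -> measurable A.
Proof.
move=> oA.
pose q2 (q : 'rV[rat]_n) : 'rV[R]_n := map_mx ratr q.
pose F (u : 'rV[rat]_n * nat) : set 'rV[R]_n :=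
  if pselect (ball (q2 u.1) (u.2.+1%:R^-1) `<=` A) then ball (q2 u.1) (u.2.+1%:R^-1) else set0.
rewrite (_ : A = \bigcup_u F u).
  apply: countable_bigcupT_measurable; first exact: countableP.
  by move=> u; rewrite /F; case: (pselect _) => H /=; [exact: measurable_ball_rV|exact: measurable0].
apply/seteqP; split => [x Ax|x [u _]]; last first.
  by rewrite /F; by case: (pselect _) => H //= ?; exact: H.
have /nbhs_ballP[e /= e0 xeA] : nbhs x A by exact: open_nbhs_nbhs.
(* With a radius below e / 2, a ball whose centre is that close to [x] stays inside [ball x e]. *)
have [k ke] : exists k : nat, k.+1%:R^-1 < e / 2.
  exists (Num.truncn (e / 2)^-1); rewrite invf_plt ?posrE ?divr_gt0//.
  exact: truncnS_gt.
have k0 : 0 < k.+1%:R^-1 :> R by rewrite invr_gt0.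
have H i : exists q : rat, `|ratr q - x ord0 i| < k.+1%:R^-1.
  have h : x ord0 i - k.+1%:R^-1 < x ord0 i + k.+1%:R^-1 by rewrite ltrD2l gtrN.
  have [q qP] := rat_in_itvoo h.
  exists q; by rewrite ltr_distl; move: qP; rewrite in_itv/=.
have [q qP] := choice H.
exists (\row_i q i, k) => //; rewrite /F/=.
have xb : ball (q2 (\row_i q i)) k.+1%:R^-1 x.
  by rewrite ball_rVE// => i; rewrite /= !mxE.
case: (pselect _) => nb //; exfalso; apply: nb => y yb; apply: xeA.
rewrite ball_rVE// => i /=; move: xb yb; rewrite !ball_rVE//= => /(_ i) + /(_ i).
rewrite !mxE => h1 h2.
rewrite (_ : _ - _ = (x ord0 i - ratr (q i)) + (ratr (q i) - y ord0 i)); last ring.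
apply: le_lt_trans (ler_normD _ _) _; rewrite (distrC (x ord0 i)). rewrite (splitr e).
by apply: ltrD; [exact: lt_trans h1 ke|exact: lt_trans h2 ke].
Qed.

Lemma continuous_measurable_rV f : continuous f -> measurable_fun [set: 'rV[R]_n] f.
Proof.
move=> cf; apply: (measurability _ (RGenOpens.measurableE R)).
move=> _ -[_ [a [b ->] <-]]; rewrite setTI.
apply: open_measurable_rV.
by move/continuousP : cf; apply; exact: interval_open.
Qed.

(** Open sets are stable under intersection, so this is the presentation that Dynkin's theorem needs
    in [approx_indic]. The coordinate cylinders over Borel sets of the line are reduced to cylinders
    over open intervals. *)
Lemma measurable_rV_open : @measurable _ 'rV[R]_n = <<s open >>.
Proof.
apply/seteqP; split; last first.
  apply: smallest_sub; first exact: sigma_algebra_measurable.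
  exact: open_measurable_rV.
apply: smallest_sub; first exact: smallest_sigma_algebra.
move=> A; rewrite -bigcup_seq => -[i _ [B mB <-]]; rewrite setTI.
pose GG : set (set R) := [set B | <<s open >> ((fun x : 'rV[R]_n => x ord0 i) @^-1` B)].
suff : <<s (@open R) >> `<=` GG.
  apply; have mB2 : (@ocitv R).-sigma.-measurable (B : set (g_sigma_algebraType (@ocitv R))) := mB.
  move: mB2; rewrite RGenOpens.measurableE.
  move: B {mB}; apply: smallest_sub; first exact: smallest_sigma_algebra.
  by move=> U [a [b ->]]; apply: sub_sigma_algebra; exact: interval_open.
have SS := smallest_sigma_algebra [set: 'rV[R]_n] (@open 'rV[R]_n).
apply: smallest_sub.
  split.
  - by rewrite /GG/= preimage_set0; apply: sigma_algebra0.
  - by move=> U HU; rewrite /GG/= setTD preimage_setC; apply: sigma_algebraC.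
  - by move=> F HF; rewrite /GG/= preimage_bigcup; exact: sigma_algebra_bigcup.
move=> U oU; apply: sub_sigma_algebra.
by have /continuousP := @coord_continuous R 1 n ord0 i; apply.
Qed.

End borel_rV.

Section fubini_rV.
Context {R : realType}.
Local Open Scope ereal_scope.

Let mcons n : measurable_fun [set: measurableTypeR R * 'rV[R]_n] (@cons_rV R n).
Proof. exact: measurable_cons_rV. Qed.

Lemma ge0_integral_rVS n (f : 'rV[R]_n.+1 -> \bar R) :
  measurable_fun [set: 'rV[R]_n.+1] f -> (forall x, 0 <= f x) ->
  \int[@lebesgue_rV R n.+1]_x f x =
  \int[lebesgue_measure]_t \int[@lebesgue_rV R n]_y f (cons_rV (t, y)).
Proof.
move=> mf f0.
transitivity (\int[pushforward (lebesgue_measure \x @lebesgue_rV R n) (@cons_rV R n)]_x f x) => //.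
rewrite (ge0_integral_pushforward (@mcons n))//.
rewrite preimage_setT fubini_tonelli1//; last by move=> x; exact: f0.
exact: measurableT_comp (@mcons n).
Qed.

Lemma integrable_cons_rV n (f : 'rV[R]_n.+1 -> \bar R) :
  (@lebesgue_rV R n.+1).-integrable [set: 'rV[R]_n.+1] f ->
  (lebesgue_measure \x @lebesgue_rV R n).-integrable [set: measurableTypeR R * 'rV[R]_n] (f \o @cons_rV R n).
Proof.
move=> /integrableP[mf foo]; apply/integrableP; split.
  exact: measurableT_comp (@mcons n).
rewrite fubini_tonelli1//.
  by move: foo; rewrite ge0_integral_rVS//; exact: measurableT_comp.
by apply: measurableT_comp => //; exact: measurableT_comp (@mcons n).
Qed.

Lemma integral_rVS n (f : 'rV[R]_n.+1 -> \bar R) :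
  (@lebesgue_rV R n.+1).-integrable [set: 'rV[R]_n.+1] f ->
  \int[@lebesgue_rV R n.+1]_x f x =
  \int[lebesgue_measure]_t \int[@lebesgue_rV R n]_y f (cons_rV (t, y)).
Proof.
move=> fi; have /integrableP[mf _] := fi.
transitivity (\int[pushforward (lebesgue_measure \x @lebesgue_rV R n) (@cons_rV R n)]_x f x) => //.
rewrite (integral_pushforward (@mcons n))//.
  by rewrite preimage_setT -integral12_prod_meas1//; exact: integrable_cons_rV.
by rewrite preimage_setT; exact: integrable_cons_rV.
Qed.

(** The distinguished coordinate is integrated innermost here, as integration by parts in that
    coordinate requires; [integral_rVS] serves the other coordinates. *)
Lemma integral_rVS2 n (f : 'rV[R]_n.+1 -> \bar R) :
  (@lebesgue_rV R n.+1).-integrable [set: 'rV[R]_n.+1] f ->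
  \int[@lebesgue_rV R n.+1]_x f x =
  \int[@lebesgue_rV R n]_y \int[lebesgue_measure]_t f (cons_rV (t, y)).
Proof.
move=> fi; rewrite integral_rVS//.
exact: (Fubini (integrable_cons_rV fi)).
Qed.

End fubini_rV.

Section cube.
Context {R : realType} {n : nat}.
Implicit Types (f : 'rV[R]_n -> R).

Definition cube (M : R) : set 'rV[R]_n := [set x | forall i, `|x ord0 i| <= M].

Lemma cube_box M : cube M = [set x | forall i, x ord0 i \in
  `[(const_mx (- M) : 'rV[R]_n) ord0 i, (const_mx M : 'rV[R]_n) ord0 i]].
Proof.
by apply/seteqP; split => x H i; have := H i; rewrite /= !mxE in_itv/= ler_norml.
Qed.

Lemma compact_cube M : compact (cube M).
Proof.
rewrite (_ : cube M = [set x | forall i, (fun=> `[- M, M]%classic) i (x ord0 i)]).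
  by apply: (@rV_compact R n (fun=> `[- M, M]%classic)) => i; exact: segment_compact.
by apply/seteqP; split => x H i; have := H i; rewrite /= in_itv/= ler_norml.
Qed.

Lemma measurable_cube M : measurable (cube M).
Proof.
rewrite (_ : cube M = \bigcap_(i in [set: 'I_n]) ([set: 'rV[R]_n] `&`
    ((fun y : 'rV[R]_n => y ord0 i : measurableTypeR R) @^-1` `[- M, M]%classic))).
  apply: fin_bigcap_measurable => // i _.
  by apply: measurable_coord_rV => //; exact: measurable_itv.
apply/seteqP; split => [y B i _|y B i].
  by split => //; have := B i; rewrite /= in_itv/= ler_norml.
by have [_] := B i Logic.I; rewrite /= in_itv/= -ler_norml.
Qed.

Lemma cube_fin M : (@lebesgue_rV R n (cube M) < +oo)%E.
Proof.
(* [lebesgue_rV_box] needs ordered end points, hence |M|. *)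
have H : (lebesgue_rV n (cube `|M|) < +oo)%E.
  by rewrite cube_box lebesgue_rV_box ?ltry// => i; rewrite !mxE; have := normr_ge0 M; lra.
apply: le_lt_trans H; apply: le_measure; rewrite ?inE; try exact: measurable_cube.
by move=> x Mx i; apply: le_trans (Mx i) (ler_norm M).
Qed.

Definition vanishes_off (M : R) f := forall x, ~ cube M x -> f x = 0.

Lemma bounded_cube_integrable f M C : measurable_fun [set: 'rV[R]_n] f ->
  vanishes_off M f -> (forall x, `|f x| <= C) ->
  (@lebesgue_rV R n).-integrable [set: 'rV[R]_n] (EFin \o f).
Proof.
move=> mf f0 fC.
rewrite (_ : EFin \o f = (EFin \o f) \_ (cube M)).
  apply/(integrable_mkcond _ _).1; first exact: measurable_cube.
  apply: measurable_bounded_integrable.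
  - exact: measurable_cube.
  - exact: cube_fin.
  - exact: measurable_funTS.
  - exists C; split; first exact: num_real.
    by move=> r Cr x _ /=; exact: le_trans (fC x) (ltW Cr).
apply/funext => x; rewrite patchE; case: ifPn => //.
by rewrite notin_setE => nx /=; rewrite f0.
Qed.

Lemma cc_bounded f M : continuous f -> vanishes_off M f -> exists C, forall x, `|f x| <= C.
Proof.
move=> cf f0.
have : compact (f @` cube M).
  by apply: continuous_compact; [exact: continuous_subspaceT|exact: compact_cube].
move=> /compact_bounded[C [_ HC]].
exists (`|C| + 1) => x.
have [xM|xM] := pselect (cube M x).
  by apply: HC; [by have := ler_norm C; lra|exists x].
by rewrite f0// normr0; have := normr_ge0 C; lra.
Qed.

Lemma cc_integrable f M : continuous f -> vanishes_off M f ->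
  (@lebesgue_rV R n).-integrable [set: 'rV[R]_n] (EFin \o f).
Proof.
move=> cf f0; have [C HC] := cc_bounded cf f0.
by apply: bounded_cube_integrable f0 HC; exact: continuous_measurable_rV.
Qed.

End cube.

(** * Partial derivatives and integration by parts *)

Section pder.
Context {R : realType}.

(** A relation carrying the derivative as an argument: existence and value travel together, and the
    sum, product and chain rules build the derivative in the form in which it is wanted. *)
Definition pder n (i : 'I_n) (f g : 'rV[R]_n -> R) :=
  forall x, is_derive x (delta_mx ord0 i) f (g x).

Lemma is_derive_line (V : normedModType R) (a v : V) (t : R) (f : V -> R) (df : R) :
  is_derive (a + t *: v) v f df -> is_derive t 1 (fun s => f (a + s *: v)) df.
Proof.
move=> [fd fE].
have E : (fun h : R => h^-1 *: (((fun s => f (a + s *: v)) \o shift t) (h *: 1) - f (a + t *: v))) =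
         (fun h : R => h^-1 *: ((f \o shift (a + t *: v)) (h *: v) - f (a + t *: v))).
  apply/funext => h /=; congr (_ *: (f _ - _)).
  by rewrite [h *: 1]mulr1 scalerDl addrCA.
split; first by rewrite /derivable E.
by rewrite /derive E -fE.
Qed.

Lemma cons_rV_line n (t : R) (y : 'rV[R]_n) :
  cons_rV (t, y) = cons_rV (0, y) + t *: delta_mx ord0 ord0.
Proof.
apply/rowP => i; rewrite !mxE; case: (unliftP ord0 i) => [j ->|->] /=.
  by rewrite mulr0 addr0.
by rewrite mulr1 add0r.
Qed.

Lemma cons_rV_lift n (t h : R) (y : 'rV[R]_n) j :
  cons_rV (t, h *: delta_mx ord0 j + y) = h *: delta_mx ord0 (lift ord0 j) + cons_rV (t, y).
Proof.
apply/rowP => i; rewrite !mxE; case: (unliftP ord0 i) => [k ->|->] /=.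
  by rewrite !mxE/= (inj_eq lift_inj).
by rewrite mulr0 add0r.
Qed.

Lemma continuous_cons_rV_l n (y : 'rV[R]_n) : continuous (fun t : R => cons_rV (t, y)).
Proof.
under eq_fun do rewrite cons_rV_line.
by move=> t; apply: cvgD; [exact: cvg_cst|exact: cvgZr_tmp].
Qed.

Lemma continuous_cons_rV_r n (t : R) : continuous (fun y : 'rV[R]_n => cons_rV (t, y)).
Proof.
move=> y A [P nP PA]; exists (fun i j => P i (lift ord0 j)).
  by move=> i j; have := nP i (lift ord0 j); rewrite (ord1 i) cons_rVS.
move=> z zP; apply: PA => i k; rewrite (ord1 i).
case: (unliftP ord0 k) => [j ->|->]; first by rewrite cons_rVS; exact: zP.
rewrite cons_rV0; have := nP ord0 ord0; rewrite cons_rV0.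
exact: nbhs_singleton.
Qed.

Lemma pder_vanishes n (i : 'I_n) f g (M : R) : pder i f g -> vanishes_off M f -> vanishes_off M g.
Proof.
move=> fg f0 x xM; have [fd <-] := fg x.
have oM : open (~` @cube R n M).
  by apply: closed_openC; apply: compact_closed; [exact: norm_hausdorff|exact: compact_cube].
rewrite -(derive_cst (0 : R) x (delta_mx ord0 i)).
apply: near_eq_derive.
have : nbhs x (~` @cube R n M) by exact: open_nbhs_nbhs.
by apply: filterS => y /= yM; rewrite f0.
Qed.

(** The fundamental theorem of calculus on an interval [[- N, N]] reaching past the support, so that
    [f] is zero at both ends. *)
Lemma integral_derive_cc (f g : R -> R) (M : R) : (forall t : R, is_derive t 1 f (g t)) -> continuous g ->
  (forall t : R, M < `|t| -> f t = 0) -> (\int[lebesgue_measure]_t (g t)%:E = 0)%E.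
Proof.
move=> fg cg f0.
pose N := `|M| + 1.
have MN : M < N by rewrite /N; have := ler_norm M; lra.
have N0 : 0 < N by rewrite /N; have := normr_ge0 M; lra.
have cf t : {for t, continuous f}.
  by apply: differentiable_continuous; apply/derivable1_diffP; case: (fg t).
have g0 t : N < `|t| -> g t = 0.
  move=> tN; have [_ <-] := fg t.
  rewrite -(derive_cst (0 : R) t (1:R)); apply: near_eq_derive.
  near=> s; rewrite /= f0//.
  near: s; apply: (@cvgr_gt _ _ _ _ (fun s : R => `|s|) `|t|).
    by apply: cvg_norm; exact: cvg_id.
  exact: lt_trans tN.
transitivity (\int[lebesgue_measure]_(t in `[(- N)%R, N]) (g t)%:E)%E.
  rewrite [RHS]integral_mkcond; apply: eq_integral => t _.
  rewrite patchE; case: ifPn => //; rewrite notin_setE/= in_itv/= -ler_norml => /negP.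
  by rewrite -ltNge => /g0 ->.
rewrite (@continuous_FTC2 _ g f)//.
- by rewrite !f0 ?subee// ?normrN gtr0_norm.
- lra.
- exact: continuous_subspaceT.
- split => [t _||]; first by case: (fg t).
    by apply: cvg_at_right_filter; exact: cf.
  by apply: cvg_at_left_filter; exact: cf.
- by move=> t _; rewrite derive1E; case: (fg t).
Unshelve. all: by end_near. Qed.

(** Induction on the dimension. A derivative in the coordinate split off by [cons_rV] integrates to
    zero along each line; a derivative in another coordinate is one on each slice, where the
    induction hypothesis applies. *)
Lemma integral_pder n (i : 'I_n) f g (M : R) : pder i f g -> continuous g ->
  vanishes_off M f -> (\int[@lebesgue_rV R n]_x (g x)%:E = 0)%E.
Proof.
elim: n i f g => [[]//|n IH] i f g fg cg f0.
have gi := cc_integrable cg (pder_vanishes fg f0).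
have [j|] := unliftP ord0 i => ei.
  rewrite (integral_rVS gi); apply: integral0_eq => t _.
  apply: (IH j (fun y => f (cons_rV (t, y))) (fun y => g (cons_rV (t, y)))).
  - move=> y; have := fg (cons_rV (t, y)); rewrite ei => -[fd fE].
    have E : (fun h : R => h^-1 *: (((fun y => f (cons_rV (t, y))) \o shift y) (h *: delta_mx ord0 j) - f (cons_rV (t, y)))) =
     (fun h : R => h^-1 *: ((f \o shift (cons_rV (t, y))) (h *: delta_mx ord0 (lift ord0 j)) - f (cons_rV (t, y)))).
      by apply/funext => h /=; rewrite cons_rV_lift.
    split; first by rewrite /derivable E.
    by rewrite /derive E -fE.
  - by move=> y; apply: continuous_comp; [exact: continuous_cons_rV_r|exact: cg].
  - move=> y yM; apply: f0 => H; apply: yM => k.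
    by have := H (lift ord0 k); rewrite cons_rVS.
rewrite (integral_rVS2 gi); apply: integral0_eq => y _.
apply: (@integral_derive_cc (fun t => f (cons_rV (t, y))) _ M).
- move=> t; under [X in is_derive _ _ X _]eq_fun do rewrite cons_rV_line.
  by apply: is_derive_line; rewrite -cons_rV_line -ei.
- by move=> t; apply: continuous_comp; [exact: continuous_cons_rV_l|exact: cg].
- move=> t tM; apply: f0 => /(_ ord0); rewrite cons_rV0/= => h.
  by move: tM; rewrite ltNge h.
Qed.

Lemma Rintegral_pder n (i : 'I_n) f g (M : R) : pder i f g -> continuous g ->
  vanishes_off M f -> \int[@lebesgue_rV R n]_x g x = 0.
Proof. by move=> fg cg f0; rewrite /Rintegral (integral_pder fg cg f0). Qed.

Lemma pder_cst n (i : 'I_n) (c : R) : pder i (fun=> c) (fun=> 0).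
Proof. by move=> x; exact: is_derive_cst. Qed.

Lemma pderD n (i : 'I_n) f g f' g' : pder i f f' -> pder i g g' ->
  pder i (fun x => f x + g x) (fun x => f' x + g' x).
Proof. by move=> ff gg x; apply: is_deriveD. Qed.

Lemma pderM n (i : 'I_n) f g f' g' : pder i f f' -> pder i g g' ->
  pder i (fun x => f x * g x) (fun x => f' x * g x + f x * g' x).
Proof.
move=> ff gg x; apply: is_derive_eq; first exact: is_deriveM.
by rewrite /GRing.scale/= addrC mulrC.
Qed.

Lemma pderZ n (i : 'I_n) (c : R) f f' : pder i f f' -> pder i (fun x => c * f x) (fun x => c * f' x).
Proof.
move=> ff x; have := pderM (pder_cst i c) ff x.
by rewrite mul0r add0r.
Qed.

Lemma pder_sum n (i : 'I_n) (I : Type) (s : seq I) (P : pred I) (f f' : I -> 'rV[R]_n -> R) :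
  (forall k, P k -> pder i (f k) (f' k)) ->
  pder i (fun x => \sum_(k <- s | P k) f k x) (fun x => \sum_(k <- s | P k) f' k x).
Proof.
move=> H; elim: s => [|k s IHs].
  by move=> x; rewrite big_nil; under [X in is_derive _ _ X _]eq_fun do rewrite big_nil; exact: is_derive_cst.
move=> x; rewrite big_cons; under [X in is_derive _ _ X _]eq_fun do rewrite big_cons.
by case: ifPn => Pk; [exact: (pderD (H k Pk) IHs)|exact: IHs].
Qed.

Lemma pder_coord n (i j : 'I_n) : pder i (fun x => x ord0 j) (fun=> (i == j)%:R).
Proof.
move=> x.
have E : (fun h : R => h^-1 *: (((fun x : 'rV[R]_n => x ord0 j) \o shift x) (h *: delta_mx ord0 i) - x ord0 j)) @ 0^'
   --> ((i == j)%:R : R).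
  apply: (@cvg_near_cst) => //.
  near=> h; rewrite /= !mxE/= (eq_sym j) addrK /GRing.scale/= mulrA mulVf ?mul1r//.
  near: h; exact: nbhs_dnbhs_neq.
split; first by apply/cvg_ex; exists ((i == j)%:R).
by apply/cvg_lim.
Unshelve. all: by end_near. Qed.

Lemma pder_comp1 n (i : 'I_n) (f : 'rV[R]_n -> R) f' (h h' : R -> R) :
  pder i f f' -> (forall x, is_derive (f x) 1 h (h' (f x))) ->
  pder i (fun x => h (f x)) (fun x => h' (f x) * f' x).
Proof.
move=> ff hh x.
have L : is_derive (0 : R) 1 (fun s => f (x + s *: delta_mx ord0 i)) (f' x).
  by apply: is_derive_line; rewrite scale0r addr0.
have H : is_derive (0 : R) 1 (h \o (fun s => f (x + s *: delta_mx ord0 i))) (h' (f x) * f' x).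
  by apply: is_derive1_comp; rewrite scale0r addr0.
case: H => Hd HE.
have E : (fun k : R => k^-1 *: (((fun x => h (f x)) \o shift x) (k *: delta_mx ord0 i) - h (f x))) =
  (fun k : R => k^-1 *: (((h \o (fun s => f (x + s *: delta_mx ord0 i))) \o shift 0) (k *: 1) - (h \o (fun s => f (x + s *: delta_mx ord0 i))) 0)).
  apply/funext => k /=; rewrite scale0r !addr0 (addrC x).
  by rewrite /GRing.scale/= mulr1.
split; first by rewrite /derivable E.
by rewrite /derive E -HE.
Qed.

Lemma pder_eq n (i : 'I_n) f g g' : pder i f g -> (forall x, g x = g' x) -> pder i f g'.
Proof. by move=> fg gg x; rewrite -gg. Qed.

End pder.

(** * The squared Euclidean norm *)

Section square_norm.
Context {R : realType} {n : nat}.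
Implicit Types x y : 'rV[R]_n.

(** Radial quantities are written as functions of |x|^2, a polynomial, so that no question of
    differentiability arises at the origin. *)
Definition sq x : R := \sum_i x ord0 i ^+ 2.

Lemma sq_ge0 x : 0 <= sq x. Proof. by apply: sumr_ge0 => i _; exact: sqr_ge0. Qed.

Lemma enorm_sqr x : enorm x ^+ 2 = sq x.
Proof. by rewrite /enorm sqr_sqrtr// sq_ge0. Qed.

Lemma enorm_ge0 x : 0 <= enorm x. Proof. exact: sqrtr_ge0. Qed.

Lemma sqr_coord_le x i : x ord0 i ^+ 2 <= sq x.
Proof.
rewrite /sq (bigD1 i)//= lerDl; apply: sumr_ge0 => j _; exact: sqr_ge0.
Qed.

Lemma pder_sq i : pder i sq (fun x => 2 * x ord0 i).
Proof.
rewrite /sq; apply: pder_eq.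
  apply: pder_sum => j _ ; apply: pder_eq; first exact: (pderM (pder_coord i j) (pder_coord i j)).
  by move=> x; reflexivity.
move=> x /=; rewrite (bigD1 i)//= eqxx big1 => [|j /negPf ji].
  by rewrite addr0 mulrC -mulr2n mulr1 mulrC mulr_natr.
by rewrite eq_sym ji mulr0 mul0r addr0.
Qed.

Lemma continuous_coord i : continuous (fun x : 'rV[R]_n => x ord0 i).
Proof. exact: coord_continuous. Qed.

Lemma continuous_sum (I : Type) (s : seq I) (P : pred I) (f : I -> 'rV[R]_n -> R) :
  (forall k, P k -> continuous (f k)) -> continuous (fun x => \sum_(k <- s | P k) f k x).
Proof.
move=> H; elim: s => [|k s IHs].
  rewrite [X in continuous X](_ : _ = cst 0); first exact: cst_continuous.
  by apply/funext => x; rewrite big_nil.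
have [Pk|/negPf Pk] := boolP (P k); last first.
  by under eq_fun do rewrite big_cons Pk.
under eq_fun do rewrite big_cons Pk.
by move=> x; apply: (@continuousD _ R^o _ (f k)); [exact: H|exact: IHs].
Qed.

Lemma continuous_sq : continuous sq.
Proof.
apply: continuous_sum => i _ x; apply: (@continuousM _ _ (fun x : 'rV[R]_n => x ord0 i) (fun x : 'rV[R]_n => x ord0 i)); exact: continuous_coord.
Qed.

Lemma measurable_sq : measurable_fun [set: 'rV[R]_n] sq.
Proof. exact: continuous_measurable_rV continuous_sq. Qed.

Lemma sq_cube x (M : R) : 0 <= M -> sq x <= M ^+ 2 -> cube M x.
Proof.
move=> M0 xM i; rewrite -(ler_pXn2r (n := 2)) ?nnegrE//.
by rewrite real_normK ?num_real// (le_trans (sqr_coord_le x i)).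
Qed.

End square_norm.

(** * Mollifiers *)

Section smooth_line.
Context {R : realType}.
Implicit Types (f g : R -> R) (t df dg : R).

Definition der1 f t df : Prop := is_derive t 1 f df.

Lemma der1_eq f t df df' : der1 f t df -> df = df' -> der1 f t df'.
Proof. by move=> h <-. Qed.

Lemma der1_cst (c : R) t : der1 (fun=> c) t 0.
Proof. exact: is_derive_cst. Qed.

Lemma der1_id t : der1 (fun s => s) t 1.
Proof. exact: is_derive_id. Qed.

Lemma der1_near f g t df : (\forall s \near t, f s = g s) -> der1 f t df -> der1 g t df.
Proof. exact: near_eq_is_derive. Qed.

(** Recursion on the order of differentiability lets closure under products, inverses and affine
    changes of variable go by plain induction. *)
Fixpoint cdiff (k : nat) f : Prop :=
  if k is k'.+1 then (forall t, derivable f t 1) /\ cdiff k' f^`()%classic else True.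

Definition smooth1 f := forall k, cdiff k f.

Lemma cdiffW k f : cdiff k.+1 f -> cdiff k f.
Proof.
by elim: k f => [//|k IH] f [df /= [df' H]]; split => //; apply: IH.
Qed.

Lemma cdiff_is_derive k f f' : (forall t, der1 f t (f' t)) -> cdiff k f' -> cdiff k.+1 f.
Proof.
move=> df cf'; split; first by move=> t; case: (df t).
by rewrite (_ : f^`()%classic = f')//; apply/funext => t; rewrite derive1E; case: (df t).
Qed.

Lemma derivable_is_derive f t : derivable f t 1 -> der1 f t (f^`()%classic t).
Proof. by move=> df; split => //; rewrite derive1E. Qed.

Lemma is_derive1D f g t df dg : der1 f t df -> der1 g t dg ->
  der1 (fun s => f s + g s) t (df + dg).
Proof. exact: is_deriveD. Qed.

Lemma is_derive1M f g t df dg : der1 f t df -> der1 g t dg ->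
  der1 (fun s => f s * g s) t (df * g t + f t * dg).
Proof.
move=> hf hg; apply: der1_eq; first exact: (is_deriveM hf hg).
by rewrite /GRing.scale/= addrC mulrC.
Qed.

Lemma der1X n f t df : der1 f t df ->
  der1 (fun s => f s ^+ n) t (n%:R * f t ^+ n.-1 * df).
Proof.
move=> hf; elim: n => [|n IH].
  by under [X in der1 X]eq_fun do rewrite expr0; apply: der1_eq; [exact: der1_cst|rewrite !mul0r].
under [X in der1 X]eq_fun do rewrite exprS.
apply: der1_eq; first exact: (is_derive1M hf IH).
case: n {IH} => [|n]; rewrite ?expr0 ?mul0r ?mulr0 ?addr0 /=; first by ring.
by rewrite exprS -[n.+2%:R]natr1; ring.
Qed.

Lemma der1_comp f g t df dg : der1 f (g t) df -> der1 g t dg ->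
  der1 (fun s => f (g s)) t (df * dg).
Proof. by move=> hf hg; exact: (@is_derive1_comp _ f g). Qed.

Lemma is_derive1V f t df : f t != 0 -> der1 f t df ->
  der1 (fun s => (f s)^-1) t (- df * (f t)^-1 * (f t)^-1).
Proof.
move=> f0 hf; apply: der1_eq; first exact: (is_deriveV f0 hf).
by rewrite [_ *: _]mulNr expr2 invfM; ring.
Qed.

Lemma cdiff_cst k (c : R) : cdiff k (fun=> c).
Proof.
elim: k c => [//|k IH] c; apply: cdiff_is_derive (IH 0) => t.
exact: der1_cst.
Qed.

Lemma cdiffD k f g : cdiff k f -> cdiff k g -> cdiff k (fun s => f s + g s).
Proof.
elim: k f g => [//|k IH] f g [df cf] [dg cg].
apply: (@cdiff_is_derive k _ (fun s => f^`()%classic s + g^`()%classic s)); last exact: IH.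
by move=> t; apply: is_derive1D; exact: derivable_is_derive.
Qed.

Lemma cdiffM k f g : cdiff k f -> cdiff k g -> cdiff k (fun s => f s * g s).
Proof.
elim: k f g => [//|k IH] f g hf hg; have [df cf] := hf; have [dg cg] := hg.
apply: (@cdiff_is_derive k _ (fun s => f^`()%classic s * g s + f s * g^`()%classic s)).
  by move=> t; apply: is_derive1M; exact: derivable_is_derive.
by apply: cdiffD; apply: IH => //; exact: cdiffW.
Qed.

Lemma cdiffV k f : (forall t, f t != 0) -> cdiff k f -> cdiff k (fun s => (f s)^-1).
Proof.
move=> f0; elim: k f f0 => [//|k IH] f f0 hf; have [df cf] := hf.
apply: (@cdiff_is_derive k _ (fun s => - 1 * f^`()%classic s * (f s)^-1 * (f s)^-1)).
  move=> t; apply: der1_eq; first by apply: is_derive1V => //; exact: derivable_is_derive.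
  by rewrite mulN1r derive1E.
have fV := IH _ f0 (cdiffW hf).
apply: cdiffM => //; apply: cdiffM => //; apply: cdiffM => //; exact: cdiff_cst.
Qed.

Lemma is_derive1_affine f (a b : R) t df : der1 f (a * t + b) df ->
  der1 (fun s => f (a * s + b)) t (a * df).
Proof.
move=> hf; rewrite mulrC.
have hg : der1 (fun s => a * s + b) t a.
  apply: der1_eq.
    apply: is_derive1D; last exact: der1_cst.
    by apply: is_derive1M; [exact: der1_cst|exact: der1_id].
  by rewrite mul0r add0r mulr1 addr0.
exact: (@is_derive1_comp _ f (fun s => a * s + b)).
Qed.

Lemma cdiff_affine k f (a b : R) : cdiff k f -> cdiff k (fun s => f (a * s + b)).
Proof.
elim: k f => [//|k IH] f [df cf].
apply: (@cdiff_is_derive k _ (fun s => a * f^`()%classic (a * s + b))).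
  by move=> t; apply: is_derive1_affine; exact: derivable_is_derive.
by apply: cdiffM; [exact: cdiff_cst|exact: IH].
Qed.

Lemma smooth1_derive f : smooth1 f -> smooth1 f^`()%classic.
Proof. by move=> sf k; have [] := sf k.+1. Qed.

Lemma smooth1_is_derive f t : smooth1 f -> der1 f t (f^`()%classic t).
Proof. by move=> sf; apply: derivable_is_derive; have [] := sf 1%N. Qed.

Lemma is_derive_continuous f t df : der1 f t df -> {for t, continuous f}.
Proof. by move=> [fd _]; apply: differentiable_continuous; apply/derivable1_diffP. Qed.

Lemma smooth1_continuous f : smooth1 f -> continuous f.
Proof. by move=> sf t; apply: is_derive_continuous; exact: smooth1_is_derive. Qed.

(** The flat function e^(-1/t) together with the powers of 1/t that differentiation creates.
    Derivatives of members of the family are linear combinations of members, so the smoothness of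
    all of them is a single induction. *)
Definition gexp (m : nat) t : R := if 0 < t then t^-1 ^+ m * expR (- t^-1) else 0.

Lemma gexp_ge0 m t : 0 <= gexp m t.
Proof.
rewrite /gexp; case: ifPn => // t0.
by rewrite mulr_ge0// ?expR_ge0// exprn_ge0// invr_ge0 ltW.
Qed.

(** With y = 1/t and k = m + 1 the claim is (y / k)^k <= (e^(y / k))^k, that is y / k <= e^(y /
    k). *)
Lemma gexp_le m t : gexp m.+1 t <= m.+1%:R ^+ m.+1.
Proof.
rewrite /gexp; case: ifPn => [t0|_]; last by rewrite exprn_ge0.
set y := t^-1; have y0 : 0 < y by rewrite invr_gt0.
rewrite expRN ler_pdivrMr ?expR_gt0//.
have -> : expR y = expR (y / m.+1%:R) ^+ m.+1.
  by rewrite -expRM_natl mulrC divfK.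
rewrite -exprMn ler_pXn2r ?nnegrE ?(ltW y0)// ?mulr_ge0// ?expR_ge0//.
rewrite -ler_pdivrMl// mulrC; apply: le_trans (expR_ge1Dx _).
by rewrite lerDr.
Qed.

Lemma gexpS m t : gexp m t = t * gexp m.+1 t.
Proof.
rewrite /gexp; case: ifPn => t0; last by rewrite mulr0.
by rewrite exprS !mulrA divff ?mul1r// gt_eqF.
Qed.

Lemma is_derive_gexp m t : der1 (gexp m) t (- (m%:R) * gexp m.+1 t + gexp m.+2 t).
Proof.
have [t0|t0|->] := ltgtP t 0.
- rewrite {2 3}/gexp ltNge (ltW t0)/= mulr0 addr0.
  apply: (@der1_near (fun=> 0)); last exact: der1_cst.
  near=> s; rewrite /gexp ltNge ltW//=.
  by near: s; exact: lt_nbhsl.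
- apply: (@der1_near (fun s => s^-1 ^+ m * expR (- s^-1))).
    near=> s; rewrite /gexp ifT//.
    by near: s; exact: lt_nbhsr.
  have h1 : der1 (fun s : R => s^-1) t (- 1 * t^-1 * t^-1).
    by apply: is_derive1V; [rewrite gt_eqF|exact: der1_id].
  have h2 : der1 (fun s : R => s^-1 ^+ m) t (m%:R * t^-1 ^+ m.-1 * (- 1 * t^-1 * t^-1)).
    exact: der1X.
  have h3 : der1 (fun s : R => expR (- s^-1)) t (expR (- t^-1) * - (- 1 * t^-1 * t^-1)).
    apply: (der1_comp (f := expR) (g := fun s => - s^-1)); first exact: is_derive_expR.
    exact: is_deriveN.
  apply: der1_eq; first exact: is_derive1M h2 h3.
  rewrite /gexp t0 !exprS; case: m {h2} => [|m]; first by rewrite !mul0r; ring.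
  by rewrite /= exprS; ring.
(* At 0 the difference quotient is [gexp m.+1 h = h * gexp m.+2 h], which tends to 0 because
   [gexp m.+2] is bounded. *)
- rewrite {2 3}/gexp ltxx mulr0 addr0.
  have E : (fun h : R => h^-1 *: ((gexp m \o shift 0) (h *: 1) - gexp m 0)) @ 0^' --> (0 : R).
    apply/cvgr0Pnorm_le => e e0; near=> h.
    rewrite /= {2}/gexp ltxx subr0 addr0 [h *: 1]mulr1.
    have h0 : h != 0 by near: h; exact: nbhs_dnbhs_neq.
    rewrite gexpS /GRing.scale/= mulKf// gexpS normrM (ger0_norm (gexp_ge0 _ _)).
    apply: (@le_trans _ _ (`|h| * m.+2%:R ^+ m.+2)).
      by rewrite ler_wpM2l// gexp_le.
    rewrite -ler_pdivlMr ?exprn_gt0//; near: h.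
    apply: dnbhs0_le; rewrite divr_gt0 ?exprn_gt0//.
  split; first by apply/cvg_ex; exists 0.
  exact/cvg_lim.
Unshelve. all: by end_near. Qed.

Lemma smooth1_gexp m : smooth1 (gexp m).
Proof.
move=> k; elim: k m => [//|k IH] m.
apply: cdiff_is_derive; first by move=> t; exact: is_derive_gexp.
apply: cdiffD; last exact: IH.
by apply: cdiffM; [exact: cdiff_cst|exact: IH].
Qed.

(* The derivative of [step] is the bump function used as mollifier. *)
Definition step t : R := gexp 0 t * (gexp 0 t + gexp 0 (-1 * t + 1))^-1.

Lemma step_den t : 0 < gexp 0 t + gexp 0 (-1 * t + 1).
Proof.
have [t0|t0] := ltP 0 t.
  by rewrite ltr_wpDr ?gexp_ge0// /gexp t0 mul1r expR_gt0.
rewrite ltr_wpDl ?gexp_ge0// /gexp ifT; last lra.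
by rewrite mul1r expR_gt0.
Qed.

Lemma smooth1_step : smooth1 step.
Proof.
move=> k; apply: cdiffM; first exact: smooth1_gexp.
apply: cdiffV; first by move=> t; rewrite gt_eqF// step_den.
apply: cdiffD; first exact: smooth1_gexp.
by apply: cdiff_affine; exact: smooth1_gexp.
Qed.

Lemma step0 t : t <= 0 -> step t = 0.
Proof. by move=> t0; rewrite /step /gexp ltNge t0/= mul0r. Qed.

Lemma step1 t : 1 <= t -> step t = 1.
Proof.
move=> t1; rewrite /step; have := step_den t.
have -> : gexp 0 (-1 * t + 1) = 0.
  by rewrite /gexp ifF//; apply/negbTE; rewrite -leNgt; lra.
by rewrite addr0 => h; rewrite divff// gt_eqF.
Qed.

Lemma step_ge0 t : 0 <= step t.
Proof. by rewrite divr_ge0 ?gexp_ge0// ltW// step_den. Qed.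

Lemma step_le1 t : step t <= 1.
Proof. by rewrite ler_pdivrMr ?step_den// mul1r lerDl gexp_ge0. Qed.

(** After cross-multiplication, with g = [gexp 0], the inequality compares g(x) g(1 - y) with g(y)
    g(1 - x), and g is non-decreasing. *)
Lemma step_homo : {homo step : x y / x <= y}.
Proof.
have gh : {homo gexp 0 : x y / x <= y}.
  move=> x y xy; rewrite /gexp !mul1r.
  case: ifPn => x0; last by case: ifPn => // _; exact: expR_ge0.
  rewrite (lt_le_trans x0 xy) ler_expR lerN2 lef_pV2 ?posrE//.
  exact: lt_le_trans xy.
move=> x y xy; rewrite /step ler_pdivrMr ?step_den// mulrAC ler_pdivlMr ?step_den//.
have h1 := gh _ _ xy.
have h2 : gexp 0 (-1 * y + 1) <= gexp 0 (-1 * x + 1) by apply: gh; lra.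
have := gexp_ge0 0 x; have := gexp_ge0 0 (-1 * y + 1).
nra.
Qed.

Lemma derive_step_ge0 t : 0 <= step^`()%classic t.
Proof.
have [d E] := derivable_is_derive (let: conj h _ := smooth1_step 1%N in h t).
rewrite derive1E; apply: (limr_ge (d : cvg _)).
near=> h; rewrite /= [h *: 1]mulr1.
have h0 : h != 0 by near: h; exact: nbhs_dnbhs_neq.
have [hp|hn|/eqP] := ltgtP h 0; last by rewrite (negPf h0).
  by rewrite nmulr_rge0 ?invr_lt0// subr_le0; apply: step_homo; lra.
by rewrite pmulr_rge0 ?invr_gt0// subr_ge0; apply: step_homo; lra.
Unshelve. all: by end_near. Qed.

End smooth_line.

(** * Product kernels and convolution *)

Section kernels.
Context {R : realType} {n : nat}.
Local Notation mu := (@lebesgue_rV R n).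
Implicit Types (g : 'I_n -> R -> R) (x y z : 'rV[R]_n) (f : 'rV[R]_n -> R).

Lemma continuous_rV_cst (c : R) : continuous (fun _ : 'rV[R]_n => c).
Proof. exact: cst_continuous. Qed.

Lemma continuous_rVM f f' : continuous f -> continuous f' -> continuous (fun x => f x * f' x).
Proof. by move=> cf cf' x; apply: (@continuousM _ _ f f' x); [exact: cf|exact: cf']. Qed.

Lemma continuous_rVD f f' : continuous f -> continuous f' -> continuous (fun x => f x + f' x).
Proof. by move=> cf cf' x; apply: (@continuousD _ R^o _ f f' x); [exact: cf|exact: cf']. Qed.

Lemma continuous_rVN f : continuous f -> continuous (fun x => - f x).
Proof. by move=> cf x; apply: (@continuousN _ R^o _ f x); exact: cf. Qed.

Lemma continuous_rVB f f' : continuous f -> continuous f' -> continuous (fun x => f x - f' x).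
Proof. by move=> cf cf'; apply: continuous_rVD => //; exact: continuous_rVN. Qed.

Definition bumpfun (b : R -> R) := smooth1 b /\ exists M, forall t, M < `|t| -> b t = 0.

Lemma bump_bounded b : bumpfun b -> exists B, forall t, `|b t| <= B.
Proof.
move=> [sb [M bM]].
have : compact (b @` `[- `|M|, `|M|]).
  apply: continuous_compact; last exact: segment_compact.
  by apply: continuous_subspaceT; exact: smooth1_continuous.
move=> /compact_bounded[C [_ HC]].
exists (`|C| + 1) => t; have [tM|tM] := ltP `|M| `|t|.
  rewrite bM ?normr0; first by have := normr_ge0 C; lra.
  by have := ler_norm M; lra.
apply: HC; first by have := ler_norm C; lra.
by exists t => //; rewrite /= in_itv/= -ler_norml.
Qed.

Lemma bump_derive b : bumpfun b -> bumpfun b^`()%classic.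
Proof.
move=> [sb [M bM]]; split; first exact: smooth1_derive.
exists M => t tM; have [_ <-] := smooth1_is_derive t sb.
have [_ <-] := der1_cst (0 : R) t; apply: near_eq_derive.
near=> s; rewrite /= bM//; near: s.
by apply: (@cvgr_gt _ _ _ _ (fun s : R => `|s|) `|t|) => //; apply: cvg_norm; exact: cvg_id.
Unshelve. all: by end_near. Qed.

Lemma bump_lipschitz b : bumpfun b -> exists B, forall s t, `|b s - b t| <= B * `|s - t|.
Proof.
move=> bb; have [B HB] := bump_bounded (bump_derive bb); exists B => s t.
wlog ts : s t / t <= s.
  by move=> H; have [/H//|/ltW/H] := leP t s; rewrite distrC (distrC t).
have [|c _ ->] := @MVT_segment R b b^`()%classic _ _ ts (fun (x : R) _ => smooth1_is_derive x bb.1).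
  by apply: continuous_subspaceT; apply: smooth1_continuous; exact: bb.1.
by rewrite normrM ler_wpM2r.
Qed.

(** A tensor product rather than a radial kernel: its partial derivatives have the same shape
    ([dker]), and its mass is a product of one-dimensional masses. *)
Definition ker g z : R := \prod_i g i (z ord0 i).

Definition dker (i : 'I_n) g : 'I_n -> R -> R :=
  fun j => if j == i then (g j)^`()%classic else g j.

Definition bumps g := forall i, bumpfun (g i).

Lemma dker_bumps i g : bumps g -> bumps (dker i g).
Proof. by move=> bg j; rewrite /dker; case: eqP => // _; exact: bump_derive. Qed.

(** This is where the symmetry of the second derivatives of every mollified function comes from. *)
Lemma dkerC i j g : dker i (dker j g) = dker j (dker i g).
Proof.
apply/funext => k; rewrite /dker; case: eqP => [->|ki]; last by [].
by case: eqP.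
Qed.

Lemma bumps_bound g : bumps g -> exists2 B, 1 <= B & forall i, (forall t, `|g i t| <= B) /\
  (forall s t, `|g i s - g i t| <= B * `|s - t|).
Proof.
move=> bg.
have [B1 H1] := choice (fun i => bump_bounded (bg i)).
have [B2 H2] := choice (fun i => bump_lipschitz (bg i)).
exists (1 + \sum_i (`|B1 i| + `|B2 i|)).
  by rewrite lerDl; apply: sumr_ge0 => i _; rewrite addr_ge0.
move=> i; have le12 : `|B1 i| + `|B2 i| <= \sum_i (`|B1 i| + `|B2 i|).
  by rewrite (bigD1 i)//= lerDl; apply: sumr_ge0 => j _; rewrite addr_ge0.
have h1 := ler_norm (B1 i); have h2 := ler_norm (B2 i).
have h3 := normr_ge0 (B1 i); have h4 := normr_ge0 (B2 i).
split=> [t|s t]; first by apply: le_trans (H1 i t) _; lra.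
by apply: le_trans (H2 i s t) _; apply: ler_wpM2r => //; lra.
Qed.

Lemma ker_bound g : bumps g -> exists2 C, 0 <= C & (forall z, `|ker g z| <= C) /\
  (forall z z', `|ker g z - ker g z'| <= C * `|z - z'|).
Proof.
move=> bg; have [B B1 HB] := bumps_bound bg.
have B0 : 0 <= B by apply: le_trans B1.
have P (s : seq 'I_n) z : `|\prod_(i <- s) g i (z ord0 i)| <= B ^+ size s.
  elim: s => [|i s IH]; first by rewrite big_nil normr1.
  by rewrite big_cons normrM exprS ler_pM//; exact: (HB i).1.
have Q (s : seq 'I_n) z z' : `|\prod_(i <- s) g i (z ord0 i) - \prod_(i <- s) g i (z' ord0 i)|
    <= (size s)%:R * B ^+ size s * `|z - z'|.
  elim: s => [|i s IH]; first by rewrite !big_nil subrr normr0 !mul0r.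
  rewrite !big_cons.
  set p := \prod_(_ <- _) _ in IH *; set p' := \prod_(_ <- _) _ in IH *.
  rewrite (_ : _ - _ = (g i (z ord0 i) - g i (z' ord0 i)) * p + g i (z' ord0 i) * (p - p')); last ring.
  apply: le_trans (ler_normD _ _) _; rewrite !normrM.
  have h1 : `|g i (z ord0 i) - g i (z' ord0 i)| * `|p| <= (B * `|z - z'|) * B ^+ size s.
    apply: ler_pM => //; last exact: P.
    apply: le_trans ((HB i).2 _ _) _; rewrite ler_wpM2l//.
    have := @mx_normrE R 1 n (z - z') => /= E.
    rewrite [leRHS]E.
    have := le_bigmax 0 (fun ij : 'I_1 * 'I_n => `|(z - z') ij.1 ij.2|) (ord0, i).
    by rewrite !mxE.
  have h2 : `|g i (z' ord0 i)| * `|p - p'| <= B * ((size s)%:R * B ^+ size s * `|z - z'|).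
    by apply: ler_pM => //; exact: (HB i).1.
  apply: le_trans (lerD h1 h2) _; rewrite /= exprS -[(size s).+1%:R]natr1.
  by rewrite le_eqVlt; apply/orP; left; apply/eqP; ring.
exists (B ^+ n + n%:R * B ^+ n); first by rewrite addr_ge0// ?mulr_ge0// exprn_ge0.
have sz : size (index_enum 'I_n) = n by rewrite -[RHS]card_ord cardT enumT.
have e1 : 0 <= B ^+ n by exact: exprn_ge0.
have e2 : 0 <= n%:R * B ^+ n by rewrite mulr_ge0.
split=> [z|z z'].
  by apply: le_trans (P _ z) _; rewrite sz lerDl.
by apply: le_trans (Q _ z z') _; rewrite sz ler_wpM2r// lerDr.
Qed.

Lemma continuous_rVP f x : (forall e : R, 0 < e -> exists2 d : R, 0 < d &
  forall y, `|x - y| < d -> `|f x - f y| <= e) -> {for x, continuous f}.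
Proof.
move=> H; apply/(@cvgrPdist_le _ _ _ (nbhs x) (nbhs_filter x)) => e e0.
have [d d0 Hd] := H e e0.
have := nbhsx_ballx x d d0; apply: filterS => y.
by rewrite -ball_normE/=; exact: Hd.
Qed.

Lemma lipschitz_continuous_rV f (C : R) : (forall z z', `|f z - f z'| <= C * `|z - z'|) -> continuous f.
Proof.
move=> H x; apply: continuous_rVP => e e0.
have C1 : 0 < `|C| + 1 by have := normr_ge0 C; lra.
exists (e / (`|C| + 1)); first exact: divr_gt0.
move=> y yx; apply: le_trans (H x y) _.
apply: (@le_trans _ _ ((`|C| + 1) * `|x - y|)).
  by rewrite ler_wpM2r//; have := ler_norm C; lra.
by rewrite mulrC -ler_pdivlMr// ltW.
Qed.

Lemma continuous_ker_refl g x : bumps g -> continuous (fun y => ker g (x - y)).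
Proof.
move=> bg; have [C _ [_ H]] := ker_bound bg; apply: (@lipschitz_continuous_rV _ C) => z z'.
apply: le_trans (H _ _) _.
by rewrite (_ : x - z - (x - z') = z' - z) 1?distrC// opprB addrC addrA subrK.
Qed.

Lemma pder_ker i g : bumps g -> pder i (ker g) (ker (dker i g)).
Proof.
move=> bg.
have E h : ker h = (fun z => h i (z ord0 i) * \prod_(j | j != i) h j (z ord0 j)).
  by apply/funext => z; rewrite /ker (bigD1 i).
rewrite !E.
have E2 : (fun z => dker i g i (z ord0 i) * \prod_(j | j != i) dker i g j (z ord0 j)) =
   (fun z => (g i)^`()%classic (z ord0 i) * 1 * \prod_(j | j != i) g j (z ord0 j) + g i (z ord0 i) * 0).
  apply/funext => z; rewrite mulr0 addr0 mulr1 /dker eqxx; congr (_ * _).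
  by apply: eq_bigr => j /negPf ->.
rewrite E2; apply: pderM.
  apply: pder_eq.
    apply: (pder_comp1 (h := g i) (h' := (g i)^`()%classic) (pder_coord i i)).
    by move=> x; apply: smooth1_is_derive; exact: (bg i).1.
  by move=> x /=; rewrite eqxx.
move=> x; have L : forall h : R, \prod_(j | j != i) g j ((h *: delta_mx ord0 i + x) ord0 j) = \prod_(j | j != i) g j (x ord0 j).
  by move=> h; apply: eq_bigr => j ji; rewrite !mxE/= (negPf ji) mulr0 add0r.
have F : (fun h : R => h^-1 *: (((fun z : 'rV[R]_n => \prod_(j | j != i) g j (z ord0 j)) \o shift x) (h *: delta_mx ord0 i) -
   \prod_(j | j != i) g j (x ord0 j))) = cst 0.
  by apply/funext => h; rewrite /= L subrr scaler0.
split; first by rewrite /derivable F; apply/cvg_ex; exists 0; exact: cvg_cst.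
by rewrite /derive F; apply/cvg_lim => //; exact: cvg_cst.
Qed.

Lemma pder_ker_refl i g x : bumps g ->
  pder i (fun y => ker g (x - y)) (fun y => - ker (dker i g) (x - y)).
Proof.
move=> bg y.
have L : is_derive (0 : R) 1 (fun s => ker g ((x - y) + s *: delta_mx ord0 i)) (ker (dker i g) (x - y)).
  by apply: is_derive_line; rewrite scale0r addr0; exact: pder_ker.
have L2 : der1 (fun s => ker g ((x - y) + (- s) *: delta_mx ord0 i)) 0 (ker (dker i g) (x - y) * -1).
  apply: (der1_comp (f := fun s => ker g ((x - y) + s *: delta_mx ord0 i)) (g := fun s => - s)).
    by rewrite oppr0.
  exact: is_deriveN.
case: L2 => d2 E2.
have E : (fun k : R => k^-1 *: (((fun y => ker g (x - y)) \o shift y) (k *: delta_mx ord0 i) - ker g (x - y))) =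
  (fun k : R => k^-1 *: (((fun s => ker g ((x - y) + (- s) *: delta_mx ord0 i)) \o shift 0) (k *: 1) - ker g (x - y + (- 0) *: delta_mx ord0 i))).
  apply/funext => k /=; rewrite oppr0 scale0r !addr0 [k *: 1]mulr1; congr (_ *: (ker g _ - _)).
  by rewrite scaleNr opprD addrA addrAC.
split; first by rewrite /derivable E.
by rewrite /derive E; exact: etrans E2 (mulrN1 _).
Qed.

Lemma foldr_partial_ker g x s : bumps g ->
  foldr partial (fun y => ker g (x - y)) s =
  (fun y => (-1) ^+ size s * ker (foldr dker g s) (x - y)) /\ bumps (foldr dker g s).
Proof.
move=> bg; elim: s => [|i s [IH bs]] /=.
  by split => //; apply/funext => y; rewrite mul1r.
split; last exact: dker_bumps.
rewrite IH; apply/funext => y.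
have [_] := pderZ ((-1) ^+ size s) (pder_ker_refl i x bs) y.
by rewrite /partial => ->; rewrite exprS; ring.
Qed.

Lemma smooth_ker g x : bumps g -> smooth (fun y => ker g (x - y)).
Proof.
move=> bg s; have [-> bs] := foldr_partial_ker x s bg; split.
  by apply: continuous_rVM; [exact: continuous_rV_cst|exact: continuous_ker_refl].
by move=> i y; have [] := pderZ ((-1) ^+ size s) (pder_ker_refl i x bs) y.
Qed.

(** The test function that turns a weak identity into a pointwise identity at [x] between mollified
    functions. *)
Lemma ker_test_function g x (e : R) (D : set 'rV[R]_n) : bumps g ->
  (forall i t, e < `|t| -> g i t = 0) ->
  (forall y, (forall i, `|x ord0 i - y ord0 i| <= e) -> D y) ->
  test_function D (fun y => ker g (x - y)).
Proof.
move=> bg ge eD; split; first exact: smooth_ker.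
exists [set y : 'rV[R]_n | forall i, (fun i => `[x ord0 i - e, x ord0 i + e]%classic) i (y ord0 i)]; split.
- by apply: (@rV_compact R n (fun i => `[x ord0 i - e, x ord0 i + e]%classic)) => i; exact: segment_compact.
- move=> y H; apply: eD => i; have := H i; rewrite /= in_itv/= ler_distl => /andP[h1 h2]; lra.
move=> y /existsNP[i yi]; rewrite /ker (bigD1 i)//= ge ?mul0r//.
rewrite ltNge; apply/negP; rewrite !mxE => h; apply: yi => /=; rewrite in_itv/=.
by move: h; rewrite ler_norml => /andP[h1 h2]; lra.
Qed.

Definition convol f g x : R := \int[mu]_y (f y * ker g (x - y)).

Lemma measurable_ker_refl g x : bumps g -> measurable_fun [set: 'rV[R]_n] (fun y => ker g (x - y)).
Proof.
by move=> bg; apply: continuous_measurable_rV; exact: continuous_ker_refl.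
Qed.

Lemma convol_integrable f g x : bumps g -> mu.-integrable [set: 'rV[R]_n] (EFin \o f) ->
  mu.-integrable [set: 'rV[R]_n] (EFin \o (fun y => f y * ker g (x - y))).
Proof.
move=> bg fi; have [C C0 [HC _]] := ker_bound bg.
under [X in _.-integrable _ X]eq_fun do rewrite /= EFinM.
apply: (integrableMl _ fi) => //; first exact: measurable_ker_refl.
exists C; split; first exact: num_real.
by move=> r Cr y _ /=; exact: le_trans (HC _) (ltW Cr).
Qed.

Lemma continuous_conv f g : bumps g -> mu.-integrable [set: 'rV[R]_n] (EFin \o f) ->
  continuous (convol f g).
Proof.
move=> bg fi; have [C C0 [_ HC]] := ker_bound bg.
apply: (@lipschitz_continuous_rV _ ((\int[mu]_y `|f y|) * C)) => x x'.
rewrite /convol -RintegralB//; [|exact: convol_integrable..].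
apply: le_trans (le_normr_Rintegral _ _) _ => //.
  have := integrableB measurableT (convol_integrable x bg fi) (convol_integrable x' bg fi).
  by apply: eq_integrable.
rewrite -mulrA -RintegralZr//; last exact: integrable_norm.
apply: le_Rintegral => //.
- apply: integrable_norm.
  have := integrableB measurableT (convol_integrable x bg fi) (convol_integrable x' bg fi).
  by apply: eq_integrable.
- have := integrableZr measurableT (C * `|x - x'|) (integrable_norm fi).
  by apply: eq_integrable.
- move=> y _; rewrite -mulrBr normrM ler_wpM2l//.
  by apply: le_trans (HC _ _) _; rewrite opprB addrA subrK.
Qed.

(** Differentiation under the integral along the line through [x], dominated by |f| times a bound of
    the differentiated kernel. *)
Lemma pder_conv i f g : bumps g -> mu.-integrable [set: 'rV[R]_n] (EFin \o f) ->
  pder i (convol f g) (convol f (dker i g)).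
Proof.
move=> bg fi x; have [C C0 [HC _]] := ker_bound (dker_bumps i bg).
pose F (h : R) (y : 'rV[R]_n) := f y * ker g ((x - y) + h *: delta_mx ord0 i).
have dF (h : R) y : der1 (F ^~ y) h (f y * ker (dker i g) ((x - y) + h *: delta_mx ord0 i)).
  apply: der1_eq.
    apply: (is_derive1M (f := fun=> f y)); first exact: der1_cst.
    by apply: is_derive_line; exact: pder_ker.
  by rewrite mul0r add0r.
have d1 : partial1of2 F 0 = (fun y => f y * ker (dker i g) (x - y)).
  by apply/funext => y; rewrite partial1of2E; have [_ ->] := dF 0 y; rewrite scale0r addr0.
have FE (h : R) y : x - y + h *: delta_mx ord0 i = (x + h *: delta_mx ord0 i) - y.
  by rewrite addrAC.
have IF (h : R) : \int[mu]_y F h y = convol f g (x + h *: delta_mx ord0 i).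
  by apply: eq_Rintegral => y _; rewrite /F FE.
have H : (fun h : R => h^-1 *: ((convol f g \o shift x) (h *: delta_mx ord0 i) - convol f g x)) @ 0^' -->
    convol f (dker i g) x.
  have := @cvg_differentiation_under_integral R _ _ mu F setT measurableT 0 (-1) 1 _ _ _ (fun y => `|f y| * C).
  rewrite d1 => H; apply: cvg_trans (H _ _ _ _ _ _).
  - rewrite (_ : (fun h : R => h^-1 *: ((fun s : R => \int[mu]_y F s y) (h + 0) - (fun s : R => \int[mu]_y F s y) 0)) =
      (fun h : R => h^-1 *: ((convol f g \o shift x) (h *: delta_mx ord0 i) - convol f g x)))//.
    by apply/funext => h; rewrite addr0 !IF scale0r addr0 /= (addrC x).
  - by rewrite /= in_itv/=; apply/andP; split; lra.
  - move=> h _; rewrite /F; under eq_fun do rewrite FE; exact: convol_integrable.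
  - by move=> h y _ _; case: (dF h y).
  - by move=> y; rewrite mulr_ge0.
  - have := integrableZr measurableT C (integrable_norm fi).
    by apply: eq_integrable.
  - move=> h y _ _; rewrite partial1of2E; have [_ ->] := dF h y.
    by rewrite normrM ler_wpM2l.
split; first by apply/cvg_ex; exists (convol f (dker i g) x).
exact/cvg_lim.
Qed.

Lemma convolD f f' g x : bumps g -> mu.-integrable [set: 'rV[R]_n] (EFin \o f) ->
  mu.-integrable [set: 'rV[R]_n] (EFin \o f') ->
  convol (fun y => f y + f' y) g x = convol f g x + convol f' g x.
Proof.
move=> bg fi fi'; rewrite /convol -RintegralD//; [|exact: convol_integrable..].
by apply: eq_Rintegral => y _; rewrite mulrDl.
Qed.

Lemma convolZ c f g x : bumps g -> mu.-integrable [set: 'rV[R]_n] (EFin \o f) ->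
  convol (fun y => c * f y) g x = c * convol f g x.
Proof.
move=> bg fi; rewrite /convol -RintegralZl//; last exact: convol_integrable.
by apply: eq_Rintegral => y _; rewrite mulrA.
Qed.

End kernels.

Section mollifier_line.
Context {R : realType}.

Lemma integral_derive_step (f g : R -> R) (M c0 c1 : R) : (forall t : R, der1 f t (g t)) ->
  continuous g -> (forall t : R, t < - M -> f t = c0) -> (forall t : R, M < t -> f t = c1) ->
  (\int[lebesgue_measure]_t (g t)%:E = (c1 - c0)%:E)%E.
Proof.
move=> fg cg f0 f1.
pose N : R := `|M| + 1.
have MN : M < N by rewrite /N; have := ler_norm M; lra.
have N0 : 0 < N by rewrite /N; have := normr_ge0 M; lra.
have cf (t : R) : {for t, continuous f} by exact: is_derive_continuous (fg t).
have g0 (t : R) : N < `|t| -> g t = 0.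
  rewrite lter_normr => /orP[tN|tN]; have [_ <-] := fg t.
    have [_ <-] := der1_cst (c1 : R) t; apply: near_eq_derive.
    near=> s; rewrite f1//; near: s; apply: lt_nbhsr; exact: lt_trans tN.
  have [_ <-] := der1_cst (c0 : R) t; apply: near_eq_derive.
  near=> s; rewrite f0//; near: s; apply: lt_nbhsl; lra.
transitivity (\int[lebesgue_measure]_(t in `[(- N)%R, N]) (g t)%:E)%E.
  rewrite [RHS]integral_mkcond; apply: eq_integral => t _.
  rewrite patchE; case: ifPn => //; rewrite notin_setE/= in_itv/= -ler_norml => /negP.
  by rewrite -ltNge => /g0 ->.
rewrite (@continuous_FTC2 _ g f)//.
- by rewrite f1// f0 ?EFinB// ltrN2.
- lra.
- exact: continuous_subspaceT.
- split => [t _||]; first by case: (fg t).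
    by apply: cvg_at_right_filter; exact: cf.
  by apply: cvg_at_left_filter; exact: cf.
- by move=> t _; rewrite derive1E; case: (fg t).
Unshelve. all: by end_near. Qed.

Definition step_scaled (k : nat) (t : R) : R := step (k.+1%:R * t + 0).

(** The derivative of a step rising from 0 to 1 within [0, 1/(k+1)] is non-negative and has mass one
    without any normalising constant. Its support is one-sided, so the kernel is not even, and
    [mollifier_mass] states both orientations. *)
Definition mollifier (k : nat) : R -> R := (step_scaled k)^`()%classic.

Lemma smooth1_step_scaled k : smooth1 (step_scaled k).
Proof. by move=> j; apply: cdiff_affine; exact: smooth1_step. Qed.

Lemma step_scaled0 k t : t < 0 -> step_scaled k t = 0.
Proof. by move=> t0; rewrite /step_scaled step0// addr0 pmulr_rle0// ltW. Qed.

Lemma step_scaled1 k t : k.+1%:R^-1 < t -> step_scaled k t = 1.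
Proof.
move=> t0; rewrite /step_scaled step1// addr0 mulrC -ler_pdivrMr ?ltr0n//.
by rewrite mul1r ltW.
Qed.

Lemma mollifier_supp k t : k.+1%:R^-1 < `|t| -> mollifier k t = 0.
Proof.
move=> tk; rewrite /mollifier derive1E.
have k0 : 0 < k.+1%:R^-1 :> R by rewrite invr_gt0.
move: tk; rewrite lter_normr => /orP[tN|tN].
  have [_ <-] := der1_cst (1 : R) t; apply: near_eq_derive.
  by near=> s; rewrite step_scaled1//; near: s; exact: lt_nbhsr.
have [_ <-] := der1_cst (0 : R) t; apply: near_eq_derive.
near=> s; rewrite step_scaled0//; near: s; apply: lt_nbhsl.
by rewrite -oppr_gt0; exact: lt_trans tN.
Unshelve. all: by end_near. Qed.

Lemma bump_mollifier k : bumpfun (mollifier k).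
Proof.
split; first exact: smooth1_derive (smooth1_step_scaled k).
by exists k.+1%:R^-1 => t; exact: mollifier_supp.
Qed.

Lemma mollifier_ge0 k t : 0 <= mollifier k t.
Proof.
have [_ E] := is_derive1_affine (a := k.+1%:R) (b := 0) (t := t) (smooth1_is_derive _ smooth1_step).
by rewrite /mollifier derive1E [X in 0 <= X]E mulr_ge0// derive_step_ge0.
Qed.

Lemma mollifier_mass k (a : R) :
  (\int[lebesgue_measure]_t (mollifier k (t - a))%:E = 1)%E /\
  (\int[lebesgue_measure]_t (mollifier k (a - t))%:E = 1)%E.
Proof.
have cm : continuous (mollifier k) by apply: smooth1_continuous; exact: (bump_mollifier k).1.
have ds t := smooth1_is_derive t (smooth1_step_scaled k).
pose M : R := `|a| + 1.
have k1 : k.+1%:R^-1 <= 1 :> R by rewrite invf_le1// ler1n.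
have ha := ler_norm a; have ha2 := ler_norm (- a); rewrite normrN in ha2.
split.
  rewrite (@integral_derive_step (fun t => step_scaled k (1 * t + - a)) _ M 0 1).
  - by rewrite subr0.
  - move=> t; apply: der1_eq; first exact: (is_derive1_affine (ds _)).
    by rewrite !mul1r.
  - move=> t; apply: (@continuous_comp _ _ _ (fun t => t - a) (mollifier k)); last exact: cm.
    by apply: cvgB; [exact: cvg_id|exact: cvg_cst].
  - by move=> t tM; rewrite step_scaled0//; rewrite /M in tM; lra.
  - move=> t tM; rewrite step_scaled1//; apply: le_lt_trans k1 _; rewrite /M in tM; lra.
rewrite (@integral_derive_step (fun t => -1 * step_scaled k (-1 * t + a)) _ M (-1) 0).
- by rewrite opprK add0r.
- move=> t; apply: der1_eq.
    by apply: is_derive1M; [exact: der1_cst|exact: (is_derive1_affine (ds _))].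
  by rewrite mul0r add0r mulrA mulrNN !mul1r mulN1r addrC.
- move=> t; apply: (@continuous_comp _ _ _ (fun t => a - t) (mollifier k)); last exact: cm.
  by apply: cvgB; [exact: cvg_cst|exact: cvg_id].
- move=> t tM; rewrite step_scaled1 ?mulr1//; apply: le_lt_trans k1 _; rewrite /M in tM; lra.
- by move=> t tM; rewrite step_scaled0 ?mulr0//; rewrite /M in tM; lra.
Qed.

End mollifier_line.

Section mollification.
Context {R : realType}.
Local Notation mu n := (@lebesgue_rV R n).

Lemma integral_prod_rV n (h : 'I_n -> R -> R) : (forall i t, 0 <= h i t) ->
  (forall i, continuous (h i)) ->
  (forall i, \int[lebesgue_measure]_t (h i t)%:E = 1)%E ->
  (\int[mu n]_x (\prod_i h i (x ord0 i))%:E = 1)%E.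
Proof.
elim: n h => [|n IH] h h0 ch h1.
  rewrite /= integral_dirac//.
    by rewrite diracT mul1e big_ord0.
  by under eq_fun do rewrite big_ord0; exact: measurable_cst.
have mh m (g : 'I_m -> R -> R) : (forall i, continuous (g i)) ->
    measurable_fun [set: 'rV[R]_m] (fun x => \prod_i g i (x ord0 i)).
  move=> cg; apply: measurable_prod => i _.
  apply: continuous_measurable_rV => x.
  by apply: (@continuous_comp _ _ _ (fun x : 'rV[R]_m => x ord0 i) (g i)); [exact: coord_continuous|exact: cg].
rewrite ge0_integral_rVS; last 2 first.
- by apply/measurable_EFinP; exact: mh.
- by move=> x; rewrite lee_fin; apply: prodr_ge0.
transitivity (\int[lebesgue_measure]_t (h ord0 t)%:E)%E; last exact: h1.
apply: eq_integral => t _.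
transitivity (\int[mu n]_y ((h ord0 t)%:E * (\prod_i h (lift ord0 i) (y ord0 i))%:E))%E.
  apply: eq_integral => y _; rewrite big_ord_recl cons_rV0 EFinM; congr (_ * _%:E)%E.
  by apply: eq_bigr => i _; rewrite cons_rVS.
rewrite ge0_integralZl_EFin//; last 2 first.
- by move=> y _; rewrite lee_fin; apply: prodr_ge0.
- by apply/measurable_EFinP; apply: (mh _ (fun i => h (lift ord0 i))).
by rewrite (IH (fun i => h (lift ord0 i))) ?mule1.
Qed.

Context {n : nat}.
Implicit Types (x y z : 'rV[R]_n) (f : 'rV[R]_n -> R).

Definition mker (k : nat) : 'I_n -> R -> R := fun=> mollifier k.

Definition moll k f := convol f (mker k).

Lemma mker_bumps k : bumps (mker k). Proof. by move=> i; exact: bump_mollifier. Qed.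

Lemma mker_ge0 k z : 0 <= ker (mker k) z.
Proof. by apply: prodr_ge0 => i _; exact: mollifier_ge0. Qed.

Lemma continuous_mollifier_l k (a : R) : continuous (fun t => mollifier k (t - a)).
Proof.
move=> t; apply: (@continuous_comp _ _ _ (fun t => t - a) (mollifier k)).
  by apply: cvgB; [exact: cvg_id|exact: cvg_cst].
by apply: smooth1_continuous; exact: (bump_mollifier k).1.
Qed.

Lemma continuous_mollifier_r k (a : R) : continuous (fun t => mollifier k (a - t)).
Proof.
move=> t; apply: (@continuous_comp _ _ _ (fun t => a - t) (mollifier k)).
  by apply: cvgB; [exact: cvg_cst|exact: cvg_id].
by apply: smooth1_continuous; exact: (bump_mollifier k).1.
Qed.

Lemma mker_mass_l k y : (\int[mu n]_x (ker (mker k) (x - y))%:E = 1)%E.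
Proof.
rewrite -(@integral_prod_rV n (fun i t => mollifier k (t - y ord0 i))).
- by apply: eq_integral => x _; congr EFin; apply: eq_bigr => i _; rewrite !mxE.
- by move=> i t; exact: mollifier_ge0.
- by move=> i; exact: continuous_mollifier_l.
- by move=> i; exact: (mollifier_mass _ _).1.
Qed.

Lemma mker_mass_r k x : (\int[mu n]_y (ker (mker k) (x - y))%:E = 1)%E.
Proof.
rewrite -(@integral_prod_rV n (fun i t => mollifier k (x ord0 i - t))).
- by apply: eq_integral => y _; congr EFin; apply: eq_bigr => i _; rewrite !mxE.
- by move=> i t; exact: mollifier_ge0.
- by move=> i; exact: continuous_mollifier_r.
- by move=> i; exact: (mollifier_mass _ _).2.
Qed.

Lemma ker_integrable k x : (mu n).-integrable [set: 'rV[R]_n] (EFin \o (fun y => ker (mker k) (x - y))).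
Proof.
apply/integrableP; split.
  by apply/measurable_EFinP; apply: measurable_ker_refl; exact: mker_bumps.
under eq_integral do rewrite /= (ger0_norm (mker_ge0 _ _)).
by rewrite mker_mass_r ltry.
Qed.

Lemma measurable_mker_sub k : measurable_fun [set: 'rV[R]_n * 'rV[R]_n]
  (fun z : 'rV[R]_n * 'rV[R]_n => ker (mker k) (z.1 - z.2)).
Proof.
apply: measurable_prod => i _.
rewrite [X in measurable_fun _ X](_ : _ =
  mollifier k \o (fun z : 'rV[R]_n * 'rV[R]_n => z.1 ord0 i - z.2 ord0 i)); last first.
  by apply/funext => z /=; rewrite !mxE.
apply: measurableT_comp.
  by apply: continuous_measurable_fun; apply: smooth1_continuous; exact: (bump_mollifier k).1.
apply: measurable_funB.
  exact: (measurableT_comp (measurable_coord_rV i) measurable_fst).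
exact: (measurableT_comp (measurable_coord_rV i) measurable_snd).
Qed.

(** After exchanging the integrals, the kernel has mass one in [x] for each fixed [y]. *)
Lemma moll_tonelli k f : measurable_fun [set: 'rV[R]_n] f -> (forall x, 0 <= f x) ->
  (\int[mu n]_x \int[mu n]_y (f y * ker (mker k) (x - y))%:E = \int[mu n]_y (f y)%:E)%E.
Proof.
move=> mf f0.
have mk := measurable_mker_sub k.
have mfk : measurable_fun [set: 'rV[R]_n * 'rV[R]_n]
    (fun z : 'rV[R]_n * 'rV[R]_n => (f z.2 * ker (mker k) (z.1 - z.2))%:E).
  apply/measurable_EFinP; apply: measurable_funM => //.
  exact: (measurableT_comp mf measurable_snd).
rewrite (fubini_tonelli (m1 := mu n) (m2 := mu n) (fun z : 'rV[R]_n * 'rV[R]_n => (f z.2 * ker (mker k) (z.1 - z.2))%:E))//; last first.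
  by move=> z; rewrite lee_fin mulr_ge0// mker_ge0.
apply: eq_integral => y _ /=.
transitivity (\int[mu n]_x ((f y)%:E * (ker (mker k) (x - y))%:E))%E.
  by apply: eq_integral => x _; rewrite EFinM.
rewrite ge0_integralZl_EFin//.
- by rewrite mker_mass_l mule1.
- by move=> x _; rewrite lee_fin mker_ge0.
- apply/measurable_EFinP.
  have := measurableT_comp mk (measurable_fun_pair (@measurable_id _ 'rV[R]_n setT) (@measurable_cst _ _ _ _ setT y)).
  by [].
Qed.

Lemma moll_le k f x : (mu n).-integrable [set: 'rV[R]_n] (EFin \o f) ->
  (`|moll k f x|%:E <= \int[mu n]_y (`|f y| * ker (mker k) (x - y))%:E)%E.
Proof.
move=> fi; have fki := convol_integrable x (mker_bumps k) fi.
rewrite EFin_normr_Rintegral//.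
apply: le_trans (le_abse_integral _ _ _) _ => //.
  by have /integrableP[] := fki.
by under eq_integral do rewrite /= normrM (ger0_norm (mker_ge0 _ _)).
Qed.

Lemma moll_L1 k f : (mu n).-integrable [set: 'rV[R]_n] (EFin \o f) ->
  (\int[mu n]_x `|moll k f x|%:E <= \int[mu n]_x `|f x|%:E)%E.
Proof.
move=> fi; have /integrableP[/measurable_EFinP mf _] := fi.
have mnf : measurable_fun [set: 'rV[R]_n] (fun x => `|f x|) by exact: measurableT_comp.
rewrite -(moll_tonelli k mnf)//.
apply: ge0_le_integral => //.
- apply/measurable_EFinP; apply: measurableT_comp => //.
  by apply: continuous_measurable_rV; apply: continuous_conv => //; exact: mker_bumps.
- apply: (measurable_fun_fubini_tonelli_F (m2 := mu n) (fun z : 'rV[R]_n * 'rV[R]_n => (`|f z.2| * ker (mker k) (z.1 - z.2))%:E)).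
    apply/measurable_EFinP; apply: measurable_funM.
      exact: (measurableT_comp mnf measurable_snd).
    exact: measurable_mker_sub.
  by move=> z; rewrite lee_fin mulr_ge0// mker_ge0.
- by move=> x _; exact: moll_le.
Qed.

Lemma moll_integrable k f : (mu n).-integrable [set: 'rV[R]_n] (EFin \o f) ->
  (mu n).-integrable [set: 'rV[R]_n] (EFin \o moll k f).
Proof.
move=> fi; apply/integrableP; split.
  apply/measurable_EFinP; apply: continuous_measurable_rV.
  by apply: continuous_conv => //; exact: mker_bumps.
have /integrableP[_] := fi; apply: le_lt_trans; exact: moll_L1.
Qed.

(** The kernel is a probability density and [c] is the mean of [f] for it; the claim says that the
    variance, the integral of (f - c)^2, is non-negative. *)
Lemma moll_jensen k f x : (mu n).-integrable [set: 'rV[R]_n] (EFin \o f) ->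
  (mu n).-integrable [set: 'rV[R]_n] (EFin \o (fun y => f y ^+ 2)) ->
  (moll k f x) ^+ 2 <= moll k (fun y => f y ^+ 2) x.
Proof.
move=> fi f2i; set c := moll k f x.
have i1 := convol_integrable x (mker_bumps k) fi.
have i2 := convol_integrable x (mker_bumps k) f2i.
have i0 := ker_integrable k x.
have : 0 <= \int[mu n]_y ((f y - c) ^+ 2 * ker (mker k) (x - y)).
  by apply: Rintegral_ge0 => y _; rewrite mulr_ge0 ?sqr_ge0 ?mker_ge0.
have -> : \int[mu n]_y ((f y - c) ^+ 2 * ker (mker k) (x - y)) =
   \int[mu n]_y (f y ^+ 2 * ker (mker k) (x - y) + ((- (c + c)) * (f y * ker (mker k) (x - y)) + c ^+ 2 * ker (mker k) (x - y))).
  by apply: eq_Rintegral => y _; ring.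
have j1 : (mu n).-integrable [set: 'rV[R]_n] (EFin \o (fun y => - (c + c) * (f y * ker (mker k) (x - y)))).
  have := integrableZl measurableT (- (c + c)) i1.
  by apply: eq_integrable.
have j0 : (mu n).-integrable [set: 'rV[R]_n] (EFin \o (fun y => c ^+ 2 * ker (mker k) (x - y))).
  have := integrableZl measurableT (c ^+ 2) i0.
  by apply: eq_integrable.
have j2 : (mu n).-integrable [set: 'rV[R]_n] (EFin \o (fun y => - (c + c) * (f y * ker (mker k) (x - y)) + c ^+ 2 * ker (mker k) (x - y))).
  have := integrableD measurableT j1 j0.
  by apply: eq_integrable.
rewrite RintegralD// RintegralD// !RintegralZl//.
have -> : \int[mu n]_y ker (mker k) (x - y) = 1 by rewrite /Rintegral mker_mass_r.
rewrite -/(convol _ _ _) -[\int[mu n]_x0 (f x0 * _)]/(convol f (mker k) x) -/(moll k _ _) -/(moll k _ _) -/c.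
nra.
Qed.

End mollification.

(** * Convergence of mollifications in L^1 *)

Section approximation.
Import HBSimple.
Context {R : realType} {n : nat}.
Local Notation mu := (@lebesgue_rV R n).
Implicit Types (x y z : 'rV[R]_n) (f h : 'rV[R]_n -> R) (A : set 'rV[R]_n).

Definition integr f := mu.-integrable [set: 'rV[R]_n] (EFin \o f).

Lemma integrD f h : integr f -> integr h -> integr (fun x => f x + h x).
Proof. by move=> fi hi; have := integrableD measurableT fi hi; apply: eq_integrable. Qed.

Lemma integrZ (c : R) f : integr f -> integr (fun x => c * f x).
Proof. by move=> fi; have := integrableZl measurableT c fi; apply: eq_integrable. Qed.

Lemma integrB f h : integr f -> integr h -> integr (fun x => f x - h x).
Proof. by move=> fi hi; have := integrableB measurableT fi hi; apply: eq_integrable. Qed.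

Lemma integr_norm f : integr f -> integr (fun x => `|f x|).
Proof. by move=> fi; have := integrable_norm fi; apply: eq_integrable. Qed.

Lemma integr_measurable f : integr f -> measurable_fun [set: 'rV[R]_n] f.
Proof. by move=> /integrableP[/measurable_EFinP]. Qed.

Lemma integr_le f h : measurable_fun [set: 'rV[R]_n] f -> integr h -> (forall x, `|f x| <= h x) ->
  integr f.
Proof.
move=> mf hi fh; apply: (le_integrable measurableT _ _ hi).
  exact/measurable_EFinP.
by move=> x _ /=; rewrite lee_fin (le_trans (fh x))// ler_norm.
Qed.

Definition L1norm f : R := \int[mu]_x `|f x|.

Lemma L1norm_ge0 f : 0 <= L1norm f.
Proof. by apply: Rintegral_ge0. Qed.

Lemma L1normD f h : integr f -> integr h -> L1norm (fun x => f x + h x) <= L1norm f + L1norm h.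
Proof.
move=> fi hi; rewrite /L1norm -RintegralD//; [|exact: integr_norm..].
apply: le_Rintegral => //; first by apply: integr_norm; exact: integrD.
  by apply: integrD; exact: integr_norm.
by move=> x _; exact: ler_normD.
Qed.

Lemma L1norm_moll k f : integr f -> L1norm (moll k f) <= L1norm f.
Proof.
move=> fi; apply: fine_le.
- by apply: integrable_fin_num => //; apply: integr_norm; exact: moll_integrable.
- by apply: integrable_fin_num => //; exact: integr_norm.
- exact: moll_L1.
Qed.

Definition approx f := integr f /\
  forall e : R, 0 < e -> exists K, forall k, (K <= k)%N -> L1norm (fun x => moll k f x - f x) <= e.

Lemma mollB k f h x : integr f -> integr h -> moll k (fun x => f x - h x) x = moll k f x - moll k h x.
Proof.
move=> fi hi; rewrite /moll -[X in _ = _ + X]mulN1r.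
rewrite -(convolZ (-1) x (@mker_bumps R n k) hi) -convolD//; last 2 first.
- exact: mker_bumps.
- exact: integrZ.
by congr (convol _ _ _); apply/funext => y; rewrite mulN1r.
Qed.

Lemma approxD f h : approx f -> approx h -> approx (fun x => f x + h x).
Proof.
move=> [fi Hf] [hi Hh]; split; first exact: integrD.
move=> e e0; have [K1 H1] := Hf (e / 2) (divr_gt0 e0 (ltr0Sn _ 1)).
have [K2 H2] := Hh (e / 2) (divr_gt0 e0 (ltr0Sn _ 1)).
exists (maxn K1 K2) => k; rewrite geq_max => /andP[k1 k2].
have -> : (fun x => moll k (fun y => f y + h y) x - (f x + h x)) =
  (fun x => (moll k f x - f x) + (moll k h x - h x)).
  apply/funext => x; rewrite /moll convolD//; last exact: mker_bumps.
  by rewrite opprD addrACA.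
apply: le_trans (L1normD _ _) _.
- by apply: integrB => //; exact: moll_integrable.
- by apply: integrB => //; exact: moll_integrable.
- by have := H1 k k1; have := H2 k k2; lra.
Qed.

Lemma approxZ (c : R) f : approx f -> approx (fun x => c * f x).
Proof.
move=> [fi Hf]; split; first exact: integrZ.
move=> e e0; have c1 : 0 < `|c| + 1 by have := normr_ge0 c; lra.
have [K1 H1] := Hf (e / (`|c| + 1)) (divr_gt0 e0 c1).
exists K1 => k kK.
have -> : (fun x => moll k (fun y => c * f y) x - c * f x) = (fun x => c * (moll k f x - f x)).
  apply/funext => x; rewrite /moll convolZ//; last exact: mker_bumps.
  by rewrite mulrBr.
rewrite /L1norm (_ : (fun x => `|c * _|) = (fun x => `|c| * `|moll k f x - f x|)); last first.
  by apply/funext => x; rewrite normrM.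
rewrite RintegralZl//; last first.
  by apply: integr_norm; apply: integrB => //; exact: moll_integrable.
have := H1 k kK; rewrite -/(L1norm _) => h.
apply: le_trans (ler_wpM2l (normr_ge0 c) h) _.
rewrite mulrA ler_pdivrMr// mulrC ler_wpM2l ?ltW//; lra.
Qed.

Lemma approx_sum (I : Type) (s : seq I) (F : I -> 'rV[R]_n -> R) :
  (forall i, approx (F i)) -> approx (fun x => \sum_(i <- s) F i x).
Proof.
move=> H; elim: s => [|i s IH].
  have -> : (fun x => \sum_(i <- [::]) F i x) = (fun x : 'rV[R]_n => 0).
    by apply/funext => x; rewrite big_nil.
  split; first exact: integrable0.
  move=> e e0; exists 0%N => k _; rewrite /L1norm /moll /convol.
  have E x : \int[mu]_y (0 * ker (mker k) (x - y)) = 0.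
    by rewrite /Rintegral integral0_eq// => y _; rewrite mul0r.
  under eq_Rintegral do rewrite E subrr normr0.
  by rewrite /Rintegral integral0 ltW.
have -> : (fun x => \sum_(j <- i :: s) F j x) = (fun x => F i x + \sum_(j <- s) F j x).
  by apply/funext => x; rewrite big_cons.
exact: approxD.
Qed.

(** Mollification contracts the L^1 norm, so that [moll k (f - h)], [moll k h - h] and [f - h] each
    contribute at most e / 3. *)
Lemma approx_closed f : integr f ->
  (forall e : R, 0 < e -> exists2 h, approx h & L1norm (fun x => f x - h x) <= e) -> approx f.
Proof.
move=> fi H; split=> // e e0; have e3 : 0 < e / 3 by lra.
have [h [hi Hh] fh] := H _ e3; have [K HK] := Hh _ e3.
exists K => k kK.
have -> : (fun x => moll k f x - f x) =
  (fun x => (moll k (fun y => f y - h y) x + (moll k h x - h x)) + (-1) * (f x - h x)).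
  by apply/funext => x; rewrite mollB//; ring.
have fhi := integrB fi hi.
have i1 : integr (moll k (fun y => f y - h y)) by exact: moll_integrable.
have i2 : integr (fun x => moll k h x - h x) by apply: integrB => //; exact: moll_integrable.
apply: le_trans (L1normD (integrD i1 i2) (integrZ _ fhi)) _.
have h1 := L1normD i1 i2; have h2 := L1norm_moll k fhi; have h3 := HK k kK.
have h4 : L1norm (fun x => -1 * (f x - h x)) = L1norm (fun x => f x - h x).
  by apply: eq_Rintegral => x _; rewrite mulN1r normrN.
by rewrite h4; lra.
Qed.

Lemma integr_indic A : measurable A -> (mu A < +oo)%E -> integr \1_A.
Proof.
move=> mA Afin; apply/integrableP; split; first by apply/measurable_EFinP.
under eq_integral do rewrite /= ger0_norm//.
by rewrite integral_indic// setIT.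
Qed.

Lemma moll_ge0 k f x : (forall y, 0 <= f y) -> 0 <= moll k f x.
Proof. by move=> f0; apply: Rintegral_ge0 => y _; rewrite mulr_ge0// mker_ge0. Qed.

Lemma Rintegral_moll k f : integr f -> (forall y, 0 <= f y) -> \int[mu]_x moll k f x = \int[mu]_x f x.
Proof.
move=> fi f0; rewrite /Rintegral; congr fine.
rewrite -(moll_tonelli k (integr_measurable fi) f0); apply: eq_integral => x _.
by rewrite fineK//; apply: integrable_fin_num => //; apply: convol_integrable => //; exact: mker_bumps.
Qed.

Lemma moll_near f x (e c : R) k : 0 < e -> k.+1%:R^-1 < e ->
  (forall y, (forall i, `|x ord0 i - y ord0 i| < e) -> f y = c) -> moll k f x = c.
Proof.
move=> e0 ke fc; transitivity (\int[mu]_y (c * ker (mker k) (x - y))).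
  apply: eq_Rintegral => y _.
  have [H|H] := pselect (forall i, `|x ord0 i - y ord0 i| < e); first by rewrite fc.
  move/existsNP : H => [i /negP]; rewrite -leNgt => H.
  suff -> : ker (mker k) (x - y) = 0 by rewrite !mulr0.
  rewrite /ker (bigD1 i)//= /mker mollifier_supp ?mul0r//.
  by rewrite !mxE; exact: lt_le_trans ke H.
by rewrite RintegralZl//; [rewrite /Rintegral mker_mass_r mulr1|exact: ker_integrable].
Qed.

(** Only the negative part of [moll k \1_A - \1_A] is controlled pointwise: it is eventually zero at
    each point of [A] and always zero off [A]. Dominated convergence sends its integral to 0, and
    the positive part has the same integral because mollification preserves the total mass. *)
Lemma approx_open A : open A -> (mu A < +oo)%E -> approx (\1_A : 'rV[R]_n -> R).
Proof.
move=> oA Afin; have mA := open_measurable_rV oA; have fi := integr_indic mA Afin.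
split=> // e e0.
pose g k x : R := Num.max 0 (\1_A x - moll k \1_A x).
have f0 y : 0 <= (\1_A y : R) by [].
have mg k : measurable_fun [set: 'rV[R]_n] (g k).
  apply: measurable_maxr => //; apply: measurable_funB; first exact: integr_measurable.
  by apply: integr_measurable; exact: moll_integrable.
have gle k x : `|g k x| <= \1_A x.
  rewrite /g ger0_norm ?le_max ?lexx// ge_max f0/= gerBl; exact: moll_ge0.
have gi k : integr (g k) by apply: (integr_le _ fi).
have gcvg : (\int[mu]_x (g k x)%:E @[k --> \oo] --> \int[mu]_x (0 : \bar R))%E.
  apply: (@dominated_cvg _ _ _ mu setT measurableT _ _ (EFin \o \1_A)) => //.
  - by move=> k; apply/measurable_EFinP.
  - move=> x _; have [Ax|Ax] := pselect (A x); last first.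
      apply: cvg_near_cst; near=> k; congr EFin.
      apply/eqP; rewrite /g eq_le le_max lexx/= andbT ge_max lexx/=.
      by rewrite indicE memNset// sub0r oppr_le0 moll_ge0.
    have /nbhs_ballP[d /= d0 xd] : nbhs x A by exact: open_nbhs_nbhs.
    apply: cvg_near_cst; near=> k; congr EFin.
    rewrite /g (@moll_near _ x d 1) ?indicE ?mem_set// ?subrr ?maxxx//.
      near: k; apply: near_infty_natSinv_lt (PosNum d0).
    by move=> y xy; rewrite indicE mem_set//; apply: xd; rewrite ball_rVE.
  - by move=> k x _; rewrite lee_fin.
rewrite integral0 in gcvg.
have gcvgR : \int[mu]_x g k x @[k --> \oo] --> (0 : R).
  by apply: (@fine_cvg _ _ _ _ _ 0).
move/cvgrPdist_le : gcvgR => /(_ (e / 2) (divr_gt0 e0 (ltr0Sn _ 1)))[K _ HK].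
exists K => k kK; have := HK k kK; rewrite /= sub0r normrN => h.
have mi := moll_integrable k fi.
(* The identity |h| = h + 2 h^-, where [g k] is the negative part. *)
have -> : L1norm (fun x => moll k \1_A x - \1_A x) = \int[mu]_x ((moll k \1_A x - \1_A x) + 2 * g k x).
  apply: eq_Rintegral => x _; rewrite /g.
  have [h1|h1] := leP 0 (\1_A x - moll k \1_A x).
    by rewrite ler0_norm; lra.
  by rewrite ger0_norm; lra.
rewrite (RintegralD measurableT (integrB mi fi) (integrZ 2 (gi k))).
rewrite (RintegralB measurableT mi fi) Rintegral_moll// subrr add0r RintegralZl//; last exact: gi.
by have := ler_norm (\int[mu]_x g k x); lra.
Unshelve. all: by end_near. Qed.

Definition ocube (M : R) : set 'rV[R]_n := ball (0 : 'rV[R]_n) M.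

Lemma ocubeE M : 0 < M -> ocube M = [set x | forall i, `|x ord0 i| < M].
Proof.
move=> M0; rewrite /ocube ball_rVE//; apply/seteqP; split => x H i; have := H i; by rewrite !mxE sub0r normrN.
Qed.

Lemma ocube_sub M : 0 < M -> ocube M `<=` cube M.
Proof. by move=> M0 x; rewrite ocubeE// => H i; exact: ltW. Qed.

Lemma open_ocube M : open (ocube M).
Proof. exact: ball_open. Qed.

Lemma fin_sub_cube M A : measurable A -> A `<=` cube M -> (mu A < +oo)%E.
Proof.
move=> mA AM; apply: le_lt_trans (cube_fin M).
by apply: le_measure => //; rewrite inE//; exact: measurable_cube.
Qed.

(** Dynkin induction starting from open sets. The intersection with a cube keeps every measure
    finite, which matters for complements. *)
Lemma approx_indic (M : R) A : 0 < M -> measurable A -> approx (\1_(A `&` ocube M) : 'rV[R]_n -> R).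
Proof.
move=> M0.
have mQ := open_measurable_rV (@open_ocube M).
have finQ B : measurable B -> (mu (B `&` ocube M) < +oo)%E.
  move=> mB; apply: (@fin_sub_cube M); first exact: measurableI.
  by apply: subset_trans (@subIsetr _ _ _) _; exact: ocube_sub.
rewrite measurable_rV_open.
apply: (dynkin_induction (P := fun A => approx (\1_(A `&` ocube M) : 'rV[R]_n -> R)) measurable_rV_open).
- exact: openI.
- by rewrite setTI; apply: approx_open (@open_ocube M) _; have := finQ _ measurableT; rewrite setTI.
- move=> B oB; apply: approx_open; first exact: openI oB (@open_ocube M).
  by apply: finQ; exact: open_measurable_rV.
- move=> B mB HB.
  have -> : (\1_(~` B `&` ocube M) : 'rV[R]_n -> R) = (fun x => \1_(setT `&` ocube M) x + (-1) * \1_(B `&` ocube M) x).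
    apply/funext => x; rewrite !indicE !in_setI in_setC in_setT.
    by case: (x \in B); case: (x \in ocube M) => /=; rewrite ?mulN1r ?subrr ?subr0 ?mulr0 ?addr0.
  apply: approxD; last exact: approxZ.
  by rewrite setTI; apply: approx_open (@open_ocube M) _; have := finQ _ measurableT; rewrite setTI.
move=> F mF tF HF.
have mU : measurable (\bigcup_k F k) by exact: bigcup_measurable.
apply: approx_closed; first by apply: integr_indic; [exact: measurableI|exact: finQ].
move=> e e0.
(* Partial sums, each an indicator of a finite union because the [F k] are disjoint; dominated
   convergence carries them to the full union. *)
pose g m x : R := \sum_(k <- iota 0 m) \1_(F k `&` ocube M) x.
have gE m x : g m x = \1_((\bigcup_(k < m) F k) `&` ocube M) x.
  elim: m => [|m IH]; first by rewrite /g big_nil II0 bigcup_set0 set0I indic0.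
  rewrite /g -addn1 iotaD big_cat/= big_seq1 -/(g m x) IH add0n addn1.
  rewrite !indicI/= -mulrDl; congr (_ * _); rewrite !indicE.
  have [xm|xm] := boolP (x \in F m).
    rewrite (_ : x \in \bigcup_(k < m.+1) F k); last by rewrite inE; exists m => /=; rewrite ?ltnS//; exact: set_mem.
    rewrite (_ : x \in \bigcup_(k < m) F k = false) ?add0r//.
    apply/negbTE; rewrite notin_setE => -[k /= km Fk].
    have := tF _ _ I I (ex_intro _ x (conj Fk (set_mem xm))).
    by move=> kE; rewrite kE ltnn in km.
  rewrite addr0; congr (_%:R); congr nat_of_bool; apply/idP/idP; rewrite !inE.
    by move=> [k /= km Fk]; exists k => //=; exact: ltn_trans (ltnSn m).
  move=> [k /=]; rewrite ltnS leq_eqVlt => /orP[/eqP ->|km Fk]; last by exists k.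
  by move=> /mem_set; rewrite (negPf xm).
have gi m : integr (g m).
  have -> : g m = \1_((\bigcup_(k < m) F k) `&` ocube M) by apply/funext => x; rewrite gE.
  have mb : measurable (\bigcup_(k < m) F k) by apply: bigcup_measurable.
  by apply: integr_indic; [exact: measurableI|exact: finQ].
have Qi : integr (\1_(ocube M) : 'rV[R]_n -> R).
  by apply: integr_indic => //; have := finQ _ measurableT; rewrite setTI.
have Ui : integr (\1_((\bigcup_k F k) `&` ocube M) : 'rV[R]_n -> R).
  by apply: integr_indic; [exact: measurableI|exact: finQ].
have : (\int[mu]_x (`|\1_((\bigcup_k F k) `&` ocube M) x - g m x|)%:E @[m --> \oo] --> \int[mu]_x (0 : \bar R))%E.
  apply: (@dominated_cvg _ _ _ mu setT measurableT _ _ (EFin \o \1_(ocube M))) => //.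
  - by move=> m; apply/measurable_EFinP; apply: integr_measurable; apply: integr_norm; exact: integrB.
  - move=> x _; have [[[k _ Fk] Qx]|Ux] := pselect (((\bigcup_k F k) `&` ocube M) x); last first.
      apply: cvg_near_cst; apply: nearW => m; congr EFin.
      rewrite gE !indicE !memNset ?subrr ?normr0// => -[[k _ Fk] Qx]; apply: Ux; split => //.
      by exists k.
    apply: cvg_near_cst; exists k.+1 => //= m km; congr EFin.
    rewrite gE !indicE !mem_set ?subrr ?normr0//; first by split => //; exists k.
    by split => //; exists k.
  - move=> m x _; rewrite lee_fin normr_id gE (indicI _ (\bigcup_k F k)) (indicI _ (\bigcup_(k < m) F k))/= -mulrBl normrM.
    rewrite (@ger0_norm _ (\1_(ocube M) x))// ler_piMl// !indicE.
    by case: (_ \in _); case: (_ \in _); rewrite /= ?subrr ?subr0 ?sub0r ?normrN ?normr1 ?normr0.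
rewrite integral0 => gcvg.
have gcvgR : L1norm (fun x => \1_((\bigcup_k F k) `&` ocube M) x - g m x) @[m --> \oo] --> (0 : R).
  by apply: (@fine_cvg _ _ _ _ _ 0).
move/cvgrPdist_le : gcvgR => /(_ e e0)[m _ Hm].
exists (g m); first by apply: approx_sum => k; exact: HF.
by have := Hm m (leqnn m); rewrite /= sub0r normrN; apply: le_trans; exact: ler_norm.
Qed.

(** Simple functions approximate [f] in L^1. Multiplied by the indicator of an open cube containing
    the support of [f], they become combinations of the indicators treated in [approx_indic]. *)
Lemma approx_vanishes f (M : R) : integr f -> vanishes_off M f -> approx f.
Proof.
move=> fi f0; apply: approx_closed => // e e0.
have [g [gi _ gcvg]] := approximation_sfun_integrable measurableT fi.
have N0 : 0 < `|M| + 1 by have := normr_ge0 M; lra.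
pose Q := ocube (`|M| + 1).
have fQ x : f x = \1_Q x * f x.
  rewrite indicE; have [xQ|xQ] := boolP (x \in Q); rewrite ?mul1r// mul0r.
  apply: f0 => xM; move: xQ; rewrite notin_setE; apply; rewrite /Q ocubeE// => i.
  by apply: le_lt_trans (xM i) _; have := ler_norm M; lra.
have gcvgR : \int[mu]_x `|f x - g m x| @[m --> \oo] --> (0 : R).
  by apply: (@fine_cvg _ _ _ _ _ 0).
move/cvgrPdist_le : gcvgR => /(_ e e0)[m _ /(_ m (leqnn m))].
rewrite /= sub0r normrN => Hm.
have mQ : measurable Q by exact: open_measurable_rV (@open_ocube _).
exists (fun x => \1_Q x * g m x).
  have -> : (fun x => \1_Q x * g m x) =
    (fun x => \sum_(r <- finmap.enum_fset (fset_set (range (g m)))) r * \1_(g m @^-1` [set r] `&` Q) x).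
    apply/funext => x; rewrite (fimfunE (g m) x) fsbig_finite//= mulr_sumr.
    by apply: eq_bigr => r _; rewrite mulrCA; congr (_ * _); rewrite !indicE in_setI mulrC -natrM mulnb.
  apply: approx_sum => r; apply: approxZ; apply: approx_indic => //.
apply: le_trans _ (le_trans (ler_norm _) Hm).
have gim : integr (g m) by exact: gi.
have mQg : measurable_fun [set: 'rV[R]_n] (fun x => \1_Q x * g m x).
  by apply: measurable_funM => //; exact: integr_measurable.
have fgi := integrB fi gim.
apply: le_Rintegral => //.
- apply: (integr_le _ (integr_norm fgi)).
    by apply: measurableT_comp => //; apply: measurable_funB => //; exact: integr_measurable.
  move=> x; rewrite normr_id {1}fQ -mulrBr normrM indicE; case: (_ \in _); rewrite ?normr1 ?mul1r// normr0 mul0r//.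
- exact: integr_norm.
- by move=> x _; rewrite {1}fQ -mulrBr normrM indicE; case: (_ \in _); rewrite ?normr1 ?mul1r// normr0 mul0r.
Qed.

End approximation.

(** * Integrals of functions that agree almost everywhere *)

Section ae_integral.
Import HBNNSimple.
Context d (T : measurableType d) (R : realType) (m : {measure set T -> \bar R}).
Local Open Scope ereal_scope.

(** This has to cover functions that are measurable only up to a null set, such as the given
    solutions. A simple function below [f], set to zero on the exceptional null set, lies below [g]
    and keeps its integral. *)
Lemma ge0_ae_integral_le (f g : T -> \bar R) : (forall x, 0 <= f x) -> (forall x, 0 <= g x) ->
  {ae m, forall x, f x = g x} -> \int[m]_x f x <= \int[m]_x g x.
Proof.
move=> f0 g0 [N [mN N0 fgN]].
rewrite ge0_integralTE// ge0_integralTE//.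
apply: ub_ereal_sup => _ [h /= hf <-].
pose h' : {nnsfun T >-> R} := mul_nnsfun h (indic_nnsfun R (measurableC mN)).
suff -> : sintegral m h = sintegral m h'.
  apply: ereal_sup_ubound; exists h' => //= x.
  rewrite /h' /= /mindic indicE; have [xN|xN] := boolP (x \in ~` N); last by rewrite mulr0.
  rewrite mulr1; apply: le_trans (hf x) _.
  have -> // : f x = g x.
  by apply: contrapT => nfg; move: xN; rewrite inE => /=; apply; exact: fgN.
rewrite -!integralT_nnsfun; apply: ae_eq_integral => //.
- by apply/measurable_EFinP.
- by apply/measurable_EFinP.
- exists N; split => // x /= H; apply: contrapT => xN; apply: H => _.
  by rewrite /h' /= /mindic indicE mem_set ?mulr1.
Qed.

Lemma ge0_ae_integral (f g : T -> \bar R) : (forall x, 0 <= f x) -> (forall x, 0 <= g x) ->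
  {ae m, forall x, f x = g x} -> \int[m]_x f x = \int[m]_x g x.
Proof.
move=> f0 g0 fg; apply/eqP; rewrite eq_le !ge0_ae_integral_le//.
by move: fg; apply: filterS => x ->.
Qed.

Lemma ae_integral (D : set T) (f g : T -> \bar R) :
  {ae m, forall x, D x -> f x = g x} -> \int[m]_(x in D) f x = \int[m]_(x in D) g x.
Proof.
move=> fg; rewrite !(integral_mkcond D) [LHS]integralE [RHS]integralE.
by congr (_ - _); apply: ge0_ae_integral => //; move: fg; apply: filterS => x H;
  rewrite ?funeposE ?funenegE !patchE; case: ifPn => // /set_mem /H ->.
Qed.

End ae_integral.

Lemma ae_Rintegral d (T : measurableType d) (R : realType) (m : {measure set T -> \bar R})
  (D : set T) (f g : T -> R) :
  {ae m, forall x, D x -> f x = g x} -> \int[m]_(x in D) f x = \int[m]_(x in D) g x.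
Proof.
move=> fg; rewrite /Rintegral (@ae_integral _ _ _ _ D (EFin \o f) (EFin \o g))//.
by move: fg; apply: filterS => x H Dx /=; rewrite H.
Qed.

(** * Convergence of mollifications in L^2 *)

Section L2_convergence.
Context {R : realType} {n : nat}.
Local Notation mu := (@lebesgue_rV R n).
Implicit Types (x y z : 'rV[R]_n) (f g h b : 'rV[R]_n -> R).

Definition sqint f := measurable_fun [set: 'rV[R]_n] f /\ integr (fun x => f x ^+ 2).

Lemma sqintD f g : sqint f -> sqint g -> sqint (fun x => f x + g x).
Proof.
move=> [mf fi] [mg gi]; split; first exact: measurable_funD.
apply: (integr_le _ (integrD (integrZ 2 fi) (integrZ 2 gi))).
  by apply: measurable_funX; exact: measurable_funD.
move=> x; rewrite ger0_norm ?sqr_ge0//; have := sqr_ge0 (f x - g x); nra.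
Qed.

Lemma sqintZ (c : R) f : sqint f -> sqint (fun x => c * f x).
Proof.
move=> [mf fi]; split; first exact: measurable_funM.
have -> : (fun x => (c * f x) ^+ 2) = (fun x => c ^+ 2 * f x ^+ 2).
  by apply/funext => x; rewrite exprMn.
exact: integrZ.
Qed.

Lemma sqintB f g : sqint f -> sqint g -> sqint (fun x => f x - g x).
Proof.
move=> hf hg; have := sqintD hf (sqintZ (-1) hg).
by rewrite (_ : (fun x => _) = (fun x => f x - g x))//; apply/funext => x; rewrite mulN1r.
Qed.

Lemma sqint_integr f (M : R) : sqint f -> vanishes_off M f -> integr f.
Proof.
move=> [mf f2] f0.
have ci : integr (\1_(cube M) : 'rV[R]_n -> R).
  by apply: integr_indic; [exact: measurable_cube|exact: cube_fin].
apply: (integr_le mf (integrD ci f2)) => x.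
have [xM|xM] := pselect (cube M x).
  rewrite indicE mem_set// -(@real_normK _ (f x)) ?num_real// (_ : true%:R = 1 :> R)//.
  have := sqr_ge0 (`|f x| - 1); have := normr_ge0 (f x); nra.
by rewrite f0// normr0 addr_ge0// sqr_ge0.
Qed.

Lemma integrM_bounded b f (C : R) : measurable_fun [set: 'rV[R]_n] b ->
  (forall x, `|b x| <= C) -> integr f -> integr (fun x => b x * f x).
Proof.
move=> mb bC fi; have mf := integr_measurable fi.
apply: (integr_le _ (integrZ C (integr_norm fi))); first exact: measurable_funM.
by move=> x; rewrite normrM ler_wpM2r.
Qed.

Lemma sqint_moll k f : integr f -> sqint f -> sqint (moll k f) /\
  \int[mu]_x (moll k f x ^+ 2) <= \int[mu]_x (f x ^+ 2).
Proof.
move=> fi [mf f2].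
have m2i := moll_integrable k f2.
have J x := moll_jensen k x fi f2.
have mm : measurable_fun [set: 'rV[R]_n] (moll k f) by apply: integr_measurable; exact: moll_integrable.
have i2 : integr (fun x => moll k f x ^+ 2).
  apply: (integr_le _ m2i); first exact: measurable_funX.
  by move=> x; rewrite ger0_norm ?sqr_ge0.
split=> //.
rewrite -(Rintegral_moll k f2); last by move=> y; exact: sqr_ge0.
by apply: le_Rintegral.
Qed.

Lemma moll_bounded k f x (C : R) : integr f -> (forall y, `|f y| <= C) -> `|moll k f x| <= C.
Proof.
move=> fi fC; apply: le_trans (le_normr_Rintegral _ _) _ => //.
  by apply: convol_integrable => //; exact: mker_bumps.
have -> : C = \int[mu]_y (C * ker (mker k) (x - y)).
  by rewrite RintegralZl//; [rewrite /Rintegral mker_mass_r mulr1|exact: ker_integrable].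
apply: le_Rintegral => //.
- by apply: integr_norm; apply: convol_integrable => //; exact: mker_bumps.
- by apply: (@integrZ _ _ C); exact: ker_integrable.
- by move=> y _; rewrite normrM (ger0_norm (mker_ge0 _ _)) ler_wpM2r// mker_ge0.
Qed.

(** Truncation reduces convergence in L^2 to convergence in L^1: for t bounded by m, (moll t - t)^2
    <= 2 m |moll t - t|. *)
Definition trunc_fun (m : nat) f x : R := Num.max (- m%:R) (Num.min m%:R (f x)).

Lemma trunc_bound m f x : `|trunc_fun m f x| <= m%:R.
Proof.
rewrite /trunc_fun ler_norml le_max lexx/= ge_max ge_min lexx/= andbT.
by rewrite -subr_ge0 opprK addr_ge0.
Qed.

Lemma trunc_id m f x : `|f x| <= m%:R -> trunc_fun m f x = f x.
Proof.
by rewrite ler_norml /trunc_fun => /andP[h1 h2]; rewrite (min_idPr h2) (max_idPr h1).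
Qed.

Lemma trunc_err m f x : (f x - trunc_fun m f x) ^+ 2 <= f x ^+ 2.
Proof.
have key (a c : R) : 0 <= a -> (c - Num.max (- a) (Num.min a c)) ^+ 2 <= c ^+ 2.
  move=> a0; case: (leP a c) => h1; first by case: (leP (- a) a) => h2; nra.
  by case: (leP (- a) c) => h2; nra.
exact: key.
Qed.

Lemma moll_L2_cvg f (M : R) : sqint f -> vanishes_off M f -> forall e : R, 0 < e ->
  exists K, forall k, (K <= k)%N -> \int[mu]_x ((moll k f x - f x) ^+ 2) <= e.
Proof.
move=> sf f0 e e0; have [mf f2] := sf; have fi := sqint_integr sf f0.
have mt m : measurable_fun [set: 'rV[R]_n] (trunc_fun m f).
  by apply: measurable_maxr => //; apply: measurable_minr.
have tcvg : (\int[mu]_x ((f x - trunc_fun m f x) ^+ 2)%:E @[m --> \oo] --> \int[mu]_x (0 : \bar R))%E.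
  apply: (@dominated_cvg _ _ _ mu setT measurableT _ _ (EFin \o (fun x => f x ^+ 2))) => //.
  - move=> m; apply/measurable_EFinP; apply: measurable_funX; exact: measurable_funB.
  - move=> x _; apply: cvg_near_cst; near=> m; congr EFin.
    rewrite trunc_id ?subrr ?expr0n//; near: m; exact: nbhs_infty_ger.
  - by move=> m x _; rewrite lee_fin ger0_norm ?sqr_ge0// trunc_err.
rewrite integral0 in tcvg.
have tcvgR : \int[mu]_x ((f x - trunc_fun m f x) ^+ 2) @[m --> \oo] --> (0 : R).
  by apply: (@fine_cvg _ _ _ _ _ 0).
(* Since (x + y + z)^2 <= 3 (x^2 + y^2 + z^2), it suffices that the three errors are at most e / 12,
   e / 6 and e / 12. *)
have e12 : 0 < e / 12 by lra.
move/cvgrPdist_le : tcvgR => /(_ _ e12)[m _ /(_ m (leqnn m))].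
rewrite /= sub0r normrN => Hm.
set t := trunc_fun m f in Hm *.
have t0 : vanishes_off M t.
  by move=> x xM; rewrite /t trunc_id f0// normr0.
have st : sqint t.
  split; first exact: mt.
  apply: (integr_le _ (integrZ 4 f2)); first exact: measurable_funX (mt m).
  move=> x; rewrite ger0_norm ?sqr_ge0//; have := trunc_err m f x; rewrite -/(t x).
  have := sqr_ge0 (f x - t x); have := sqr_ge0 (t x - 2 * f x); nra.
have ti := sqint_integr st t0.
have [_ Ht] := approx_vanishes ti t0.
have d0 : 0 < e / (12 * (m%:R + 1)).
  by rewrite divr_gt0// mulr_gt0//; have : 0 <= m%:R :> R by []; lra.
have [K HK] := Ht _ d0; exists K => k kK.
have sd := sqintB sf st.
have di := integrB fi ti.
have [smd mdle] := sqint_moll k di sd.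
have [smt _] := sqint_moll k ti st.
have smtt := sqintB smt st.
have i3 := sd.2; have i1 := smd.2; have i2 := smtt.2.
have [smf _] := sqint_moll k fi sf.
have i0 := (sqintB smf sf).2.
apply: (@le_trans _ _ (\int[mu]_x (3 * (moll k (fun y => f y - t y) x ^+ 2 + ((moll k t x - t x) ^+ 2 + (f x - t x) ^+ 2))))).
  apply: le_Rintegral => //.
    by apply: (@integrZ _ _ 3); apply: (integrD i1); exact: integrD.
  move=> x _; rewrite mollB//.
  set a := moll k f x; set c := moll k t x.
  have := sqr_ge0 (a - c - (c - t x)); have := sqr_ge0 (a - c - (t x - f x)).
  have := sqr_ge0 (c - t x - (t x - f x)); nra.
rewrite RintegralZl//; last by apply: (integrD i1); exact: integrD.
rewrite (RintegralD measurableT i1 (integrD i2 i3)) (RintegralD measurableT i2 i3).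
have h3 : \int[mu]_x ((f x - t x) ^+ 2) <= e / 12 by apply: le_trans (ler_norm _) Hm.
have h2 : \int[mu]_x ((moll k t x - t x) ^+ 2) <= e / 6.
  apply: (@le_trans _ _ (\int[mu]_x (2 * m%:R * `|moll k t x - t x|))).
    apply: le_Rintegral => //.
      by apply: integrZ; apply: integr_norm; apply: integrB => //; exact: moll_integrable.
    move=> x _; rewrite -(@real_normK _ (_ - _)) ?num_real// expr2 ler_wpM2r//.
    apply: le_trans (ler_normB _ _) _.
    have := moll_bounded k x ti (trunc_bound m f); have := trunc_bound m f x; rewrite -/(t x); lra.
  rewrite RintegralZl//; last by apply: integr_norm; apply: integrB => //; exact: moll_integrable.
  have := HK k kK; rewrite /L1norm => h.
  have m0 : 0 <= m%:R :> R by [].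
  apply: le_trans (ler_wpM2l _ h) _; first by rewrite mulr_ge0.
  rewrite mulrA ler_pdivrMr ?mulr_gt0//; last lra.
have h1 := mdle; lra.
Unshelve. all: by end_near. Qed.

(** Based on |x^2 - y^2| <= (1 + 1 / del) (x - y)^2 + del y^2: [del] makes the second term small
    once and for all, then convergence in L^2 makes the first small. *)
Lemma moll_quad_cvg f b (M C : R) : sqint f -> vanishes_off M f ->
  measurable_fun [set: 'rV[R]_n] b -> (forall x, `|b x| <= C) ->
  \int[mu]_x (b x * moll k f x ^+ 2) @[k --> \oo] --> \int[mu]_x (b x * f x ^+ 2).
Proof.
move=> sf f0 mb bC; have fi := sqint_integr sf f0.
apply/cvgrPdist_le => e e0.
have C0 : 0 <= C by apply: le_trans (bC 0).
have I0 : 0 <= \int[mu]_x (f x ^+ 2) by apply: Rintegral_ge0 => x _; exact: sqr_ge0.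
set I := \int[mu]_x (f x ^+ 2) in I0.
(* Adding 1 to [C] and [I] keeps the denominators positive when these vanish. *)
pose del := e / (2 * (C + 1) * (I + 1)).
have del0 : 0 < del by rewrite divr_gt0// !mulr_gt0//; lra.
pose e' := e / (2 * (C + 1) * (1 + del^-1)).
have dV : 0 < del^-1 by rewrite invr_gt0.
have e'0 : 0 < e' by rewrite divr_gt0// !mulr_gt0//; lra.
have [K HK] := moll_L2_cvg sf f0 e'0.
exists K => // k /= kK.
have [smf _] := sqint_moll k fi sf.
have i1 := integrM_bounded mb bC sf.2.
have i2 := integrM_bounded mb bC smf.2.
have i3 := (sqintB smf sf).2.
rewrite -(RintegralB measurableT i1 i2).
apply: le_trans (le_normr_Rintegral _ _) _ => //; first exact: integrB.
apply: (@le_trans _ _ (\int[mu]_x (C * ((1 + del^-1) * (moll k f x - f x) ^+ 2 + del * f x ^+ 2)))).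
  have iB : integr (fun x => (1 + del^-1) * (moll k f x - f x) ^+ 2 + del * f x ^+ 2).
    by apply: integrD; apply: integrZ => //; exact: sf.2.
  apply: le_Rintegral => //; first by apply: integr_norm; exact: integrB.
    exact: (integrZ C iB).
  move=> x _; rewrite -mulrBr normrM.
  apply: ler_pM => //.
  set a := moll k f x; set c := f x.
  have H (X Y : R) : 2 * (X * Y) <= del^-1 * X ^+ 2 + del * Y ^+ 2.
    rewrite -subr_ge0.
    have -> : del^-1 * X ^+ 2 + del * Y ^+ 2 - 2 * (X * Y) = del^-1 * (X - del * Y) ^+ 2.
      by field; rewrite gt_eqF.
    by rewrite mulr_ge0 ?sqr_ge0// ltW.
  have h1 := H (a - c) c; have h2 := H (a - c) (- c); rewrite sqrrN mulrN in h2.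
  have h3 := sqr_ge0 (a - c).
  rewrite ler_norml; apply/andP; split; nra.
rewrite RintegralZl//; last first.
  by apply: integrD; apply: integrZ => //; exact: sf.2.
rewrite (RintegralD measurableT (integrZ _ i3) (integrZ _ sf.2)) RintegralZl// RintegralZl//; last exact: sf.2.
rewrite -/I.
have h := HK k kK.
set J := \int[mu]_x _ in h *.
have J0 : 0 <= J by apply: Rintegral_ge0 => x _; exact: sqr_ge0.
have h1 : (C + 1) * ((1 + del^-1) * J) <= e / 2.
  apply: (@le_trans _ _ ((C + 1) * ((1 + del^-1) * e'))).
    by rewrite ler_wpM2l ?ler_wpM2l//; lra.
  rewrite /e' le_eqVlt; apply/orP; left; apply/eqP; field.
  by apply/andP; split; rewrite gt_eqF//; lra.
have h2 : (C + 1) * (del * (I + 1)) = e / 2.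
  by rewrite /del; field; apply/andP; split; rewrite gt_eqF//; lra.
have h3 : C * ((1 + del^-1) * J + del * I) <= (C + 1) * ((1 + del^-1) * J + del * (I + 1)).
  apply: ler_pM => //; [|lra|].
    by apply: addr_ge0; apply: mulr_ge0 => //; lra.
  by rewrite lerD2l ler_wpM2l//; lra.
lra.
Qed.

End L2_convergence.

(** * Borel representatives of weak solutions *)

Section weak_gradients.
Context {R : realType} {n : nat}.
Local Notation mu := (@lebesgue_rV R n).
Implicit Types (x y z : 'rV[R]_n) (f g h : 'rV[R]_n -> R) (D : set 'rV[R]_n).

Definition sball (r : R) : set 'rV[R]_n := [set x | sq x < r ^+ 2].
Definition scball (r : R) : set 'rV[R]_n := [set x | sq x <= r ^+ 2].

Lemma eballE (r : R) : 0 < r -> eball r = sball r.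
Proof.
move=> r0; apply/seteqP; split=> x; rewrite /eball /sball /= -enorm_sqr => h.
  by rewrite ltr_pXn2r ?nnegrE ?enorm_ge0 ?ltW.
by move: h; rewrite ltr_pXn2r ?nnegrE ?enorm_ge0 ?ltW.
Qed.

Lemma open_sball r : open (sball r).
Proof.
rewrite (_ : sball r = sq @^-1` [set t | t < r ^+ 2]) //.
have /continuousP := @continuous_sq R n; apply; exact: open_lt.
Qed.

Lemma scball_cube r : 0 <= r -> scball r `<=` cube r.
Proof. by move=> r0 x; exact: sq_cube. Qed.

Lemma compact_scball r : 0 <= r -> compact (scball r).
Proof.
move=> r0; apply: (subclosed_compact _ (@compact_cube R n r)); last exact: scball_cube.
rewrite (_ : scball r = sq @^-1` [set t | t <= r ^+ 2]) //.
have /continuous_closedP := @continuous_sq R n; apply; exact: closed_le.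
Qed.

(** A scale below which mollification at a point of the smaller ball sees only the larger one;
    distances are coordinatewise, like the supports of the kernels. *)
Lemma sball_near (r r' : R) : 0 < r -> r < r' -> exists2 d : R, 0 < d &
  forall x y, sball r x -> (forall i, `|x ord0 i - y ord0 i| <= d) -> sball r' y.
Proof.
move=> r0 rr'.
pose N : R := n%:R + 1; have N0 : 0 < N by rewrite /N; have : 0 <= n%:R :> R by []; lra.
pose d := (r' ^+ 2 - r ^+ 2) / (N * (r' ^+ 2 + 3 * r' + 3)).
have P0 : 0 < r' ^+ 2 + 3 * r' + 3 by have := sqr_ge0 r'; nra.
have D0 : 0 < r' ^+ 2 - r ^+ 2 by nra.
have d0 : 0 < d by rewrite divr_gt0// mulr_gt0.
have N1 : 1 <= N by rewrite /N lerDr.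
have dNP : d * (N * (r' ^+ 2 + 3 * r' + 3)) = r' ^+ 2 - r ^+ 2 by rewrite divfK// gt_eqF// mulr_gt0.
have d1 : d <= 1.
  rewrite ler_pdivrMr ?mulr_gt0// mul1r; apply: (@le_trans _ _ (r' ^+ 2 + 3 * r' + 3)).
    by have := sqr_ge0 r; lra.
  by rewrite ler_peMl// ltW.
exists d => // x y; rewrite /sball/= => xr xy.
have bnd i : y ord0 i ^+ 2 <= x ord0 i ^+ 2 + d * (2 * r' + 1).
  have xi : x ord0 i ^+ 2 <= r ^+ 2 by exact: le_trans (sqr_coord_le x i) (ltW xr).
  have xi2 : `|x ord0 i| <= r' .
    have h : `|x ord0 i| ^+ 2 <= r' ^+ 2 by rewrite real_normK ?num_real//; lra.
    by rewrite -(@ler_pXn2r _ 2) ?nnegrE//; lra.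
  have := xy i; rewrite ler_norml => /andP[h1 h2].
  move: xi2; rewrite ler_norml => /andP[h3 h4].
  have [h5|h5] := leP 0 (y ord0 i + x ord0 i); nra.
have : sq y <= sq x + d * (2 * r' + 1) * n%:R.
  have -> : d * (2 * r' + 1) * n%:R = \sum_(i < n) d * (2 * r' + 1).
    by rewrite sumr_const card_ord -[RHS]mulr_natr.
  by rewrite /sq -big_split/=; apply: ler_sum => i _; exact: bnd.
have n0 : 0 <= n%:R :> R by [].
have : d * (2 * r' + 1) * n%:R <= d * (N * (2 * r' + 1)).
  by rewrite -mulrA ler_pM2l// mulrC ler_wpM2r//; rewrite /N; lra.
have : d * (N * (2 * r' + 1)) < d * (N * (r' ^+ 2 + 3 * r' + 3)).
  by rewrite ltr_pM2l// ltr_pM2l//; have := sqr_ge0 r'; lra.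
lra.
Qed.

Lemma sub_sball (r s : R) : 0 <= r -> r <= s -> sball r `<=` sball s.
Proof.
by move=> r0 rs x; rewrite /sball/= => h; apply: lt_le_trans h _; rewrite ler_pXn2r ?nnegrE//; exact: le_trans rs.
Qed.

Lemma sball_scball (r s : R) : 0 <= r -> r <= s -> sball r `<=` scball s.
Proof. by move=> r0 rs x /(sub_sball r0 rs) /ltW. Qed.

Lemma measurable_sball r : measurable (sball r).
Proof. exact: open_measurable_rV (@open_sball r). Qed.

Lemma Rintegral_restrict D f : \int[mu]_(x in D) f x = \int[mu]_x (\1_D x * f x).
Proof.
rewrite Rintegral_mkcond; apply: eq_Rintegral => x _.
by rewrite patchE indicE; case: (x \in D); rewrite ?mul1r ?mul0r.
Qed.

(* du Bois-Reymond *)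
Lemma test_zero (r0 : R) h (r : R) : 0 < r -> r < r0 -> measurable_fun [set: 'rV[R]_n] h ->
  (forall s : R, 0 < s -> s < r0 -> integr (fun x => \1_(scball s) x * h x)) ->
  (forall phi, test_function (sball r0) phi -> \int[mu]_x (\1_(sball r0) x * (h x * phi x)) = 0) ->
  {ae mu, forall x, sball r x -> h x = 0}.
Proof.
move=> r_gt0 rr0 mh hi H.
pose s := (r + r0) / 2.
have rs : r < s by rewrite /s; lra.
have sr0 : s < r0 by rewrite /s; lra.
have s0 : 0 < s by lra.
have [d d0 Hd] := sball_near r_gt0 rs.
have hsi := hi s s0 sr0.
have hs0 : vanishes_off s (fun x => \1_(scball s) x * h x).
  by move=> x xs; rewrite indicE memNset ?mul0r// => /(scball_cube (ltW s0)).
have [_ Happ] := approx_vanishes hsi hs0.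
(* The kernel centred at [x] is an admissible test function, so the hypothesis itself says that the
   mollification vanishes at [x]. *)
have moll0 k x : k.+1%:R^-1 < d -> sball r x -> moll k (fun x => \1_(scball s) x * h x) x = 0.
  move=> kd rx.
  have sub y : (forall i, `|x ord0 i - y ord0 i| <= k.+1%:R^-1) -> sball s y.
    by move=> xy; apply: (Hd x) => // i; apply: le_trans (xy i) (ltW kd).
  have tf : test_function (sball r0) (fun y => ker (@mker R n k) (x - y)).
    apply: (@ker_test_function R n _ x k.+1%:R^-1); first exact: mker_bumps.
      by move=> i t; exact: mollifier_supp.
    by move=> y /sub; apply: sub_sball; lra.
  rewrite -[RHS](H _ tf); apply: eq_Rintegral => y _.
  have [ys|ys] := pselect (sball s y).
    have e1 : sball r0 y by apply: sub_sball ys; lra.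
    have e2 : scball s y by apply: sball_scball ys => //; lra.
    by rewrite !indicE (mem_set e1) (mem_set e2) !mul1r.
  rewrite (_ : ker _ _ = 0) ?mulr0//.
  apply: contrapT => /eqP kn0; apply: ys; apply: sub => i; rewrite leNgt; apply/negP => h1.
  by move/eqP : kn0; apply; rewrite /ker (bigD1 i)//= /mker mollifier_supp ?mul0r// !mxE.
(* On the small ball the mollification is zero, so the L^1 norm of [h] there is part of the error of
   approximation, which tends to 0. *)
have I0 : L1norm (fun x => \1_(sball r) x * h x) = 0.
  apply/eqP; rewrite eq_le L1norm_ge0 andbT; apply/ler_addgt0Pl => e e0; rewrite addr0.
  have [K HK] := Happ e e0.
  have [k kK kd] : exists2 k, (K <= k)%N & k.+1%:R^-1 < d :> R.
    near \oo => k; exists k; first by near: k; exact: nbhs_infty_ge.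
    near: k; exact: near_infty_natSinv_lt (PosNum d0).
  apply: le_trans (HK k kK); rewrite /L1norm; apply: le_Rintegral => //.
  - apply: integr_norm; apply: (integr_le _ (integr_norm hsi)).
      by apply: measurable_funM => //; apply: measurable_indic; exact: measurable_sball.
    move=> x; rewrite !normrM ler_wpM2r// !indicE; have [xr|xr] := boolP (x \in sball r); last by rewrite normr0.
    by rewrite mem_set//; apply: sball_scball (set_mem xr); lra.
  - by apply: integr_norm; apply: integrB => //; exact: moll_integrable.
  - move=> x _; have [xr|xr] := pselect (sball r x); last by rewrite indicE memNset// mul0r normr0.
    have e2 : scball s x by apply: sball_scball xr; lra.
    by rewrite moll0// sub0r normrN !indicE (mem_set xr) (mem_set e2).
have mh' : measurable_fun [set: 'rV[R]_n] (fun x => \1_(sball r) x * h x).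
  by apply: measurable_funM => //; apply: measurable_indic; exact: measurable_sball.
have hri : integr (fun x => \1_(sball r) x * h x).
  apply: (integr_le mh' (integr_norm hsi)) => x.
  rewrite !normrM ler_wpM2r// !indicE; have [xr|xr] := boolP (x \in sball r); last by rewrite normr0.
  by rewrite mem_set//; apply: sball_scball (set_mem xr); lra.
have E0 : (\int[mu]_x `|(\1_(sball r) x * h x)%:E| = 0)%E.
  have := integrable_fin_num measurableT (integr_norm hri) => /fineK <-.
  by rewrite -[fine _]/(L1norm (fun x => \1_(sball r) x * h x)) I0.
have mhE : measurable_fun [set: 'rV[R]_n] (EFin \o (fun x => \1_(sball r) x * h x)) by exact/measurable_EFinP.
have [/(_ E0) H0 _] := @ae_eq_integral_abs _ _ _ mu setT measurableT
  (EFin \o (fun x => \1_(sball r) x * h x)) mhE.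
move: H0; apply: filterS => x /(_ Logic.I) /= [+] xr.
by rewrite indicE mem_set// mul1r.
Unshelve. all: by end_near. Qed.


Definition locint D g := measurable_fun [set: 'rV[R]_n] g /\
  forall K, compact K -> K `<=` D -> integr (fun x => \1_K x * g x).

Lemma compact_measurable_rV (K : set 'rV[R]_n) : compact K -> measurable K.
Proof.
move=> cK; rewrite -[K]setCK; apply: measurableC; apply: open_measurable_rV.
by apply: closed_openC; apply: compact_closed => //; exact: norm_hausdorff.
Qed.

Lemma ae_and (P Q : 'rV[R]_n -> Prop) : {ae mu, forall x, P x} -> {ae mu, forall x, Q x} ->
  {ae mu, forall x, P x /\ Q x}.
Proof. by move=> HP HQ; near=> x; split; near: x. Unshelve. all: by end_near. Qed.

Lemma ae_forall (I : finType) (P : I -> 'rV[R]_n -> Prop) :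
  (forall i, {ae mu, forall x, P i x}) -> {ae mu, forall x, forall i, P i x}.
Proof.
move=> H.
have K (s : seq I) : {ae mu, forall x, forall i, i \in s -> P i x}.
  elim: s => [|i s IH]; first by apply: aeW.
  have := ae_and (H i) IH; apply: filterS => x [h1 h2] j.
  by rewrite inE => /orP[/eqP ->//|]; exact: h2.
by move: (K (index_enum I)); apply: filterS => x h i; apply: h; rewrite mem_index_enum.
Qed.

Lemma integr_restrictP K g : measurable K -> measurable_fun [set: 'rV[R]_n] g ->
  (\int[mu]_(x in K) `|g x|%:E < +oo)%E <-> integr (fun x => \1_K x * g x).
Proof.
move=> mK mg.
have E : (\int[mu]_(x in K) `|g x|%:E = \int[mu]_x `|\1_K x * g x|%:E)%E.
  rewrite integral_mkcond; apply: eq_integral => x _; rewrite patchE indicE.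
  by case: (x \in K); rewrite ?mul1r// mul0r normr0.
rewrite E; split=> [h|/integrableP[_]//].
by apply/integrableP; split => //; apply/measurable_EFinP; apply: measurable_funM.
Qed.

Lemma L1loc_rep D f : L1loc D f -> exists2 g, locint D g & {ae mu, forall x, D x -> f x = g x}.
Proof.
move=> [[g mg fg] fK]; exists g => //; split => // K cK KD.
apply/integr_restrictP => //; first exact: compact_measurable_rV.
have := fK K cK KD; rewrite (@ae_integral _ _ _ mu K _ (fun x => `|g x|%:E))//.
by move: fg; apply: filterS => x H Kx; rewrite H//; exact: KD.
Qed.

Lemma L2_rep D f : measurable D -> L2 D f -> exists g,
  [/\ measurable_fun [set: 'rV[R]_n] g, sqint (fun x => \1_D x * g x) &
      {ae mu, forall x, D x -> f x = g x}].
Proof.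
move=> mD [[g mg fg] f2]; exists g; split=> //.
split; first by apply: measurable_funM => //; exact: measurable_indic.
rewrite (_ : (fun x => _) = (fun x => \1_D x * (g x ^+ 2))); last first.
  apply/funext => x; rewrite exprMn indicE.
  by case: (x \in D); rewrite ?expr1n// expr0n.
apply/integr_restrictP => //; first exact: measurable_funX.
move: f2; rewrite (@ae_integral _ _ _ mu D _ (fun x => `|g x ^+ 2|%:E))//.
by move: fg; apply: filterS => x H Dx; rewrite H// ger0_norm ?sqr_ge0.
Qed.

Lemma test_integr D g phi : measurable D -> locint D g -> test_function D phi ->
  integr (fun x => \1_D x * (g x * phi x)).
Proof.
move=> mD [mg gK] [sphi [K [cK KD phi0]]].
have cphi : continuous phi by have [] := sphi [::].
have [C HC] : exists C : R, forall x, `|phi x| <= C.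
  have [C [_ HC]] := compact_bounded (continuous_compact (continuous_subspaceT cphi) cK).
  exists (`|C| + 1) => x; have [Kx|Kx] := pselect (K x).
    by apply: HC; [have := ler_norm C; lra|exists x].
  by rewrite phi0// normr0; have := normr_ge0 C; lra.
apply: (integr_le _ (integrZ C (integr_norm (gK K cK KD)))).
  apply: measurable_funM; first exact: measurable_indic.
  by apply: measurable_funM => //; exact: continuous_measurable_rV.
move=> x; have [Kx|Kx] := pselect (K x); last by rewrite phi0// !mulr0 normr0 mulr_ge0// (le_trans _ (HC x)).
rewrite !indicE (mem_set Kx) (mem_set (KD _ Kx)) !mul1r normrM mulrC.
by rewrite ler_wpM2r.
Qed.

(** [H1] provides some square integrable weak gradient, whereas [stokes] and the theorem name
    gradients of their own; this identifies them. *)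
Lemma weak_gradient_unique (r0 : R) f (g g' : 'rV[R]_n -> 'rV[R]_n) (i : 'I_n) : 0 < r0 ->
  weak_gradient (sball r0) f g -> weak_gradient (sball r0) f g' ->
  {ae mu, forall x, sball r0 x -> g x ord0 i = g' x ord0 i}.
Proof.
move=> r00 [_ /(_ i)[gl Hg]] [_ /(_ i)[gl' Hg']].
have [G Gl gG] := L1loc_rep gl; have [G' Gl' gG'] := L1loc_rep gl'.
have mD := @measurable_sball r0.
have mh : measurable_fun [set: 'rV[R]_n] (fun x => G x - G' x).
  by apply: measurable_funB; [exact: Gl.1|exact: Gl'.1].
have Z (r : R) : 0 < r -> r < r0 -> {ae mu, forall x, sball r x -> G x - G' x = 0}.
  move=> r_gt0 rr0; apply: (@test_zero r0 _ r) => //.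
  - move=> s s0 sr0.
    have sD : scball s `<=` sball r0.
      by move=> x; rewrite /scball /sball/= => h; apply: le_lt_trans h _; rewrite ltr_pXn2r ?nnegrE// ltW.
    have := integrB (Gl.2 _ (compact_scball (ltW s0)) sD) (Gl'.2 _ (compact_scball (ltW s0)) sD).
    by rewrite (_ : (fun x => _) = (fun x => \1_(scball s) x * (G x - G' x)))//; apply/funext => x; rewrite mulrBr.
  - move=> phi tphi.
    have E1 : \int[mu]_x (\1_(sball r0) x * (G x * phi x)) = \int[mu]_x (\1_(sball r0) x * (G' x * phi x)).
      rewrite -!Rintegral_restrict.
      have := Hg phi tphi; rewrite (Hg' phi tphi) => /oppr_inj/esym.
      rewrite (@ae_Rintegral _ _ _ _ _ _ (fun x => G x * phi x)); last first.
        by move: gG; apply: filterS => x H Dx; rewrite H.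
      rewrite [X in _ = X](@ae_Rintegral _ _ _ _ _ _ (fun x => G' x * phi x))//.
      by move: gG'; apply: filterS => x H Dx; rewrite H.
    have i1 := test_integr mD Gl tphi; have i2 := test_integr mD Gl' tphi.
    transitivity (\int[mu]_x (\1_(sball r0) x * (G x * phi x) - \1_(sball r0) x * (G' x * phi x))).
      by apply: eq_Rintegral => x _; ring.
    by rewrite (RintegralB measurableT i1 i2) E1 subrr.
(* Radii increasing to [r0]; the index [k.+2] makes the first one r0 / 2, hence all of them
   positive. *)
pose rk (k : nat) : R := r0 * (1 - k.+2%:R^-1).
have kk (k : nat) : (0 < (k.+2%:R^-1 : R)) && ((k.+2%:R^-1 : R) < 1).
  have h0 : (0 : R) < k.+2%:R by rewrite ltr0n.
  by rewrite invr_gt0 h0/= invf_lt1 ?h0// ltr1n.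
have Zk : {ae mu, forall x, forall k : nat, sball (rk k) x -> G x - G' x = 0}.
  apply/ae_foralln => k; apply: Z; have /andP[h1 h2] := kk k.
    by rewrite /rk mulr_gt0// subr_gt0.
  by rewrite /rk gtr_pMr// gtrBl.
have {}Zk := ae_and Zk (ae_and gG gG').
move: Zk; apply: filterS => x [h1 [h2 h3]] Dx.
rewrite h2// h3//; apply/eqP; rewrite -subr_eq0; apply/eqP.
suff [k kx] : exists k : nat, sball (rk k) x by exact: h1 kx.
have sx : Num.sqrt (sq x) < r0.
  rewrite -(ltr_pXn2r (n := 2)) ?nnegrE ?sqrtr_ge0//; last exact: ltW.
  by rewrite sqr_sqrtr ?sq_ge0.
have e0 : 0 < 1 - Num.sqrt (sq x) / r0.
  by rewrite subr_gt0 ltr_pdivrMr// mul1r.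
near \oo => k.
have kd : k.+1%:R^-1 < 1 - Num.sqrt (sq x) / r0.
  by near: k; exact: near_infty_natSinv_lt (PosNum e0).
exists k; rewrite /sball/= -(@sqr_sqrtr _ (sq x)) ?sq_ge0//.
have /andP[k1 k2] := kk k.
have k3 : k.+2%:R^-1 <= k.+1%:R^-1 :> R by rewrite lef_pV2 ?posrE// ler_nat.
have : Num.sqrt (sq x) < rk k.
  by rewrite /rk mulrC -ltr_pdivrMr// ltrBrDl -ltrBrDr; apply: le_lt_trans k3 kd.
move=> h; rewrite ltr_pXn2r ?nnegrE ?sqrtr_ge0//.
by apply: ltW; apply: le_lt_trans h; exact: sqrtr_ge0.
Unshelve. all: by end_near. Qed.


Lemma lebesgue_measurable_sub D D' f : D' `<=` D -> lebesgue_measurable D f -> lebesgue_measurable D' f.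
Proof.
by move=> DD [g mg fg]; exists g => //; move: fg; apply: filterS => x H /DD /H.
Qed.

(** The given gradient [Df] inherits its square integrability from the gradient hidden in [H1], by
    uniqueness. *)
Lemma H1_rep (r0 : R) f (Df : 'rV[R]_n -> 'rV[R]_n) : 0 < r0 -> H1 (sball r0) f ->
  weak_gradient (sball r0) f Df -> exists (F : 'rV[R]_n -> R) (G : 'I_n -> 'rV[R]_n -> R),
  [/\ [/\ measurable_fun [set: 'rV[R]_n] F, sqint (fun x => \1_(sball r0) x * F x) &
          {ae mu, forall x, sball r0 x -> f x = F x}],
      forall i, [/\ measurable_fun [set: 'rV[R]_n] (G i), sqint (fun x => \1_(sball r0) x * G i x) &
          {ae mu, forall x, sball r0 x -> Df x ord0 i = G i x}] &
      forall i phi, test_function (sball r0) phi ->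
        \int[mu]_x (\1_(sball r0) x * (F x * partial i phi x)) =
        - \int[mu]_x (\1_(sball r0) x * (G i x * phi x))].
Proof.
move=> r00 [f2 [g wg g2]] wDf; have mD := @measurable_sball r0.
have [F [mF sF fF]] := L2_rep mD f2.
have /choice[G HG] : forall i, exists G : 'rV[R]_n -> R, [/\ measurable_fun [set: 'rV[R]_n] G, sqint (fun x => \1_(sball r0) x * G x) &
          {ae mu, forall x, sball r0 x -> Df x ord0 i = G x}].
  move=> i; have [G [mG sG gG]] := L2_rep mD (g2 i); exists G; split=> //.
  have := ae_and gG (weak_gradient_unique i r00 wDf wg).
  by apply: filterS => x [h1 h2] Dx; rewrite h2// h1.
exists F, G; split=> // i phi tphi; have [mG sG dG] := HG i.
have [_ /(_ i)[_ /(_ phi tphi)]] := wDf.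
rewrite (@ae_Rintegral _ _ _ _ _ _ (fun x => F x * partial i phi x)); last first.
  by move: fF; apply: filterS => x H Dx; rewrite H.
rewrite (@ae_Rintegral _ _ _ _ _ (fun x => Df x ord0 i * phi x) (fun x => G i x * phi x)); last first.
  by move: dG; apply: filterS => x H Dx; rewrite H.
by rewrite (Rintegral_restrict (sball r0) (fun x => F x * partial i phi x))
  (Rintegral_restrict (sball r0) (fun x => G i x * phi x)).
Qed.

(** Afterwards all data are Borel functions on the whole space, and the equations carry an
    indicator. The almost everywhere identities serve again only to transfer the bound on [A] and to
    return to the integrals of the theorem. *)
Lemma stokes_rep (r0 : R) (A u : 'rV[R]_n -> 'rV[R]_n) p Dp : 0 < r0 ->
  (forall i, lebesgue_measurable (sball r0) (fun x => A x ord0 i)) ->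
  (forall i, H1 (sball r0) (fun x => u x ord0 i)) -> H1 (sball r0) p ->
  stokes (sball r0) A u p -> weak_gradient (sball r0) p Dp ->
  exists (a U : 'I_n -> 'rV[R]_n -> R) (V : 'I_n -> 'I_n -> 'rV[R]_n -> R)
    (P : 'rV[R]_n -> R) (Q : 'I_n -> 'rV[R]_n -> R),
  [/\ [/\ forall j, measurable_fun [set: 'rV[R]_n] (a j),
         forall i, measurable_fun [set: 'rV[R]_n] (U i), forall i j, measurable_fun [set: 'rV[R]_n] (V i j),
         measurable_fun [set: 'rV[R]_n] P & forall j, measurable_fun [set: 'rV[R]_n] (Q j)],
      [/\ forall i, sqint (fun x => \1_(sball r0) x * U i x),
          forall i j, sqint (fun x => \1_(sball r0) x * V i j x), sqint (fun x => \1_(sball r0) x * P x) &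
          forall j, sqint (fun x => \1_(sball r0) x * Q j x)],
      {ae mu, forall x, sball r0 x -> [/\ forall j, A x ord0 j = a j x, forall i, u x ord0 i = U i x,
          p x = P x & forall j, Dp x ord0 j = Q j x]} &
      forall phi, test_function (sball r0) phi ->
      [/\ forall i j, \int[mu]_x (\1_(sball r0) x * (U i x * partial j phi x)) =
             - \int[mu]_x (\1_(sball r0) x * (V i j x * phi x)),
          forall j, \int[mu]_x (\1_(sball r0) x * (P x * partial j phi x)) =
             - \int[mu]_x (\1_(sball r0) x * (Q j x * phi x)),
          forall i, \int[mu]_x (\1_(sball r0) x * (U i x * laplacian phi x +
              (\sum_j a j x * V i j x) * phi x - P x * partial i phi x)) = 0 &
          \int[mu]_x (\1_(sball r0) x * \sum_i U i x * partial i phi x) = 0]].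
Proof.
move=> r00 mA hu hp [Du [wDu st dv]] wDp.
have /choice[a Ha] : forall j, exists a : 'rV[R]_n -> R, measurable_fun [set: 'rV[R]_n] a /\
    {ae mu, forall x, sball r0 x -> A x ord0 j = a x}.
  by move=> j; have [g] := mA j; exists g.
have /choice[U HU] : forall k, exists U : ('rV[R]_n -> R) * ('I_n -> 'rV[R]_n -> R),
  [/\ [/\ measurable_fun [set: 'rV[R]_n] U.1, sqint (fun x => \1_(sball r0) x * U.1 x) &
          {ae mu, forall x, sball r0 x -> u x ord0 k = U.1 x}],
      forall i, [/\ measurable_fun [set: 'rV[R]_n] (U.2 i), sqint (fun x => \1_(sball r0) x * U.2 i x) &
          {ae mu, forall x, sball r0 x -> Du x k i = U.2 i x}] &
      forall i phi, test_function (sball r0) phi ->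
        \int[mu]_x (\1_(sball r0) x * (U.1 x * partial i phi x)) =
        - \int[mu]_x (\1_(sball r0) x * (U.2 i x * phi x))].
  move=> k.
  have [F [G [h1 h2 h3]]] := H1_rep r00 (hu k) (wDu k); exists (F, G); split=> // i.
  have [m1 m2 m3] := h2 i; split=> //.
  by move: m3; apply: filterS => x H Dx; rewrite /= -(H Dx) mxE.
have [P [Q [[mP sP pP] HQ hPQ]]] := H1_rep r00 hp wDp.
have aeA := ae_forall (fun j => (Ha j).2).
have aeU : {ae mu, forall x, forall i, sball r0 x -> u x ord0 i = (U i).1 x}.
  by apply: ae_forall => i; have [[]] := HU i.
have aeV : {ae mu, forall x, forall i j, sball r0 x -> Du x i j = (U i).2 j x}.
  by apply: ae_forall => i; apply: ae_forall => j; have [_ /(_ j)[]] := HU i.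
have aeQ : {ae mu, forall x, forall j, sball r0 x -> Dp x ord0 j = Q j x}.
  by apply: ae_forall => j; have [] := HQ j.
exists a, (fun i => (U i).1), (fun i => (U i).2), P, Q; split.
- split=> //; [by move=> j; have [] := Ha j|by move=> i; have [[]] := HU i
    |by move=> i j; have [_ /(_ j)[]] := HU i|by move=> j; have [] := HQ j].
- by split=> //; [move=> i; have [[]] := HU i
    |move=> i j; have [_ /(_ j)[]] := HU i|move=> j; have [] := HQ j].
- have := ae_and (ae_and aeA aeU) (ae_and pP aeQ).
  by apply: filterS => x [[h1 h2] [h3 h4]] Dx; split=> [j|i||j]; [exact: h1|exact: h2|exact: h3|exact: h4].
- move=> phi tphi; split=> [i j|j|i|].
  + by have [_ _ /(_ j phi tphi)] := HU i.
  + exact: hPQ.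
  + rewrite -[RHS](st i phi tphi) -Rintegral_restrict; apply: ae_Rintegral.
    have := ae_and (ae_and aeA aeU) (ae_and pP aeV).
    apply: filterS => x [[h1 h2] [h3 h4]] Dx; rewrite h2// h3//; congr (_ + _ * _ - _).
    by apply: eq_bigr => j _; rewrite h1// h4.
  + rewrite -[RHS](dv phi tphi) -Rintegral_restrict; apply: ae_Rintegral.
    by move: aeU; apply: filterS => x h Dx; apply: eq_bigr => i _; rewrite h.
Qed.

End weak_gradients.

(** * Radial weights and rotations *)

Section cont.
Context {R : realType} {n : nat}.
Implicit Types f g : 'rV[R]_n -> R.

(* An opaque-looking alias: it keeps the unifier away from the canonical structures of 'rV. *)
Definition cont f := continuous f.
Lemma contE f : cont f -> continuous f. Proof. by []. Qed.
Lemma contM f g : cont f -> cont g -> cont (fun x => f x * g x).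
Proof. exact: continuous_rVM. Qed.
Lemma contD f g : cont f -> cont g -> cont (fun x => f x + g x).
Proof. exact: continuous_rVD. Qed.
Lemma contB f g : cont f -> cont g -> cont (fun x => f x - g x).
Proof. exact: continuous_rVB. Qed.
Lemma contN f : cont f -> cont (fun x => - f x).
Proof. exact: continuous_rVN. Qed.
Lemma contX f k : cont f -> cont (fun x => f x ^+ k).
Proof.
move=> cf; elim: k => [|k IH]; first by under eq_fun do rewrite expr0; exact: continuous_rV_cst.
by under eq_fun do rewrite exprS; exact: contM.
Qed.
Lemma cont_cst (c : R) : cont (fun=> c).
Proof. exact: continuous_rV_cst. Qed.
Lemma cont_coord i : cont (fun x => x ord0 i).
Proof. exact: continuous_coord. Qed.
Lemma cont_sq : cont sq.
Proof. exact: continuous_sq. Qed.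
Lemma cont_sum (I : Type) (s : seq I) (P : pred I) (F : I -> 'rV[R]_n -> R) :
  (forall k, cont (F k)) -> cont (fun x => \sum_(k <- s | P k) F k x).
Proof. by move=> H; apply: continuous_sum => k _; exact: H. Qed.
End cont.

Ltac rv_cont := lazymatch goal with
  | |- cont (fun _ => ?a) => exact: cont_cst
  | |- cont (fun x => @GRing.mul _ (@?a x) (@?b x)) => refine (@contM _ _ a b _ _); rv_cont
  | |- cont (fun x => @GRing.add _ (@?a x) (@GRing.opp _ (@?b x))) => refine (@contB _ _ a b _ _); rv_cont
  | |- cont (fun x => @GRing.add _ (@?a x) (@?b x)) => refine (@contD _ _ a b _ _); rv_cont
  | |- cont (fun x => @GRing.opp _ (@?a x)) => refine (@contN _ _ a _); rv_cont
  | |- cont (fun x => @GRing.exp _ (@?a x) _) => refine (@contX _ _ a _ _); rv_cont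
  | |- cont (fun x => bigop _ _ _) => refine (@cont_sum _ _ _ _ _ _ _); intro; rv_cont
  | |- cont (fun x => fun_of_matrix x _ _) => exact: cont_coord
  | |- cont (fun x => sq x) => exact: cont_sq
  | |- _ => unfold cont; solve [match goal with H : _ |- _ => simple apply H end]
  end.
Ltac rv_continuity := apply: contE; rv_cont.

Section cc_calculus.
Context {R : realType} {n : nat}.
Local Notation mu := (@lebesgue_rV R n).
Implicit Types (x : 'rV[R]_n) (f g h : 'rV[R]_n -> R).

(** A class of integrable functions closed under all operations in use, so that linearity and
    monotonicity of the integral need no separate integrability arguments. *)
Definition ccf f := continuous f /\ exists M, vanishes_off M f.

Lemma vanishes_offW (M N : R) f : M <= N -> vanishes_off M f -> vanishes_off N f.
Proof. by move=> MN f0 x xN; apply: f0 => xM; apply: xN => i; apply: le_trans (xM i) MN. Qed.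

Lemma ccf_integr f : ccf f -> integr f.
Proof. by move=> [cf [M f0]]; exact: (cc_integrable cf f0). Qed.

Lemma ccfD f g : ccf f -> ccf g -> ccf (fun x => f x + g x).
Proof.
move=> [cf [M f0]] [cg [N g0]]; split; first exact: continuous_rVD.
exists (Num.max M N) => x xM.
by rewrite (vanishes_offW _ f0 xM) ?le_max ?lexx// (vanishes_offW _ g0 xM) ?le_max ?lexx ?orbT// addr0.
Qed.

Lemma ccfM f g : ccf f -> continuous g -> ccf (fun x => f x * g x).
Proof.
move=> [cf [M f0]] cg; split; first exact: continuous_rVM.
by exists M => x xM; rewrite f0// mul0r.
Qed.

Lemma ccfMr f g : ccf g -> continuous f -> ccf (fun x => f x * g x).
Proof. by move=> hg hf; under eq_fun do rewrite mulrC; exact: ccfM. Qed.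

Lemma ccfZ (c : R) f : ccf f -> ccf (fun x => c * f x).
Proof. by move=> hf; apply: ccfMr => //; exact: continuous_rV_cst. Qed.

Lemma ccfN f : ccf f -> ccf (fun x => - f x).
Proof. by move=> hf; under eq_fun do rewrite -mulN1r; exact: ccfZ. Qed.

Lemma ccfB f g : ccf f -> ccf g -> ccf (fun x => f x - g x).
Proof. by move=> hf hg; apply: ccfD => //; exact: ccfN. Qed.

Lemma ccf0 : ccf (fun=> 0).
Proof. by split; [exact: continuous_rV_cst|exists 0]. Qed.

Lemma ccf_sum (I : Type) (s : seq I) (P : pred I) (F : I -> 'rV[R]_n -> R) :
  (forall i, P i -> ccf (F i)) -> ccf (fun x => \sum_(i <- s | P i) F i x).
Proof.
move=> H; elim: s => [|i s IH]; first by under eq_fun do rewrite big_nil; exact: ccf0.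
under eq_fun do rewrite big_cons.
by case: (boolP (P i)) => Pi //; apply: ccfD => //; exact: H.
Qed.

Lemma IccD f g : ccf f -> ccf g -> \int[mu]_x (f x + g x) = \int[mu]_x f x + \int[mu]_x g x.
Proof. by move=> hf hg; rewrite RintegralD//; exact: ccf_integr. Qed.

Lemma IccZ (c : R) f : ccf f -> \int[mu]_x (c * f x) = c * \int[mu]_x f x.
Proof. by move=> hf; rewrite RintegralZl//; exact: ccf_integr. Qed.

Lemma IccB f g : ccf f -> ccf g -> \int[mu]_x (f x - g x) = \int[mu]_x f x - \int[mu]_x g x.
Proof. by move=> hf hg; rewrite RintegralB//; exact: ccf_integr. Qed.

Lemma Icc0 : \int[mu]_x (0 : R) = 0.
Proof. by rewrite /Rintegral integral0. Qed.

Lemma Icc_sum (I : Type) (s : seq I) (P : pred I) (F : I -> 'rV[R]_n -> R) :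
  (forall i, P i -> ccf (F i)) ->
  \int[mu]_x (\sum_(i <- s | P i) F i x) = \sum_(i <- s | P i) \int[mu]_x F i x.
Proof.
move=> H; elim: s => [|i s IH].
  by rewrite big_nil -[RHS]Icc0; apply: eq_Rintegral => x _; rewrite big_nil.
rewrite big_cons; case: (boolP (P i)) => Pi; last first.
  by rewrite -IH; apply: eq_Rintegral => x _; rewrite big_cons (negbTE Pi).
rewrite -IH -IccD; [|exact: H|exact: ccf_sum].
by apply: eq_Rintegral => x _; rewrite big_cons Pi.
Qed.

Lemma Icc_le f g : ccf f -> ccf g -> (forall x, f x <= g x) -> \int[mu]_x f x <= \int[mu]_x g x.
Proof. by move=> hf hg fg; apply: le_Rintegral => //; exact: ccf_integr. Qed.

Lemma Icc_ge0 f : (forall x, 0 <= f x) -> 0 <= \int[mu]_x f x.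
Proof. by move=> f0; exact: Rintegral_ge0. Qed.

Lemma ccf_pder i f g : pder i f g -> ccf f -> continuous g -> ccf g.
Proof. by move=> fg [_ [M f0]] cg; split => //; exists M; exact: pder_vanishes fg f0. Qed.

Lemma Icc_pder i f g : pder i f g -> ccf f -> continuous g -> \int[mu]_x g x = 0.
Proof. by move=> fg [_ [M f0]] cg; exact: Rintegral_pder fg cg f0. Qed.

Lemma sum_delta (i : 'I_n) (F : 'I_n -> R) : \sum_l (i == l)%:R * F l = F i.
Proof.
rewrite (bigD1 i)//= eqxx mul1r big1 ?addr0// => l /negPf li.
by rewrite eq_sym li mul0r.
Qed.

(* Radial functions are written w (sq x) with w a function on the line vanishing beyond some b. *)
Definition radial (b : R) (w dw : R -> R) :=
  [/\ forall t, der1 w t (dw t), continuous dw & forall t, b < t -> w t = 0].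

Lemma radial_continuous b w dw : radial b w dw -> continuous w.
Proof. by move=> [hw _ _] t; exact: is_derive_continuous (hw t). Qed.

Lemma continuous_comp_sq (w : R -> R) : continuous w -> continuous (fun x => w (sq x)).
Proof. by move=> cw x; apply: continuous_comp; [exact: continuous_sq|exact: cw]. Qed.

Lemma comp_sq_vanishes (b : R) (w : R -> R) : (forall t, b < t -> w t = 0) ->
  exists M, vanishes_off M (fun x => w (sq x)).
Proof.
move=> w0; exists (`|b| + 1) => x xb; apply: w0; rewrite ltNge; apply/negP => h; apply: xb.
apply: sq_cube; first by have := normr_ge0 b; lra.
apply: le_trans h _; have := ler_norm b; have := normr_ge0 b; nra.
Qed.

Lemma radial_ccf b w dw : radial b w dw -> ccf (fun x => w (sq x)).
Proof.
move=> hw; split; first exact: continuous_comp_sq (radial_continuous hw).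
by have [_ _] := hw; exact: comp_sq_vanishes.
Qed.

Lemma radial_pder i b w dw : radial b w dw -> pder i (fun x => w (sq x)) (fun x => dw (sq x) * (2 * x ord0 i)).
Proof. by move=> [hw _ _]; apply: (pder_comp1 (pder_sq i)) => x; exact: hw. Qed.

Implicit Types (Df Dg : 'I_n -> 'rV[R]_n -> R) (Hf Hg : 'I_n -> 'I_n -> 'rV[R]_n -> R).

Definition C2 f (Df : 'I_n -> 'rV[R]_n -> R) (Hf : 'I_n -> 'I_n -> 'rV[R]_n -> R) :=
  [/\ continuous f /\ forall i, continuous (Df i), forall i j, continuous (Hf i j),
      forall i, pder i f (Df i), forall i j, pder j (Df i) (Hf i j) &
      forall i j x, Hf i j x = Hf j i x].

(** |x| times the radial derivative. *)
Definition euler (Df : 'I_n -> 'rV[R]_n -> R) x := \sum_l x ord0 l * Df l x.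

(** Generators of the rotations: they annihilate functions of |x|^2, commute with [euler], and carry
    the tangential part of the gradient. *)
Definition rot (i j : 'I_n) (Df : 'I_n -> 'rV[R]_n -> R) x := x ord0 j * Df i x - x ord0 i * Df j x.

Lemma continuous_euler Df : (forall i, continuous (Df i)) -> continuous (euler Df).
Proof. by move=> cf; apply: continuous_sum => l _; apply: continuous_rVM => //; exact: continuous_coord. Qed.

Lemma continuous_rot i j Df : (forall i, continuous (Df i)) -> continuous (rot i j Df).
Proof. by move=> cf; apply: continuous_rVB; apply: continuous_rVM => //; exact: continuous_coord. Qed.

Lemma pder_euler i f Df Hf : C2 f Df Hf ->
  pder i (euler Df) (fun x => Df i x + \sum_l x ord0 l * Hf l i x).
Proof.
move=> [_ _ _ df1 _]; rewrite /euler; apply: pder_eq.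
  by apply: pder_sum => l _; exact: (pderM (pder_coord i l) (df1 l i)).
by move=> x /=; rewrite big_split/= sum_delta.
Qed.

Lemma pder_rot l i j f Df Hf : C2 f Df Hf ->
  pder l (rot i j Df) (fun x => (l == j)%:R * Df i x + x ord0 j * Hf i l x
                              - ((l == i)%:R * Df j x + x ord0 i * Hf j l x)).
Proof.
move=> [_ _ _ df1 _]; rewrite /rot; apply: pder_eq.
  apply: pderD; first exact: (pderM (pder_coord l j) (df1 i l)).
  by under eq_fun do rewrite -mulN1r; apply: pderZ; exact: (pderM (pder_coord l i) (df1 j l)).
by move=> x /=; rewrite mulN1r.
Qed.

(** The integrand is the divergence of the field x w(|x|^2) f^2. *)
Lemma virial b w dw f Df : radial b w dw -> continuous f -> (forall i, continuous (Df i)) ->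
  (forall i, pder i f (Df i)) ->
  \int[mu]_x (2 * (w (sq x) * (f x * euler Df x)) +
    (n%:R * w (sq x) + 2 * sq x * dw (sq x)) * (f x * f x)) = 0.
Proof.
move=> hw cf cf1 df.
have cw := continuous_comp_sq (radial_continuous hw).
have [_ /continuous_comp_sq cdw _] := hw.
pose g l x := x ord0 l * (w (sq x) * (f x * f x)).
pose dg l x := w (sq x) * (f x * f x) + x ord0 l * (dw (sq x) * (2 * x ord0 l) * (f x * f x) +
   w (sq x) * (Df l x * f x + f x * Df l x)).
have dgP l : pder l (g l) (dg l).
  apply: pder_eq; first exact: (pderM (pder_coord l l) (pderM (radial_pder l hw) (pderM (df l) (df l)))).
  by move=> x /=; rewrite eqxx mul1r.
have cg l : ccf (g l).
  apply: ccfMr; last exact: continuous_coord.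
  by apply: ccfM; [exact: radial_ccf hw|exact: continuous_rVM].
have cdg l : continuous (dg l).
  by rewrite /dg; rv_continuity.
transitivity (\int[mu]_x \sum_l dg l x); last first.
  rewrite Icc_sum ?big1// => l _; [exact: Icc_pder (dgP l) (cg l) (cdg l)|exact: ccf_pder (dgP l) (cg l) (cdg l)].
apply: eq_Rintegral => x _; rewrite big_split/= sumr_const card_ord -[_ *+ n]mulr_natl.
rewrite -[RHS]addr0; have -> : \sum_i x ord0 i * (dw (sq x) * (2 * x ord0 i) * (f x * f x) +
  w (sq x) * (Df i x * f x + f x * Df i x)) = 2 * dw (sq x) * (f x * f x) * sq x + 2 * w (sq x) * f x * euler Df x.
  by rewrite /sq /euler !mulr_sumr -big_split/=; apply: eq_bigr => i _; ring.
by ring.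
Qed.

(** The right-hand side is symmetric in [f] and [g], which is what [carleman] exploits. Writing E
    for [euler] and R for [rot i j], the difference of the two sides is the integral of div (x w f R
    g) - R (w f E g). Both parts integrate to zero, and in the expansion f E R g cancels f R E g. *)
Lemma rot_euler_sym b w dw f Df Hf g Dg Hg i j : radial b w dw -> C2 f Df Hf -> C2 g Dg Hg ->
  \int[mu]_x (2 * (w (sq x) * (euler Df x * rot i j Dg x)) +
    (n%:R * w (sq x) + 2 * sq x * dw (sq x)) * (f x * rot i j Dg x)) =
  \int[mu]_x (w (sq x) * (euler Df x * rot i j Dg x + rot i j Df x * euler Dg x)).
Proof.
move=> hw hf hg.
have cw := continuous_comp_sq (radial_continuous hw).
have [_ /continuous_comp_sq cdw _] := hw.
have [[cf cf1] cf2 df df1 sf] := hf; have [[cg cg1] cg2 dg dg1 sg] := hg.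
have cEf := continuous_euler cf1; have cEg := continuous_euler cg1.
have cRf := continuous_rot (i:=i) (j:=j) cf1; have cRg := continuous_rot (i:=i) (j:=j) cg1.
pose E2 k x := Dg k x + \sum_l x ord0 l * Hg l k x.
have cE2 k : continuous (E2 k).
  apply: continuous_rVD; first exact: cg1.
  by apply: continuous_sum => l _; apply: continuous_rVM; [exact: continuous_coord|exact: cg2].
pose R2 (l : 'I_n) x := (l == j)%:R * Dg i x + x ord0 j * Hg i l x - ((l == i)%:R * Dg j x + x ord0 i * Hg j l x).
have cR2 l : continuous (R2 l).
  by rewrite /R2; rv_continuity.
pose p l x := x ord0 l * (w (sq x) * (f x * rot i j Dg x)).
pose dp l x := w (sq x) * (f x * rot i j Dg x) + x ord0 l * (dw (sq x) * (2 * x ord0 l) * (f x * rot i j Dg x) +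
   w (sq x) * (Df l x * rot i j Dg x + f x * R2 l x)).
have dpP l : pder l (p l) (dp l).
  apply: pder_eq; first exact: (pderM (pder_coord l l) (pderM (radial_pder l hw) (pderM (df l) (pder_rot l i j hg)))).
  by move=> x /=; rewrite eqxx mul1r.
pose q (l : 'I_n) x := x ord0 l * (w (sq x) * (f x * euler Dg x)).
pose dq (k l : 'I_n) x := (k == l)%:R * (w (sq x) * (f x * euler Dg x)) + x ord0 l * (dw (sq x) * (2 * x ord0 k) * (f x * euler Dg x) +
   w (sq x) * (Df k x * euler Dg x + f x * E2 k x)).
have dqP k l : pder k (q l) (dq k l).
  exact: (pderM (pder_coord k l) (pderM (radial_pder k hw) (pderM (df k) (pder_euler k hg)))).
have cp l : ccf (p l).
  apply: ccfMr; last exact: continuous_coord.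
  by apply: ccfM; [exact: radial_ccf hw|exact: continuous_rVM].
have cq l : ccf (q l).
  apply: ccfMr; last exact: continuous_coord.
  by apply: ccfM; [exact: radial_ccf hw|exact: continuous_rVM].
have cdp l : continuous (dp l).
  by rewrite /dp; rv_continuity.
have cdq k l : continuous (dq k l).
  by rewrite /dq; rv_continuity.
have Cp l := ccf_pder (dpP l) (cp l) (cdp l).
have Cq k l := ccf_pder (dqP k l) (cq l) (cdq k l).
have Cw := radial_ccf hw.
have Cw2 : ccf (fun x => (n%:R * w (sq x) + 2 * sq x * dw (sq x))).
  apply: ccfD; first exact: ccfZ.
  have -> : (fun x => 2 * sq x * dw (sq x)) = (fun x => \sum_l x ord0 l * (dw (sq x) * (2 * x ord0 l))).
    apply/funext => x; rewrite /sq mulr_sumr mulr_suml; apply: eq_bigr => l _; ring.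
  apply: ccf_sum => l _; apply: ccfMr; last exact: continuous_coord.
  apply: ccf_pder (radial_pder l hw) Cw _.
  by rv_continuity.
apply/eqP; rewrite -subr_eq0 -IccB; last 2 first.
- apply: ccfD; last by apply: ccfM => //; exact: continuous_rVM.
  by apply: ccfZ; apply: ccfM => //; exact: continuous_rVM.
- by apply: ccfM => //; apply: continuous_rVD; exact: continuous_rVM.
rewrite (_ : \int[mu]_x _ = \int[mu]_x (\sum_l dp l x - (dq i j x - dq j i x))).
  rewrite IccB; [|exact: ccf_sum|exact: ccfB].
  rewrite Icc_sum// IccB// !(Icc_pder (dqP _ _) (cq _) (cdq _ _)) big1 ?subrr// => l _.
  exact: Icc_pder (dpP l) (cp l) (cdp l).
apply: eq_Rintegral => x _; rewrite big_split/= sumr_const card_ord -[_ *+ n]mulr_natl.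
have -> : \sum_l x ord0 l * (dw (sq x) * (2 * x ord0 l) * (f x * rot i j Dg x) +
   w (sq x) * (Df l x * rot i j Dg x + f x * R2 l x)) =
   2 * dw (sq x) * (f x * rot i j Dg x) * sq x + w (sq x) * rot i j Dg x * euler Df x +
   w (sq x) * f x * (x ord0 j * E2 i x - x ord0 i * E2 j x).
  have -> : x ord0 j * E2 i x - x ord0 i * E2 j x = \sum_l x ord0 l * R2 l x.
    rewrite /E2 /R2 !mulrDr opprD addrACA -{1}(sum_delta j (fun l => x ord0 l)) -{1}(sum_delta i (fun l => x ord0 l)).
    rewrite !mulr_suml !mulr_sumr -!sumrN -!big_split/=; apply: eq_bigr => l _.
    by rewrite (sg i l) (sg j l) (eq_sym l) (eq_sym l); ring.
  by rewrite /sq /euler !mulr_sumr -!big_split/=; apply: eq_bigr => l _; ring.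
by rewrite /dq /rot (eq_sym j i); ring.
Qed.

End cc_calculus.

(** * The Dirac operator *)

Section clifford.
Context {R : realType}.

Definition clifford n N (c : 'I_n -> 'M[R]_N) :=
  (forall i, (c i)^T = c i) /\ forall i j, c i *m c j + c j *m c i = (2 * (i == j)%:R)%:M.

(** Doubling the size: [c j] becomes diag (c j, - c j), and the new generator swaps the two blocks;
    it is symmetric, squares to 1 and anticommutes with the others. Starting from size 1 keeps the
    size positive, so that a unit vector exists. *)
Lemma clifford_exists n : exists N (c : 'I_n -> 'M[R]_N), (0 < N)%N /\ clifford c.
Proof.
elim: n => [|n [N [c [N0 [cT cC]]]]].
  by exists 1%N, (fun=> 0); split=> //; split=> [|] [].
exists (N + N)%N, (fun i => if unlift ord0 i is Some j then block_mx (c j) 0 0 (- c j) else block_mx 0 1%:M 1%:M 0).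
split; first by rewrite addn_gt0 N0.
split=> [i|i j].
  case: (unliftP ord0 i) => [k _|_]; rewrite tr_block_mx ?trmx0 ?trmx1 //.
  by rewrite linearN/= cT.
case: (unliftP ord0 i) => [k ->|->]; case: (unliftP ord0 j) => [l ->|->];
  rewrite !mulmx_block !(mulmx0, mul0mx, mulmxN, mulNmx, mulmx1, mul1mx, opprK, addr0, add0r, oppr0)
    add_block_mx ?(addrN, addNr, addr0, add0r) ?eqxx.
- rewrite cC (inj_eq lift_inj); apply/esym; exact: scalar_mx_block.
- rewrite (_ : (_ == ord0) = false)// mulr0; apply/esym; rewrite scalar_mx_block.
  by rewrite (_ : 0%:M = 0)//; apply/matrixP => a b; rewrite !mxE mul0rn.
- rewrite (_ : (ord0 == _) = false)// mulr0; apply/esym; rewrite scalar_mx_block.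
  by rewrite (_ : 0%:M = 0)//; apply/matrixP => a b; rewrite !mxE mul0rn.
- rewrite mulr1; apply/esym; rewrite scalar_mx_block.
  have -> : (1%:M + 1%:M : 'M[R]_N) = (2 : R)%:M by rewrite -raddfD.
  by [].
Qed.

Lemma half_scaler (V : lmodType R) (v : V) : 2^-1 *: (v + v) = v.
Proof. by rewrite -[in LHS](scale1r v) -scalerDl scalerA mulVf ?scale1r// pnatr_eq0. Qed.

Definition dot N (a b : 'rV[R]_N) : R := \sum_m a ord0 m * b ord0 m.

Context {n N : nat} {c : 'I_n -> 'M[R]_N} (cl : clifford c).
Implicit Types (a b : 'rV[R]_N) (d : 'I_n -> 'rV[R]_N) (x : 'rV[R]_n).

Lemma dotE a b : dot a b = (a *m b^T) ord0 ord0.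
Proof. by rewrite mxE; apply: eq_bigr => m _; rewrite mxE. Qed.

Lemma dotC a b : dot a b = dot b a.
Proof. by apply: eq_bigr => m _; rewrite mulrC. Qed.

Lemma dotM a b (M : 'M[R]_N) : dot (a *m M) b = dot a (b *m M^T).
Proof. by rewrite !dotE trmx_mul trmxK mulmxA. Qed.

Lemma dotDl a a' b : dot (a + a') b = dot a b + dot a' b.
Proof. by rewrite /dot -big_split/=; apply: eq_bigr => m _; rewrite mxE mulrDl. Qed.

Lemma dotZl (k : R) a b : dot (k *: a) b = k * dot a b.
Proof. by rewrite /dot mulr_sumr; apply: eq_bigr => m _; rewrite mxE mulrA. Qed.

Lemma dot_suml (I : Type) (s : seq I) (P : pred I) (F : I -> 'rV[R]_N) b :
  dot (\sum_(i <- s | P i) F i) b = \sum_(i <- s | P i) dot (F i) b.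
Proof.
by rewrite !dotE mulmx_suml summxE; apply: eq_bigr => i _; rewrite dotE.
Qed.

Lemma dotDr a b b' : dot a (b + b') = dot a b + dot a b'.
Proof. by rewrite dotC dotDl !(dotC _ a). Qed.

Lemma dotZr (k : R) a b : dot a (k *: b) = k * dot a b.
Proof. by rewrite dotC dotZl dotC. Qed.

Lemma dot_sumr (I : Type) (s : seq I) (P : pred I) (F : I -> 'rV[R]_N) a :
  dot a (\sum_(i <- s | P i) F i) = \sum_(i <- s | P i) dot a (F i).
Proof. by rewrite dotC dot_suml; apply: eq_bigr => i _; rewrite dotC. Qed.

Lemma dot_ge0 a : 0 <= dot a a.
Proof. by apply: sumr_ge0 => m _; rewrite -expr2 sqr_ge0. Qed.

Lemma dot_le2 (k : R) a b : 0 < k -> 2 * dot a b <= k * dot a a + k^-1 * dot b b.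
Proof.
move=> k0; rewrite /dot !mulr_sumr -big_split/=; apply: ler_sum => m _.
set p := a _ _; set q := b _ _; rewrite -subr_ge0.
rewrite (_ : _ - _ = k^-1 * (k * p - q) ^+ 2); last by field; rewrite gt_eqF.
by rewrite mulr_ge0 ?sqr_ge0// invr_ge0 ltW.
Qed.

(** Clifford multiplication by the vector [x], a symmetric square root of |x|^2. *)
Definition symbol x : 'M[R]_N := \sum_j x ord0 j *: c j.

(** Added to its copy with the summation indices exchanged, the double sum involves only the
    anticommutators. *)
Lemma symbol_sqr x : symbol x *m symbol x = (sq x)%:M.
Proof.
have E : symbol x *m symbol x = \sum_i \sum_j (x ord0 i * x ord0 j) *: (c i *m c j).
  rewrite mulmx_suml; apply: eq_bigr => i _; rewrite mulmx_sumr; apply: eq_bigr => j _.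
  by rewrite -scalemxAl -scalemxAr scalerA.
have E2 : symbol x *m symbol x + symbol x *m symbol x = (2 * sq x)%:M.
  rewrite {2}E E [X in X + _]exchange_big/= -big_split/= /sq mulr_sumr raddf_sum.
  apply: eq_bigr => i _; rewrite -big_split/= (bigD1 i)//= big1 ?addr0.
    by rewrite -scalerDr cl.2 eqxx mulr1 scale_scalar_mx -expr2 mulrC.
  move=> j ji; rewrite (mulrC (x _ j)) -scalerDr cl.2 (negbTE ji) mulr0.
  by rewrite scale_scalar_mx mulr0; apply/matrixP => a b; rewrite !mxE mul0rn.
have := congr1 (fun M => 2^-1 *: M) E2.
rewrite half_scaler => ->.
by rewrite scale_scalar_mx mulrA mulVf ?pnatr_eq0// mul1r.
Qed.

Lemma symbol_tr x : (symbol x)^T = symbol x.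
Proof.
by rewrite /symbol linear_sum; apply: eq_bigr => j _; rewrite linearZ/= cl.1.
Qed.

Lemma dot_symbol a x : dot (a *m symbol x) (a *m symbol x) = sq x * dot a a.
Proof.
by rewrite dotM symbol_tr -mulmxA symbol_sqr mul_mx_scalar dotZr.
Qed.

Definition dirac d : 'rV[R]_N := \sum_i d i *m c i.

(** Polar decomposition of the Dirac operator: multiplying by the symbol of [x] separates the radial
    derivative, due to c_i c_i = 1, from the rotations, paired with the products c_i c_j that are
    antisymmetric in the indices. *)
Lemma dirac_symbol d x : dirac d *m symbol x =
  \sum_i x ord0 i *: d i + 2^-1 *: \sum_i \sum_j (x ord0 j *: d i - x ord0 i *: d j) *m (c i *m c j).
Proof.
have E : dirac d *m symbol x = \sum_i \sum_j (x ord0 j *: d i) *m (c i *m c j).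
  rewrite /dirac mulmx_suml; apply: eq_bigr => i _; rewrite mulmx_sumr; apply: eq_bigr => j _.
  by rewrite -scalemxAr -scalemxAl mulmxA.
have E' : \sum_i \sum_j (x ord0 i *: d j) *m (c i *m c j) = 2 *: \sum_i x ord0 i *: d i - dirac d *m symbol x.
  rewrite exchange_big/= E scaler_sumr -sumrB; apply: eq_bigr => i _.
  apply/eqP; rewrite eq_sym subr_eq -big_split/= (bigD1 i)//= big1.
    by rewrite addr0 -mulmxDr cl.2 eqxx mulr1 mul_mx_scalar.
  move=> j ji; rewrite -mulmxDr cl.2 (negbTE ji) mulr0.
  by rewrite mul_mx_scalar scale0r.
have -> : \sum_i \sum_j (x ord0 j *: d i - x ord0 i *: d j) *m (c i *m c j) =
  \sum_i \sum_j (x ord0 j *: d i) *m (c i *m c j) - \sum_i \sum_j (x ord0 i *: d j) *m (c i *m c j).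
  rewrite -sumrB; apply: eq_bigr => i _; rewrite -sumrB; apply: eq_bigr => j _.
  by rewrite mulmxBl.
rewrite -E E'; set S := _ *m symbol x; set T := \sum_i _.
by rewrite opprB addrA scalerBr half_scaler scalerA mulVf ?pnatr_eq0// scale1r addrC subrK.
Qed.

Lemma dot_dirac d : dot (dirac d) (dirac d) = \sum_i \sum_j dot (d i) (d j *m (c j *m c i)).
Proof.
rewrite /dirac dot_suml; apply: eq_bigr => i _; rewrite dot_sumr; apply: eq_bigr => j _.
by rewrite dotM cl.1 mulmxA.
Qed.

End clifford.

(** * The Carleman estimate and Garding's inequality with general weights *)

Section carleman.
Context {R : realType} {n N : nat} {c : 'I_n -> 'M[R]_N} (cl : clifford c).
Local Notation mu := (@lebesgue_rV R n).
Implicit Types (x : 'rV[R]_n).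

Lemma radial_d0 b (w dw : R -> R) t : radial b w dw -> b < t -> dw t = 0.
Proof.
move=> [hw _ w0] bt; have [_ <-] := hw t.
rewrite -[RHS](derive_cst (0 : R) t (1 : R)); apply: near_eq_derive.
near=> s; rewrite /= w0//; near: s; exact: lt_nbhsr.
Unshelve. all: by end_near. Qed.

Lemma radial_sqr b (w dw : R -> R) : radial b w dw ->
  radial b (fun t => w t * w t) (fun t => 2 * (w t * dw t)).
Proof.
move=> hw; have cw := radial_continuous hw; have [dwP cdw w0] := hw.
split=> [t|t|t bt]; last by rewrite w0// mul0r.
- by apply: der1_eq; [exact: is_derive1M (dwP t) (dwP t)|ring].
- by apply: cvgM; [exact: cvg_cst|apply: cvgM; [exact: cw|exact: cdw]].
Qed.

Lemma rad_ccf b (w : R -> R) : continuous w -> (forall t, b < t -> w t = 0) ->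
  ccf (fun x => w (sq x)).
Proof. by move=> cw w0; split; [exact: continuous_comp_sq|exact: comp_sq_vanishes w0]. Qed.

Lemma dot_mx (a d : 'rV[R]_N) (M : 'M[R]_N) :
  dot a (d *m M) = \sum_m \sum_k a ord0 m * d ord0 k * M k m.
Proof.
apply: eq_bigr => m _; rewrite mxE mulr_sumr; apply: eq_bigr => k _; exact: mulrA.
Qed.

Lemma lin_sum2 (I : finType) (a b : R) (f g h : I -> I -> R) :
  a * (\sum_i \sum_j f i j) + b * (\sum_i \sum_j g i j + \sum_i \sum_j h i j) =
  \sum_i \sum_j (a * f i j + b * (g i j + h i j)).
Proof.
rewrite -big_split/= !mulr_sumr -big_split/=; apply: eq_bigr => i _.
by rewrite -big_split/= !mulr_sumr -big_split/=.
Qed.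

Context (v : 'I_N -> 'rV[R]_n -> R) (Dv : 'I_N -> 'I_n -> 'rV[R]_n -> R)
  (Hv : 'I_N -> 'I_n -> 'I_n -> 'rV[R]_n -> R).
Hypothesis v2 : forall m, C2 (v m) (Dv m) (Hv m).

Definition vec x : 'rV[R]_N := \row_m v m x.
Definition grad x (i : 'I_n) : 'rV[R]_N := \row_m Dv m i x.

Let cv m : continuous (v m). Proof. by have [[]] := v2 m. Qed.
Let cDv m i : continuous (Dv m i). Proof. by have [[]] := v2 m. Qed.
Let cHv m i j : continuous (Hv m i j). Proof. by have [] := v2 m. Qed.
Let dv m i : pder i (v m) (Dv m i). Proof. by have [] := v2 m. Qed.
Let dDv m i j : pder j (Dv m i) (Hv m i j). Proof. by have [] := v2 m. Qed.
Let sHv m i j x : Hv m i j x = Hv m j i x. Proof. by have [] := v2 m. Qed.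

Lemma dirac_grad x m : dirac (c := c) (grad x) ord0 m = \sum_i \sum_k Dv k i x * c i k m.
Proof.
by rewrite /dirac summxE; apply: eq_bigr => i _; rewrite mxE; apply: eq_bigr => k _; rewrite mxE.
Qed.

Lemma cont_dot (F G : 'rV[R]_n -> 'rV[R]_N) : (forall m, cont (fun x => F x ord0 m)) ->
  (forall m, cont (fun x => G x ord0 m)) -> cont (fun x => dot (F x) (G x)).
Proof. by move=> cF cG; apply: cont_sum => m; exact: contM. Qed.

Lemma cont_vec m : cont (fun x => vec x ord0 m).
Proof. rewrite (_ : (fun x => _) = v m); [exact: cv|by apply/funext => x; rewrite mxE]. Qed.

Lemma cont_grad i m : cont (fun x => grad x i ord0 m).
Proof. rewrite (_ : (fun x => _) = Dv m i); [exact: cDv|by apply/funext => x; rewrite mxE]. Qed.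

Lemma cont_dirac m : cont (fun x => dirac (c := c) (grad x) ord0 m).
Proof.
have -> : (fun x => dirac (c := c) (grad x) ord0 m) = (fun x => \sum_i \sum_k Dv k i x * c i k m).
  by apply/funext => x; rewrite dirac_grad.
by rv_cont.
Qed.

(** Let E be the radial operator [euler], G the tangential part of D v, A = (E + n/2) (w v) with E +
    n/2 skew-adjoint, and B = w G + a v. In the integral of <A, B> the term with G vanishes, and the
    term with the free coefficient [a] is evaluated by [virial]; four times the integral is twice
    the left-hand side. Then 4 <A, B> <= |A + B|^2, where A + B is w (D v) x plus the multiple of v
    that appears squared on the right. *)
Lemma carleman b (w dw a dp : R -> R) : radial b w dw -> radial b (fun t => a t * w t) dp ->
  continuous a -> (forall t, b < t -> a t = 0) ->
  \int[mu]_x ((4 * sq x * dw (sq x) * a (sq x) - 2 * sq x * dp (sq x)) * dot (vec x) (vec x)) <=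
  \int[mu]_x (sq x * w (sq x) ^+ 2 * dot (dirac (c := c) (grad x)) (dirac (c := c) (grad x))) +
  \int[mu]_x ((2 * sq x * dw (sq x) + n%:R / 2 * w (sq x) + a (sq x)) ^+ 2 * dot (vec x) (vec x)).
Proof.
move=> hw hp ca a0.
have [_ cdw w0] := hw; have [_ cdp p0] := hp.
have Cw := radial_ccf hw (n := n).
have Cdw : ccf (fun x => dw (sq x)) by apply: rad_ccf cdw _ => t; exact: radial_d0 hw.
have Cdp : ccf (fun x => dp (sq x)) by apply: rad_ccf cdp _ => t; exact: radial_d0 hp.
have Ca : ccf (fun x => a (sq x)) by exact: rad_ccf ca a0.
have cw := Cw.1; have cdw' := Cdw.1; have cdp' := Cdp.1; have ca' := Ca.1.
have cE m : continuous (euler (Dv m)) by apply: continuous_euler => i; exact: cDv.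
have cR i j m : continuous (rot i j (Dv m)) by by apply: continuous_rot => l; exact: cDv.
have cN := cont_dot cont_vec cont_vec; have cD := cont_dot cont_dirac cont_dirac.
pose G m x := 2^-1 * \sum_i \sum_j \sum_k rot i j (Dv k) x * (c i *m c j) k m.
have cG m : continuous (G m) by rewrite /G; rv_continuity.
have EG x m : (dirac (c := c) (grad x) *m symbol (c := c) x) ord0 m = euler (Dv m) x + G m x.
  rewrite (dirac_symbol cl) !mxE !summxE; congr (_ + _ * _).
    by apply: eq_bigr => i _; rewrite !mxE.
  apply: eq_bigr => i _; rewrite summxE; apply: eq_bigr => j _; rewrite mxE.
  by apply: eq_bigr => k _; rewrite !mxE.
pose A m x := w (sq x) * euler (Dv m) x + (2 * sq x * dw (sq x) + n%:R / 2 * w (sq x)) * v m x.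
have CA m : ccf (A m).
  apply: ccfD; first exact: ccfM.
  apply: ccfM => //; apply: ccfD; last by apply: ccfMr => //; rv_continuity.
  by apply: ccfMr => //; rv_continuity.
have hw2 := radial_sqr hw.
(* This is 2 w A_m R_ij v_k. Its integral is symmetric in [m], [k] by [rot_euler_sym] and
   antisymmetric in [i], [j]. *)
pose T i j m k x := 2 * (w (sq x) * w (sq x) * (euler (Dv m) x * rot i j (Dv k) x)) +
    (n%:R * (w (sq x) * w (sq x)) + 2 * sq x * (2 * (w (sq x) * dw (sq x)))) * (v m x * rot i j (Dv k) x).
have CT i j m k : ccf (T i j m k).
  apply: ccfD.
    apply: ccfZ; apply: ccfM; last by rv_continuity.
    exact: ccfM.
  apply: ccfM; last by rv_continuity.
  apply: ccfD; first by apply: ccfZ; exact: ccfM.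
  apply: ccfMr; last by rv_continuity.
  by apply: ccfZ; exact: ccfM.
have ITsym i j m k : \int[mu]_x T i j m k x = \int[mu]_x T i j k m x.
  rewrite (rot_euler_sym i j hw2 (v2 m) (v2 k)) (rot_euler_sym i j hw2 (v2 k) (v2 m)).
  by apply: eq_Rintegral => x _; ring.
have ITanti i j m k : \int[mu]_x T i j m k x = - \int[mu]_x T j i m k x.
  rewrite -mulN1r -IccZ//; apply: eq_Rintegral => x _; rewrite /T /rot; ring.
pose F1 m x := 4 * (A m x * (w (sq x) * G m x)).
pose F2 m x := 4 * (A m x * (a (sq x) * v m x)).
have CF1 m : ccf (F1 m) by apply: ccfZ; apply: ccfM => //; rv_continuity.
have CF2 m : ccf (F2 m) by apply: ccfZ; apply: ccfM => //; rv_continuity.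
have I1 : \int[mu]_x \sum_m F1 m x = 0.
  pose S := \sum_i \sum_j \sum_m \sum_k (c i *m c j) k m * \int[mu]_x T i j m k x.
  have -> : \int[mu]_x \sum_m F1 m x = S.
    transitivity (\int[mu]_x \sum_i \sum_j \sum_m \sum_k (c i *m c j) k m * T i j m k x); last first.
      rewrite Icc_sum; last by move=> i _; do 3! (apply: ccf_sum => ? _); exact: ccfZ.
      apply: eq_bigr => i _; rewrite Icc_sum; last by move=> j _; do 2! (apply: ccf_sum => ? _); exact: ccfZ.
      apply: eq_bigr => j _; rewrite Icc_sum; last by move=> m _; apply: ccf_sum => ? _; exact: ccfZ.
      apply: eq_bigr => m _; rewrite Icc_sum; last by move=> k _; exact: ccfZ.
      by apply: eq_bigr => k _; rewrite IccZ.
    apply: eq_Rintegral => x _.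
    transitivity (\sum_i \sum_m \sum_j \sum_k (c i *m c j) k m * T i j m k x); last first.
      by apply: eq_bigr => i _; exact: exchange_big.
    rewrite exchange_big/=; apply: eq_bigr => m _; rewrite /F1 /G !mulr_sumr.
    apply: eq_bigr => i _; rewrite !mulr_sumr; apply: eq_bigr => j _; rewrite !mulr_sumr.
    by apply: eq_bigr => k _; rewrite /T /A; field.
  (* Exchanging both pairs of indices changes the sign once, while c_i c_j becomes its transpose
     read with transposed indices, that is, itself. *)
  have SN : S = - S.
    rewrite {1}/S exchange_big/= -sumrN; apply: eq_bigr => j _; rewrite -sumrN; apply: eq_bigr => i _.
    rewrite exchange_big/= -sumrN; apply: eq_bigr => k _; rewrite -sumrN; apply: eq_bigr => m _.
    rewrite ITsym ITanti mulrN; congr (- (_ * _)).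
    by rewrite -[in LHS](trmxK (c i *m c j)) trmx_mul !cl.1 mxE.
  by move: SN; clearbody S => SN; lra.
pose g t := 4 * t * dw t * a t - 2 * t * dp t.
have Cg : ccf (fun x => g (sq x) * dot (vec x) (vec x)).
  by apply: ccfM => //; apply: ccfB; apply: ccfMr => //; rv_continuity.
have I2 : \int[mu]_x \sum_m F2 m x = 2 * \int[mu]_x (g (sq x) * dot (vec x) (vec x)).
  pose V m x := 2 * (a (sq x) * w (sq x) * (v m x * euler (Dv m) x)) +
    (n%:R * (a (sq x) * w (sq x)) + 2 * sq x * dp (sq x)) * (v m x * v m x).
  have CV m : ccf (V m).
    apply: ccfD.
      apply: ccfZ; apply: ccfM; last by rv_continuity.
      exact: ccfM.
    apply: ccfM; last by rv_continuity.
    apply: ccfD; first by apply: ccfZ; exact: ccfM.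
    by apply: ccfMr => //; rv_continuity.
  have IV m : \int[mu]_x V m x = 0 by apply: virial hp _ _ _ => //.
  transitivity (\int[mu]_x (2 * \sum_m V m x + 2 * (g (sq x) * dot (vec x) (vec x)))).
    apply: eq_Rintegral => x _; rewrite /dot !mulr_sumr -big_split/=; apply: eq_bigr => m _.
    by rewrite !mxE /F2 /A /V /g; field.
  rewrite IccD; [|by apply: ccfZ; exact: ccf_sum|exact: ccfZ].
  by rewrite !IccZ ?Icc_sum ?big1 ?mulr0 ?add0r//; exact: ccf_sum.
have C1 : ccf (fun x => sq x * w (sq x) ^+ 2 * dot (dirac (c := c) (grad x)) (dirac (c := c) (grad x))).
  apply: ccfM => //; apply: ccfMr; last exact: continuous_sq.
  by under eq_fun do rewrite expr2; exact: ccfM.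
have C2' : ccf (fun x => (2 * sq x * dw (sq x) + n%:R / 2 * w (sq x) + a (sq x)) ^+ 2 * dot (vec x) (vec x)).
  apply: ccfM => //; under eq_fun do rewrite expr2.
  have H : ccf (fun x => 2 * sq x * dw (sq x) + n%:R / 2 * w (sq x) + a (sq x)).
    apply: ccfD => //; apply: ccfD; last by apply: ccfMr => //; rv_continuity.
    by apply: ccfMr => //; rv_continuity.
  by apply: ccfM => //; exact: H.1.
have {}I2 : 2 * \int[mu]_x (g (sq x) * dot (vec x) (vec x)) = \int[mu]_x (\sum_m F1 m x + \sum_m F2 m x).
  by rewrite IccD; [rewrite I1 add0r|exact: ccf_sum|exact: ccf_sum].
rewrite -(ler_pM2l (ltr0n R 2)) I2.
rewrite mulrDr -!IccZ// -IccD; [|exact: ccfZ..].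
apply: Icc_le; [by apply: ccfD; exact: ccf_sum|by apply: ccfD; exact: ccfZ|] => x.
have -> : sq x * w (sq x) ^+ 2 * dot (dirac (c := c) (grad x)) (dirac (c := c) (grad x)) =
  \sum_m w (sq x) ^+ 2 * (euler (Dv m) x + G m x) ^+ 2.
  rewrite mulrAC -(dot_symbol cl) mulrC /dot mulr_sumr; apply: eq_bigr => m _.
  by rewrite !EG expr2.
rewrite -big_split/= [X in _ <= X + _]mulr_sumr /dot [X in _ <= _ + 2 * X]mulr_sumr.
rewrite [X in _ <= _ + X]mulr_sumr -big_split/=; apply: ler_sum => m _; rewrite !mxE.
rewrite /F1 /F2 -mulrDr -mulrDr.
set e := euler _ _; set v' := v m x; set h := (2 * _ * _ + _ + _).
set B := _ + a _ * _.
have -> : A m x = w (sq x) * (e + G m x) + h * v' - B by rewrite /A /B /h -/e -/v'; ring.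
(* With S = A + B, the inequality 4 A B <= S^2 is (S - 2 B)^2 >= 0. *)
have := sqr_ge0 (w (sq x) * (e + G m x) + h * v' - 2 * B).
have := sqr_ge0 (w (sq x) * (e + G m x) - h * v').
by nra.
Qed.

(** Integration by parts against [M i j] = c_j c_i - delta_ij, antisymmetric in [i] and [j]: the
    second derivatives cancel by their symmetry, leaving w^2 (|D v|^2 - |grad v|^2) and terms in the
    derivative of [w], which Cauchy-Schwarz absorbs. *)
Lemma garding b (w dw : R -> R) : radial b w dw ->
  \int[mu]_x (w (sq x) ^+ 2 * \sum_i dot (grad x i) (grad x i)) <=
  4 * \int[mu]_x (w (sq x) ^+ 2 * dot (dirac (c := c) (grad x)) (dirac (c := c) (grad x))) +
  24 * \int[mu]_x (sq x * dw (sq x) ^+ 2 * dot (vec x) (vec x)).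
Proof.
move=> hw; have hw2 := radial_sqr hw; have [_ cdw w0] := hw.
have Cw := radial_ccf hw (n := n).
have Cdw : ccf (fun x => dw (sq x)) by apply: rad_ccf cdw _ => t; exact: radial_d0 hw.
have cw := Cw.1; have cdw' := Cdw.1.
have cN := cont_dot cont_vec cont_vec; have cD := cont_dot cont_dirac cont_dirac.
have cS : continuous (fun x => \sum_i dot (grad x i) (grad x i)).
  by apply: contE; apply: cont_sum => i; apply: cont_dot => m; exact: cont_grad.
pose K i j m k x := 2 * (w (sq x) * dw (sq x)) * (2 * x ord0 i) * (v m x * Dv k j x) +
  w (sq x) * w (sq x) * (Dv m i x * Dv k j x + v m x * Hv k j i x).
have KP i j m k : pder i (fun x => w (sq x) * w (sq x) * (v m x * Dv k j x)) (K i j m k).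
  exact: (pderM (radial_pder i hw2) (pderM (@dv m i) (@dDv k j i))).
have CK0 j m k : ccf (fun x => w (sq x) * w (sq x) * (v m x * Dv k j x)).
  by apply: ccfM; [exact: ccfM|rv_continuity].
have cK i j m k : continuous (K i j m k) by rewrite /K; rv_continuity.
have CK i j m k := ccf_pder (@KP i j m k) (@CK0 j m k) (@cK i j m k).
have IK i j m k := Icc_pder (@KP i j m k) (@CK0 j m k) (@cK i j m k).
pose M i j : 'M[R]_N := c j *m c i - (i == j)%:R%:M.
pose J x := \sum_i \sum_j \sum_m \sum_k K i j m k x * M i j k m.
have CJ : ccf J.
  rewrite /J; do 4! (apply: ccf_sum => ? _).
  by apply: ccfM; [exact: CK|exact: continuous_rV_cst].
have IJ : \int[mu]_x J x = 0.
  have CK' i j m k : ccf (fun x => K i j m k x * M i j k m) by apply: ccfM; [exact: CK|exact: continuous_rV_cst].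
  rewrite /J Icc_sum ?big1// => i _; last by do 3! (apply: ccf_sum => ? _).
  rewrite Icc_sum ?big1// => j _; last by do 2! (apply: ccf_sum => ? _).
  rewrite Icc_sum ?big1// => m _; last by apply: ccf_sum => ? _.
  rewrite Icc_sum ?big1// => k _.
  rewrite -[RHS](mulr0 (M i j k m)) -[in RHS](IK i j m k) -IccZ//.
  by apply: eq_Rintegral => x _; rewrite mulrC.
pose h x i j : 'rV[R]_N := \row_k Hv k j i x.
have EJ x : J x = 4 * (w (sq x) * dw (sq x)) * (dot (vec x) (dirac (c := c) (grad x) *m symbol (c := c) x) -
      \sum_i dot (x ord0 i *: vec x) (grad x i)) +
    w (sq x) ^+ 2 * (dot (dirac (c := c) (grad x)) (dirac (c := c) (grad x)) - \sum_i dot (grad x i) (grad x i)).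
  have E i j : \sum_m \sum_k K i j m k x * M i j k m =
    4 * (w (sq x) * dw (sq x)) * (x ord0 i * dot (vec x) (grad x j *m M i j)) +
    w (sq x) ^+ 2 * (dot (grad x i) (grad x j *m M i j) + dot (vec x) (h x i j *m M i j)).
    rewrite !dot_mx mulrA lin_sum2; apply: eq_bigr => m _; apply: eq_bigr => k _.
    by rewrite !mxE /K; ring.
  have h0 : \sum_i \sum_j h x i j *m M i j = 0.
    set S := LHS; have S2 : S + S = 0.
      rewrite {1}/S exchange_big/= -big_split/= big1// => i _; rewrite -big_split/= big1// => j _.
      have -> : h x j i = h x i j by apply/rowP => k; rewrite !mxE sHv.
      rewrite -mulmxDr /M eq_sym addrACA cl.2 -opprD -raddfD.
      rewrite (_ : _ + _ = 2 * (i == j)%:R :> R); last by ring.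
      by rewrite subrr mulmx0.
    by have := half_scaler S; rewrite S2 scaler0.
  have hv : \sum_i \sum_j dot (vec x) (h x i j *m M i j) = 0.
    transitivity (dot (vec x) (\sum_i \sum_j h x i j *m M i j)).
      by rewrite dot_sumr; apply: eq_bigr => i _; rewrite dot_sumr.
    by rewrite h0 /dot big1// => m _; rewrite [X in _ * X]mxE mulr0.
  have hP : \sum_i \sum_j x ord0 i * dot (vec x) (grad x j *m M i j) =
      dot (vec x) (dirac (c := c) (grad x) *m symbol (c := c) x) - \sum_i dot (x ord0 i *: vec x) (grad x i).
    have -> : dot (vec x) (dirac (c := c) (grad x) *m symbol (c := c) x) =
      \sum_i \sum_j x ord0 i * dot (vec x) (grad x j *m (c j *m c i)).
      rewrite /symbol mulmx_sumr dot_sumr; apply: eq_bigr => i _.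
      rewrite -scalemxAr dotZr /dirac mulmx_suml dot_sumr mulr_sumr.
      by apply: eq_bigr => j _; rewrite mulmxA.
    rewrite -sumrB; apply: eq_bigr => i _.
    rewrite -[dot (_ *: _) _](sum_delta i (fun j => dot (x ord0 i *: vec x) (grad x j))) -sumrB.
    apply: eq_bigr => j _; rewrite /M mulmxBr mul_mx_scalar dotDr -scaleN1r !dotZr dotZl; ring.
  have hD : \sum_i \sum_j dot (grad x i) (grad x j *m M i j) =
      dot (dirac (c := c) (grad x)) (dirac (c := c) (grad x)) - \sum_i dot (grad x i) (grad x i).
    rewrite (dot_dirac cl) -sumrB; apply: eq_bigr => i _.
    rewrite -[X in _ = _ - X](sum_delta i (fun j => dot (grad x i) (grad x j))) -sumrB.
    apply: eq_bigr => j _; rewrite /M mulmxBr mul_mx_scalar dotDr -scaleN1r !dotZr; ring.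
  transitivity (\sum_i \sum_j (4 * (w (sq x) * dw (sq x)) * (x ord0 i * dot (vec x) (grad x j *m M i j)) +
    w (sq x) ^+ 2 * (dot (grad x i) (grad x j *m M i j) + dot (vec x) (h x i j *m M i j)))).
    by apply: eq_bigr => i _; apply: eq_bigr => j _.
  by rewrite -lin_sum2 hP hD hv addr0.
have C1 : ccf (fun x => w (sq x) ^+ 2 * dot (dirac (c := c) (grad x)) (dirac (c := c) (grad x))).
  by apply: ccfM => //; under eq_fun do rewrite expr2; exact: ccfM.
have C2' : ccf (fun x => sq x * dw (sq x) ^+ 2 * dot (vec x) (vec x)).
  apply: ccfM => //; apply: ccfMr; last exact: continuous_sq.
  by under eq_fun do rewrite expr2; exact: ccfM.
have C3 : ccf (fun x => w (sq x) ^+ 2 * \sum_i dot (grad x i) (grad x i)).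
  by apply: ccfM => //; under eq_fun do rewrite expr2; exact: ccfM.
rewrite -!IccZ// -IccD; [|exact: ccfZ..].
rewrite -[leLHS]addr0 -{2}(mulr0 2) -{2}IJ -IccZ// -IccD//; last exact: ccfZ.
apply: Icc_le; [by apply: ccfD => //; exact: ccfZ|by apply: ccfD; exact: ccfZ|] => x.
rewrite EJ.
have H1 := dot_le2 ((2 * dw (sq x)) *: (vec x *m symbol (c := c) x)) (w (sq x) *: dirac (c := c) (grad x)) (@ltr01 R).
rewrite invr1 !mul1r !(dotZl, dotZr) (dot_symbol cl) dotM (symbol_tr cl) in H1.
have H2 : - (4 * (w (sq x) * dw (sq x)) * \sum_i dot (x ord0 i *: vec x) (grad x i)) <=
  8 * dw (sq x) ^+ 2 * (sq x * dot (vec x) (vec x)) + 2^-1 * (w (sq x) ^+ 2 * \sum_i dot (grad x i) (grad x i)).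
  rewrite /sq mulr_suml -/(sq x) [X in - X]mulr_sumr -sumrN [X in _ <= X + _]mulr_sumr.
  rewrite [X in _ <= _ + 2^-1 * X]mulr_sumr [X in _ <= _ + X]mulr_sumr -big_split/=.
  apply: ler_sum => i _.
  have := dot_le2 ((- (2 * dw (sq x) * x ord0 i)) *: vec x) (w (sq x) *: grad x i) (ltr0n R 2).
  rewrite !(dotZl, dotZr) => H; rewrite ?dotZl.
  lra.
lra.
Qed.

End carleman.

(** * Weighted estimates *)

Section weights.
Context {R : realType}.
Implicit Types (H : R -> R) (t : R).

Definition vanishes_out (a b : R) H := forall t, t < a \/ b < t -> H t = 0.

(** Continuity is two-sided even at the end points: the functions concerned are smooth across them,
    and gluing needs it there. *)
Definition cont_on (a b : R) H := forall t, a <= t <= b -> {for t, continuous H}.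

Lemma near_out (a b t : R) : t < a \/ b < t -> \forall s \near t, s < a \/ b < s.
Proof.
move=> [ta|bt].
- by near=> s; left; near: s; exact: lt_nbhsl.
- by near=> s; right; near: s; exact: lt_nbhsr.
Unshelve. all: by end_near. Qed.

Lemma in_or_out (a b t : R) : a <= t <= b \/ (t < a \/ b < t).
Proof.
have [ta|ta] := leP a t; last by right; left.
by have [tb|tb] := leP t b; [left|right; right].
Qed.

(** The logarithmic weights are regular only on [a, b]; a cut-off vanishing outside extends the
    products by zero. *)
Lemma glue_continuous a b (g : R -> R) H : continuous g -> vanishes_out a b g -> cont_on a b H ->
  continuous (fun t => g t * H t).
Proof.
move=> cg g0 cH t; have [tab|tout] := in_or_out a b t.
  by apply: cvgM; [exact: cg|exact: cH].
apply: (@is_derive_continuous _ _ _ 0); apply: (@der1_near _ (fun=> 0)); last exact: der1_cst.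
by move: (near_out tout); apply: filterS => s /g0 ->; rewrite mul0r.
Qed.

Lemma glue_der1 a b (g dg : R -> R) H dH t : (forall t, der1 g t (dg t)) -> vanishes_out a b g ->
  (a <= t <= b -> der1 H t (dH t)) -> der1 (fun t => g t * H t) t (dg t * H t + g t * dH t).
Proof.
move=> hg g0 hH; have [tab|tout] := in_or_out a b t; first exact: is_derive1M (hg t) (hH tab).
have dg0 : dg t = 0.
  have [_ <-] := hg t; rewrite -[RHS](derive_cst (0 : R) t (1 : R)); apply: near_eq_derive.
  by move: (near_out tout); apply: filterS => s /g0 ->.
rewrite dg0 g0// !mul0r addr0; apply: (@der1_near _ (fun=> 0)); last exact: der1_cst.
by move: (near_out tout); apply: filterS => s /g0 ->; rewrite mul0r.
Qed.

Lemma cont_onM a b H H' : cont_on a b H -> cont_on a b H' -> cont_on a b (fun t => H t * H' t).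
Proof. by move=> cH cH' t tab; apply: cvgM; [exact: cH|exact: cH']. Qed.

Lemma cont_onD a b H H' : cont_on a b H -> cont_on a b H' -> cont_on a b (fun t => H t + H' t).
Proof. by move=> cH cH' t tab; apply: cvgD; [exact: cH|exact: cH']. Qed.

Lemma cont_on_cst a b (k : R) : cont_on a b (fun=> k).
Proof. by move=> t _; exact: cvg_cst. Qed.

Lemma cont_on_id a b : cont_on a b (fun t => t).
Proof. by move=> t _; exact: cvg_id. Qed.

Lemma cont_onV a b H : (forall t, a <= t <= b -> H t != 0) -> cont_on a b H -> cont_on a b (fun t => (H t)^-1).
Proof. by move=> H0 cH t tab; apply: cvgV; [exact: H0|exact: cH]. Qed.

Lemma cont_on_der a b H dH : (forall t, a <= t <= b -> der1 H t (dH t)) -> cont_on a b H.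
Proof. by move=> h t /h; exact: is_derive_continuous. Qed.

Context (a b l3 : R) (chi dchi : R -> R).
Hypotheses (a0 : 0 < a) (hchi : radial b chi dchi) (chi0 : forall t, t < a -> chi t = 0).

(** ln (R3 / |x|) at t = |x|^2, when [l3] is ln R3. *)
Definition Lg t := l3 - 2^-1 * ln t.
Hypothesis Lg2 : forall t, a <= t <= b -> 2 <= Lg t.

(** |x|^(- la) L^(- ka); for la = ka = be this is (e^L / L)^be up to the constant R3^(- be). The two
    exponents are separate because multiplication by |x| or L just shifts one of them. *)
Definition wt (la ka t : R) := expR (- (2^-1 * la) * ln t - ka * ln (Lg t)).
Definition dwt (la ka t : R) := wt la ka t * (- (2^-1 * la) * t^-1 + 2^-1 * ka * (t^-1 * (Lg t)^-1)).

Lemma ab_gt0 t : a <= t <= b -> 0 < t.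
Proof. by move=> /andP[/(lt_le_trans a0)]. Qed.

Lemma Lg_gt0 t : a <= t <= b -> 0 < Lg t.
Proof. by move=> /Lg2; apply: lt_le_trans. Qed.

Lemma der1_ln t : 0 < t -> der1 (@ln R) t t^-1.
Proof. exact: is_derive1_ln. Qed.

Lemma der1_Lg t : a <= t <= b -> der1 Lg t (- (2^-1 * t^-1)).
Proof.
move=> /ab_gt0 t0; apply: der1_eq.
  apply: is_derive1D (der1_cst l3 t) _.
  under [X in der1 X]eq_fun do rewrite -mulNr.
  exact: is_derive1M (der1_cst _ t) (der1_ln t0).
by rewrite mul0r !add0r mulNr.
Qed.

Lemma der1_wt la ka t : a <= t <= b -> der1 (wt la ka) t (dwt la ka t).
Proof.
move=> tab; have t0 := ab_gt0 tab; have L0 := Lg_gt0 tab.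
apply: der1_eq.
  apply: der1_comp (is_derive_expR _) _.
  apply: is_derive1D; first exact: is_derive1M (der1_cst _ t) (der1_ln t0).
  under [X in der1 X]eq_fun do rewrite -mulNr.
  exact: is_derive1M (der1_cst _ t) (der1_comp (der1_ln L0) (der1_Lg tab)).
by rewrite /dwt /wt; ring.
Qed.

Lemma chi_out : vanishes_out a b chi.
Proof. by move=> t [/chi0//|bt]; have [_ _] := hchi; exact. Qed.

Lemma dchi_out : vanishes_out a b dchi.
Proof.
move=> t tout; have [hc _ _] := hchi; have [_ <-] := hc t.
rewrite -[RHS](derive_cst (0 : R) t (1 : R)); apply: near_eq_derive.
by move: (near_out tout); apply: filterS => s /chi_out ->.
Qed.

Lemma glue_radial (g dg : R -> R) H dH : radial b g dg -> vanishes_out a b g -> vanishes_out a b dg ->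
  (forall t, a <= t <= b -> der1 H t (dH t)) -> cont_on a b dH ->
  radial b (fun t => g t * H t) (fun t => dg t * H t + g t * dH t).
Proof.
move=> hg g0 dg0 hH cdH; have [dgP cdg gb] := hg; split=> [t|t|t bt]; last by rewrite gb// mul0r.
- exact: glue_der1 dgP g0 (hH t).
- apply: cvgD; first exact: glue_continuous cdg dg0 (cont_on_der hH) t.
  exact: glue_continuous (radial_continuous hg) g0 cdH t.
Qed.

Lemma cont_on_wt la ka : cont_on a b (wt la ka).
Proof. exact: cont_on_der (@der1_wt la ka). Qed.

Lemma cont_on_tV : cont_on a b (fun t => t^-1).
Proof. by apply: cont_onV; [move=> t /ab_gt0; rewrite lt0r => /andP[]|exact: cont_on_id]. Qed.

Lemma cont_on_LgV : cont_on a b (fun t => (Lg t)^-1).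
Proof.
by apply: cont_onV; [move=> t /Lg_gt0; rewrite lt0r => /andP[]|exact: cont_on_der der1_Lg].
Qed.

Lemma cont_on_dwt la ka : cont_on a b (dwt la ka).
Proof.
apply: cont_onM; first exact: cont_on_wt.
apply: cont_onD; first by apply: cont_onM; [exact: cont_on_cst|exact: cont_on_tV].
by apply: cont_onM; [exact: cont_on_cst|apply: cont_onM; [exact: cont_on_tV|exact: cont_on_LgV]].
Qed.

Lemma radial_chi_wt la ka : radial b (fun t => chi t * wt la ka t)
  (fun t => dchi t * wt la ka t + chi t * dwt la ka t).
Proof.
apply: glue_radial hchi chi_out dchi_out _ _ => [t|]; first exact: der1_wt.
exact: cont_on_dwt.
Qed.

(** For k = n/2, [al * wt] is the zero-order term cancelling ([euler] + n/2) applied to [wt]. Only -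
    ka / L in [al] varies: it is the sole source of positivity in the Carleman estimate. *)
Lemma radial_alpha la ka (k : R) : let al t := la - ka * (Lg t)^-1 - k in
  radial b (fun t => chi t * (al t * wt la ka t) * (chi t * wt la ka t))
    (fun t => 2 * (chi t * dchi t) * (al t * (wt la ka t * wt la ka t)) + chi t * chi t *
      (- (ka * (2^-1 * (t^-1 * ((Lg t)^-1 * (Lg t)^-1)))) * (wt la ka t * wt la ka t) +
       al t * (2 * (wt la ka t * dwt la ka t)))).
Proof.
move=> al.
have dal t : a <= t <= b -> der1 al t (- (ka * (2^-1 * (t^-1 * ((Lg t)^-1 * (Lg t)^-1))))).
  move=> tab; have L0 := Lg_gt0 tab; have t0 := ab_gt0 tab; apply: der1_eq.
    apply: is_derive1D (der1_cst _ t).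
    apply: is_derive1D (der1_cst _ t) _.
    under [X in der1 X]eq_fun do rewrite -mulNr.
    apply: is_derive1M (der1_cst _ t) (is_derive1V _ (der1_Lg tab)); exact: lt0r_neq0.
  by move=> /=; ring.
have dw2 t : a <= t <= b -> der1 (fun t => wt la ka t * wt la ka t) t (2 * (wt la ka t * dwt la ka t)).
  move=> tab; apply: der1_eq; first exact: is_derive1M (der1_wt la ka tab) (der1_wt la ka tab).
  by ring.
have := @glue_radial (fun t => chi t * chi t) (fun t => 2 * (chi t * dchi t))
  (fun t => al t * (wt la ka t * wt la ka t)) (fun t => - (ka * (2^-1 * (t^-1 * ((Lg t)^-1 * (Lg t)^-1)))) * (wt la ka t * wt la ka t) +
       al t * (2 * (wt la ka t * dwt la ka t))) (radial_sqr hchi).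
move=> H.
rewrite (_ : (fun t => chi t * (al t * wt la ka t) * (chi t * wt la ka t)) =
  (fun t => chi t * chi t * (al t * (wt la ka t * wt la ka t)))); last by apply/funext => t; ring.
apply: H.
- by move=> t /chi_out ->; rewrite mul0r.
- by move=> t /chi_out ->; rewrite mul0r mulr0.
- by move=> t tab; exact: is_derive1M (dal t tab) (dw2 t tab).
- have cL := cont_on_LgV; have ct := cont_on_tV; have cw : cont_on a b (wt la ka) by exact: cont_on_wt.
  have cc (k' : R) : cont_on a b (fun=> k') by exact: cont_on_cst.
  apply: cont_onD; apply: cont_onM.
  + rewrite (_ : (fun x => _) = (fun t => (- ka) * (2^-1 * (t^-1 * ((Lg t)^-1 * (Lg t)^-1))))).
      by do 3! (apply: cont_onM => //); exact: cont_onM.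
    by apply/funext => t; rewrite mulNr.
  + exact: cont_onM.
  + exact: cont_on_der dal.
  + by apply: cont_onM => //; apply: cont_onM => //; exact: cont_on_dwt.
Qed.

End weights.

Section weighted_integrals.
Context {R : realType} {n : nat} (a b : R).
Local Notation mu := (@lebesgue_rV R n).
Implicit Types (x : 'rV[R]_n) (g H : R -> R) (X Y : 'rV[R]_n -> R).

Definition adm g := continuous g /\ vanishes_out a b g.

(** Every term of the estimates has this shape, [g] being a cut-off or its derivative; [g] hides the
    values of [H] outside [a, b]. *)
Definition J g H X := \int[mu]_x (g (sq x) ^+ 2 * H (sq x) * X x).

Lemma J_ccf g H X : adm g -> cont_on a b H -> continuous X ->
  ccf (fun x => g (sq x) ^+ 2 * H (sq x) * X x).
Proof.
move=> [cg g0] cH cX; apply: ccfM => //.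
have c2 : continuous (fun t => g t * (g t * H t)).
  move=> t; apply: cvgM; [exact: cg|exact: glue_continuous cg g0 cH t].
rewrite (_ : (fun x => _) = (fun x => (fun t => g t * (g t * H t)) (sq x))).
  have c0 t : b < t -> g t * (g t * H t) = 0 by move=> bt; rewrite g0 ?mul0r//; right.
  exact: (rad_ccf c2 c0).
by apply/funext => x /=; rewrite expr2 mulrA.
Qed.

Lemma J_le g H H' X : adm g -> cont_on a b H -> cont_on a b H' -> continuous X ->
  (forall x, 0 <= X x) -> (forall t, a <= t <= b -> H t <= H' t) -> J g H X <= J g H' X.
Proof.
move=> ag cH cH' cX X0 HH; apply: Icc_le; [exact: J_ccf|exact: J_ccf|] => x.
have [tab|tout] := in_or_out a b (sq x); last by rewrite ag.2// expr0n !mul0r.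
by rewrite ler_wpM2r// ler_wpM2l ?sqr_ge0// HH.
Qed.

Lemma J_ext g H H' X : adm g -> (forall t, a <= t <= b -> H t = H' t) -> J g H X = J g H' X.
Proof.
move=> ag HH; apply: eq_Rintegral => x _.
have [tab|tout] := in_or_out a b (sq x); last by rewrite ag.2// expr0n !mul0r.
by rewrite HH.
Qed.

Lemma J_eqX g H X Y : adm g -> (forall x, a <= sq x <= b -> X x = Y x) -> J g H X = J g H Y.
Proof.
move=> ag XY; apply: eq_Rintegral => x _.
have [tab|tout] := in_or_out a b (sq x); last by rewrite ag.2// expr0n !mul0r.
by rewrite XY.
Qed.

Lemma J_leX g H X Y : adm g -> cont_on a b H -> (forall t, a <= t <= b -> 0 <= H t) ->
  continuous X -> continuous Y ->
  (forall x, a <= sq x <= b -> X x <= Y x) -> J g H X <= J g H Y.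
Proof.
move=> ag cH H0 cX cY XY; apply: Icc_le; [exact: J_ccf|exact: J_ccf|] => x.
have [tab|tout] := in_or_out a b (sq x); last by rewrite ag.2// expr0n !mul0r.
by rewrite ler_wpM2l ?XY// mulr_ge0 ?sqr_ge0// H0.
Qed.

Lemma J_Z g (k : R) H X : adm g -> cont_on a b H -> continuous X ->
  J g (fun t => k * H t) X = k * J g H X.
Proof.
move=> ag cH cX; rewrite -IccZ; last exact: J_ccf.
by apply: eq_Rintegral => x _; ring.
Qed.

Lemma J_ZX g (k : R) H X : adm g -> cont_on a b H -> continuous X ->
  J g H (fun x => k * X x) = k * J g H X.
Proof.
move=> ag cH cX; rewrite -IccZ; last exact: J_ccf.
by apply: eq_Rintegral => x _; ring.
Qed.

Lemma J_DX g H X Y : adm g -> cont_on a b H -> continuous X -> continuous Y ->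
  J g H (fun x => X x + Y x) = J g H X + J g H Y.
Proof.
move=> ag cH cX cY; rewrite -IccD; [|exact: J_ccf..].
by apply: eq_Rintegral => x _; ring.
Qed.

Lemma J_ge0 g H X : adm g -> (forall t, a <= t <= b -> 0 <= H t) -> (forall x, 0 <= X x) -> 0 <= J g H X.
Proof.
move=> ag H0 X0; apply: Icc_ge0 => x.
have [tab|tout] := in_or_out a b (sq x); last by rewrite ag.2// expr0n !mul0r.
by rewrite mulr_ge0// mulr_ge0 ?sqr_ge0// H0.
Qed.

End weighted_integrals.

Section weighted_carleman.
Context {R : realType} {n N : nat} {c : 'I_n -> 'M[R]_N} (cl : clifford c).
Local Notation mu := (@lebesgue_rV R n).
Implicit Types (x : 'rV[R]_n).
Context (a b l3 : R) (chi dchi : R -> R).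
Hypotheses (a0 : 0 < a) (hchi : radial b chi dchi) (chi0 : forall t, t < a -> chi t = 0)
  (Lg2 : forall t, a <= t <= b -> 2 <= Lg l3 t).
Context (v : 'I_N -> 'rV[R]_n -> R) (Dv : 'I_N -> 'I_n -> 'rV[R]_n -> R)
  (Hv : 'I_N -> 'I_n -> 'I_n -> 'rV[R]_n -> R).
Hypothesis v2 : forall m, C2 (v m) (Dv m) (Hv m).

Local Notation wt := (wt l3).
Local Notation V x := (dot (vec v x) (vec v x)).
Local Notation D x := (dot (dirac (c := c) (grad Dv x)) (dirac (c := c) (grad Dv x))).

Lemma adm_chi : adm a b chi.
Proof. by split; [exact: radial_continuous hchi|exact: chi_out hchi chi0]. Qed.

Lemma adm_dchi : adm a b dchi.
Proof. by split; [have [] := hchi|exact: dchi_out hchi chi0]. Qed.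

(** [carleman] for the weight [chi * wt] and the zero-order term of [radial_alpha]: the square on
    the right keeps only the derivative of the cut-off, and the coefficient on the left is - 2 t al'
    wt^2 = ka L^-2 wt^2. *)
Lemma weighted_carleman la ka :
  J chi (fun t => ka * wt la ka t ^+ 2 * (Lg l3 t) ^- 2) (fun x => V x) <=
  J chi (fun t => t * wt la ka t ^+ 2) (fun x => D x) +
  J dchi (fun t => 4 * t ^+ 2 * wt la ka t ^+ 2) (fun x => V x).
Proof.
have chiO := chi_out hchi chi0; have dchiO := dchi_out hchi chi0.
have hw := radial_chi_wt a0 hchi chi0 Lg2 la ka.
have hp := radial_alpha a0 hchi chi0 Lg2 la ka (n%:R / 2).
pose al t := la - ka * (Lg l3 t)^-1 - n%:R / 2.
have cal : cont_on a b al.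
  rewrite (_ : al = fun t => (la - n%:R / 2) + (- ka) * (Lg l3 t)^-1); last by apply/funext => t; rewrite /al; ring.
  by apply: cont_onD; [exact: cont_on_cst|apply: cont_onM; [exact: cont_on_cst|exact: cont_on_LgV a0 Lg2]].
have c1 : continuous (fun t => chi t * (al t * wt la ka t)).
  apply: glue_continuous (radial_continuous hchi) chiO _.
  by apply: cont_onM => //; exact: cont_on_wt a0 Lg2 _ _.
have c2 t : b < t -> chi t * (al t * wt la ka t) = 0 by move=> bt; rewrite chiO ?mul0r//; right.
have H := carleman cl v2 hw hp c1 c2.
rewrite (_ : J chi _ _ = \int[mu]_x ((4 * sq x *
       (dchi (sq x) * wt la ka (sq x) + chi (sq x) * dwt l3 la ka (sq x)) *
       (chi (sq x) * (al (sq x) * wt la ka (sq x))) -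
       2 * sq x *
       (2 * (chi (sq x) * dchi (sq x)) *
        (al (sq x) * (wt la ka (sq x) * wt la ka (sq x))) +
        chi (sq x) * chi (sq x) *
        (- (ka * (2^-1 * ((sq x)^-1 * ((Lg l3 (sq x))^-1 / Lg l3 (sq x))))) *
         (wt la ka (sq x) * wt la ka (sq x)) +
         al (sq x) * (2 * (wt la ka (sq x) * dwt l3 la ka (sq x)))))) * V x)); last first.
  apply: eq_Rintegral => x _; congr (_ * _).
  have [tab|tout] := in_or_out a b (sq x); last by rewrite chiO// dchiO//; ring.
  have L0 := Lg_gt0 Lg2 tab; have t0 := ab_gt0 a0 tab.
  by rewrite /dwt; field; rewrite !lt0r_neq0.
apply: le_trans H _; rewrite le_eqVlt; apply/orP; left; apply/eqP; congr (_ + _).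
  by apply: eq_Rintegral => x _; rewrite exprMn; ring.
apply: eq_Rintegral => x _; congr (_ * _).
have [tab|tout] := in_or_out a b (sq x); last by rewrite chiO// dchiO//; ring.
have L0 := Lg_gt0 Lg2 tab; have t0 := ab_gt0 a0 tab.
by rewrite /dwt; field; rewrite !lt0r_neq0.
Qed.

(** Since 2 t wt' = (ka / L - la) wt, the number [be] bounds the logarithmic derivative of the
    weight, whose square multiplies |v|^2 in [garding]. *)
Lemma weighted_garding la ka (be : R) : 0 <= be ->
  (forall t, a <= t <= b -> - be <= ka * (Lg l3 t)^-1 - la <= be) ->
  J chi (fun t => wt la ka t ^+ 2) (fun x => \sum_i dot (grad Dv x i) (grad Dv x i)) <=
  4 * J chi (fun t => wt la ka t ^+ 2) (fun x => D x) +
  12 * J dchi (fun t => 4 * t * wt la ka t ^+ 2) (fun x => V x) +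
  12 * be ^+ 2 * J chi (fun t => t^-1 * wt la ka t ^+ 2) (fun x => V x).
Proof.
move=> be0 hbe.
have chiO := chi_out hchi chi0; have dchiO := dchi_out hchi chi0.
have hw := radial_chi_wt a0 hchi chi0 Lg2 la ka.
have cwt : cont_on a b (wt la ka) by exact: cont_on_wt.
have ctV : cont_on a b (fun t => t^-1) by exact: cont_on_tV.
have cw2 : cont_on a b (fun t => wt la ka t ^+ 2) by under eq_fun do rewrite expr2; exact: cont_onM.
have ct : cont_on a b (fun t => t) by exact: cont_on_id.
have c4 (k : R) : cont_on a b (fun=> k) by exact: cont_on_cst.
have cV : continuous (fun x => V x) by apply: contE; apply: cont_dot => m; exact: cont_vec.
have H := garding cl v2 hw.
rewrite (_ : J chi _ _ = \int[mu]_x ((chi (sq x) * wt la ka (sq x)) ^+ 2 * \sum_i dot (grad Dv x i) (grad Dv x i))); last first.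
  by apply: eq_Rintegral => x _; rewrite exprMn.
apply: le_trans H _; rewrite -addrA lerD//.
  rewrite ler_pM2l// le_eqVlt; apply/orP; left; apply/eqP.
  by apply: eq_Rintegral => x _; rewrite exprMn.
have ca1 : cont_on a b (fun t => 4 * t * wt la ka t ^+ 2) by apply: cont_onM => //; exact: cont_onM.
have ca2 : cont_on a b (fun t => t^-1 * wt la ka t ^+ 2) by exact: cont_onM.
rewrite -(IccZ _ (J_ccf adm_dchi ca1 cV)) -(IccZ _ (J_ccf adm_chi ca2 cV)).
rewrite -IccD; [|apply: ccfZ; exact: (J_ccf adm_dchi ca1 cV)|apply: ccfZ; exact: (J_ccf adm_chi ca2 cV)].
have [_ cdw' dw0] := hw.
have Cl : ccf (fun x => sq x * (dchi (sq x) * wt la ka (sq x) + chi (sq x) * dwt l3 la ka (sq x)) ^+ 2 * V x).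
  apply: ccfM => //; apply: ccfMr; last exact: continuous_sq.
  have C' : ccf (fun x : 'rV[R]_n => dchi (sq x) * wt la ka (sq x) + chi (sq x) * dwt l3 la ka (sq x)).
    by apply: (rad_ccf (b := b) cdw') => t bt; exact: radial_d0 hw bt.
  by under eq_fun do rewrite expr2; apply: ccfM; [exact: C'|exact: C'.1].
rewrite -IccZ//; apply: Icc_le; [exact: ccfZ| |].
  by apply: ccfD; apply: ccfZ; [exact: (J_ccf adm_dchi ca1 cV)|exact: (J_ccf adm_chi ca2 cV)].
move=> x.
suff K : 24 * (sq x * (dchi (sq x) * wt la ka (sq x) + chi (sq x) * dwt l3 la ka (sq x)) ^+ 2) <=
    12 * (dchi (sq x) ^+ 2 * (4 * sq x * wt la ka (sq x) ^+ 2)) +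
    12 * be ^+ 2 * (chi (sq x) ^+ 2 * ((sq x)^-1 * wt la ka (sq x) ^+ 2)).
  by have := ler_wpM2r (dot_ge0 (vec v x)) K; congr (is_true (_ <= _)); ring.
have [tab|tout] := in_or_out a b (sq x); last by rewrite chiO// dchiO//; rewrite le_eqVlt; apply/orP; left; apply/eqP; ring.
have L0 := Lg_gt0 Lg2 tab; have t0 := ab_gt0 a0 tab.
have /andP[h1 h2] := hbe _ tab.
have -> : dwt l3 la ka (sq x) = wt la ka (sq x) * (2^-1 * (sq x)^-1 * (ka * (Lg l3 (sq x))^-1 - la)).
  by rewrite /dwt; ring.
set e := _ - la in h1 h2 *; set w := wt _ _ _; set s := sq x in t0 *; set p := dchi s; set q := chi s.
have e2 : e ^+ 2 <= be ^+ 2 by nra.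
have E1 : s * (p * w + q * (w * (2^-1 * s^-1 * e))) ^+ 2 <= 2 * (s * p ^+ 2 * w ^+ 2) + 2^-1 * (q ^+ 2 * w ^+ 2 * s^-1 * e ^+ 2).
  rewrite -subr_ge0 (_ : _ - _ = s * (p * w - q * (w * (2^-1 * s^-1 * e))) ^+ 2).
    by rewrite mulr_ge0 ?sqr_ge0// ltW.
  by field; rewrite lt0r_neq0.
have E2 : q ^+ 2 * w ^+ 2 * s^-1 * e ^+ 2 <= q ^+ 2 * w ^+ 2 * s^-1 * be ^+ 2.
  apply: ler_wpM2l e2; apply: mulr_ge0; first by rewrite mulr_ge0 ?sqr_ge0.
  by rewrite invr_ge0 ltW.
lra.
Qed.

End weighted_carleman.

(** * The Stokes system for smooth functions *)

Section C2_closure.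
Context {R : realType} {n : nat}.
Implicit Types (f g : 'rV[R]_n -> R).

Lemma C2D f Df Hf g Dg Hg : C2 f Df Hf -> C2 g Dg Hg ->
  C2 (fun x => f x + g x) (fun i x => Df i x + Dg i x) (fun i j x => Hf i j x + Hg i j x).
Proof.
move=> [[cf cf1] cf2 df df1 sf] [[cg cg1] cg2 dg dg1 sg]; split.
- by split=> [|i]; exact: continuous_rVD.
- by move=> i j; exact: continuous_rVD.
- by move=> i; exact: pderD.
- by move=> i j; exact: pderD.
- by move=> i j x; rewrite sf sg.
Qed.

Lemma C2Z (k : R) f Df Hf : C2 f Df Hf ->
  C2 (fun x => f x * k) (fun i x => Df i x * k) (fun i j x => Hf i j x * k).
Proof.
move=> [[cf cf1] cf2 df df1 sf].
have pZ i g g' : pder i g g' -> pder i (fun x => g x * k) (fun x => g' x * k).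
  move=> h; under eq_fun do rewrite mulrC.
  by apply: pder_eq; [exact: pderZ h|move=> x /=; rewrite mulrC].
split.
- by split=> [|i]; apply: continuous_rVM => //; exact: continuous_rV_cst.
- by move=> i j; apply: continuous_rVM => //; exact: continuous_rV_cst.
- by move=> i; exact: pZ.
- by move=> i j; exact: pZ.
- by move=> i j x; rewrite sf.
Qed.

Lemma C2_sum (I : finType) (f : I -> 'rV[R]_n -> R) Df Hf : (forall i, C2 (f i) (Df i) (Hf i)) ->
  C2 (fun x => \sum_i f i x) (fun j x => \sum_i Df i j x) (fun j l x => \sum_i Hf i j l x).
Proof.
move=> H; split.
- by split=> [|j]; apply: continuous_sum => i _; have [[]] := H i.
- by move=> j l; apply: continuous_sum => i _; have [] := H i.
- by move=> j; apply: pder_sum => i _; have [] := H i.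
- by move=> j l; apply: pder_sum => i _; have [] := H i.
- by move=> j l x; apply: eq_bigr => i _; have [] := H i.
Qed.

End C2_closure.

Section dirac_system.
Context {R : realType} {n N : nat} {c : 'I_n -> 'M[R]_N} (cl : clifford c).
Implicit Types (x : 'rV[R]_n).

Lemma dot_c (i : 'I_n) (e e' : 'rV[R]_N) : dot (e *m c i) (e' *m c i) = dot e e'.
Proof.
have c2 : c i *m c i = 1%:M.
  have := cl.2 i i; rewrite eqxx mulr1 => h.
  by have := congr1 (fun M => 2^-1 *: M) h; rewrite half_scaler scale_scalar_mx mulVf ?pnatr_eq0.
by rewrite dotM cl.1 -mulmxA c2 mulmx1.
Qed.

Lemma dirac_bound (d : 'I_n -> 'rV[R]_N) :
  dot (dirac (c := c) d) (dirac (c := c) d) <= n%:R * \sum_j dot (d j) (d j).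
Proof.
rewrite /dirac dot_suml.
have E : n%:R * \sum_j dot (d j) (d j) = \sum_i \sum_j 2^-1 * (dot (d i) (d i) + dot (d j) (d j)).
  under [RHS]eq_bigr do rewrite -mulr_sumr big_split/= sumr_const card_ord.
  rewrite -mulr_sumr big_split/= sumrMnl sumr_const card_ord -mulr_natl; by field.
rewrite E; apply: ler_sum => i _; rewrite dot_sumr; apply: ler_sum => j _.
have := dot_le2 (d i *m c i) (d j *m c j) (@ltr01 R); rewrite invr1 !mul1r !dot_c; lra.
Qed.

Context (xi : 'rV[R]_N) (xi1 : dot xi xi = 1).
Context (u : 'I_n -> 'rV[R]_n -> R) (Du : 'I_n -> 'I_n -> 'rV[R]_n -> R)
  (Hu : 'I_n -> 'I_n -> 'I_n -> 'rV[R]_n -> R) (Tu : 'I_n -> 'I_n -> 'I_n -> 'I_n -> 'rV[R]_n -> R)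
  (p : 'rV[R]_n -> R) (Dp : 'I_n -> 'rV[R]_n -> R) (Hp : 'I_n -> 'I_n -> 'rV[R]_n -> R).
Hypotheses (u2 : forall i, C2 (u i) (Du i) (Hu i)) (u3 : forall i j, C2 (Du i j) (Hu i j) (Tu i j))
  (p2 : C2 p Dp Hp).

(** Coordinate formulas, so that [C2_sum] supplies the derivatives; [vec_bu] and [vec_qq] recover
    the invariant forms. *)
Definition bu (m : 'I_N) x := \sum_i u i x * (xi *m c i) ord0 m.
Definition Dbu (m : 'I_N) (j : 'I_n) x := \sum_i Du i j x * (xi *m c i) ord0 m.
Definition Hbu (m : 'I_N) (j l : 'I_n) x := \sum_i Hu i j l x * (xi *m c i) ord0 m.

Definition qq (m : 'I_N) x := \sum_i \sum_j Du i j x * (xi *m c i *m c j) ord0 m + p x * xi ord0 m.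
Definition Dqq (m : 'I_N) (l : 'I_n) x :=
  \sum_i \sum_j Hu i j l x * (xi *m c i *m c j) ord0 m + Dp l x * xi ord0 m.
Definition Hqq (m : 'I_N) (l k : 'I_n) x :=
  \sum_i \sum_j Tu i j l k x * (xi *m c i *m c j) ord0 m + Hp l k x * xi ord0 m.

Lemma bu_C2 m : C2 (bu m) (Dbu m) (Hbu m).
Proof. by apply: C2_sum => i; exact: C2Z. Qed.

Lemma qq_C2 m : C2 (qq m) (Dqq m) (Hqq m).
Proof.
apply: (C2D _ (C2Z _ p2)); apply: C2_sum => i; apply: C2_sum => j; exact: C2Z.
Qed.

Lemma vec_bu x : vec bu x = xi *m symbol (c := c) (\row_i u i x).
Proof.
apply/rowP => m; rewrite mxE /bu /symbol mulmx_sumr summxE; apply: eq_bigr => i _.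
by rewrite -scalemxAr !mxE.
Qed.

Lemma grad_bu x j : grad Dbu x j = xi *m symbol (c := c) (\row_i Du i j x).
Proof.
apply/rowP => m; rewrite mxE /Dbu /symbol mulmx_sumr summxE; apply: eq_bigr => i _.
by rewrite -scalemxAr !mxE.
Qed.

Lemma dot_symbol1 (y : 'rV[R]_n) : dot (xi *m symbol (c := c) y) (xi *m symbol (c := c) y) = \sum_i y ord0 i ^+ 2.
Proof. by rewrite (dot_symbol cl) xi1 mulr1. Qed.

Lemma nsq_bu x : dot (vec bu x) (vec bu x) = \sum_i u i x ^+ 2.
Proof. by rewrite vec_bu dot_symbol1; apply: eq_bigr => i _; rewrite mxE. Qed.

Lemma nsq_grad_bu x : \sum_j dot (grad Dbu x j) (grad Dbu x j) = \sum_j \sum_i Du i j x ^+ 2.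
Proof.
apply: eq_bigr => j _; rewrite grad_bu dot_symbol1; apply: eq_bigr => i _; by rewrite mxE.
Qed.

Lemma dirac_bu x : dirac (c := c) (grad Dbu x) = \sum_i \sum_j Du i j x *: (xi *m c i *m c j).
Proof.
rewrite exchange_big/=; apply: eq_bigr => j _; rewrite grad_bu /symbol mulmx_sumr mulmx_suml.
by apply: eq_bigr => i _; rewrite -scalemxAr -scalemxAl mxE.
Qed.

(** For i <> j the matrix c_i c_j is antisymmetric, so its quadratic form is zero. Consequently the
    component of D (b u) along [xi] is div u ([dot_sum2_xi]). *)
Lemma dot_cc_xi i j : dot (xi *m c i *m c j) xi = (i == j)%:R.
Proof.
have [<-|ij] := eqVneq i j.
  have := dot_c i xi xi; rewrite xi1 => <-; by rewrite dotM cl.1.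
have h : dot (xi *m c i *m c j) xi = - dot (xi *m c i *m c j) xi.
  rewrite {1}dotM cl.1 dotM cl.1 dotC -[X in X = _]opprK; congr (- _).
  have : xi *m c i *m c j + xi *m c j *m c i = 0.
    by rewrite -!mulmxA -mulmxDr cl.2 (negbTE ij) mulr0 mul_mx_scalar scale0r.
  move=> /eqP; rewrite addr_eq0 => /eqP ->.
  by rewrite -[- (xi *m _ *m _)]scaleN1r dotZl mulN1r.
have h0 (d : R) : d = - d -> d = 0 by lra.
  exact: h0 h.
Qed.

Lemma dot_sum2_xi (f : 'I_n -> 'I_n -> R) :
  dot (\sum_i \sum_j f i j *: (xi *m c i *m c j)) xi = \sum_i f i i.
Proof.
rewrite dot_suml; apply: eq_bigr => i _; rewrite dot_suml.
rewrite -[RHS](sum_delta i (fun j => f i j)); apply: eq_bigr => j _.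
by rewrite dotZl dot_cc_xi mulrC.
Qed.

Lemma vec_qq x : vec qq x = \sum_i \sum_j Du i j x *: (xi *m c i *m c j) + p x *: xi.
Proof.
apply/rowP => m; rewrite !mxE /qq summxE; congr (_ + _); apply: eq_bigr => i _.
by rewrite summxE; apply: eq_bigr => j _; rewrite !mxE.
Qed.

Lemma grad_qq x l : grad Dqq x l = \sum_i \sum_j Hu i j l x *: (xi *m c i *m c j) + Dp l x *: xi.
Proof.
apply/rowP => m; rewrite !mxE /Dqq summxE; congr (_ + _); apply: eq_bigr => i _.
by rewrite summxE; apply: eq_bigr => j _; rewrite !mxE.
Qed.

Lemma nsq_qq x : \sum_i Du i i x = 0 ->
  dot (vec qq x) (vec qq x) = dot (dirac (c := c) (grad Dbu x)) (dirac (c := c) (grad Dbu x)) + p x ^+ 2.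
Proof.
move=> dv; rewrite vec_qq -dirac_bu dotDl !dotDr !dotZl !dotZr xi1 (dotC xi).
by rewrite dirac_bu dot_sum2_xi dv; ring.
Qed.

(** The derivatives of D (b u) are orthogonal to [xi] since those of div u vanish; their squares are
    dropped. *)
Lemma nsq_grad_qq x : (forall l, \sum_i Hu i i l x = 0) ->
  \sum_l Dp l x ^+ 2 <= \sum_l dot (grad Dqq x l) (grad Dqq x l).
Proof.
move=> ddv; apply: ler_sum => l _; rewrite grad_qq dotDl !dotDr !dotZl !dotZr xi1 (dotC xi) dot_sum2_xi ddv.
set e := \sum_i _; have := dot_ge0 e; lra.
Qed.

(** D^2 is the Laplacian, so D q = b (Delta u + grad p) = - b F. The products c_j c_l with j <> l
    drop out against the symmetric second derivatives. *)
Lemma nsq_dirac_qq x (F : 'I_n -> R) : (forall i, \sum_l Hu i l l x + F i + Dp i x = 0) ->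
  dot (dirac (c := c) (grad Dqq x)) (dirac (c := c) (grad Dqq x)) = \sum_i F i ^+ 2.
Proof.
move=> st; have -> : dirac (c := c) (grad Dqq x) = xi *m symbol (c := c) (\row_i - F i).
  have E i : - F i = \sum_l Hu i l l x + Dp i x by have := st i; lra.
  have -> : symbol (c := c) (\row_i - F i) = \sum_i (\sum_l Hu i l l x) *: c i + \sum_i Dp i x *: c i.
    by rewrite -big_split/=; apply: eq_bigr => i _; rewrite mxE E scalerDl.
  rewrite mulmxDr !mulmx_sumr /dirac.
  under eq_bigr do rewrite grad_qq mulmxDl.
  rewrite big_split/=; congr (_ + _); last by apply: eq_bigr => i _; rewrite -scalemxAl -scalemxAr.
  under eq_bigr do rewrite mulmx_suml.
  rewrite exchange_big/=; apply: eq_bigr => i _; rewrite -scalemxAr.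
  pose T := \sum_l \sum_j Hu i j l x *: (xi *m c i *m c j *m c l).
  have -> : \sum_(l < n) (\sum_j Hu i j l x *: (xi *m c i *m c j)) *m c l = T.
    by apply: eq_bigr => l _; rewrite mulmx_suml; apply: eq_bigr => j _; rewrite -scalemxAl.
  have T2 : T + T = (2 * \sum_l Hu i l l x) *: (xi *m c i).
    rewrite {1}/T exchange_big/= -big_split/= mulr_sumr scaler_suml; apply: eq_bigr => l _.
    rewrite -big_split/= (bigD1 l)//= big1 ?addr0.
      by rewrite -scalerDr -!mulmxA -2!mulmxDr cl.2 eqxx mulr1 mul_mx_scalar -scalemxAr scalerA mulrC.
    move=> j jl; have [_ _ _ _ sH] := u2 i.
    rewrite (sH j l) -scalerDr -!mulmxA -2!mulmxDr cl.2 eq_sym (negbTE jl) mulr0.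
    by rewrite mul_mx_scalar scale0r mulmx0 scaler0.
  by rewrite -[T]half_scaler T2 scalerA mulrA mulVf ?mul1r// pnatr_eq0.
by rewrite dot_symbol1; apply: eq_bigr => i _; rewrite mxE sqrrN.
Qed.

End dirac_system.

(** The bookkeeping of [classical_carleman]: Carleman estimates for b u and q, then Garding's
    inequality for both. The factor be^2 of the latter is paid by the factors be and be - 1 >= be /
    2 of the former, leaving at most one power of be. *)
Lemma carleman_absorb (R : realFieldType) (be Xu Xp XD Xg Xq XF eu eD ep err : R) : 2 <= be ->
  0 <= XD -> 0 <= Xp -> 0 <= Xu -> 0 <= XF -> 0 <= eu -> 0 <= ep -> 0 <= eD ->
  be * Xu <= XD + eu -> (be - 1) * (XD + Xp) <= XF + (eD + ep) ->
  Xg <= 4 * XD + 12 * eu + 12 * be ^+ 2 * Xu ->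
  Xq <= 4 * XF + 12 * (eD + ep) + 12 * be ^+ 2 * (XD + Xp) -> eu + eD + ep <= err ->
  Xg <= 32 * XF + 32 * be * err /\ Xu + Xp + Xq <= 40 * be * (XF + err).
Proof.
move=> be2 XD0 Xp0 Xu0 XF0 eu0 ep0 eD0 E1 E3 E2 E4 Ee.
have Y0 : be * (XD + Xp) <= 2 * (XF + (eD + ep)) by nra.
have Y1 : be ^+ 2 * Xu <= be * XD + be * eu by nra.
have Y2 : be ^+ 2 * (XD + Xp) <= 2 * be * (XF + (eD + ep)) by nra.
have Y3 : XD + Xp <= XF + (eD + ep) by nra.
have Y4 : Xu <= XD + eu by nra.
have Y5 : be * (eu + eD + ep) <= be * err by nra.
have Y6 : 0 <= be * eu by nra.
have Y7 : 0 <= be * ep by nra.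
have Y8 : 0 <= be * eD by nra.
have Y9 : 0 <= be * XF by nra.
have Z1 : 2 * XF <= be * XF by nra.
have Z2 : 2 * (eu + eD + ep) <= be * (eu + eD + ep) by nra.
have Z3 : 0 <= be * Xp by nra.
by split; lra.
Qed.

Section classical_carleman.
Context {R : realType} {n N : nat} {c : 'I_n -> 'M[R]_N} (cl : clifford c).
Implicit Types (x : 'rV[R]_n).
Context (xi : 'rV[R]_N) (xi1 : dot xi xi = 1).
Context (u : 'I_n -> 'rV[R]_n -> R) (Du : 'I_n -> 'I_n -> 'rV[R]_n -> R)
  (Hu : 'I_n -> 'I_n -> 'I_n -> 'rV[R]_n -> R) (Tu : 'I_n -> 'I_n -> 'I_n -> 'I_n -> 'rV[R]_n -> R)
  (p : 'rV[R]_n -> R) (Dp : 'I_n -> 'rV[R]_n -> R) (Hp : 'I_n -> 'I_n -> 'rV[R]_n -> R)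
  (F : 'I_n -> 'rV[R]_n -> R).
Hypotheses (u2 : forall i, C2 (u i) (Du i) (Hu i)) (u3 : forall i j, C2 (Du i j) (Hu i j) (Tu i j))
  (p2 : C2 p Dp Hp) (cF : forall i, continuous (F i)).
Context (a b l3 : R) (chi dchi : R -> R).
Hypotheses (a0 : 0 < a) (hchi : radial b chi dchi) (chi0 : forall t, t < a -> chi t = 0)
  (Lg2 : forall t, a <= t <= b -> 2 <= Lg l3 t).
Hypotheses (st : forall x, a <= sq x <= b -> forall i, \sum_l Hu i l l x + F i x + Dp i x = 0)
  (dv : forall x, a <= sq x <= b -> \sum_i Du i i x = 0)
  (ddv : forall x, a <= sq x <= b -> forall l, \sum_i Hu i i l x = 0).

Local Notation wt := (wt l3).
Local Notation L := (Lg l3).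

Lemma expRln2 (s : R) : 0 < s -> expR (ln s) = s.
Proof. by move=> s0; rewrite lnK. Qed.

Lemma wt_la (la ka t : R) : a <= t <= b -> wt (la - 1) ka t ^+ 2 = t * wt la ka t ^+ 2.
Proof.
move=> /(ab_gt0 a0) t0; rewrite /wt -!expRM_natr.
transitivity (expR (ln t) * expR ((- (2^-1 * la) * ln t - ka * ln (L t)) * 2%:R)); last by rewrite expRln2.
by rewrite -expRD; congr expR; field.
Qed.

Lemma wt_ka (la ka t : R) : a <= t <= b -> wt la (ka - 1) t ^+ 2 = L t ^+ 2 * wt la ka t ^+ 2.
Proof.
move=> /(Lg_gt0 Lg2) L0; rewrite /wt -!expRM_natr.
transitivity (expR (ln (L t) * 2%:R) * expR ((- (2^-1 * la) * ln t - ka * ln (L t)) * 2%:R)).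
  by rewrite -expRD; congr expR; ring.
by rewrite expRM_natr expRln2.
Qed.

(** Lowering [la] by 1 multiplies wt^2 by t, lowering [ka] by 1 multiplies it by L^2. So the
    estimate for q at exponents (be - 1, be - 1) controls |D (b u)|^2 + p^2 with weight [t * om],
    which is the weight of |D (b u)|^2 on the right of the estimate for b u at (be, be). *)
Lemma classical_carleman (be : R) : 2 <= be ->
  let om t := wt be be t ^+ 2 in
  let u2s x := \sum_i u i x ^+ 2 in
  let g2s x := \sum_j \sum_i Du i j x ^+ 2 in
  let F2s x := \sum_i F i x ^+ 2 in
  let dp2s x := \sum_i Dp i x ^+ 2 in
  let p2s x := p x ^+ 2 in
  let XF := J chi (fun t => t ^+ 2 * L t ^+ 2 * om t) F2s in
  let err := J dchi (fun t => 4 * t ^+ 2 * om t) u2s +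
    n%:R * J dchi (fun t => 4 * t ^+ 3 * L t ^+ 2 * om t) g2s +
    J dchi (fun t => 4 * t ^+ 3 * L t ^+ 2 * om t) p2s in
  J chi (fun t => t * L t ^- 2 * om t) g2s <= 32 * XF + 32 * be * err /\
  J chi (fun t => L t ^- 2 * om t) u2s + J chi (fun t => t * om t) p2s +
  J chi (fun t => t ^+ 2 * om t) dp2s <= 40 * be * (XF + err).
Proof.
move=> be2 om u2s g2s F2s dp2s p2s XF err.
have bu2 (m : 'I_N) : C2 (bu (c := c) xi u m) (Dbu (c := c) xi Du m) (Hbu (c := c) xi Hu m) by exact: bu_C2.
have qq2 (m : 'I_N) : C2 (qq (c := c) xi Du p m) (Dqq (c := c) xi Hu Dp m) (Hqq (c := c) xi Tu Hp m) by exact: qq_C2.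
have achi := adm_chi hchi chi0; have adchi := adm_dchi hchi chi0.
pose D x := dot (dirac (c := c) (grad (Dbu (c := c) xi Du) x)) (dirac (c := c) (grad (Dbu (c := c) xi Du) x)).
have cu i : continuous (u i) by have [[]] := u2 i.
have cDu i j : continuous (Du i j) by have [[]] := u2 i.
have cp : continuous p by have [[]] := p2.
have cDp i : continuous (Dp i) by have [[]] := p2.
have cu2s : continuous u2s by rewrite /u2s; rv_continuity.
have cg2s : continuous g2s by rewrite /g2s; rv_continuity.
have cF2s : continuous F2s by rewrite /F2s; rv_continuity.
have cdp2s : continuous dp2s by rewrite /dp2s; rv_continuity.
have cp2s : continuous p2s by rewrite /p2s; rv_continuity.
have cD : continuous D by apply: contE; apply: cont_dot => m; exact: cont_dirac bu2 m.
have cV : continuous (fun x => dot (vec (bu (c := c) xi u) x) (vec (bu (c := c) xi u) x)).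
  by apply: contE; apply: cont_dot => m; exact: cont_vec bu2 m.
have cQ : continuous (fun x => dot (vec (qq (c := c) xi Du p) x) (vec (qq (c := c) xi Du p) x)).
  by apply: contE; apply: cont_dot => m; exact: cont_vec qq2 m.
have cDQ : continuous (fun x => dot (dirac (c := c) (grad (Dqq (c := c) xi Hu Dp) x)) (dirac (c := c) (grad (Dqq (c := c) xi Hu Dp) x))).
  by apply: contE; apply: cont_dot => m; exact: cont_dirac qq2 m.
have cGQ : continuous (fun x => \sum_i dot (grad (Dqq (c := c) xi Hu Dp) x i) (grad (Dqq (c := c) xi Hu Dp) x i)).
  by apply: contE; apply: cont_sum => i; apply: cont_dot => m; exact: cont_grad qq2 i m.
have D0 x : 0 <= D x by exact: dot_ge0.
have u2s0 x : 0 <= u2s x by apply: sumr_ge0 => i _; exact: sqr_ge0.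
have g2s0 x : 0 <= g2s x by apply: sumr_ge0 => j _; apply: sumr_ge0 => i _; exact: sqr_ge0.
have F2s0 x : 0 <= F2s x by apply: sumr_ge0 => i _; exact: sqr_ge0.
have p2s0 x : 0 <= p2s x by exact: sqr_ge0.
have Dg x : D x <= n%:R * g2s x.
  by apply: le_trans (dirac_bound cl _) _; rewrite (nsq_grad_bu cl xi1).
have Vu x : dot (vec (bu (c := c) xi u) x) (vec (bu (c := c) xi u) x) = u2s x by exact: nsq_bu.
have Qx x : a <= sq x <= b -> dot (vec (qq (c := c) xi Du p) x) (vec (qq (c := c) xi Du p) x) = D x + p2s x.
  by move=> xS; rewrite (nsq_qq cl xi1)// dv.
have DQx x : a <= sq x <= b -> dot (dirac (c := c) (grad (Dqq (c := c) xi Hu Dp) x)) (dirac (c := c) (grad (Dqq (c := c) xi Hu Dp) x)) = F2s x.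
  by move=> xS; apply: (nsq_dirac_qq cl xi1 u2); exact: st.
have GQx x : a <= sq x <= b -> dp2s x <= \sum_l dot (grad (Dqq (c := c) xi Hu Dp) x l) (grad (Dqq (c := c) xi Hu Dp) x l).
  by move=> xS; apply: (nsq_grad_qq cl xi1); exact: ddv.
have ct : cont_on a b (fun t => t) by exact: cont_on_id.
have cL : cont_on a b L by apply: (cont_on_der (dH := fun t => - (2^-1 * t^-1))) => t tab; exact: der1_Lg tab.
have cLV : cont_on a b (fun t => (L t)^-1) by exact: cont_on_LgV a0 Lg2.
have cw la ka : cont_on a b (wt la ka) by exact: cont_on_wt.
have cX H k : cont_on a b H -> cont_on a b (fun t => H t ^+ k).
  move=> cH; elim: k => [|k IH]; first by under eq_fun do rewrite expr0; exact: cont_on_cst.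
  by under eq_fun do rewrite exprS; exact: cont_onM.
have cLV2 : cont_on a b (fun t => L t ^- 2).
  rewrite (_ : (fun t => _) = (fun t => (L t)^-1 ^+ 2)); first exact: cX.
  by apply/funext => t; rewrite exprVn.
have com : cont_on a b om by exact: cX.
have ck (k : R) : cont_on a b (fun=> k) by exact: cont_on_cst.
have om0 t : 0 <= om t by exact: sqr_ge0.
have L1 t : a <= t <= b -> 1 <= L t ^+ 2 by move=> /Lg2 h; rewrite expr_ge1//; lra.
have LV1 t : a <= t <= b -> L t ^- 2 <= 1.
  by move=> tab; rewrite invf_le1 ?L1// (lt_le_trans _ (L1 t tab)).
have LV0 t : 0 <= L t ^- 2 by rewrite invr_ge0 sqr_ge0.
pose Xu := J chi (fun t => L t ^- 2 * om t) u2s.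
pose Xp := J chi (fun t => t * om t) p2s.
pose XD := J chi (fun t => t * om t) D.
pose Xg := J chi (fun t => t * L t ^- 2 * om t) g2s.
pose Xq := J chi (fun t => t ^+ 2 * om t) dp2s.
pose eu := J dchi (fun t => 4 * t ^+ 2 * om t) u2s.
pose eD := J dchi (fun t => 4 * t ^+ 3 * L t ^+ 2 * om t) D.
pose eg := J dchi (fun t => 4 * t ^+ 3 * L t ^+ 2 * om t) g2s.
pose ep := J dchi (fun t => 4 * t ^+ 3 * L t ^+ 2 * om t) p2s.
have ab0 t : a <= t <= b -> 0 <= t by move=> /(ab_gt0 a0)/ltW.
have cont1 : cont_on a b (fun t => t * om t) by exact: cont_onM.
have cont2 : cont_on a b (fun t => L t ^- 2 * om t) by exact: cont_onM.
have cont3 : cont_on a b (fun t => 4 * t ^+ 3 * L t ^+ 2 * om t) by exact: (cont_onM (cont_onM (cont_onM (ck 4) (cX _ 3%N ct)) (cX _ 2%N cL)) com).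
have cont4 : cont_on a b (fun t => t ^+ 2 * L t ^+ 2 * om t) by exact: (cont_onM (cont_onM (cX _ 2%N ct) (cX _ 2%N cL)) com).
have cont5 : cont_on a b (fun t => t * L t ^- 2 * om t) by exact: (cont_onM (cont_onM ct cLV2) com).
have cont6 : cont_on a b (fun t => 4 * t ^+ 2 * om t) by exact: (cont_onM (cont_onM (ck 4) (cX _ 2%N ct)) com).
have cont7 : cont_on a b (fun t => t ^+ 2 * om t) by exact: (cont_onM (cX _ 2%N ct) com).
have cont8 : cont_on a b (fun t => 4 * t * (t ^+ 2 * om t)) by exact: (cont_onM (cont_onM (ck 4) ct) cont7).
have cont9 : cont_on a b (fun t => 4 * t * (t * L t ^- 2 * om t)) by exact: (cont_onM (cont_onM (ck 4) ct) cont5).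
have pos3 t : a <= t <= b -> 0 <= 4 * t ^+ 3 * L t ^+ 2 * om t.
  move=> tab; apply: mulr_ge0 => //; apply: mulr_ge0; last exact: sqr_ge0.
  by apply: mulr_ge0 => //; apply: exprn_ge0; exact: ab0.
have pos4 t : a <= t <= b -> 0 <= t ^+ 2 * L t ^+ 2 * om t.
  by move=> tab; apply: mulr_ge0 => //; apply: mulr_ge0; exact: sqr_ge0.
have pos6 t : a <= t <= b -> 0 <= 4 * t ^+ 2 * om t.
  by move=> tab; apply: mulr_ge0 => //; apply: mulr_ge0 => //; exact: sqr_ge0.
have eDg : eD <= n%:R * eg.
  rewrite /eg -(J_ZX _ adchi cont3 cg2s); apply: (J_leX adchi cont3) => //; by rv_continuity.
have VE : (fun x => dot (vec (bu (c := c) xi u) x) (vec (bu (c := c) xi u) x)) = u2s by apply/funext.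
have E1 : be * Xu <= XD + eu.
  have H := weighted_carleman cl a0 hchi chi0 Lg2 bu2 be be.
  rewrite VE in H; rewrite /Xu -(J_Z _ achi cont2 cu2s); apply: le_trans (le_trans _ H) _.
    by rewrite le_eqVlt; apply/orP; left; apply/eqP; apply: (J_ext _ achi) => t tab; rewrite /om; ring.
  by [].
have E3 : (be - 1) * (XD + Xp) <= XF + (eD + ep).
  have H := weighted_carleman cl a0 hchi chi0 Lg2 qq2 (be - 1) (be - 1).
  have W t : a <= t <= b -> wt (be - 1) (be - 1) t ^+ 2 = t * (L t ^+ 2 * om t).
    by move=> tab; rewrite wt_la// wt_ka.
  rewrite /XD /Xp /eD /ep -(J_DX achi cont1 cD cp2s) -(J_DX adchi cont3 cD cp2s).
  rewrite -(J_Z _ achi cont1 (continuous_rVD cD cp2s)).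
  rewrite -(J_eqX _ achi Qx) -(J_eqX _ adchi Qx) /XF -(J_eqX _ achi DQx).
  have W1 t : a <= t <= b -> t * wt (be - 1) (be - 1) t ^+ 2 = t ^+ 2 * L t ^+ 2 * om t.
    by move=> tab; rewrite W//; ring.
  have W2 t : a <= t <= b -> 4 * t ^+ 2 * wt (be - 1) (be - 1) t ^+ 2 = 4 * t ^+ 3 * L t ^+ 2 * om t.
    by move=> tab; rewrite W//; ring.
  have W3 t : a <= t <= b -> (be - 1) * wt (be - 1) (be - 1) t ^+ 2 * L t ^- 2 = (be - 1) * (t * om t).
    by move=> tab; rewrite W//; have L0 := Lg_gt0 Lg2 tab; field; exact: lt0r_neq0.
  by rewrite (J_ext _ achi W1) (J_ext _ adchi W2) (J_ext _ achi W3) in H.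
(* Exponents (be - 1, be + 1): the zero-order term, with its factor 1/t, is then the left-hand side
   of [E1]. *)
have E2 : Xg <= 4 * XD + 12 * eu + 12 * be ^+ 2 * Xu.
  have be0 : 0 <= be by lra.
  have W t : a <= t <= b -> wt (be - 1) (be + 1) t ^+ 2 = t * L t ^- 2 * om t.
    move=> tab; rewrite wt_la// -mulrA; congr (_ * _).
    have := wt_ka be (be + 1) tab; rewrite addrK -/(om t) => ->.
    have L0 := lt0r_neq0 (Lg_gt0 Lg2 tab).
    by rewrite mulrA mulVf ?mul1r// expf_neq0.
  have B t : a <= t <= b -> - be <= (be + 1) * (L t)^-1 - (be - 1) <= be.
    move=> tab; have L0 := Lg_gt0 Lg2 tab.
    have h1 : 0 <= (be + 1) * (L t)^-1 by rewrite mulr_ge0 ?invr_ge0 ?ltW//; lra.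
    have h2 : (be + 1) * (L t)^-1 <= (be + 1) / 2.
      by rewrite ler_wpM2l ?lef_pV2 ?posrE ?Lg2//; lra.
    by apply/andP; split; lra.
  have H := weighted_garding cl a0 hchi chi0 Lg2 bu2 be0 B.
  rewrite VE in H.
  have G1 : (fun x => \sum_i dot (grad (Dbu (c := c) xi Du) x i) (grad (Dbu (c := c) xi Du) x i)) = g2s.
    by apply/funext => x; exact: nsq_grad_bu.
  rewrite G1 (J_ext _ achi W) (J_ext (fun x => D x) achi W) in H.
  apply: le_trans H _; apply: lerD; first apply: lerD.
  - rewrite ler_pM2l//; apply: (J_le achi cont5 cont1) => // t tab.
    by rewrite ler_wpM2r// ler_piMr ?LV1 ?ab0.
  - have W9 t : a <= t <= b -> 4 * t * wt (be - 1) (be + 1) t ^+ 2 = 4 * t * (t * L t ^- 2 * om t).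
      by move=> tab; rewrite W.
    rewrite (ler_pM2l (ltr0Sn R 11)) (J_ext _ adchi W9).
    apply: (J_le adchi cont9 cont6) => // t tab.
    rewrite (_ : 4 * t * _ = (4 * t ^+ 2 * om t) * L t ^- 2); last by ring.
    by apply: ler_piMr; [exact: pos6|exact: LV1].
  - apply: ler_wpM2l; first exact: mulr_ge0 (ler0n R 12) (sqr_ge0 be).
    rewrite le_eqVlt; apply/orP; left; apply/eqP.
    apply: (J_ext _ achi) => t tab; rewrite W//; have t0 := lt0r_neq0 (ab_gt0 a0 tab).
    by have L0 := lt0r_neq0 (Lg_gt0 Lg2 tab); field; rewrite t0 L0.
(* Exponents (be - 2, be): the zero-order term is then the one controlled by [E3]. *)
have E4 : Xq <= 4 * XF + 12 * (eD + ep) + 12 * be ^+ 2 * (XD + Xp).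
  have be0 : 0 <= be by lra.
  have W t : a <= t <= b -> wt (be - 1 - 1) be t ^+ 2 = t ^+ 2 * om t.
    by move=> tab; rewrite (wt_la (be - 1) be tab) (wt_la be be tab) mulrA -expr2.
  have B t : a <= t <= b -> - be <= be * (L t)^-1 - (be - 1 - 1) <= be.
    move=> tab; have L0 := Lg_gt0 Lg2 tab.
    have h1 : 0 <= be * (L t)^-1 by rewrite mulr_ge0 ?invr_ge0 ?ltW//; lra.
    have h2 : be * (L t)^-1 <= be / 2.
      by rewrite ler_wpM2l ?lef_pV2 ?posrE ?Lg2//; lra.
    by apply/andP; split; lra.
  have H := weighted_garding cl a0 hchi chi0 Lg2 qq2 be0 B.
  rewrite !(J_ext _ achi W) (J_eqX _ achi DQx) (J_eqX _ adchi Qx) (J_eqX _ achi Qx) in H.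
  apply: le_trans (le_trans _ H) _.
    by apply: (J_leX achi cont7) => // t tab; rewrite mulr_ge0// sqr_ge0.
  apply: lerD; first apply: lerD.
  - rewrite ler_pM2l//; apply: (J_le achi cont7 cont4) => // t tab.
    by rewrite ler_wpM2r// ler_peMr ?L1// sqr_ge0.
  - have W9 t : a <= t <= b -> 4 * t * wt (be - 1 - 1) be t ^+ 2 = 4 * t * (t ^+ 2 * om t).
      by move=> tab; rewrite W.
    rewrite (ler_pM2l (ltr0Sn R 11)) -(J_DX adchi cont3 cD cp2s) (J_ext _ adchi W9).
    apply: (J_le adchi cont8 cont3) => //; [exact: continuous_rVD|by move=> x; rewrite addr_ge0|move=> t tab].
    rewrite (_ : 4 * t * _ = 4 * t ^+ 3 * 1 * om t); last by ring.
    by rewrite ler_wpM2r// ler_wpM2l ?L1// mulr_ge0// exprn_ge0// ab0.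
  - apply: ler_wpM2l; first exact: mulr_ge0 (ler0n R 12) (sqr_ge0 be).
    rewrite -(J_DX achi cont1 cD cp2s) le_eqVlt; apply/orP; left; apply/eqP.
    apply: (J_ext _ achi) => t tab; rewrite W//; have t0 := lt0r_neq0 (ab_gt0 a0 tab).
    by field.
have XD0 : 0 <= XD by apply: (J_ge0 achi) => // t tab; rewrite mulr_ge0// ab0.
have Xp0 : 0 <= Xp by apply: (J_ge0 achi) => // t tab; rewrite mulr_ge0// ab0.
have Xu0 : 0 <= Xu by apply: (J_ge0 achi) => // t tab; rewrite mulr_ge0.
have XF0 : 0 <= XF by apply: (J_ge0 achi).
have eu0 : 0 <= eu by apply: (J_ge0 adchi).
have ep0 : 0 <= ep by apply: (J_ge0 adchi).
have eD0 : 0 <= eD by apply: (J_ge0 adchi).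
have Eerr : err = eu + n%:R * eg + ep by [].
rewrite -/Xg -/Xu -/Xp -/Xq.
have Ee : eu + eD + ep <= err by rewrite Eerr lerD2r lerD2l.
exact: (carleman_absorb be2 XD0 Xp0 Xu0 XF0 eu0 ep0 eD0 E1 E3 E2 E4 Ee).
Qed.

End classical_carleman.

Lemma lin_sum4 (R : realType) (I : finType) (a b c d : R) (f g h k : I -> R) :
  a * (\sum_i f i) + b * (\sum_i g i) + c * (\sum_i h i) + d * (\sum_i k i) =
  \sum_i (a * f i + b * g i + c * h i + d * k i).
Proof. by rewrite !mulr_sumr -!big_split. Qed.

(** * Caccioppoli's inequality *)

Section caccioppoli.
Context {R : realType} {n : nat}.
Local Notation mu := (@lebesgue_rV R n).
Implicit Types (x : 'rV[R]_n).
Context (u : 'I_n -> 'rV[R]_n -> R) (Du : 'I_n -> 'I_n -> 'rV[R]_n -> R)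
  (Hu : 'I_n -> 'I_n -> 'I_n -> 'rV[R]_n -> R)
  (p : 'rV[R]_n -> R) (Dp : 'I_n -> 'rV[R]_n -> R) (Hp : 'I_n -> 'I_n -> 'rV[R]_n -> R)
  (F : 'I_n -> 'rV[R]_n -> R).
Hypotheses (u2 : forall i, C2 (u i) (Du i) (Hu i)) (p2 : C2 p Dp Hp) (cF : forall i, continuous (F i)).
Context (a b : R) (chi dchi : R -> R).
Hypotheses (a0 : 0 < a) (hchi : radial b chi dchi) (chi0 : forall t, t < a -> chi t = 0).
Hypotheses (st : forall x, a <= sq x <= b -> forall i, \sum_l Hu i l l x + F i x + Dp i x = 0)
  (dv : forall x, a <= sq x <= b -> \sum_i Du i i x = 0).

(** The equation is tested with chi^2 u. Because div u = 0, the pressure meets only the gradient of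
    the cut-off, so p itself and not grad p remains on the right. [K] balances the two halves of u .
    F. *)
Lemma caccioppoli (K : R) : 0 < K ->
  J chi (fun=> 1) (fun x => \sum_j \sum_i Du i j x ^+ 2) <=
  24 * J dchi (fun t => t) (fun x => \sum_i u i x ^+ 2) + 2 * J chi (fun=> 1) (fun x => p x ^+ 2) +
  K * J chi (fun t => t^-1) (fun x => \sum_i u i x ^+ 2) + K^-1 * J chi (fun t => t) (fun x => \sum_i F i x ^+ 2).
Proof.
move=> K0; pose u2s x := \sum_i u i x ^+ 2; rewrite -[fun x => \sum_i u i x ^+ 2]/u2s.
have achi := adm_chi hchi chi0; have adchi := adm_dchi hchi chi0.
have cu i : continuous (u i) by have [[]] := u2 i.
have cDu i j : continuous (Du i j) by have [[]] := u2 i.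
have cHu i j l : continuous (Hu i j l) by have [] := u2 i.
have cp : continuous p by have [[]] := p2.
have cDp i : continuous (Dp i) by have [[]] := p2.
have cu2s : continuous u2s by rewrite /u2s; rv_continuity.
have cg2s : continuous (fun x => \sum_j \sum_i Du i j x ^+ 2) by rv_continuity.
have cF2s : continuous (fun x => \sum_i F i x ^+ 2) by rv_continuity.
have cp2s : continuous (fun x => p x ^+ 2) by rv_continuity.
have ck (k : R) : cont_on a b (fun=> k) by exact: cont_on_cst.
have ct : cont_on a b (fun t => t) by exact: cont_on_id.
have ctV : cont_on a b (fun t => t^-1) by exact: cont_on_tV.
have hw2 := radial_sqr hchi.
have Cw := radial_ccf hw2 (n := n); have cw := Cw.1.
have Cc := radial_ccf hchi (n := n); have cc := Cc.1.
have cdw : continuous (fun x : 'rV[R]_n => dchi (sq x)) by apply: continuous_comp_sq; have [] := hchi.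
(* the divergence of chi^2 u_i (grad u_i + p e_i) *)
pose T i j x := 2 * (chi (sq x) * dchi (sq x)) * (2 * x ord0 j) * (u i x * Du i j x) +
  chi (sq x) * chi (sq x) * (Du i j x * Du i j x + u i x * Hu i j j x).
have TP i j : pder j (fun x => chi (sq x) * chi (sq x) * (u i x * Du i j x)) (T i j).
  have [_ _ du ddu _] := u2 i.
  exact: (pderM (radial_pder j hw2) (pderM (du j) (ddu j j))).
have CT0 i j : ccf (fun x => chi (sq x) * chi (sq x) * (u i x * Du i j x)).
  by apply: ccfM; [exact: Cw|rv_continuity].
have cT i j : continuous (T i j) by rewrite /T; rv_continuity.
pose S i x := 2 * (chi (sq x) * dchi (sq x)) * (2 * x ord0 i) * (u i x * p x) +
  chi (sq x) * chi (sq x) * (Du i i x * p x + u i x * Dp i x).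
have SP i : pder i (fun x => chi (sq x) * chi (sq x) * (u i x * p x)) (S i).
  have [_ _ du _ _] := u2 i; have [_ _ dp _ _] := p2.
  exact: (pderM (radial_pder i hw2) (pderM (du i) (dp i))).
have CS0 i : ccf (fun x => chi (sq x) * chi (sq x) * (u i x * p x)).
  by apply: ccfM; [exact: Cw|rv_continuity].
have cS i : continuous (S i) by rewrite /S; rv_continuity.
have CT i j := ccf_pder (TP i j) (CT0 i j) (cT i j).
have CS i := ccf_pder (SP i) (CS0 i) (cS i).
pose W x := \sum_i (\sum_j T i j x + S i x).
have CW : ccf W by apply: ccf_sum => i _; apply: ccfD => //; exact: ccf_sum.
have IW : \int[mu]_x W x = 0.
  rewrite Icc_sum ?big1// => i _; last by apply: ccfD => //; exact: ccf_sum.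
  rewrite IccD ?Icc_sum ?big1 ?add0r//; last exact: ccf_sum.
    exact: Icc_pder (SP i) (CS0 i) (cS i).
  move=> j _; exact: Icc_pder (TP i j) (CT0 i j) (cT i j).
have C1 := J_ccf achi (ck 1) cg2s; have C2' := J_ccf adchi ct cu2s; have C3 := J_ccf achi (ck 1) cp2s.
have C4 := J_ccf achi ctV cu2s; have C5 := J_ccf achi ct cF2s.
rewrite /J -!IccZ//.
rewrite -IccD; [|exact: ccfZ..].
rewrite -IccD; [|by apply: ccfD; exact: ccfZ|exact: ccfZ].
rewrite -IccD; [|by do ! apply: ccfD; exact: ccfZ|exact: ccfZ].
rewrite -[leRHS]addr0 -[X in _ <= _ + X](mulr0 2) -[X in _ <= _ + 2 * X]IW -IccZ// -IccD; last 2 first.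
- by do ! apply: ccfD; exact: ccfZ.
- exact: ccfZ.
apply: Icc_le => //; first by do ! apply: ccfD; exact: ccfZ.
move=> x; have [tab|tout] := in_or_out a b (sq x); last first.
  rewrite achi.2// adchi.2// expr0n/= !(mul0r, mulr0, addr0, add0r) /W big1 ?mulr0// => i _.
  rewrite big1 ?add0r; first by rewrite /S achi.2//; ring.
  by move=> j _; rewrite /T achi.2//; ring.
have s0 := ab_gt0 a0 tab.
have EW : W x = \sum_i (\sum_j (4 * (chi (sq x) * dchi (sq x)) * (x ord0 j * u i x * Du i j x) + chi (sq x) ^+ 2 * Du i j x ^+ 2)
   + (4 * (chi (sq x) * dchi (sq x)) * (x ord0 i * u i x * p x) - chi (sq x) ^+ 2 * (u i x * F i x))).
  transitivity (\sum_i ((\sum_j (4 * (chi (sq x) * dchi (sq x)) * (x ord0 j * u i x * Du i j x) + chi (sq x) ^+ 2 * Du i j x ^+ 2)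
   + (4 * (chi (sq x) * dchi (sq x)) * (x ord0 i * u i x * p x) - chi (sq x) ^+ 2 * (u i x * F i x))) +
     chi (sq x) ^+ 2 * p x * Du i i x)).
    apply: eq_bigr => i _.
    have e1 : \sum_j T i j x = \sum_j (4 * (chi (sq x) * dchi (sq x)) * (x ord0 j * u i x * Du i j x) + chi (sq x) ^+ 2 * Du i j x ^+ 2)
      + chi (sq x) ^+ 2 * u i x * \sum_j Hu i j j x.
      by rewrite mulr_sumr -big_split/=; apply: eq_bigr => j _; rewrite /T; ring.
    have e2 : \sum_j Hu i j j x = - F i x - Dp i x by have := st tab i; lra.
    by rewrite e1 e2 /S; ring.
  by rewrite big_split/= -mulr_sumr dv// mulr0 addr0.
set s := sq x in s0 *; set q := chi s; set r := dchi s.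
have HW : 2^-1 * q ^+ 2 * (\sum_i \sum_j Du i j x ^+ 2) + (- (12 * r ^+ 2 * s) - 2^-1 * K * s^-1 * q ^+ 2) * u2s x +
   (- (s^-1 * q ^+ 2 * p x ^+ 2)) * s + (- (2^-1 * K^-1 * s * q ^+ 2)) * (\sum_i F i x ^+ 2) <= W x.
  apply: (@le_trans _ _ (\sum_i (2^-1 * q ^+ 2 * (\sum_j Du i j x ^+ 2) +
      (- (12 * r ^+ 2 * s) - 2^-1 * K * s^-1 * q ^+ 2) * u i x ^+ 2 +
      (- (s^-1 * q ^+ 2 * p x ^+ 2)) * x ord0 i ^+ 2 + (- (2^-1 * K^-1 * s * q ^+ 2)) * F i x ^+ 2))).
    by rewrite -lin_sum4.
  rewrite EW; apply: ler_sum => i _.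
  rewrite -/s -/q -/r.
  have h1 : 2^-1 * q ^+ 2 * (\sum_j Du i j x ^+ 2) - 8 * r ^+ 2 * u i x ^+ 2 * s <=
     \sum_j (4 * (q * r) * (x ord0 j * u i x * Du i j x) + q ^+ 2 * Du i j x ^+ 2).
    apply: (@le_trans _ _ (\sum_j (2^-1 * q ^+ 2 * Du i j x ^+ 2 + (- (8 * r ^+ 2 * u i x ^+ 2)) * x ord0 j ^+ 2
      + 0 * 0 + 0 * 0))); first by rewrite -lin_sum4 !mul0r !addr0 mulNr.
    apply: ler_sum => j _.
    have := sqr_ge0 (q * Du i j x + 4 * r * x ord0 j * u i x).
    set f := Du i j x; set y := x _ _; set v := u i x; nra.
  have h2 : - (s^-1 * q ^+ 2 * p x ^+ 2 * x ord0 i ^+ 2 + 4 * s * r ^+ 2 * u i x ^+ 2) <=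
     4 * (q * r) * (x ord0 i * u i x * p x).
    rewrite -subr_ge0 (_ : _ - _ = s^-1 * (q * p x * x ord0 i + 2 * s * r * u i x) ^+ 2).
      by rewrite mulr_ge0 ?sqr_ge0// invr_ge0 ltW.
    by field; rewrite lt0r_neq0.
  have h3 : q ^+ 2 * (u i x * F i x) <= q ^+ 2 * (2^-1 * K * s^-1 * u i x ^+ 2 + 2^-1 * K^-1 * s * F i x ^+ 2).
    rewrite ler_wpM2l ?sqr_ge0// -subr_ge0 (_ : _ - _ = 2^-1 * (K * s)^-1 * (K * u i x - s * F i x) ^+ 2).
      by apply: mulr_ge0; [rewrite mulr_ge0// invr_ge0 mulr_ge0 ?ltW|exact: sqr_ge0].
    by field; rewrite !lt0r_neq0.
  by lra.
have E3 : (- (s^-1 * q ^+ 2 * p x ^+ 2)) * s = - (q ^+ 2 * p x ^+ 2) by field; rewrite lt0r_neq0.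
rewrite E3 in HW.
have -> : \sum_j \sum_i Du i j x ^+ 2 = \sum_i \sum_j Du i j x ^+ 2 by exact: exchange_big.
move: HW; rewrite -/(u2s x).
set g2 := \sum_i \sum_j _; set f2 := \sum_i _; set v2 := u2s x.
lra.
Qed.

End caccioppoli.

(** * Passage to the limit in the mollified system *)

Section mollified_system.
Context {R : realType} {n : nat}.
Local Notation mu := (@lebesgue_rV R n).
Implicit Types (x y : 'rV[R]_n) (g : 'I_n -> R -> R) (D G : set 'rV[R]_n).

Definition supp_in (e : R) g := forall i t, e < `|t| -> g i t = 0.

Lemma dker_supp e i g : supp_in e g -> supp_in e (dker i g).
Proof.
move=> ge j t et; rewrite /dker; case: ifP => // _; last exact: ge.
rewrite derive1E -[RHS](derive_cst (0 : R) t (1 : R)); apply: near_eq_derive.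
near=> s; rewrite /= ge//; near: s.
apply: (@cvgr_gt _ _ _ _ (fun s : R => `|s|) `|t|) => //.
by apply: cvg_norm; exact: cvg_id.
Unshelve. all: by end_near. Qed.

Lemma ker_off e g x y : supp_in e g -> ~ (forall i, `|x ord0 i - y ord0 i| <= e) -> ker g (x - y) = 0.
Proof.
move=> ge; apply: contra_notP => /eqP kn0 i; rewrite leNgt; apply/negP => h.
by move/eqP : kn0; apply; rewrite /ker (bigD1 i)//= ge ?mul0r// !mxE.
Qed.

Lemma partial_ker i g x : bumps g ->
  partial i (fun y => ker g (x - y)) = (fun y => - ker (dker i g) (x - y)).
Proof. by move=> bg; apply/funext => y; have [_] := pder_ker_refl i x bg y. Qed.

Lemma laplacian_ker g x y : bumps g ->
  laplacian (fun y => ker g (x - y)) y = \sum_l ker (dker l (dker l g)) (x - y).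
Proof.
move=> bg; apply: eq_bigr => l _.
have [/= -> _] := foldr_partial_ker x [:: l; l] bg.
by rewrite expr2 mulrNN !mul1r.
Qed.

Lemma convol_C2 (f : 'rV[R]_n -> R) g : bumps g -> integr f ->
  C2 (convol f g) (fun i => convol f (dker i g)) (fun i j => convol f (dker j (dker i g))).
Proof.
move=> bg fi; have b1 i := dker_bumps i bg; have b2 i j := dker_bumps j (b1 i).
split=> [|i j|i|i j|i j x].
- by split=> [|i]; exact: continuous_conv.
- exact: continuous_conv.
- exact: pder_conv.
- exact: pder_conv.
- by rewrite dkerC.
Qed.

Context (D G : set 'rV[R]_n) (GD : G `<=` D)
  (U : 'I_n -> 'rV[R]_n -> R) (V : 'I_n -> 'I_n -> 'rV[R]_n -> R) (F : 'I_n -> 'rV[R]_n -> R)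
  (P : 'rV[R]_n -> R) (Q : 'I_n -> 'rV[R]_n -> R).

Definition weak_stokes := forall phi, test_function D phi ->
  [/\ forall i j, \int[mu]_x (\1_D x * (U i x * partial j phi x)) =
             - \int[mu]_x (\1_D x * (V i j x * phi x)),
      forall j, \int[mu]_x (\1_D x * (P x * partial j phi x)) =
             - \int[mu]_x (\1_D x * (Q j x * phi x)),
      forall i, \int[mu]_x (\1_D x * (U i x * laplacian phi x + F i x * phi x - P x * partial i phi x)) = 0 &
      \int[mu]_x (\1_D x * \sum_i U i x * partial i phi x) = 0].

(** Data are replaced by zero off [G], for the sake of integrability; mollification at points well
    inside [G] does not see the change. *)
Definition cut (f : 'rV[R]_n -> R) x := \1_G x * f x.

Hypotheses (HS : weak_stokes) (iU : forall i, integr (cut (U i))) (iV : forall i j, integr (cut (V i j)))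
  (iF : forall i, integr (cut (F i))) (iP : integr (cut P)) (iQ : forall j, integr (cut (Q j))).

Context (e : R) (g : 'I_n -> R -> R) (x : 'rV[R]_n) (bg : bumps g) (ge : supp_in e g)
  (xG : forall y, (forall i, `|x ord0 i - y ord0 i| <= e) -> G y).

Let phi y := ker g (x - y).

Let tphi : test_function D phi.
Proof. by apply: (ker_test_function bg ge) => y /xG /GD. Qed.

Let ker_cut g' (f : 'rV[R]_n -> R) y : supp_in e g' -> \1_D y * (f y * ker g' (x - y)) = cut f y * ker g' (x - y).
Proof.
move=> ge'; have [yG|yG] := pselect (G y).
  by rewrite /cut !indicE (mem_set yG) (mem_set (GD yG)) !mul1r.
by rewrite (ker_off ge') ?mulr0// => /xG.
Qed.

Lemma convolN (f : 'rV[R]_n -> R) g' : bumps g' -> integr f ->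
  - convol f g' x = \int[mu]_y (f y * - ker g' (x - y)).
Proof.
move=> bg' fi; rewrite -mulN1r /convol -RintegralZl//; last exact: convol_integrable.
by apply: eq_Rintegral => y _; rewrite mulN1r mulrN.
Qed.

(** The weak identity tested on the kernel centred at [x]; the sign from differentiating in [y] a
    function of [x - y] compensates the sign of the weak gradient. *)
Lemma moll_grad (f h : 'rV[R]_n -> R) j : integr (cut f) ->
  \int[mu]_y (\1_D y * (f y * partial j phi y)) = - (\int[mu]_y (\1_D y * (h y * phi y))) ->
  convol (cut f) (dker j g) x = convol (cut h) g x.
Proof.
move=> fi; have -> : \int[mu]_y (\1_D y * (h y * phi y)) = convol (cut h) g x.
  by apply: eq_Rintegral => y _; rewrite ker_cut.
have -> : \int[mu]_y (\1_D y * (f y * partial j phi y)) = - convol (cut f) (dker j g) x.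
  rewrite convolN//; last exact: dker_bumps.
  apply: eq_Rintegral => y _; rewrite partial_ker// !mulrN ker_cut//; exact: dker_supp.
by move/oppr_inj.
Qed.

Lemma moll_U i j : convol (cut (U i)) (dker j g) x = convol (cut (V i j)) g x.
Proof. by have [H _ _ _] := HS tphi; exact: moll_grad. Qed.

Lemma moll_P j : convol (cut P) (dker j g) x = convol (cut (Q j)) g x.
Proof. by have [_ H _ _] := HS tphi; exact: moll_grad. Qed.

Lemma Rintegral_sum (I : Type) (s : seq I) (f : I -> 'rV[R]_n -> R) : (forall i, integr (f i)) ->
  \int[mu]_y (\sum_(i <- s) f i y) = \sum_(i <- s) \int[mu]_y f i y /\ integr (fun y => \sum_(i <- s) f i y).
Proof.
move=> fi; elim: s => [|i s [IH1 IH2]].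
  rewrite big_nil -[X in _ = X /\ _](@Icc0 R n); split.
    by apply: eq_Rintegral => y _; rewrite big_nil.
  by under eq_fun do rewrite big_nil; exact: ccf_integr (@ccf0 R n).
rewrite big_cons -IH1; split.
  rewrite -RintegralD//; last exact: fi.
  by apply: eq_Rintegral => y _; rewrite big_cons.
by under eq_fun do rewrite big_cons; apply: integrD.
Qed.

Lemma moll_stokes i :
  \sum_l convol (cut (U i)) (dker l (dker l g)) x + convol (cut (F i)) g x + convol (cut P) (dker i g) x = 0.
Proof.
have [_ _ /(_ i) H _] := HS tphi; rewrite -[RHS]H.
have b1 l := dker_bumps l bg; have b2 l := dker_bumps l (b1 l).
pose f l y := cut (U i) y * ker (dker l (dker l g)) (x - y).
have fi l : integr (f l) by exact: (convol_integrable x (b2 l) (iU i)).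
have [E1 E2] := Rintegral_sum (index_enum 'I_n) fi.
have c1 := convol_integrable x bg (iF i); have c2 := convol_integrable x (b1 i) iP.
rewrite /convol -E1 -RintegralD// -RintegralD//; last exact: integrD.
apply: eq_Rintegral => y _; rewrite laplacian_ker// partial_ker// mulrN opprK.
rewrite !mulrDr !ker_cut//; last exact: dker_supp.
congr (_ + _ + _); rewrite !mulr_sumr; apply: eq_bigr => l _.
by rewrite ker_cut//; do 2! apply: dker_supp.
Qed.

Lemma moll_div : \sum_i convol (cut (U i)) (dker i g) x = 0.
Proof.
have [_ _ _ H] := HS tphi; apply/eqP; rewrite -oppr_eq0 -[X in _ == X]H -sumrN; apply/eqP.
have b1 l := dker_bumps l bg.
under eq_bigr do rewrite convolN//.
pose f l y := cut (U l) y * - ker (dker l g) (x - y).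
have fi l : integr (f l).
  have := integrZ (-1) (convol_integrable x (b1 l) (iU l)).
  by rewrite (_ : (fun y => _) = f l)//; apply/funext => y; rewrite /f mulN1r mulrN.
have [E1 _] := Rintegral_sum (index_enum 'I_n) fi.
rewrite -E1; apply: eq_Rintegral => y _; rewrite mulr_sumr; apply: eq_bigr => l _.
by rewrite partial_ker// /f !mulrN ker_cut//; exact: dker_supp.
Qed.

End mollified_system.

Section J_limit.
Context {R : realType} {n : nat}.
Local Notation mu := (@lebesgue_rV R n).
Context (a b : R).

Lemma J_weight (g H : R -> R) : adm a b g -> cont_on a b H ->
  exists2 C, forall x : 'rV[R]_n, `|g (sq x) ^+ 2 * H (sq x)| <= C &
    measurable_fun [set: 'rV[R]_n] (fun x : 'rV[R]_n => g (sq x) ^+ 2 * H (sq x)).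
Proof.
move=> ag cH; have [ch [M h0]] := J_ccf ag cH (@continuous_rV_cst R n 1).
rewrite (_ : (fun x => _) = (fun x => g (sq x) ^+ 2 * H (sq x) * 1)).
  have [C HC] := cc_bounded ch h0; exists C; last exact: continuous_measurable_rV.
  by move=> x; have := HC x; rewrite mulr1.
by apply/funext => x; rewrite mulr1.
Qed.

Lemma J_integr (I : finType) (g H : R -> R) (f : I -> 'rV[R]_n -> R) : adm a b g -> cont_on a b H ->
  (forall i, sqint (f i)) ->
  integr (fun x => g (sq x) ^+ 2 * H (sq x) * \sum_i f i x ^+ 2) /\
  J g H (fun x => \sum_i f i x ^+ 2) = \sum_i \int[mu]_x (g (sq x) ^+ 2 * H (sq x) * f i x ^+ 2).
Proof.
move=> ag cH sf; have [C HC mw] := J_weight ag cH.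
have fi i : integr (fun x => g (sq x) ^+ 2 * H (sq x) * f i x ^+ 2).
  by apply: (integrM_bounded mw HC); have [] := sf i.
have [E1 E2] := Rintegral_sum (index_enum I) fi.
have E x : g (sq x) ^+ 2 * H (sq x) * (\sum_i f i x ^+ 2) = \sum_i g (sq x) ^+ 2 * H (sq x) * f i x ^+ 2.
  by rewrite mulr_sumr.
split; first by under eq_fun do rewrite E.
by rewrite -E1; apply: eq_Rintegral => x _; rewrite E.
Qed.

(** The weight is bounded, being continuous with compact support, so [moll_quad_cvg] applies term by
    term. *)
Lemma J_cvg (I : finType) (g H : R -> R) (f : I -> 'rV[R]_n -> R) (M : R) : adm a b g -> cont_on a b H ->
  (forall i, sqint (f i)) -> (forall i, vanishes_off M (f i)) ->
  J g H (fun x => \sum_i moll k (f i) x ^+ 2) @[k --> \oo] --> J g H (fun x => \sum_i f i x ^+ 2).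
Proof.
move=> ag cH sf f0; have [C HC mw] := J_weight ag cH.
rewrite (J_integr ag cH sf).2.
have smf k i : sqint (moll k (f i)) by have [] := sqint_moll k (sqint_integr (sf i) (f0 i)) (sf i).
rewrite (_ : (fun k => _) = (fun k => \sum_i \int[mu]_x (g (sq x) ^+ 2 * H (sq x) * moll k (f i) x ^+ 2))).
  elim: (index_enum I) => [|i s IH].
    by under eq_fun do rewrite big_nil; rewrite big_nil; exact: cvg_cst.
  under eq_fun do rewrite big_cons; rewrite big_cons; apply: cvgD => //.
  exact: (moll_quad_cvg (sf i) (f0 i) mw HC).
by apply/funext => k; rewrite (J_integr ag cH (smf k)).2.
Qed.

End J_limit.

Section limit_system.
Context {R : realType} {n : nat}.
Local Notation mu := (@lebesgue_rV R n).
Implicit Types (x y : 'rV[R]_n).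

(** A scale below which mollification on the closed annulus only sees the open one. *)
Lemma annulus_near (g0 a b g1 : R) : 0 <= g0 -> g0 < a -> b < g1 -> 0 < g1 -> exists2 e : R, 0 < e &
  forall x y, a <= sq x <= b -> (forall i, `|x ord0 i - y ord0 i| <= e) -> g0 < sq y < g1.
Proof.
move=> g00 g0a bg1 g10.
pose d := Num.min (a - g0) (g1 - b); pose B := `|b| + 1.
have d0 : 0 < d by rewrite lt_min !subr_gt0 g0a bg1.
have B1 : 1 <= B by rewrite /B; have := normr_ge0 b; lra.
pose N : R := n%:R + 1.
have N0 : 0 < N by rewrite /N ltr_wpDl.
have q0 : 0 < N * (2 * B + 1) by rewrite mulr_gt0//; lra.
pose e := Num.min 1 (d / (N * (2 * B + 1))).
have e0 : 0 < e by rewrite lt_min ltr01 divr_gt0.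
have e1 : e <= 1 by rewrite ge_min lexx.
have ed : e * (N * (2 * B + 1)) <= d by rewrite -ler_pdivlMr// ge_min lexx orbT.
exists e => // x y /andP[ax xb] xy.
have bnd i : `|y ord0 i ^+ 2 - x ord0 i ^+ 2| <= e * (2 * B + 1).
  have xB : `|x ord0 i| <= B.
    have h : `|x ord0 i| ^+ 2 <= b by rewrite real_normK ?num_real//; exact: le_trans (sqr_coord_le x i) xb.
    have := ler_norm b; have := normr_ge0 (x ord0 i); rewrite /B; nra.
  have xyi := xy i.
  have -> : y ord0 i ^+ 2 - x ord0 i ^+ 2 = (y ord0 i - x ord0 i) * (2 * x ord0 i - (x ord0 i - y ord0 i)) by ring.
  rewrite normrM distrC; apply: ler_pM => //.
  apply: le_trans (ler_normB _ _) _; rewrite normrM (ger0_norm (_ : 0 <= 2))//.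
  by apply: lerD; [rewrite ler_pM2l|apply: le_trans xyi e1].
have : `|sq y - sq x| <= e * (2 * B + 1) * n%:R.
  have -> : e * (2 * B + 1) * n%:R = \sum_(i < n) e * (2 * B + 1).
    by rewrite sumr_const card_ord -[RHS]mulr_natr.
  by rewrite /sq -sumrB; apply: le_trans (ler_norm_sum _ _ _) _; apply: ler_sum => i _; exact: bnd.
have : e * (2 * B + 1) * n%:R < d.
  apply: lt_le_trans ed; rewrite -mulrA ltr_pM2l// mulrC ltr_pM2r; last lra.
  by rewrite /N ltrDl.
move=> h1; rewrite ler_norml => /andP[h2 h3].
have [h4 h5] : d <= a - g0 /\ d <= g1 - b by rewrite /d !ge_min !lexx orbT.
by apply/andP; split; lra.
Qed.

Context (D G : set 'rV[R]_n) (GD : G `<=` D)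
  (U : 'I_n -> 'rV[R]_n -> R) (V : 'I_n -> 'I_n -> 'rV[R]_n -> R) (F : 'I_n -> 'rV[R]_n -> R)
  (P : 'rV[R]_n -> R) (Q : 'I_n -> 'rV[R]_n -> R).
Local Notation cutG := (cut G).
Hypotheses (HS : weak_stokes D U V F P Q)
  (sU : forall i, sqint (cutG (U i))) (sV : forall i j, sqint (cutG (V i j)))
  (sF : forall i, sqint (cutG (F i))) (sP : sqint (cutG P)) (sQ : forall j, sqint (cutG (Q j))).
Context (M : R) (GM : G `<=` cube M).
Context (a b : R) (e : R) (e0 : 0 < e)
  (xG : forall x y, a <= sq x <= b -> (forall i, `|x ord0 i - y ord0 i| <= e) -> G y).

Lemma cut_vanishes f : vanishes_off M (cutG f).
Proof. by move=> x xM; rewrite /cut indicE memNset ?mul0r// => /GM. Qed.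

Let iU i : integr (cutG (U i)). Proof. exact: sqint_integr (sU i) (cut_vanishes _). Qed.
Let iV i j : integr (cutG (V i j)). Proof. exact: sqint_integr (sV i j) (cut_vanishes _). Qed.
Let iF i : integr (cutG (F i)). Proof. exact: sqint_integr (sF i) (cut_vanishes _). Qed.
Let iP : integr (cutG P). Proof. exact: sqint_integr sP (cut_vanishes _). Qed.
Let iQ j : integr (cutG (Q j)). Proof. exact: sqint_integr (sQ j) (cut_vanishes _). Qed.

Let mk k := @mker R n k.
Let u k i := convol (cutG (U i)) (mk k).
Let Du k i j := convol (cutG (U i)) (dker j (mk k)).
Let Hu k i j l := convol (cutG (U i)) (dker l (dker j (mk k))).
Let Tu k i j l m := convol (cutG (U i)) (dker m (dker l (dker j (mk k)))).
Let p k := convol (cutG P) (mk k).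
Let Dp k i := convol (cutG P) (dker i (mk k)).
Let Hp k i j := convol (cutG P) (dker j (dker i (mk k))).
Let f k i := convol (cutG (F i)) (mk k).

Let bmk k : bumps (mk k). Proof. exact: mker_bumps. Qed.
Let smk k : supp_in k.+1%:R^-1 (mk k). Proof. by move=> i t; exact: mollifier_supp. Qed.

Let u2 k i : C2 (u k i) (Du k i) (Hu k i). Proof. exact: convol_C2 (bmk k) (iU i). Qed.
Let u3 k i j : C2 (Du k i j) (Hu k i j) (Tu k i j).
Proof. exact: convol_C2 (dker_bumps j (bmk k)) (iU i). Qed.
Let p2 k : C2 (p k) (Dp k) (Hp k). Proof. exact: convol_C2 (bmk k) iP. Qed.
Let cf k i : continuous (f k i). Proof. exact: continuous_conv (bmk k) (iF i). Qed.

Let fine k := k.+1%:R^-1 <= e.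

Let xGk k x : fine k -> a <= sq x <= b -> forall y, (forall i, `|x ord0 i - y ord0 i| <= k.+1%:R^-1) -> G y.
Proof. by move=> ke xab y xy; apply: (xG xab) => i; exact: le_trans (xy i) ke. Qed.

Let st k x : fine k -> a <= sq x <= b -> forall i, \sum_l Hu k i l l x + f k i x + Dp k i x = 0.
Proof. by move=> ke xab i; exact: (moll_stokes GD HS iU iF iP (bmk k) (@smk k) (xGk ke xab) i). Qed.

Let dv k x : fine k -> a <= sq x <= b -> \sum_i Du k i i x = 0.
Proof. by move=> ke xab; exact: (moll_div GD HS iU (bmk k) (@smk k) (xGk ke xab)). Qed.

Let ddv k x : fine k -> a <= sq x <= b -> forall l, \sum_i Hu k i i l x = 0.
Proof.
(* The differentiated constraint is the constraint mollified with the kernel differentiated in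
   direction [l]. *)
move=> ke xab l; rewrite -[RHS](moll_div GD HS iU (dker_bumps l (bmk k)) (dker_supp l (@smk k)) (xGk ke xab)).
by apply: eq_bigr => i _; rewrite /Hu dkerC.
Qed.

Let DuV k x i j : fine k -> a <= sq x <= b -> Du k i j x = moll k (cutG (V i j)) x.
Proof. by move=> ke xab; exact: (moll_U GD HS iU (bmk k) (@smk k) (xGk ke xab) i j). Qed.

Let DpQ k x j : fine k -> a <= sq x <= b -> Dp k j x = moll k (cutG (Q j)) x.
Proof. by move=> ke xab; exact: (moll_P GD HS iP (bmk k) (@smk k) (xGk ke xab) j). Qed.

Let near_fine : \forall k \near \oo, fine k.
Proof.
have := near_infty_natSinv_lt (PosNum e0); apply: filterS => k; exact: ltW.
Qed.

Section terms.
Context (g H : R -> R) (ag : adm a b g) (cH : cont_on a b H).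

Lemma J_cvg_u : J g H (fun x => \sum_i u k i x ^+ 2) @[k --> \oo] --> J g H (fun x => \sum_i cutG (U i) x ^+ 2).
Proof. by apply: (J_cvg ag cH (M := M)) => i; [exact: sU|exact: cut_vanishes]. Qed.

Lemma J_cvg_f : J g H (fun x => \sum_i f k i x ^+ 2) @[k --> \oo] --> J g H (fun x => \sum_i cutG (F i) x ^+ 2).
Proof. by apply: (J_cvg ag cH (M := M)) => i; [exact: sF|exact: cut_vanishes]. Qed.

Lemma J_cvg_p : J g H (fun x => p k x ^+ 2) @[k --> \oo] --> J g H (fun x => cutG P x ^+ 2).
Proof.
have : J g H (fun x => \sum_(i < 1) moll k (cutG P) x ^+ 2) @[k --> \oo] --> J g H (fun x => \sum_(i < 1) cutG P x ^+ 2).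
  by apply: (J_cvg ag cH (M := M) (f := fun=> cutG P)) => i; [exact: sP|exact: cut_vanishes].
have E (h : 'rV[R]_n -> R) : (fun x => \sum_(i < 1) h x ^+ 2) = (fun x => h x ^+ 2).
  by apply/funext => x; rewrite big_ord1.
by rewrite E; under eq_fun do rewrite E.
Qed.

Lemma J_cvg_Dp : J g H (fun x => \sum_i Dp k i x ^+ 2) @[k --> \oo] --> J g H (fun x => \sum_i cutG (Q i) x ^+ 2).
Proof.
have := J_cvg ag cH (M := M) sQ (fun i => cut_vanishes _); apply: cvg_trans.
apply: near_eq_cvg; move: near_fine; apply: filterS => k ke.
by apply: (J_eqX _ ag) => x xab; apply: eq_bigr => i _; rewrite DpQ.
Qed.

(** [Du] differentiates a function that jumps at the boundary of [G], but on the annulus it is the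
    mollification of [V], which converges in L^2. *)
Lemma J_cvg_Du : J g H (fun x => \sum_j \sum_i Du k i j x ^+ 2) @[k --> \oo] -->
  J g H (fun x => \sum_j \sum_i cutG (V i j) x ^+ 2).
Proof.
have := J_cvg ag cH (M := M) (f := fun q : 'I_n * 'I_n => cutG (V q.2 q.1)) (fun q => sV _ _) (fun q => cut_vanishes _).
have E (W : 'I_n -> 'I_n -> 'rV[R]_n -> R) : (fun x => \sum_(q : 'I_n * 'I_n) W q.2 q.1 x ^+ 2) = (fun x => \sum_j \sum_i W i j x ^+ 2).
  by apply/funext => x; rewrite pair_big.
rewrite (E (fun i j => cutG (V i j))).
apply: cvg_trans; apply: near_eq_cvg; move: near_fine; apply: filterS => k ke.
rewrite (E (fun i j => moll k (cutG (V i j)))).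
by apply: (J_eqX _ ag) => x xab; apply: eq_bigr => j _; apply: eq_bigr => i _; rewrite DuV.
Qed.

End terms.

Context (chi dchi : R -> R) (a0 : 0 < a) (hchi : radial b chi dchi) (chi0 : forall t, t < a -> chi t = 0).

Lemma limit_caccioppoli (K : R) : 0 < K ->
  J chi (fun=> 1) (fun x => \sum_j \sum_i cutG (V i j) x ^+ 2) <=
  24 * J dchi (fun t => t) (fun x => \sum_i cutG (U i) x ^+ 2) + 2 * J chi (fun=> 1) (fun x => cutG P x ^+ 2) +
  K * J chi (fun t => t^-1) (fun x => \sum_i cutG (U i) x ^+ 2) +
  K^-1 * J chi (fun t => t) (fun x => \sum_i cutG (F i) x ^+ 2).
Proof.
move=> K0; have achi := adm_chi hchi chi0; have adchi := adm_dchi hchi chi0.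
have ck (k : R) : cont_on a b (fun=> k) by exact: cont_on_cst.
have ct : cont_on a b (fun t => t) by exact: cont_on_id.
have ctV : cont_on a b (fun t => t^-1) by exact: cont_on_tV.
have cZ (l : R) (z : nat -> R) w : z k @[k --> \oo] --> w -> l * z k @[k --> \oo] --> l * w.
  by move=> zw; apply: cvgM => //; exact: cvg_cst.
have RH : 24 * J dchi (fun t => t) (fun x => \sum_i u k i x ^+ 2) + 2 * J chi (fun=> 1) (fun x => p k x ^+ 2) +
  K * J chi (fun t => t^-1) (fun x => \sum_i u k i x ^+ 2) +
  K^-1 * J chi (fun t => t) (fun x => \sum_i f k i x ^+ 2) @[k --> \oo] -->
  24 * J dchi (fun t => t) (fun x => \sum_i cutG (U i) x ^+ 2) + 2 * J chi (fun=> 1) (fun x => cutG P x ^+ 2) +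
  K * J chi (fun t => t^-1) (fun x => \sum_i cutG (U i) x ^+ 2) +
  K^-1 * J chi (fun t => t) (fun x => \sum_i cutG (F i) x ^+ 2).
  apply: cvgD; last exact: cZ (J_cvg_f achi ct).
  apply: cvgD; last exact: cZ (J_cvg_u achi ctV).
  by apply: cvgD; [exact: cZ (J_cvg_u adchi ct)|exact: cZ (J_cvg_p achi (ck 1))].
apply: (ler_cvg_to (J_cvg_Du achi (ck 1)) RH).
move: near_fine; apply: filterS => k ke.
exact: (caccioppoli (u2 k) (p2 k) (@cf k) a0 hchi chi0 (fun x => @st k x ke) (fun x => @dv k x ke) K0).
Qed.

Context (l3 : R) (Lg2 : forall t, a <= t <= b -> 2 <= Lg l3 t).
Local Notation L := (Lg l3).

(** Every fine enough mollification solves the smooth system on the annulus, so [classical_carleman]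
    applies to it. That estimate involves only quantities with a limit in L^2: no second derivative
    of [u] or [p] occurs in it. *)
Lemma limit_carleman (be : R) : 2 <= be ->
  let om t := wt l3 be be t ^+ 2 in
  let u2s x := \sum_i cutG (U i) x ^+ 2 in
  let g2s x := \sum_j \sum_i cutG (V i j) x ^+ 2 in
  let F2s x := \sum_i cutG (F i) x ^+ 2 in
  let dp2s x := \sum_i cutG (Q i) x ^+ 2 in
  let p2s x := cutG P x ^+ 2 in
  let XF := J chi (fun t => t ^+ 2 * L t ^+ 2 * om t) F2s in
  let err := J dchi (fun t => 4 * t ^+ 2 * om t) u2s +
    n%:R * J dchi (fun t => 4 * t ^+ 3 * L t ^+ 2 * om t) g2s +
    J dchi (fun t => 4 * t ^+ 3 * L t ^+ 2 * om t) p2s in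
  J chi (fun t => t * L t ^- 2 * om t) g2s <= 32 * XF + 32 * be * err /\
  J chi (fun t => L t ^- 2 * om t) u2s + J chi (fun t => t * om t) p2s +
  J chi (fun t => t ^+ 2 * om t) dp2s <= 40 * be * (XF + err).
Proof.
move=> be2 om u2s g2s F2s dp2s p2s XF err.
have [N [c [N0 cl]]] := @clifford_exists R n.
pose xi : 'rV[R]_N := delta_mx ord0 (Ordinal N0).
have xi1 : dot xi xi = 1.
  rewrite /dot (bigD1 (Ordinal N0))//= big1 ?addr0 => [|m mN]; rewrite !mxE/=.
    by rewrite mulr1.
  by rewrite (negbTE mN) mulr0.
have achi := adm_chi hchi chi0; have adchi := adm_dchi hchi chi0.
have ct : cont_on a b (fun t => t) by exact: cont_on_id.
have cL : cont_on a b L by apply: (cont_on_der (dH := fun t => - (2^-1 * t^-1))) => t tab; exact: der1_Lg tab.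
have cLV : cont_on a b (fun t => (L t)^-1) by exact: cont_on_LgV a0 Lg2.
have cw : cont_on a b (wt l3 be be) by exact: cont_on_wt.
have cX H k : cont_on a b H -> cont_on a b (fun t => H t ^+ k).
  move=> cH; elim: k => [|k IH]; first by under eq_fun do rewrite expr0; exact: cont_on_cst.
  by under eq_fun do rewrite exprS; exact: cont_onM.
have cLV2 : cont_on a b (fun t => L t ^- 2).
  rewrite (_ : (fun t => _) = (fun t => (L t)^-1 ^+ 2)); first exact: cX.
  by apply/funext => t; rewrite exprVn.
have com : cont_on a b om by exact: cX.
have ck (k : R) : cont_on a b (fun=> k) by exact: cont_on_cst.
have cont1 : cont_on a b (fun t => t * om t) by exact: cont_onM.
have cont2 : cont_on a b (fun t => L t ^- 2 * om t) by exact: cont_onM.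
have cont3 : cont_on a b (fun t => 4 * t ^+ 3 * L t ^+ 2 * om t) by exact: (cont_onM (cont_onM (cont_onM (ck 4) (cX _ 3%N ct)) (cX _ 2%N cL)) com).
have cont4 : cont_on a b (fun t => t ^+ 2 * L t ^+ 2 * om t) by exact: (cont_onM (cont_onM (cX _ 2%N ct) (cX _ 2%N cL)) com).
have cont5 : cont_on a b (fun t => t * L t ^- 2 * om t) by exact: (cont_onM (cont_onM ct cLV2) com).
have cont6 : cont_on a b (fun t => 4 * t ^+ 2 * om t) by exact: (cont_onM (cont_onM (ck 4) (cX _ 2%N ct)) com).
have cont7 : cont_on a b (fun t => t ^+ 2 * om t) by exact: (cont_onM (cX _ 2%N ct) com).
have cZ (l : R) (z : nat -> R) w : z k @[k --> \oo] --> w -> l * z k @[k --> \oo] --> l * w.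
  by move=> zw; apply: cvgM => //; exact: cvg_cst.
pose XFk k := J chi (fun t => t ^+ 2 * L t ^+ 2 * om t) (fun x => \sum_i f k i x ^+ 2).
pose errk k := J dchi (fun t => 4 * t ^+ 2 * om t) (fun x => \sum_i u k i x ^+ 2) +
    n%:R * J dchi (fun t => 4 * t ^+ 3 * L t ^+ 2 * om t) (fun x => \sum_j \sum_i Du k i j x ^+ 2) +
    J dchi (fun t => 4 * t ^+ 3 * L t ^+ 2 * om t) (fun x => p k x ^+ 2).
have HF : XFk k @[k --> \oo] --> XF by exact: J_cvg_f achi cont4.
have HE : errk k @[k --> \oo] --> err.
  apply: cvgD; last exact: J_cvg_p adchi cont3.
  by apply: cvgD; [exact: J_cvg_u adchi cont6|exact: cZ (J_cvg_Du adchi cont3)].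
have CC k (ke : fine k) := classical_carleman cl xi1 (u2 k) (u3 k) (p2 k) (@cf k) a0 hchi chi0 Lg2
  (fun x => @st k x ke) (fun x => @dv k x ke) (fun x => @ddv k x ke) be2.
split.
  have RH : 32 * XFk k + 32 * be * errk k @[k --> \oo] --> 32 * XF + 32 * be * err.
    by apply: cvgD; apply: cZ.
  apply: (ler_cvg_to (J_cvg_Du achi cont5) RH).
  by move: near_fine; apply: filterS => k /CC [].
have RH : 40 * be * (XFk k + errk k) @[k --> \oo] --> 40 * be * (XF + err).
  by apply: cZ; apply: cvgD.
have LH : J chi (fun t => L t ^- 2 * om t) (fun x => \sum_i u k i x ^+ 2) +
  J chi (fun t => t * om t) (fun x => p k x ^+ 2) +
  J chi (fun t => t ^+ 2 * om t) (fun x => \sum_i Dp k i x ^+ 2) @[k --> \oo] -->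
  J chi (fun t => L t ^- 2 * om t) u2s + J chi (fun t => t * om t) p2s +
  J chi (fun t => t ^+ 2 * om t) dp2s.
  apply: cvgD; last exact: J_cvg_Dp achi cont7.
  by apply: cvgD; [exact: J_cvg_u achi cont2|exact: J_cvg_p achi cont1].
apply: (ler_cvg_to LH RH).
by move: near_fine; apply: filterS => k /CC [].
Qed.

End limit_system.

(** * Estimates on annuli *)

Section cutoff.
Context {R : realType}.
Implicit Types t p q : R.

Lemma dstep_out t : t < 0 \/ 1 < t -> (@step R)^`()%classic t = 0.
Proof.
move=> tout; rewrite derive1E.
have [c Hc] : exists c : R, \forall s \near t, step s = c.
  case: tout => [t0|t1].
    by exists 0; near=> s; apply: step0; apply: ltW; near: s; exact: lt_nbhsl.
  by exists 1; near=> s; apply: step1; apply: ltW; near: s; exact: lt_nbhsr.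
by rewrite -[RHS](derive_cst c t (1 : R)); apply: near_eq_derive.
Unshelve. all: by end_near. Qed.

Lemma dstep_bound : exists2 C : R, 0 < C & forall t, `|(@step R)^`()%classic t| <= C.
Proof.
have bd : bumpfun (@step R)^`()%classic.
  split; first exact: smooth1_derive smooth1_step.
  exists 1 => t; rewrite lter_normr => /orP[t1|t1]; apply: dstep_out; [right|left] => //; lra.
have [C HC] := bump_bounded bd.
exists (`|C| + 1); first by have := normr_ge0 C; lra.
by move=> t; apply: le_trans (HC t) _; have := ler_norm C; lra.
Qed.

Definition ramp p q t := step ((q - p)^-1 * t + - ((q - p)^-1 * p)).
Definition dramp p q t := (q - p)^-1 * (@step R)^`()%classic ((q - p)^-1 * t + - ((q - p)^-1 * p)).

Lemma rampE p q t : (q - p)^-1 * t + - ((q - p)^-1 * p) = (t - p) / (q - p).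
Proof. by ring. Qed.

Lemma der1_ramp p q t : der1 (ramp p q) t (dramp p q t).
Proof. by apply: is_derive1_affine; exact: smooth1_is_derive smooth1_step. Qed.

Lemma continuous_dramp p q : continuous (dramp p q).
Proof.
move=> t; apply: cvgM; first exact: cvg_cst.
apply: (@continuous_comp _ _ _ (fun t => (q - p)^-1 * t + - ((q - p)^-1 * p)) (@step R)^`()%classic).
  by apply: cvgD; [apply: cvgM; [exact: cvg_cst|exact: cvg_id]|exact: cvg_cst].
exact: smooth1_continuous (smooth1_derive smooth1_step) _.
Qed.

Lemma ramp0 p q t : p < q -> t <= p -> ramp p q t = 0.
Proof.
move=> pq tp; rewrite /ramp rampE step0// ler_pdivrMr ?subr_gt0// mul0r; lra.
Qed.

Lemma ramp1 p q t : p < q -> q <= t -> ramp p q t = 1.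
Proof.
move=> pq tp; rewrite /ramp rampE step1// ler_pdivlMr ?subr_gt0// mul1r; lra.
Qed.

Lemma dramp_out p q t : p < q -> t < p \/ q < t -> dramp p q t = 0.
Proof.
move=> pq tout; rewrite /dramp rampE dstep_out ?mulr0//.
have qp : 0 < q - p by rewrite subr_gt0.
case: tout => h; [left|right].
  by rewrite ltr_pdivrMr// mul0r; lra.
by rewrite ltr_pdivlMr// mul1r; lra.
Qed.

Lemma ramp_ge0 p q t : 0 <= ramp p q t. Proof. exact: step_ge0. Qed.
Lemma ramp_le1 p q t : ramp p q t <= 1. Proof. exact: step_le1. Qed.

(* Equal to 1 on [p1, q0] and to 0 off [p0, q1]. *)
Definition cutoff p0 p1 q0 q1 t := ramp p0 p1 t * (1 - ramp q0 q1 t).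
Definition dcutoff p0 p1 q0 q1 t := dramp p0 p1 t - dramp q0 q1 t.

Context (p0 p1 q0 q1 : R) (p01 : p0 < p1) (pq : p1 < q0) (q01 : q0 < q1).
Local Notation chi := (cutoff p0 p1 q0 q1).
Local Notation dchi := (dcutoff p0 p1 q0 q1).

Lemma radial_cutoff : radial q1 chi dchi.
Proof.
split=> [t|t|t tq].
- apply: der1_eq.
    apply: is_derive1M (der1_ramp p0 p1 t) (is_derive1D (der1_cst 1 t) _).
    under [X in der1 X]eq_fun do rewrite -mulN1r.
    exact: is_derive1M (der1_cst _ t) (der1_ramp q0 q1 t).
  (* The ramps vary on disjoint intervals, so each derivative is multiplied by 1 wherever it is
     non-zero. *)
  rewrite /dcutoff; have [tq|tq] := leP q0 t.
    have pt : p1 < t by exact: lt_le_trans tq.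
    by rewrite (dramp_out p01 (or_intror pt)) (ramp1 p01 (ltW pt)); ring.
  rewrite (ramp0 q01 (ltW tq)) (dramp_out q01 (or_introl tq)); ring.
- by apply: cvgB; exact: continuous_dramp.
- by rewrite /cutoff (ramp1 (p := q0))// ?subrr ?mulr0//; exact: ltW.
Qed.

Lemma cutoff_lt t : t < p0 -> chi t = 0.
Proof. by move=> tp; rewrite /cutoff ramp0 ?mul0r// ltW. Qed.

Lemma cutoff_ge0 t : 0 <= chi t.
Proof. by rewrite mulr_ge0 ?ramp_ge0// subr_ge0 ramp_le1. Qed.

Lemma cutoff_le1 t : chi t <= 1.
Proof.
have := ramp_ge0 p0 p1 t; have := ramp_le1 p0 p1 t; have := ramp_ge0 q0 q1 t; have := ramp_le1 q0 q1 t.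
rewrite /cutoff; nra.
Qed.

Lemma cutoff1 t : p1 <= t <= q0 -> chi t = 1.
Proof. by move=> /andP[h1 h2]; rewrite /cutoff ramp1// ramp0// subr0 mulr1. Qed.

Lemma dcutoff_bound (C : R) t : (forall t, `|(@step R)^`()%classic t| <= C) ->
  `|dchi t| <= C / (p1 - p0) * \1_`[p0, p1]%classic t + C / (q1 - q0) * \1_`[q0, q1]%classic t.
Proof.
move=> HC; have C0 : 0 <= C by apply: le_trans (HC 0).
have B p q : p < q -> `|dramp p q t| <= C / (q - p) * \1_`[p, q]%classic t.
  move=> ltpq; rewrite indicE; have [tpq|tpq] := boolP (t \in `[p, q]%classic).
    have qp : 0 <= (q - p)^-1 by rewrite invr_ge0 subr_ge0 ltW.
    by rewrite mulr1 /dramp normrM (ger0_norm qp) mulrC ler_wpM2r.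
  rewrite mulr0 dramp_out ?normr0//.
  move: tpq; rewrite notin_setE/= in_itv/= => /negP; rewrite negb_and -!ltNge => /orP[h|h]; [left|right] => //.
by apply: le_trans (ler_normB _ _) _; apply: lerD; exact: B.
Qed.

End cutoff.

(** * Elementary inequalities for the weights *)

Section log_bounds.
Context {R : realType}.

Lemma ln_diff (x y : R) : 0 < x -> x <= y -> ln y - ln x <= (y - x) / x.
Proof.
move=> x0 xy; have y0 : 0 < y by exact: lt_le_trans xy.
have -> : ln y - ln x = ln (1 + (y - x) / x).
  rewrite (_ : 1 + (y - x) / x = y / x); last by field; exact: lt0r_neq0.
  by rewrite ln_div.
apply: le_ln1Dx; apply: (@lt_le_trans _ _ 0) => //.
by apply: divr_ge0; [rewrite subr_ge0|exact: ltW].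
Qed.

(** The exponent of e^L / L increases with L >= 1, so on a layer this factor is largest at the inner
    radius. *)
Lemma sub_ln_homo (x y : R) : 1 <= x -> x <= y -> x - ln x <= y - ln y.
Proof.
move=> x1 xy; have x0 : 0 < x by lra.
have := ln_diff x0 xy.
have : (y - x) / x <= y - x by rewrite ler_pdivrMr// ler_peMr// subr_ge0.
lra.
Qed.

Lemma two_le_gt0 (y : R) : 2 <= y -> 0 < y. Proof. by move=> ?; lra. Qed.

Lemma sqr_ge1 (y : R) : 2 <= y -> 1 <= y ^+ 2.
Proof. by move=> y2; rewrite expr_ge1//; lra. Qed.

Lemma invr_sqr_le1 (y : R) : 2 <= y -> y ^- 2 <= 1.
Proof. by move=> y2; rewrite invf_le1 ?sqr_ge1// exprn_gt0// two_le_gt0. Qed.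

Lemma ler_sqr2 (y w : R) : 2 <= y -> y <= w -> y ^+ 2 <= w ^+ 2.
Proof. by move=> y2 yw; rewrite lerXn2r ?nnegrE//; lra. Qed.

(** The logarithm of the expression has derivative 2 be - (2 be + 2) / u >= be - 1 for u >= 2. Hence
    the weight of |u|^2 in the Carleman estimate is smallest at the outer radius. *)
Lemma weight_homo (be l u v : R) : 2 <= be -> 2 <= u -> u <= v ->
  u ^- 2 * expR (2 * be * (u - l - ln u)) <= v ^- 2 * expR (2 * be * (v - l - ln v)).
Proof.
move=> be2 u2 uv; have u0 : 0 < u by lra.
have v0 : 0 < v by lra.
have ex (y w : R) : 0 < y -> y ^- 2 * expR w = expR (w - 2 * ln y).
  by move=> y0; rewrite expRD mulrC; congr (_ * _); rewrite -{1}(lnK y0) -expRM_natr -expRN; congr expR; ring.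
rewrite !ex// ler_expR.
have d1 := ln_diff u0 uv.
have d2 : (v - u) / u <= (v - u) / 2 by apply: ler_wpM2l; [rewrite subr_ge0|rewrite lef_pV2 ?posrE].
nra.
Qed.

Lemma nested_intervals (A B b2 g0 g1 : R) : 0 < A -> g0 < A / 4 -> 9 * B < g1 -> 4 * A < B ->
  4 * A <= b2 -> b2 <= B ->
  [/\ [/\ 0 < B, 0 < b2, A < 4 * A & B < 4 * B], [/\ 9 * A < g1, g0 < B / 4, g0 < A & 4 * B < g1],
    [/\ A <= b2 <= 4 * B, forall t, 4 * A <= t -> t <= b2 -> A <= t <= 4 * B &
        forall t, A <= t <= 4 * B -> g0 < t < g1] &
    [/\ forall t, A <= t <= 4 * A -> A <= t <= 4 * B, forall t, B <= t <= 4 * B -> A <= t <= 4 * B &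
        forall t, A <= t <= 4 * A -> (B <= t <= 4 * B) = false]].
Proof.
move=> A0 hg0 hg1 AB Ab2 b2B; split; split; try lra.
- by move=> t t1 t2; apply/andP; split; lra.
- by move=> t /andP[t1 t2]; apply/andP; split; lra.
- by move=> t /andP[t1 t2]; apply/andP; split; lra.
- by move=> t /andP[t1 t2]; apply/andP; split; lra.
- by move=> t /andP[t1 t2]; apply/negbTE; rewrite negb_and -ltNge; apply/orP; left; lra.
Qed.

Lemma potential_small (C0 L0 y : R) : 2 <= L0 -> 64 * C0 ^+ 2 <= L0 ^+ 2 -> L0 <= y -> C0 ^+ 2 * y ^- 2 <= 64^-1.
Proof.
move=> h2 h1 y0; have h3 : L0 ^+ 2 <= y ^+ 2 by exact: ler_sqr2.
by rewrite ler_pdivrMr ?exprn_gt0//; lra.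
Qed.

Lemma sqr_le_2sqr (y C : R) : 0 <= C -> `|y| <= 4 / 3 * C -> y ^+ 2 <= 2 * C ^+ 2.
Proof. by move=> C0; rewrite -real_normK ?num_real//; have := normr_ge0 y; nra. Qed.

(** Absorption of the drift: 64 f <= g <= 32 f + 32 be er leaves f <= be er. *)
Lemma absorb_error (be f g er q : R) : 2 <= be -> g <= 32 * f + 32 * be * er -> f <= 64^-1 * g ->
  q <= 40 * be * (f + er) -> 0 <= g -> [/\ f <= be * er, 0 <= er & q <= 80 * be ^+ 2 * er].
Proof.
move=> be2 h1 h2 h3 h4; have h5 : f <= be * er by lra.
have h6 : 0 <= be * er by lra.
have h7 : 0 <= er by move: h6; rewrite pmulr_rge0//; lra.
by split=> //; apply: le_trans h3 _; nra.
Qed.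

Lemma Lg_homo (l3 s t : R) : 0 < s -> s <= t -> Lg l3 t <= Lg l3 s.
Proof.
move=> s0 st; rewrite /Lg lerD2l lerN2 ler_pM2l ?invr_gt0// ler_ln ?posrE//.
exact: lt_le_trans st.
Qed.

Lemma wt_sqr (l3 be t : R) : wt l3 be be t ^+ 2 = expR (2 * be * (Lg l3 t - l3 - ln (Lg l3 t))).
Proof. by rewrite /wt -expRM_natr; congr expR; rewrite /Lg; field. Qed.

End log_bounds.

Section annuli.
Context {R : realType} {n : nat}.
Local Notation mu := (@lebesgue_rV R n).
Implicit Types (x y : 'rV[R]_n).

Definition annulus (lo hi : R) : set 'rV[R]_n := [set x | lo < sq x < hi].
Definition cannulus (lo hi : R) : set 'rV[R]_n := [set x | lo <= sq x <= hi].

Lemma measurable_cannulus lo hi : measurable (cannulus lo hi).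
Proof.
rewrite -[X in measurable X]setTI.
have := @measurable_sq R n measurableT `[lo, hi]%classic (measurable_itv `[lo, hi]).
by rewrite (_ : sq @^-1` _ = cannulus lo hi)//; apply/seteqP; split=> x; rewrite /= in_itv.
Qed.

Lemma measurable_annulus lo hi : measurable (annulus lo hi).
Proof.
rewrite -[X in measurable X]setTI.
have := @measurable_sq R n measurableT `]lo, hi[%classic (measurable_itv `]lo, hi[).
by rewrite (_ : sq @^-1` _ = annulus lo hi)//; apply/seteqP; split=> x; rewrite /= in_itv.
Qed.

Context (g0 g1 : R) (g00 : 0 <= g0) (g10 : 0 < g1).
Local Notation G := (annulus g0 g1).
Context (D : set 'rV[R]_n) (GD : G `<=` D)
  (U : 'I_n -> 'rV[R]_n -> R) (V : 'I_n -> 'I_n -> 'rV[R]_n -> R) (F : 'I_n -> 'rV[R]_n -> R)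
  (P : 'rV[R]_n -> R) (Q : 'I_n -> 'rV[R]_n -> R).
Local Notation cutG := (cut G).
Hypotheses (HS : weak_stokes D U V F P Q)
  (sU : forall i, sqint (cutG (U i))) (sV : forall i j, sqint (cutG (V i j)))
  (sF : forall i, sqint (cutG (F i))) (sP : sqint (cutG P)) (sQ : forall j, sqint (cutG (Q j))).
Context (l3 L0 C0 : R) (C00 : 0 < C0) (L02 : 2 <= L0) (L0C : 64 * C0 ^+ 2 <= L0 ^+ 2)
  (LG : forall t, g0 < t < g1 -> L0 <= Lg l3 t)
  (HF : forall x, G x -> \sum_i F i x ^+ 2 <=
     C0 ^+ 2 * (Lg l3 (sq x)) ^- 6 * (sq x)^-1 * \sum_j \sum_i V i j x ^+ 2).
Context (Cs : R) (Cs0 : 0 < Cs) (HCs : forall t, `|(@step R)^`()%classic t| <= Cs).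
Local Notation L := (Lg l3).

Let GM : G `<=` cube (g1 + 1).
Proof.
have h1 : 0 <= g1 + 1 by rewrite addr_ge0// ltW.
move=> x /andP[_ h]; apply: sq_cube => //.
by apply: (le_trans (ltW h)); have := ltW g10; nra.
Qed.

Let u2 x := \sum_i cutG (U i) x ^+ 2.
Let g2 x := \sum_j \sum_i cutG (V i j) x ^+ 2.
Let F2 x := \sum_i cutG (F i) x ^+ 2.
Let p2 x := cutG P x ^+ 2.
Let q2 x := \sum_i cutG (Q i) x ^+ 2.

Let u20 x : 0 <= u2 x. Proof. by apply: sumr_ge0 => i _; exact: sqr_ge0. Qed.
Let g20 x : 0 <= g2 x. Proof. by apply: sumr_ge0 => j _; apply: sumr_ge0 => i _; exact: sqr_ge0. Qed.
Let p20 x : 0 <= p2 x. Proof. exact: sqr_ge0. Qed.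
Let q20 x : 0 <= q2 x. Proof. by apply: sumr_ge0 => i _; exact: sqr_ge0. Qed.
Let F20 x : 0 <= F2 x. Proof. by apply: sumr_ge0 => i _; exact: sqr_ge0. Qed.
Let iu2 : integr u2. Proof. by have [_ ] := Rintegral_sum (index_enum 'I_n) (fun i => (sU i).2). Qed.
Let iF2 : integr F2. Proof. by have [_ ] := Rintegral_sum (index_enum 'I_n) (fun i => (sF i).2). Qed.
Let iq2 : integr q2. Proof. by have [_ ] := Rintegral_sum (index_enum 'I_n) (fun i => (sQ i).2). Qed.
Let ip2 : integr p2. Proof. exact: sP.2. Qed.
Let ig2 : integr g2.
Proof.
have h j : integr (fun x => \sum_i cutG (V i j) x ^+ 2).
  by have [_ ] := Rintegral_sum (index_enum 'I_n) (fun i => (sV i j).2).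
by have [_] := Rintegral_sum (index_enum 'I_n) h.
Qed.

Let HF2 x : G x -> F2 x <= C0 ^+ 2 * (L (sq x)) ^- 6 * (sq x)^-1 * g2 x.
Proof.
move=> Gx; have cE f : cutG f x = f x by rewrite /cut indicE (mem_set Gx) mul1r.
rewrite /F2 /g2; under eq_bigr do rewrite cE.
by under [in leRHS]eq_bigr do under eq_bigr do rewrite cE; exact: HF.
Qed.

Lemma weight_integr a b (g H : R -> R) h : adm a b g -> cont_on a b H -> integr h ->
  integr (fun x => g (sq x) ^+ 2 * H (sq x) * h x).
Proof.
by move=> ag cH ih; have [C HC mw] := J_weight (n := n) ag cH; exact: integrM_bounded mw HC ih.
Qed.

Lemma sq_integr lo hi h : integr h -> integr (fun x => \1_(cannulus lo hi) x * (sq x * h x)).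
Proof.
move=> ih.
have : integr (fun x => (\1_(cannulus lo hi) x * sq x) * h x).
  apply: (@integrM_bounded _ _ _ _ (`|hi|)) => //.
    by apply: measurable_funM; [apply: measurable_indic; exact: measurable_cannulus|exact: measurable_sq].
  move=> x; rewrite indicE; have [/set_mem /andP[_ h1]|_] := boolP (x \in _); last by rewrite mul0r normr0.
  by rewrite mul1r ger0_norm ?sq_ge0//; apply: le_trans h1 _; exact: ler_norm.
by under eq_fun do rewrite -mulrA.
Qed.

Lemma ind_integr lo hi h : integr h -> integr (fun x => \1_(cannulus lo hi) x * h x).
Proof.
move=> ih; apply: (@integrM_bounded _ _ _ _ 1) => //.
  by apply: measurable_indic; exact: measurable_cannulus.
by move=> x; rewrite indicE; case: (_ \in _); rewrite ?normr1 ?normr0.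
Qed.

(** 48 * 36 Cs^2 from the slope of the cut-off, 4 * 4 from the pressure, and 2 C0^2 * 4 from the
    choice K = C0^2 in [limit_caccioppoli]. *)
Definition Cacc := 1728 * Cs ^+ 2 + 16 + 8 * C0 ^+ 2.

(** With K = C0^2 the drift contributes C0^-2 |x|^2 |F|^2 <= L^-6 |grad u|^2, at most half of the
    left-hand side since L >= 2. The cut-off has slope O(1/A) in |x|^2 and lives where |x|^2 <= 9 A,
    which gives the scaling. *)
Lemma caccioppoli_annulus (al : R) : 0 < al -> g0 < al ^+ 2 / 4 -> 9 * al ^+ 2 < g1 ->
  al ^+ 2 * \int[mu]_x (\1_(cannulus (al ^+ 2) (4 * al ^+ 2)) x * g2 x) <=
  Cacc * \int[mu]_x (\1_(cannulus (al ^+ 2 / 4) (9 * al ^+ 2)) x * (u2 x + sq x * p2 x)).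
Proof.
move=> al0 hg0 hg1; set A := al ^+ 2 in hg0 hg1 *.
have A0 : 0 < A by rewrite exprn_gt0.
have p01 : A / 4 < A by lra.
have inG (t : R) : A / 4 <= t <= 9 * A -> g0 < t < g1 by move=> /andP[t1 t2]; apply/andP; split; lra.
have e1 : Cs / (A - A / 4) = 4 / 3 * (Cs / A) by field; rewrite lt0r_neq0//; lra.
have e2 : Cs / (9 * A - 4 * A) = 5^-1 * (Cs / A) by field; rewrite lt0r_neq0//; lra.
have slopes (y : R) (b1 b2 : bool) : 0 <= y -> 4 / 3 * y * b1%:R + 5^-1 * y * b2%:R <= 2 * y.
  by case: b1; case: b2 => /=; lra.
have cut_le (w s : R) : w <= 1 -> A / 4 <= s -> A * w <= 4 * s by move=> w1 s1; nra.
have L6 (y : R) : L0 <= y -> y ^- 6 <= 2^-1.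
  have h2 := L02 => hy; have y0 : 0 < y by lra.
  rewrite lef_pV2 ?posrE ?exprn_gt0//; apply: (@le_trans _ _ (2 ^+ 6)); first by rewrite -natrX ler_nat.
  by rewrite lerXn2r ?nnegrE//; lra.
have Cacc_gt0 : 0 <= Cacc by rewrite /Cacc; have := sqr_ge0 Cs; have := sqr_ge0 C0; lra.
have pq : A < 4 * A by lra.
have q01 : 4 * A < 9 * A by lra.
pose z := cutoff (A / 4) A (4 * A) (9 * A); pose dz := dcutoff (A / 4) A (4 * A) (9 * A).
have hz : radial (9 * A) z dz by exact: radial_cutoff.
have z0 t : t < A / 4 -> z t = 0 by exact: cutoff_lt.
have a0 : 0 < A / 4 by lra.
have az := adm_chi hz z0; have adz := adm_dchi hz z0.
have [e e0 xG] := annulus_near g00 hg0 hg1 g10 (n := n).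
have K0 : 0 < C0 ^+ 2 by rewrite exprn_gt0.
have H := limit_caccioppoli GD HS sU sV sF sP GM e0 xG a0 hz z0 K0.
rewrite -/u2 -/g2 -/F2 -/p2 in H.
have ck (k : R) : cont_on (A / 4) (9 * A) (fun=> k) by exact: cont_on_cst.
have ct : cont_on (A / 4) (9 * A) (fun t => t) by exact: cont_on_id.
have ctV : cont_on (A / 4) (9 * A) (fun t => t^-1) by exact: cont_on_tV.
have E1 : (C0 ^+ 2)^-1 * J z (fun t => t) F2 <= 2^-1 * J z (fun=> 1) g2.
  have w1 := weight_integr az ct iF2; have w2 := weight_integr az (ck 1) ig2.
  rewrite /J -!RintegralZl//; apply: le_Rintegral => //; [exact: integrZ|exact: integrZ|] => x _.
  have [tab|tout] := in_or_out (A / 4) (9 * A) (sq x); last by rewrite az.2// expr0n !mul0r !mulr0.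
  have Gx : G x by exact: inG.
  have t0 := ab_gt0 a0 tab.
  have LL : L0 <= L (sq x) by exact: LG.
  have L6x := L6 _ LL.
  have F2' : sq x * F2 x <= C0 ^+ 2 * 2^-1 * g2 x.
    apply: (@le_trans _ _ (C0 ^+ 2 * (L (sq x)) ^- 6 * g2 x)).
      rewrite [leRHS](_ : _ = sq x * (C0 ^+ 2 * (L (sq x)) ^- 6 * (sq x)^-1 * g2 x)).
        by apply: ler_wpM2l; [exact: ltW|exact: HF2].
      by set l6 := _ ^- 6; field; exact: lt0r_neq0.
    by apply: ler_wpM2r => //; apply: ler_wpM2l => //; exact: ltW.
  have := ler_wpM2l (sqr_ge0 (z (sq x))) F2'.
  rewrite -(ler_pM2l (x := (C0 ^+ 2)^-1)) ?invr_gt0// => h.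
  apply: le_trans (le_trans _ h) _; first by rewrite le_eqVlt; apply/orP; left; apply/eqP; ring.
  by rewrite le_eqVlt; apply/orP; left; apply/eqP; field; exact: lt0r_neq0.
have E2 : J z (fun=> 1) g2 <= 48 * J dz (fun t => t) u2 + 4 * J z (fun=> 1) p2 + 2 * C0 ^+ 2 * J z (fun t => t^-1) u2.
  lra.
apply: (@le_trans _ _ (A * J z (fun=> 1) g2)).
  rewrite ler_pM2l//; apply: le_Rintegral => //; [exact: ind_integr|exact: weight_integr az (ck 1) ig2|] => x _.
  rewrite indicE; have [/set_mem h|_] := boolP (x \in _); last first.
    by rewrite mul0r mulr1; apply: mulr_ge0 => //; exact: sqr_ge0.
  by rewrite /z cutoff1// expr1n mulr1.
apply: le_trans (ler_wpM2l (ltW A0) E2) _.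
have w1 := weight_integr adz ct iu2; have w2 := weight_integr az (ck 1) ip2; have w3 := weight_integr az ctV iu2.
have i1 := ind_integr (A / 4) (9 * A) iu2; have i2 := sq_integr (A / 4) (9 * A) ip2.
have i3 : integr (fun x => \1_(cannulus (A / 4) (9 * A)) x * (u2 x + sq x * p2 x)).
  by under eq_fun do rewrite mulrDr; exact: integrD.
rewrite /J -!RintegralZl//.
rewrite -RintegralD//; [|exact: integrZ|exact: integrZ].
rewrite -RintegralD//; [|by apply: integrD; exact: integrZ|exact: integrZ].
have i4 : integr (fun x => 48 * (dz (sq x) ^+ 2 * sq x * u2 x) + 4 * (z (sq x) ^+ 2 * 1 * p2 x) +
    2 * C0 ^+ 2 * (z (sq x) ^+ 2 * (sq x)^-1 * u2 x)).
  by apply: integrD; [apply: integrD|]; exact: integrZ.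
rewrite -[X in X <= _](RintegralZl _ measurableT i4).
apply: le_Rintegral => //; [exact: integrZ|exact: integrZ|] => x _.
have [tab|tout] := in_or_out (A / 4) (9 * A) (sq x); last first.
  rewrite az.2// adz.2// expr0n/= !mul0r !mulr0 !addr0 mulr0.
  apply: mulr_ge0 => //.
  by apply: mulr_ge0 => //; apply: addr_ge0 => //; apply: mulr_ge0 => //; exact: sq_ge0.
rewrite indicE mem_set// mul1r; have t0 := ab_gt0 a0 tab; move: (tab) => /andP[t1 t2].
set s := sq x in t0 t1 t2 tab *.
have d1 : `|dz s| <= 2 * Cs / A.
  apply: le_trans (dcutoff_bound p01 q01 s HCs) _; rewrite !indicE.
  by rewrite e1 e2 -[2 * Cs / A]mulrA; apply: slopes; apply: divr_ge0; exact: ltW.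
have d2 : A * (dz s ^+ 2 * s) <= 36 * Cs ^+ 2.
  have d3 : dz s ^+ 2 <= (2 * Cs / A) ^+ 2.
    by rewrite -real_normK ?num_real// lerXn2r ?nnegrE//; apply: divr_ge0; [rewrite mulr_ge0// ltW|exact: ltW].
  apply: (@le_trans _ _ (A * ((2 * Cs / A) ^+ 2 * (9 * A)))).
    by rewrite ler_pM2l//; apply: ler_pM => //; [exact: sqr_ge0|exact: ltW].
  by rewrite le_eqVlt; apply/orP; left; apply/eqP; field; exact: lt0r_neq0.
have z1 : z s ^+ 2 <= 1 by rewrite expr_le1// ?cutoff_ge0// cutoff_le1.
have zp := sqr_ge0 (z s).
have z3 : A * z s ^+ 2 <= 4 * s by exact: cut_le.
have z2 : A * (z s ^+ 2 * s^-1) <= 4 by rewrite mulrA ler_pdivrMr.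
have := u20 x; have := p20 x; set U2 := u2 x; set P2 := p2 x => P20 U20.
rewrite /Cacc.
have k1 := ler_wpM2r U20 d2; have k2 := ler_wpM2r U20 z2; have k3 := ler_wpM2r P20 z3.
have k2' := ler_wpM2l (ltW K0) k2.
have k4 : 0 <= s * P2 by rewrite mulr_ge0// ltW.
have k5 : 0 <= Cs ^+ 2 * (s * P2) by rewrite mulr_ge0// sqr_ge0.
have k6 : 0 <= C0 ^+ 2 * (s * P2) by rewrite mulr_ge0// ltW.
lra.
Qed.

Definition energy x := u2 x + sq x * p2 x + sq x ^+ 2 * q2 x.

(** Without grad p, which does not occur in the cut-off terms of [limit_carleman]. *)
Definition lower_energy lo hi := \int[mu]_x (\1_(cannulus lo hi) x * (u2 x + sq x * p2 x)).

(** The gradient on a layer where a cut-off varies is traded, by Caccioppoli's inequality, for u and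
    p on a wider annulus. *)
Lemma annulus_error (C : R) : 0 < C -> g0 < C / 4 -> 9 * C < g1 ->
  \int[mu]_x (\1_(cannulus C (4 * C)) x * (u2 x + 4 * n%:R * C * g2 x + sq x * p2 x)) <=
  (1 + 4 * n%:R * Cacc) * lower_energy (C / 4) (9 * C).
Proof.
move=> C0' hC1 hC2.
have wideC (t : R) : C <= t -> t <= 4 * C -> C / 4 <= t <= 9 * C by move=> t1 t2; apply/andP; split; lra.
have i1 := ind_integr C (4 * C) iu2; have i2 := sq_integr C (4 * C) ip2; have i3 := ind_integr C (4 * C) ig2.
have i4 : integr (fun x => \1_(cannulus C (4 * C)) x * (u2 x + sq x * p2 x)).
  by under eq_fun do rewrite mulrDr; exact: integrD.
have i5 : integr (fun x => \1_(cannulus (C / 4) (9 * C)) x * (u2 x + sq x * p2 x)).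
  by under eq_fun do rewrite mulrDr; apply: integrD; [exact: ind_integr|exact: sq_integr].
have -> : \int[mu]_x (\1_(cannulus C (4 * C)) x * (u2 x + 4 * n%:R * C * g2 x + sq x * p2 x)) =
   \int[mu]_x (\1_(cannulus C (4 * C)) x * (u2 x + sq x * p2 x)) + 4 * n%:R * (C * \int[mu]_x (\1_(cannulus C (4 * C)) x * g2 x)).
  rewrite -!RintegralZl//; last exact: integrZ.
  rewrite -RintegralD//; last by do 2! apply: integrZ.
  by apply: eq_Rintegral => x _; ring.
have h1 : \int[mu]_x (\1_(cannulus C (4 * C)) x * (u2 x + sq x * p2 x)) <= lower_energy (C / 4) (9 * C).
  apply: le_Rintegral => // x _; apply: ler_wpM2r.
    by apply: addr_ge0 => //; apply: mulr_ge0 => //; exact: sq_ge0.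
  rewrite !indicE; have [/set_mem/andP[t1 t2]|_] := boolP (x \in cannulus C _) => //.
  by rewrite mem_set//; exact: wideC.
(* [caccioppoli_annulus] is stated in terms of a radius, whereas [C] is a value of |x|^2. *)
have sC0 : 0 < Num.sqrt C by rewrite sqrtr_gt0.
have := caccioppoli_annulus sC0; rewrite (sqr_sqrtr (ltW C0')) => /(_ hC1 hC2) h2.
have h3 : 0 <= 4 * n%:R :> R by apply: mulr_ge0.
have := ler_wpM2l h3 h2; rewrite -/(lower_energy (C / 4) (9 * C)).
have -> : (1 + 4 * n%:R * Cacc) * lower_energy (C / 4) (9 * C) =
  lower_energy (C / 4) (9 * C) + 4 * n%:R * (Cacc * lower_energy (C / 4) (9 * C)) by ring.
exact: lerD.
Qed.

(** The weight is taken at its minimum, reached at |x|^2 = b2, on the left, and at its maximum on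
    each cut-off layer on the right. On the inner layer L^(- 2 be) is merely bounded by 1; on the
    outer one it is kept, since comparing L - ln L at [b2] and at [B] is what gives decay in be. *)
Lemma carleman_annulus (A B b2 be : R) : 0 < A -> g0 < A / 4 -> 9 * B < g1 -> 4 * A < B ->
  4 * A <= b2 -> b2 <= B -> 2 <= be ->
  L b2 ^- 2 * expR (2 * be * (L b2 - l3 - ln (L b2))) * \int[mu]_x (\1_(cannulus (4 * A) b2) x * energy x) <=
  640 * be ^+ 2 * Cs ^+ 2 * (1 + 4 * n%:R * Cacc) *
  (L A ^+ 2 * expR (2 * be * (L A - l3)) * lower_energy (A / 4) (9 * A) +
   L B ^+ 2 * expR (2 * be * (L B - l3 - ln (L B))) * lower_energy (B / 4) (9 * B)).
Proof.
move=> A0 hg0 hg1 AB Ab2 b2B be2.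
have twobe0 : 0 < 2 * be by rewrite mulr_gt0// two_le_gt0.
have [[B0 b20 p01 q01] [hgA4 hgB4 hgA hgB] [inb2 in2 inG] [inA inB outB]] := nested_intervals A0 hg0 hg1 AB Ab2 b2B.
pose z := cutoff A (4 * A) B (4 * B); pose dz := dcutoff A (4 * A) B (4 * B).
have hz : radial (4 * B) z dz by exact: radial_cutoff.
have z0 t : t < A -> z t = 0 by exact: cutoff_lt.
have az := adm_chi hz z0; have adz := adm_dchi hz z0.
have [e e0 xG] := annulus_near g00 hgA hgB g10 (n := n).
have LL t : A <= t <= 4 * B -> L0 <= L t by move=> /inG; exact: LG.
have Lg2 t : A <= t <= 4 * B -> 2 <= L t by move=> /LL; exact: le_trans L02.
pose om t := wt l3 be be t ^+ 2.
pose XF := J z (fun t => t ^+ 2 * L t ^+ 2 * om t) F2.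
pose Xg := J z (fun t => t * L t ^- 2 * om t) g2.
pose err := J dz (fun t => 4 * t ^+ 2 * om t) u2 +
    n%:R * J dz (fun t => 4 * t ^+ 3 * L t ^+ 2 * om t) g2 +
    J dz (fun t => 4 * t ^+ 3 * L t ^+ 2 * om t) p2.
have [H1 H2] : Xg <= 32 * XF + 32 * be * err /\
  J z (fun t => L t ^- 2 * om t) u2 + J z (fun t => t * om t) p2 +
  J z (fun t => t ^+ 2 * om t) q2 <= 40 * be * (XF + err).
  exact: (limit_carleman GD HS sU sV sF sP sQ GM e0 xG A0 hz z0 Lg2 be2).
have om0 t : 0 <= om t by exact: sqr_ge0.
have ct : cont_on A (4 * B) (fun t => t) by exact: cont_on_id.
have cL : cont_on A (4 * B) L by apply: (cont_on_der (dH := fun t => - (2^-1 * t^-1))) => t tab; exact: der1_Lg tab.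
have cLV : cont_on A (4 * B) (fun t => (L t)^-1) by exact: cont_on_LgV A0 Lg2.
have cw : cont_on A (4 * B) (wt l3 be be) by exact: cont_on_wt.
have cX H k : cont_on A (4 * B) H -> cont_on A (4 * B) (fun t => H t ^+ k).
  move=> cH; elim: k => [|k IH]; first by under eq_fun do rewrite expr0; exact: cont_on_cst.
  by under eq_fun do rewrite exprS; exact: cont_onM.
have cLV2 : cont_on A (4 * B) (fun t => L t ^- 2).
  rewrite (_ : (fun t => _) = (fun t => (L t)^-1 ^+ 2)); first exact: cX.
  by apply/funext => t; rewrite exprVn.
have com : cont_on A (4 * B) om by exact: cX.
have ck (k : R) : cont_on A (4 * B) (fun=> k) by exact: cont_on_cst.
have cont1 : cont_on A (4 * B) (fun t => t * om t) by exact: cont_onM.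
have cont2 : cont_on A (4 * B) (fun t => L t ^- 2 * om t) by exact: cont_onM.
have cont3 : cont_on A (4 * B) (fun t => 4 * t ^+ 3 * L t ^+ 2 * om t) by exact: (cont_onM (cont_onM (cont_onM (ck 4) (cX _ 3%N ct)) (cX _ 2%N cL)) com).
have cont4 : cont_on A (4 * B) (fun t => t ^+ 2 * L t ^+ 2 * om t) by exact: (cont_onM (cont_onM (cX _ 2%N ct) (cX _ 2%N cL)) com).
have cont5 : cont_on A (4 * B) (fun t => t * L t ^- 2 * om t) by exact: (cont_onM (cont_onM ct cLV2) com).
have cont6 : cont_on A (4 * B) (fun t => 4 * t ^+ 2 * om t) by exact: (cont_onM (cont_onM (ck 4) (cX _ 2%N ct)) com).
have cont7 : cont_on A (4 * B) (fun t => t ^+ 2 * om t) by exact: (cont_onM (cX _ 2%N ct) com).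
(* The exponent 3 in the bound on A is used here: t^2 L^2 |F|^2 <= (C0^2 L^-2) t L^-2 |grad u|^2,
   and C0^2 L^-2 <= 1/64. *)
have E1 : XF <= 64^-1 * Xg.
  have w1 := weight_integr az cont4 iF2; have w2 := weight_integr az cont5 ig2.
  rewrite /XF /Xg /J -RintegralZl//; apply: le_Rintegral => //; [exact: integrZ|] => x _.
  have [tab|tout] := in_or_out A (4 * B) (sq x); last by rewrite az.2// expr0n !mul0r !mulr0.
  have Gx : G x by exact: inG.
  have t0 := ab_gt0 A0 tab; have Lx := LL _ tab; have Lp : 0 < L (sq x) by apply: two_le_gt0; exact: Lg2.
  have F2' := potential_small L02 L0C Lx.
  apply: (@le_trans _ _ (z (sq x) ^+ 2 * (sq x ^+ 2 * L (sq x) ^+ 2 * om (sq x)) *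
     (C0 ^+ 2 * (L (sq x)) ^- 6 * (sq x)^-1 * g2 x))).
    apply: ler_wpM2l; last exact: HF2.
    apply: mulr_ge0; first exact: sqr_ge0.
    by apply: mulr_ge0 => //; apply: mulr_ge0; exact: sqr_ge0.
  rewrite [leLHS](_ : _ = (C0 ^+ 2 * (L (sq x)) ^- 2) * (z (sq x) ^+ 2 * (sq x * L (sq x) ^- 2 * om (sq x)) * g2 x)).
    apply: ler_wpM2r => //; apply: mulr_ge0 => //; apply: mulr_ge0; first exact: sqr_ge0.
    by apply: mulr_ge0 => //; apply: mulr_ge0; [exact: ltW|rewrite invr_ge0 exprn_ge0// ltW].
  by move: (om (sq x)) => o; field; rewrite !lt0r_neq0.
have Xg0 : 0 <= Xg.
  apply: (J_ge0 az) => // t tab; apply: mulr_ge0 => //; apply: mulr_ge0; first exact: ltW (ab_gt0 A0 tab).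
  by rewrite invr_ge0 sqr_ge0.
have {H1 E1 H2} [H4 err0 H2] := absorb_error be2 H1 E1 H2 Xg0.
pose m2 := L b2 ^- 2 * expR (2 * be * (L b2 - l3 - ln (L b2))).
have Lb2 : 2 <= L b2 by exact: Lg2.
have E2 : m2 * \int[mu]_x (\1_(cannulus (4 * A) b2) x * energy x) <=
  J z (fun t => L t ^- 2 * om t) u2 + J z (fun t => t * om t) p2 + J z (fun t => t ^+ 2 * om t) q2.
  have w1 := weight_integr az cont2 iu2; have w2 := weight_integr az cont1 ip2; have w3 := weight_integr az cont7 iq2.
  have ie : integr (fun x => \1_(cannulus (4 * A) b2) x * energy x).
    rewrite (_ : (fun x => _) = (fun x => \1_(cannulus (4 * A) b2) x * u2 x + \1_(cannulus (4 * A) b2) x * (sq x * p2 x)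
       + \1_(cannulus (4 * A) b2) x * (sq x * (\1_(cannulus (4 * A) b2) x * (sq x * q2 x))))).
      by apply: integrD; [apply: integrD; [exact: ind_integr|exact: sq_integr]|do 2! apply: sq_integr].
    apply/funext => x; rewrite /energy indicE; case: (_ \in _); rewrite ?mul0r ?mul1r; ring.
  rewrite /J -RintegralZl// -RintegralD// -RintegralD//; last exact: integrD.
  apply: le_Rintegral => //; [exact: integrZ|by apply: integrD => //; exact: integrD|] => x _.
  rewrite indicE; have [/set_mem/andP[t1 t2]|_] := boolP (x \in _); last first.
    rewrite mul0r mulr0; apply: addr_ge0; [apply: addr_ge0|]; apply: mulr_ge0 => //; apply: mulr_ge0; rewrite ?sqr_ge0//.
    - by apply: mulr_ge0 => //; rewrite invr_ge0 sqr_ge0.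
    - by apply: mulr_ge0 => //; exact: sq_ge0.
    - by apply: mulr_ge0 => //; exact: sqr_ge0.
  rewrite /z cutoff1//; last by rewrite t1 (le_trans t2).
  rewrite expr1n !mul1r.
  have tab := in2 _ t1 t2.
  have s0 := ab_gt0 A0 tab.
  have LLx : L b2 <= L (sq x) by exact: Lg_homo.
  have m2le : m2 <= L (sq x) ^- 2 * om (sq x) by rewrite /om wt_sqr; exact: weight_homo.
  have m2om : m2 <= om (sq x).
    by apply: le_trans m2le _; apply: ler_piMl => //; apply: invr_sqr_le1; exact: Lg2.
  rewrite /energy !mulrDr; apply: lerD; [apply: lerD|].
  - exact: ler_wpM2r.
  - rewrite [leRHS](_ : _ = om (sq x) * (sq x * p2 x)); last by ring.
    by apply: ler_wpM2r => //; apply: mulr_ge0 => //; exact: ltW.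
  - rewrite [leRHS](_ : _ = om (sq x) * (sq x ^+ 2 * q2 x)); last by ring.
    by apply: ler_wpM2r => //; apply: mulr_ge0 => //; exact: sqr_ge0.
pose Min := L A ^+ 2 * expR (2 * be * (L A - l3)).
pose Mout := L B ^+ 2 * expR (2 * be * (L B - l3 - ln (L B))).
pose T (C : R) x := u2 x + 4 * n%:R * C * g2 x + sq x * p2 x.
have E3 : err <= 8 * Cs ^+ 2 * (Min * \int[mu]_x (\1_(cannulus A (4 * A)) x * T A x) +
   Mout * \int[mu]_x (\1_(cannulus B (4 * B)) x * T B x)).
  clear E2 H2 H4 XF Xg Xg0 cont1 cont2 cont4 cont5 cont7 m2 LL in2 inG inb2 xG.
  have iT C : integr (fun x => \1_(cannulus C (4 * C)) x * T C x).
    rewrite (_ : (fun x => _) = (fun x => \1_(cannulus C (4 * C)) x * u2 x + 4 * n%:R * C * (\1_(cannulus C (4 * C)) x * g2 x)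
       + \1_(cannulus C (4 * C)) x * (sq x * p2 x))).
      apply: integrD; last exact: sq_integr.
      by apply: integrD; [exact: ind_integr|apply: integrZ; exact: ind_integr].
    by apply/funext => x; rewrite /T; ring.
  have w1 := weight_integr adz cont6 iu2; have w2 := weight_integr adz cont3 ig2; have w3 := weight_integr adz cont3 ip2.
  pose f1 x := dz (sq x) ^+ 2 * (4 * sq x ^+ 2 * om (sq x)) * u2 x.
  pose f2 x := dz (sq x) ^+ 2 * (4 * sq x ^+ 3 * L (sq x) ^+ 2 * om (sq x)) * g2 x.
  pose f3 x := dz (sq x) ^+ 2 * (4 * sq x ^+ 3 * L (sq x) ^+ 2 * om (sq x)) * p2 x.
  have if12 : integr (fun x => f1 x + n%:R * f2 x) by apply: integrD => //; exact: integrZ.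
  have -> : err = \int[mu]_x (f1 x + n%:R * f2 x + f3 x).
    rewrite RintegralD// RintegralD//; last exact: integrZ.
    by rewrite RintegralZl.
  have -> : Min * \int[mu]_x (\1_(cannulus A (4 * A)) x * T A x) + Mout * \int[mu]_x (\1_(cannulus B (4 * B)) x * T B x) =
      \int[mu]_x (Min * (\1_(cannulus A (4 * A)) x * T A x) + Mout * (\1_(cannulus B (4 * B)) x * T B x)).
    rewrite RintegralD//; [|exact: integrZ|exact: integrZ].
    by rewrite (RintegralZl Min measurableT (iT A)) (RintegralZl Mout measurableT (iT B)).
  have i1 : integr (fun x => Min * (\1_(cannulus A (4 * A)) x * T A x) + Mout * (\1_(cannulus B (4 * B)) x * T B x)).
    by apply: integrD; exact: integrZ.
  rewrite -RintegralZl//; apply: le_Rintegral => //; [exact: integrD|exact: integrZ|] => x _.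
  have T0 C : 0 <= C -> 0 <= T C x.
    move=> C0'; apply: addr_ge0; [apply: addr_ge0 => //|by apply: mulr_ge0 => //; exact: sq_ge0].
    by apply: mulr_ge0 => //; apply: mulr_ge0.
  have r0 (C Mx : R) : 0 <= C -> 0 <= Mx -> 0 <= Mx * (\1_(cannulus C (4 * C)) x * T C x).
    by move=> h1 h2; apply: mulr_ge0 => //; apply: mulr_ge0; [rewrite indicE|exact: T0].
  rewrite /f1 /f2 /f3; set lhs := _ + _ + _.
  (* One pointwise bound for both layers, [C] being [A] or [B] and [Mx] the maximum of L^2 om there.
     The slope Cs / (3 C) times |x|^2 <= 4 C is at most 4/3 Cs, and (4/3)^2 <= 2. *)
  have key (C Mx : R) : 0 < C -> C <= sq x <= 4 * C -> `|dz (sq x)| <= Cs / (3 * C) -> L (sq x) ^+ 2 * om (sq x) <= Mx ->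
      1 <= L (sq x) ^+ 2 -> lhs <= 8 * Cs ^+ 2 * (Mx * T C x).
    move=> C0' /andP[t1 t2] d1 oM L1.
    have d2 : (dz (sq x) * sq x) ^+ 2 <= 2 * Cs ^+ 2.
      have d3 : `|dz (sq x) * sq x| <= 4 / 3 * Cs.
        rewrite normrM (ger0_norm (sq_ge0 x)).
        apply: (@le_trans _ _ (Cs / (3 * C) * (4 * C))); first by apply: ler_pM => //; exact: sq_ge0.
        by rewrite le_eqVlt; apply/orP; left; apply/eqP; field; exact: lt0r_neq0.
      exact: sqr_le_2sqr (ltW Cs0) d3.
    have o1 : om (sq x) <= Mx by apply: le_trans oM; exact: ler_peMl.
    have M0 : 0 <= Mx by exact: le_trans o1.
    have u0 := u20 x; have gg0 := g20 x; have pp0 := p20 x; have s0 := sq_ge0 x.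
    have -> : lhs = 4 * (dz (sq x) * sq x) ^+ 2 * (om (sq x) * u2 x + L (sq x) ^+ 2 * om (sq x) * (n%:R * (sq x * g2 x) + sq x * p2 x)).
      rewrite /lhs; ring.
    have in1 : om (sq x) * u2 x + L (sq x) ^+ 2 * om (sq x) * (n%:R * (sq x * g2 x) + sq x * p2 x) <= Mx * T C x.
      rewrite /T; have -> : Mx * (u2 x + 4 * n%:R * C * g2 x + sq x * p2 x) = Mx * u2 x + Mx * (n%:R * (4 * C * g2 x) + sq x * p2 x) by ring.
      apply: lerD; first exact: ler_wpM2r.
      apply: ler_pM => //; [by apply: mulr_ge0 => //; exact: sqr_ge0| |].
        by apply: addr_ge0; apply: mulr_ge0 => //; apply: mulr_ge0.
      by apply: lerD => //; apply: ler_wpM2l => //; exact: ler_wpM2r.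
    rewrite [leRHS](_ : _ = 4 * (2 * Cs ^+ 2) * (Mx * T C x)); last by ring.
    apply: ler_pM => //; [by apply: mulr_ge0 => //; exact: sqr_ge0| |by apply: ler_wpM2l].
    apply: addr_ge0; first exact: mulr_ge0.
    apply: mulr_ge0; first by apply: mulr_ge0 => //; exact: sqr_ge0.
    by apply: addr_ge0; apply: mulr_ge0 => //; apply: mulr_ge0.
  have dzb := dcutoff_bound p01 q01 (sq x) HCs; rewrite -/(dz (sq x)) in dzb.
  have e1 : Cs / (4 * A - A) = Cs / (3 * A) by congr (_ / _); ring.
  have e2 : Cs / (4 * B - B) = Cs / (3 * B) by congr (_ / _); ring.
  rewrite e1 e2 in dzb.
  have k8 : 0 <= 8 * Cs ^+ 2 by rewrite mulr_ge0 ?sqr_ge0.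
  have inP C : (sq x \in `[C, 4 * C]%classic) = (C <= sq x <= 4 * C).
    by apply/idP/idP => [/set_mem/=|h]; [rewrite in_itv|apply: mem_set; rewrite /= in_itv].
  have inC C : (x \in cannulus C (4 * C)) = (C <= sq x <= 4 * C).
    by apply/idP/idP => [/set_mem//|h]; apply: mem_set.
  rewrite !indicE !inP in dzb; rewrite !indicE !inC.
  have L1 : A <= sq x <= 4 * B -> 1 <= L (sq x) ^+ 2 by move=> /Lg2; exact: sqr_ge1.
  have oE : om (sq x) = expR (2 * be * (L (sq x) - l3 - ln (L (sq x)))) by exact: wt_sqr.
  have [hA|hA] := boolP (A <= sq x <= 4 * A).
    have hB := outB _ hA.
    rewrite hA hB mulr1 mulr0 addr0 in dzb; rewrite hB mul0r mulr0 addr0 mul1r.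
    have tab := inA _ hA.
    apply: key => //; last exact: L1.
    have LxA : L (sq x) <= L A by apply: Lg_homo => //; case/andP: hA.
    have Lx2 := Lg2 _ tab.
    rewrite oE /Min; apply: ler_pM; rewrite ?sqr_ge0 ?expR_ge0//.
      exact: ler_sqr2.
    rewrite ler_expR; apply: ler_wpM2l; first exact: ltW.
    rewrite -addrA lerD// lerBlDr addrC -lerBlDr subrr.
    by apply: ln_ge0; apply: le_trans Lx2; rewrite ler1n.
  have [hB|hB] := boolP (B <= sq x <= 4 * B); last first.
    have dz0 : dz (sq x) = 0.
      apply/eqP; rewrite -normr_le0; apply: le_trans dzb _.
      by rewrite (negbTE hA) (negbTE hB) !mulr0 addr0.
    have -> : lhs = 0 by rewrite /lhs dz0 expr0n !mul0r mulr0 !addr0.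
    by rewrite !mul0r !mulr0 addr0 mulr0.
  rewrite (negbTE hA) hB mulr1 mulr0 add0r in dzb; rewrite mul0r mulr0 add0r mul1r.
  have tab := inB _ hB.
  apply: key => //; last exact: L1.
  have LxB : L (sq x) <= L B by apply: Lg_homo => //; case/andP: hB.
  have Lx2 := Lg2 _ tab.
  rewrite oE /Mout; apply: ler_pM; rewrite ?sqr_ge0 ?expR_ge0//.
    exact: ler_sqr2.
  rewrite ler_expR; apply: ler_wpM2l; first exact: ltW.
  have Lx1 : 1 <= L (sq x) by apply: le_trans Lx2; rewrite ler1n.
  by rewrite -!addrA ![- l3 + _]addrC !addrA lerD2r; exact: sub_ln_homo.
have E4 := annulus_error.
have Min0 : 0 <= Min by rewrite mulr_ge0 ?sqr_ge0 ?expR_ge0.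
have Mout0 : 0 <= Mout by rewrite mulr_ge0 ?sqr_ge0 ?expR_ge0.
have k1 := ler_wpM2l Min0 (E4 A A0 hg0 hgA4).
have k2 := ler_wpM2l Mout0 (E4 B B0 hgB4 hg1).
have k3 : 0 <= 8 * Cs ^+ 2 by rewrite mulr_ge0 ?sqr_ge0.
have k4 : 0 <= 80 * be ^+ 2 by rewrite mulr_ge0 ?sqr_ge0.
apply: le_trans E2 (le_trans H2 _).
apply: le_trans (ler_wpM2l k4 (le_trans E3 (ler_wpM2l k3 (lerD k1 k2)))) _.
rewrite le_eqVlt; apply/orP; left; apply/eqP; rewrite -/Min -/Mout; ring.
Qed.

End annuli.

Section cauchy_schwarz.
Context {R : realType} (I : finType).

(** Lagrange's identity: twice the defect is the double sum of (a_i b_j - a_j b_i)^2. *)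
Lemma sum_cauchy (a b : I -> R) : (\sum_i a i * b i) ^+ 2 <= (\sum_i a i ^+ 2) * \sum_i b i ^+ 2.
Proof.
have h : 0 <= \sum_i \sum_j (a i * b j - a j * b i) ^+ 2.
  by apply: sumr_ge0 => i _; apply: sumr_ge0 => j _; exact: sqr_ge0.
have e : \sum_i \sum_j (a i * b j - a j * b i) ^+ 2 =
    (\sum_i a i ^+ 2) * (\sum_j b j ^+ 2) + (\sum_i b i ^+ 2) * (\sum_j a j ^+ 2)
    + (-2) * ((\sum_i a i * b i) * (\sum_j a j * b j)).
  rewrite !big_distrlr/= big_distrr/= -!big_split/=; apply: eq_bigr => i _.
  by rewrite big_distrr/= -!big_split/=; apply: eq_bigr => j _; ring.
move: h; rewrite e expr2; set A := \sum_i a i ^+ 2; set B := \sum_i b i ^+ 2; set C := \sum_i a i * b i; nra.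
Qed.

End cauchy_schwarz.

Section total_energy.
Context {R : realType} {n : nat}.
Local Notation mu := (@lebesgue_rV R n).
Local Notation sq := (@sq R n).
Context (U : 'I_n -> 'rV[R]_n -> R) (P : 'rV[R]_n -> R) (Q : 'I_n -> 'rV[R]_n -> R).

(** |U|^2 of the theorem with its square root removed, see [stokesU_sqr]. *)
Definition total_energy (x : 'rV[R]_n) : R :=
  \sum_i U i x ^+ 2 + sq x * P x ^+ 2 + sq x ^+ 2 * \sum_i Q i x ^+ 2.

Lemma total_energy_ge0 x : 0 <= total_energy x.
Proof.
have s0 := sq_ge0 x; apply: addr_ge0; [apply: addr_ge0|]; last apply: mulr_ge0; rewrite ?sqr_ge0//.
- by apply: sumr_ge0 => i _; exact: sqr_ge0.
- by apply: mulr_ge0 => //; exact: sqr_ge0.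
- by apply: sumr_ge0 => i _; exact: sqr_ge0.
Qed.

Context (r0 : R) (sU : forall i, sqint (fun x => \1_(sball r0) x * U i x))
  (sP : sqint (fun x => \1_(sball r0) x * P x)) (sQ : forall j, sqint (fun x => \1_(sball r0) x * Q j x)).

Let indic_sqr A (f : 'rV[R]_n -> R) x : (\1_A x * f x) ^+ 2 = \1_A x * f x ^+ 2.
Proof. by rewrite exprMn indicE; case: (_ \in _); rewrite ?expr1n ?expr0n. Qed.

Lemma total_energy_integr A : measurable A -> A `<=` sball r0 -> integr (fun x => \1_A x * total_energy x).
Proof.
move=> mA AB.
have h0 : integr (fun x => \1_(sball r0) x * total_energy x).
  have m1 k : measurable_fun [set: 'rV[R]_n] (fun x : 'rV[R]_n => \1_(sball r0) x * sq x ^+ k).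
    apply: measurable_funM; first by apply: measurable_indic; exact: measurable_sball.
    by apply: measurable_funX; exact: measurable_sq.
  have bd k (x : 'rV[R]_n) : `|\1_(sball r0) x * sq x ^+ k| <= (r0 ^+ 2) ^+ k.
    rewrite indicE; have [/set_mem h|_] := boolP (x \in _).
      by rewrite mul1r ger0_norm ?exprn_ge0 ?sq_ge0// lerXn2r ?nnegrE ?sq_ge0 ?sqr_ge0//; exact: ltW.
    by rewrite mul0r normr0 exprn_ge0// sqr_ge0.
  have [_ i1] := Rintegral_sum (index_enum 'I_n) (fun i => (sU i).2).
  have [_ i2] := Rintegral_sum (index_enum 'I_n) (fun i => (sQ i).2).
  have i3 := integrD (integrD i1 (integrM_bounded (m1 1) (bd 1) sP.2)) (integrM_bounded (m1 2) (bd 2) i2).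
  rewrite (_ : (fun x => _) = (fun x => \sum_i (\1_(sball r0) x * U i x) ^+ 2 +
     (\1_(sball r0) x * sq x ^+ 1) * (\1_(sball r0) x * P x) ^+ 2 +
     (\1_(sball r0) x * sq x ^+ 2) * \sum_i (\1_(sball r0) x * Q i x) ^+ 2))//.
  apply/funext => x.
  have eU (f : 'I_n -> 'rV[R]_n -> R) : \sum_i (\1_(sball r0) x * f i x) ^+ 2 = \1_(sball r0) x * \sum_i f i x ^+ 2.
    by rewrite mulr_sumr; apply: eq_bigr => i _; exact: indic_sqr.
  by rewrite !eU indic_sqr /total_energy indicE; case: (_ \in _); rewrite ?mul1r ?mul0r ?addr0.
rewrite (_ : (fun x => _) = (fun x => \1_A x * (\1_(sball r0) x * total_energy x))).
  apply: (@integrM_bounded _ _ _ _ 1) => // x.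
  by rewrite indicE; case: (_ \in _); rewrite ?normr1 ?normr0.
apply/funext => x; rewrite !indicE; have [/set_mem /AB h|_] := boolP (x \in A); last by rewrite !mul0r.
by rewrite mem_set// !mul1r.
Qed.

End total_energy.

Section radii.
Context {R : realType}.

Lemma Lg_sqr (l3 r : R) : 0 < r -> Lg l3 (r ^+ 2) = l3 - ln r.
Proof. by move=> r0; rewrite /Lg expr2 lnM ?posrE//; field. Qed.

(* ln (R3 / |x|) >= 2 + 8 C as soon as |x| <= 5 * outer_ratio C * R3. *)
Definition outer_ratio (C : R) := expR (- (2 + 8 * C + 2)) / 2.

Lemma outer_ratio_gt0 (C : R) : 0 < outer_ratio C.
Proof. by rewrite divr_gt0// expR_gt0. Qed.

Lemma outer_ratio_le (C : R) : 0 < C -> outer_ratio C <= 10^-1.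
Proof.
move=> C0; rewrite /outer_ratio expRN.
have h : 5 <= expR (2 + 8 * C + 2) by apply: le_trans (expR_ge1Dx _); lra.
have : (expR (2 + 8 * C + 2))^-1 <= 5^-1 by rewrite lef_pV2 ?posrE ?expR_gt0//; lra.
lra.
Qed.

Lemma Lg_outer_ratio (C R3 t : R) : 0 < C -> 0 < R3 -> 0 < t -> t < (5 * (outer_ratio C * R3)) ^+ 2 ->
  2 + 8 * C <= Lg (ln R3) t.
Proof.
move=> C0 R30 t0 t2.
have R40 : 0 < 5 * (outer_ratio C * R3) by apply: mulr_gt0 => //; apply: mulr_gt0 => //; exact: outer_ratio_gt0.
(* Since ln (1 + 3/2) <= 3/2, the margin 2 in the exponent of [outer_ratio] absorbs the factor
   5/2. *)
have h5 : 5 * (outer_ratio C * R3) = (1 + 3 / 2) * (expR (- (2 + 8 * C + 2)) * R3) by rewrite /outer_ratio; field.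
have hl : ln (5 * (outer_ratio C * R3)) <= 3 / 2 + (- (2 + 8 * C + 2) + ln R3).
  rewrite h5 lnM ?posrE; [|lra|by rewrite mulr_gt0 ?expR_gt0].
  by rewrite lnM ?posrE ?expR_gt0// expRK lerD2r; apply: le_ln1Dx; lra.
have := Lg_homo (ln R3) t0 (ltW t2); rewrite Lg_sqr//; lra.
Qed.

(** In terms of |x|: data are kept on ]R1/16, 5 R4[, the cut-offs vary on [R1/4, R1/2] and
    [R4, 2 R4], and the annuli for Caccioppoli's inequality are [R1/8, 3 R1/4], inside the ball of
    radius R1, and [R4/2, 3 R4], inside that of radius R3. *)
Lemma annulus_radii (R1 R2 R3 R4 r0 : R) : 0 < R1 -> R1 < R2 -> R2 <= R4 -> R4 <= R3 / 10 -> R3 <= r0 ->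
  [/\ [/\ 0 < (R1 / 16) ^+ 2, 0 < (5 * R4) ^+ 2 & (5 * R4) ^+ 2 <= r0 ^+ 2],
    [/\ 0 < (R1 / 4) ^+ 2, (R1 / 16) ^+ 2 < (R1 / 4) ^+ 2 / 4, 9 * R4 ^+ 2 < (5 * R4) ^+ 2,
       4 * (R1 / 4) ^+ 2 < R4 ^+ 2 & 4 * (R1 / 4) ^+ 2 <= R2 ^+ 2],
    [/\ R2 ^+ 2 <= R4 ^+ 2, 9 * (R1 / 4) ^+ 2 < R1 ^+ 2, 9 * (R1 / 4) ^+ 2 < (5 * R4) ^+ 2,
       9 * R4 ^+ 2 < R3 ^+ 2 & (R1 / 16) ^+ 2 < R4 ^+ 2 / 4] &
    (R1 / 16) ^+ 2 < (R1 / 2) ^+ 2 /\ R2 ^+ 2 < (5 * R4) ^+ 2].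
Proof.
move=> R10 R12 R24 R43 R3r.
by split; [split|split|split|split]; nra.
Qed.

End radii.

(** * The Carleman estimate for the Stokes system with drift *)

Section carleman_stokes.
Context {R : realType} {n : nat}.
Local Notation mu := (@lebesgue_rV R n).
Local Notation sq := (@sq R n).

Lemma ln_enorm (x : 'rV[R]_n) : ln (enorm x) = 2^-1 * ln (sq x).
Proof.
have := enorm_ge0 x; rewrite le_eqVlt => /orP[/eqP h|h]; last first.
  by rewrite -enorm_sqr expr2 lnM ?posrE//; field.
by rewrite -enorm_sqr -h expr0n !ln0// mulr0.
Qed.

Lemma sqint_bounded (b f : 'rV[R]_n -> R) (C : R) : measurable_fun [set: 'rV[R]_n] b ->
  (forall x, `|b x| <= C) -> sqint f -> sqint (fun x => b x * f x).
Proof.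
move=> mb bC [mf iff]; split; first exact: measurable_funM.
under eq_fun do rewrite exprMn.
apply: (@integrM_bounded _ _ _ _ (C ^+ 2)) => //; first exact: measurable_funX.
by move=> x; rewrite normrX lerXn2r ?nnegrE// (le_trans _ (bC x)).
Qed.

Lemma sqint_sum (I : Type) (s : seq I) (f : I -> 'rV[R]_n -> R) :
  (forall i, sqint (f i)) -> sqint (fun x => \sum_(i <- s) f i x).
Proof.
move=> sf; elim: s => [|i s IH].
  under eq_fun do rewrite big_nil.
  have -> : (fun=> 0) = (fun x => 0 * 0) :> ('rV[R]_n -> R) by apply/funext => x; rewrite mul0r.
  split; first exact: measurable_cst.
  by under eq_fun do rewrite mul0r expr0n; exact: integrable0.
by under eq_fun do rewrite big_cons; exact: sqintD.
Qed.

Definition carleman_cst (C Cs : R) := 640 * Cs ^+ 2 * (1 + 4 * n%:R * Cacc C Cs).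

Lemma carleman_cst_ge0 (C Cs : R) : 0 <= carleman_cst C Cs.
Proof.
have h640 : 0 <= 640 :> R by lra.
have hC : 0 <= Cacc C Cs by rewrite /Cacc; have := sqr_ge0 Cs; have := sqr_ge0 C; lra.
have h4n : 0 <= 4 * n%:R * Cacc C Cs by apply: mulr_ge0 => //; exact: mulr_ge0.
by apply: (mulr_ge0 (mulr_ge0 h640 (sqr_ge0 Cs)) _); exact: addr_ge0.
Qed.

Context (C0 Cs r0 : R) (C00 : 0 < C0) (Cs0 : 0 < Cs) (HCs : forall t, `|(@step R)^`()%classic t| <= Cs)
  (r00 : 0 < r0) (r01 : r0 <= 1).
Context (a U : 'I_n -> 'rV[R]_n -> R) (V : 'I_n -> 'I_n -> 'rV[R]_n -> R) (P : 'rV[R]_n -> R) (Q : 'I_n -> 'rV[R]_n -> R).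
Hypotheses (ma : forall j, measurable_fun [set: 'rV[R]_n] (a j))
  (sU : forall i, sqint (fun x => \1_(sball r0) x * U i x)) (sV : forall i j, sqint (fun x => \1_(sball r0) x * V i j x))
  (sP : sqint (fun x => \1_(sball r0) x * P x)) (sQ : forall j, sqint (fun x => \1_(sball r0) x * Q j x))
  (HS : weak_stokes (sball r0) U V (fun i x => \sum_j a j x * V i j x) P Q)
  (Ha : {ae mu, forall x, sball r0 x -> x != 0 -> enorm x != 1 ->
     \sum_j a j x ^+ 2 <= (C0 * `|ln (enorm x)| ^- 3 * (enorm x)^-1) ^+ 2}).

Lemma carleman_stokes (R1 R2 R3 be : R) (L := fun r => ln R3 - ln r) (R4 := outer_ratio C0 * R3) :
  0 < R1 -> R1 < R2 -> R2 <= R4 -> R1 <= R4 -> R3 <= r0 -> 2 <= be ->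
  L R2 ^- 2 * expR (2 * be * (L R2 - ln (L R2))) *
    \int[mu]_x (\1_(cannulus ((R1 / 2) ^+ 2) (R2 ^+ 2)) x * total_energy U P Q x) <=
  carleman_cst C0 Cs * be ^+ 2 *
  (L (R1 / 4) ^+ 2 * expR (2 * be * L (R1 / 4)) * \int[mu]_x (\1_(sball R1) x * total_energy U P Q x) +
   L R4 ^+ 2 * expR (2 * be * (L R4 - ln (L R4))) * \int[mu]_x (\1_(sball R3) x * total_energy U P Q x)).
Proof.
move=> R10 R12 R24 R14 R3r be2; have C0p := C00; have r0p := r00; have r1p := r01.
have R40 : 0 < R4 by exact: lt_le_trans R14.
have R30 : 0 < R3 by move: R40; rewrite /R4 pmulr_rgt0 ?outer_ratio_gt0.
have R43 : R4 <= R3 / 10 by rewrite /R4 [leRHS]mulrC; apply: ler_wpM2r; [exact: ltW|exact: outer_ratio_le].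
pose g0 := (R1 / 16) ^+ 2; pose g1 := (5 * R4) ^+ 2; pose G : set 'rV[R]_n := annulus g0 g1.
have [[g00 g10 g1r] radii radii' radii''] := annulus_radii R10 R12 R24 R43 R3r.
rewrite -/g0 -/g1 in g00 g10 g1r.
have GD : G `<=` sball r0 by move=> x /andP[_ h]; exact: lt_le_trans h g1r.
have R14_gt0 : 0 < R1 / 4 by exact: divr_gt0.
have R20 : 0 < R2 by exact: lt_trans R12.
have R1r : R1 <= r0 by apply: le_trans (le_trans (ltW R12) R24) _; lra.
pose L0 := 2 + 8 * C0; pose l3 := ln R3.
have L02 : 2 <= L0 by rewrite /L0; lra.
have L00 : 0 < L0 by rewrite /L0; lra.
have L01 : 1 <= L0 by rewrite /L0; lra.
have L0C : 64 * C0 ^+ 2 <= L0 ^+ 2 by rewrite /L0; nra.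
have l30 : l3 <= 0 by apply: ln_le0; exact: le_trans r1p.
have LG t : g0 < t < g1 -> L0 <= Lg l3 t.
  by move=> /andP[t1 t2]; apply: Lg_outer_ratio => //; exact: lt_trans t1.
(* The bound on A only holds almost everywhere: A is replaced by 0 where it fails. *)
pose Bset : set 'rV[R]_n := ~` G `|` [set x | (\sum_j a j x ^+ 2) * (Lg l3 (sq x) ^+ 6 * sq x) <= C0 ^+ 2].
have mB : measurable Bset.
  apply: measurableU; first by apply: measurableC; exact: measurable_annulus.
  have mf : measurable_fun [set: 'rV[R]_n] (fun x => (\sum_j a j x ^+ 2) * (Lg l3 (sq x) ^+ 6 * sq x)).
    apply: measurable_funM; first by apply: measurable_sum => j; exact: measurable_funX.
    apply: measurable_funM; last exact: measurable_sq.
    apply: measurable_funX; apply: measurable_funB; first exact: measurable_cst.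
    apply: measurable_funM; first exact: measurable_cst.
    exact: (measurableT_comp (@measurable_ln R) (@measurable_sq R n)).
  rewrite -[X in measurable X]setTI.
  have := mf measurableT _ (measurable_itv `]-oo, (C0 ^+ 2)]).
  by congr (measurable _); apply/seteqP; split => x [_]; rewrite /= in_itv/=.
pose b j x := \1_(G `&` Bset) x * a j x.
have bb (x : 'rV[R]_n) : G x -> Bset x -> \sum_j a j x ^+ 2 <= C0 ^+ 2 / Lg l3 (sq x) ^+ 6 / sq x.
  move=> Gx [//|h]; have Lx := LG _ Gx.
  have s0 : 0 < sq x by case/andP: Gx => h1 _; exact: lt_trans h1.
  have L6 : 0 < Lg l3 (sq x) ^+ 6 by rewrite exprn_gt0//; exact: lt_le_trans Lx.
  by rewrite !ler_pdivlMr// -mulrA [sq x * _]mulrC.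
pose F i x := \1_Bset x * \sum_j a j x * V i j x.
have HSF : weak_stokes (sball r0) U V F P Q.
  move=> phi tphi; have [h1 h2 h3 h4] := HS tphi; split=> // i; rewrite -[RHS](h3 i).
  apply: ae_Rintegral; move: Ha; apply: filterS => x Hx _.
  rewrite /F !indicE; have [/set_mem Dx|_] := boolP (x \in sball r0); last by rewrite !mul0r.
  rewrite mem_set ?mul1r//; have [Gx|] := pselect (G x); [right|by left].
  have s0 : 0 < sq x by case/andP: Gx => t1 _; exact: lt_trans t1.
  have en0 : 0 < enorm x by rewrite lt_def enorm_ge0 andbT; apply/eqP => e; move: s0; rewrite -enorm_sqr e expr0n ltxx.
  have s1 : sq x < 1.
    by case/andP: Gx => _ t1; apply: (lt_le_trans t1); apply: (le_trans g1r); rewrite expr_le1//; exact: ltW.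
  have x0 : x != 0.
    by apply/eqP => e; move: s0; rewrite e (_ : sq 0 = 0) ?ltxx//; apply: big1 => j _; rewrite mxE expr0n.
  have en1 : enorm x != 1 by apply/eqP => e; move: s1; rewrite -enorm_sqr e expr1n ltxx.
  (* ln R3 <= 0, so L is at most |log |x||, and the hypothesis on A yields the weaker bound with
     L. *)
  have LL : Lg l3 (sq x) <= `|ln (enorm x)|.
    rewrite ln_enorm -normrN; by apply: le_trans (ler_norm _); rewrite /Lg gerDr.
  have Lx := LG _ Gx; have Lp := lt_le_trans L00 Lx.
  have lp : 0 < `|ln (enorm x)| by exact: lt_le_trans LL.
  have := Hx Dx x0 en1; set l := `|_|; rewrite /= => hb.
  apply: (@le_trans _ _ ((C0 * l ^- 3 * (enorm x)^-1) ^+ 2 * (Lg l3 (sq x) ^+ 6 * sq x))).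
    by apply: ler_wpM2r => //; rewrite mulr_ge0 ?exprn_ge0// ltW.
  have -> : (C0 * l ^- 3 * (enorm x)^-1) ^+ 2 * (Lg l3 (sq x) ^+ 6 * sq x) = C0 ^+ 2 * (Lg l3 (sq x) / l) ^+ 6.
    by rewrite -(enorm_sqr x); field; rewrite !lt0r_neq0.
  apply: ler_piMr; first exact: sqr_ge0.
  by apply: exprn_ile1; [exact: divr_ge0 (ltW Lp) (ltW lp)|rewrite ler_pdivrMr// mul1r].
have cutD f : sqint (fun x => \1_(sball r0) x * f x) -> sqint (cut G f).
  move=> sf; have := @sqint_bounded (\1_G) _ 1 (measurable_indic (measurable_annulus g0 g1)) _ sf.
  rewrite (_ : cut G f = (fun x => \1_G x * (\1_(sball r0) x * f x))).
    by apply=> x; rewrite indicE; case: (_ \in _); rewrite ?normr1 ?normr0.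
  apply/funext => x; rewrite /cut !indicE; have [/set_mem /GD h|_] := boolP (x \in G); last by rewrite !mul0r.
  by rewrite mem_set// !mul1r.
(* On [G] and where its bound holds, the drift is at most C0 / (R1/16). This serves only for square
   integrability: the constant enters no estimate. *)
have sF i : sqint (cut G (F i)).
  rewrite (_ : cut G (F i) = (fun x => \sum_j b j x * cut G (V i j) x)); last first.
    apply/funext => x; rewrite /cut /F /b indicI !mulr_sumr; apply: eq_bigr => j _.
    by rewrite /= !indicE; case: (x \in G); case: (x \in Bset); rewrite !(mul0r, mul1r, mulr0).
  apply: sqint_sum => j; apply: (@sqint_bounded _ _ (C0 / (R1 / 16))); last exact: cutD.
    by apply: measurable_funM => //; apply: measurable_indic; apply: measurableI => //; exact: measurable_annulus.
  move=> x; have c0 : 0 < C0 / (R1 / 16) by rewrite !divr_gt0.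
  rewrite /b indicE; have [/set_mem[Gx Bx]|_] := boolP (x \in _); last by rewrite mul0r normr0 ltW.
  rewrite mul1r -(@ler_pXn2r _ 2)// ?nnegrE//; last exact: ltW.
  rewrite real_normK ?num_real//.
  apply: (@le_trans _ _ (\sum_j a j x ^+ 2)).
    by rewrite (bigD1 j)//= lerDl; apply: sumr_ge0 => k _; exact: sqr_ge0.
  apply: le_trans (bb _ Gx Bx) _; have Lx := LG _ Gx.
  have s0 : g0 < sq x by case/andP: Gx.
  have h6 : 1 <= Lg l3 (sq x) ^+ 6 by rewrite exprn_ege1//; exact: le_trans Lx.
  rewrite [leRHS]expr_div_n -/g0; apply: ler_pM.
  - by rewrite divr_ge0 ?sqr_ge0// (le_trans _ h6).
  - by rewrite invr_ge0 sq_ge0.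
  - by rewrite ler_pdivrMr ?(lt_le_trans _ h6)// ler_peMr// sqr_ge0.
  - by rewrite lef_pV2 ?posrE ?ltW// (lt_trans _ s0).
have HF x : G x -> \sum_i F i x ^+ 2 <= C0 ^+ 2 / Lg l3 (sq x) ^+ 6 / sq x * \sum_j \sum_i V i j x ^+ 2.
  move=> Gx; have Lx := LG _ Gx.
  have s0 : g0 < sq x by case/andP: Gx.
  have V0 : 0 <= \sum_j \sum_i V i j x ^+ 2 by apply: sumr_ge0 => j _; apply: sumr_ge0 => i _; exact: sqr_ge0.
  rewrite /F indicE; have [/set_mem Bx|_] := boolP (x \in Bset).
    rewrite exchange_big/=; under eq_bigr do rewrite mul1r.
    apply: (@le_trans _ _ (\sum_i (\sum_j a j x ^+ 2) * \sum_j V i j x ^+ 2)).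
      by apply: ler_sum => i _; exact: sum_cauchy.
    rewrite -mulr_sumr; apply: ler_wpM2r; last exact: bb.
    by apply: sumr_ge0 => j _; apply: sumr_ge0 => i _; exact: sqr_ge0.
  under eq_bigr do rewrite mul0r expr0n.
  rewrite big1//; apply: mulr_ge0 => //; rewrite divr_ge0 ?sq_ge0// divr_ge0 ?sqr_ge0// exprn_ge0//; exact: ltW (lt_le_trans L00 Lx).
have [A0 c1 c2 c3 c4] := radii; have [c5 c6 c7 c8 c9] := radii'; have [c10 c11] := radii''.
have := carleman_annulus (ltW g00) g10 GD HSF (fun i => cutD _ (sU i)) (fun i j => cutD _ (sV i j)) sF
  (cutD _ sP) (fun j => cutD _ (sQ j)) C00 L02 L0C LG HF Cs0 HCs A0 c1 c2 c3 c4 c5 be2.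
rewrite !Lg_sqr// -/(L R2) -/(L R4) -/(L (R1 / 4)).
have cE f (x : 'rV[R]_n) : G x -> cut G f x = f x by move=> Gx; rewrite /cut indicE mem_set// mul1r.
have sE (f : 'I_n -> 'rV[R]_n -> R) x : G x -> \sum_i cut G (f i) x ^+ 2 = \sum_i f i x ^+ 2.
  by move=> Gx; apply: eq_bigr => i _; rewrite cE.
have iW := total_energy_integr sU sP sQ.
pose X := \int[mu]_x (\1_(sball R1) x * total_energy U P Q x).
pose Y := \int[mu]_x (\1_(sball R3) x * total_energy U P Q x).
have lowW lo hi r : r <= r0 -> 0 < r -> hi < r ^+ 2 -> g0 < lo -> hi < g1 ->
    lower_energy g0 g1 U P lo hi <= \int[mu]_x (\1_(sball r) x * total_energy U P Q x).
  move=> rr r_gt0 hir lo0 hi1; rewrite /lower_energy.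
  have [_ iu] := Rintegral_sum (index_enum 'I_n) (fun i => (cutD _ (sU i)).2).
  apply: le_Rintegral => //.
  - by under eq_fun do rewrite mulrDr; apply: integrD; [exact: ind_integr|apply: sq_integr; exact: (cutD _ sP).2].
  - by apply: iW; [exact: measurable_sball|apply: sub_sball => //; exact: ltW].
  move=> x _; rewrite indicE; have [/set_mem /andP[t1 t2]|_] := boolP (x \in cannulus _ _); last first.
    by rewrite mul0r mulr_ge0 ?total_energy_ge0// indicE.
  have Gx : G x by apply/andP; split; [exact: lt_le_trans t1|exact: le_lt_trans hi1].
  rewrite indicE mem_set ?mul1r; last exact: le_lt_trans hir.
  rewrite /total_energy; rewrite sE// cE// lerDl.
  by apply: mulr_ge0; [exact: sqr_ge0|apply: sumr_ge0 => j _; exact: sqr_ge0].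
have EW : \int[mu]_x (\1_(cannulus ((R1 / 2) ^+ 2) (R2 ^+ 2)) x * energy g0 g1 U P Q x) =
  \int[mu]_x (\1_(cannulus ((R1 / 2) ^+ 2) (R2 ^+ 2)) x * total_energy U P Q x).
  apply: eq_Rintegral => x _; rewrite indicE; have [/set_mem /andP[t1 t2]|_] := boolP (x \in _); last by rewrite !mul0r.
  have Gx : G x by apply/andP; split; [exact: lt_le_trans t1|exact: le_lt_trans c11].
  by rewrite /energy /total_energy !sE// cE.
have -> : 4 * (R1 / 4) ^+ 2 = (R1 / 2) ^+ 2 by field.
rewrite EW => H.
have lX : lower_energy g0 g1 U P ((R1 / 4) ^+ 2 / 4) (9 * (R1 / 4) ^+ 2) <= X by apply: lowW => //; exact: R1r.
have lY : lower_energy g0 g1 U P (R4 ^+ 2 / 4) (9 * R4 ^+ 2) <= Y by exact: lowW.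
(* The common factor R3^(- 2 be) of all weights cancels, leaving only ratios of radii. *)
have k0 : 0 < expR (- (2 * be * l3)) by exact: expR_gt0.
have kE y : expR (2 * be * (y - l3)) = expR (- (2 * be * l3)) * expR (2 * be * y) by rewrite -expRD; congr expR; ring.
have kE' y z : expR (2 * be * (y - l3 - z)) = expR (- (2 * be * l3)) * expR (2 * be * (y - z)) by rewrite -expRD; congr expR; ring.
move: H; rewrite !kE' kE => H.
have KE : 640 * be ^+ 2 * Cs ^+ 2 * (1 + 4 * n%:R * Cacc C0 Cs) = carleman_cst C0 Cs * be ^+ 2 by rewrite /carleman_cst; ring.
rewrite KE in H.
have K0 : 0 <= carleman_cst C0 Cs * be ^+ 2 by exact: mulr_ge0 (carleman_cst_ge0 C0 Cs) (sqr_ge0 be).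
rewrite -(ler_pM2l k0).
rewrite [leLHS](_ : _ = L R2 ^- 2 * (expR (- (2 * be * l3)) * expR (2 * be * (L R2 - ln (L R2)))) *
  \int[mu]_x (\1_(cannulus ((R1 / 2) ^+ 2) (R2 ^+ 2)) x * total_energy U P Q x)); last by ring.
apply: (le_trans H).
rewrite [leRHS](_ : _ = carleman_cst C0 Cs * be ^+ 2 *
  (L (R1 / 4) ^+ 2 * (expR (- (2 * be * l3)) * expR (2 * be * L (R1 / 4))) * X +
   L R4 ^+ 2 * (expR (- (2 * be * l3)) * expR (2 * be * (L R4 - ln (L R4)))) * Y)); last by rewrite /X /Y; ring.
apply: ler_wpM2l => //.
have pos (x y z : R) : 0 <= x ^+ 2 * (expR y * expR z) by rewrite -expRD mulr_ge0 ?expR_ge0 ?sqr_ge0.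
by apply: lerD; apply: ler_wpM2l.
Qed.

End carleman_stokes.

(** * Three balls *)

Section optimisation.
Context {R : realType}.

Lemma le_expR (x : R) : x <= expR x.
Proof. by apply: le_trans (expR_ge1Dx x); rewrite lerDr. Qed.

Lemma sqr_le_expR (x : R) : 0 <= x -> x ^+ 2 <= expR (2 * x).
Proof.
move=> x0; rewrite expRM_natl lerXn2r ?nnegrE ?expR_ge0//; exact: le_expR.
Qed.

(** The choice be = tau ln (Y / X) makes both terms equal to X^tau Y^(1 - tau). If this value is
    below 2, then X^tau Y^(1 - tau) = e^(- be) Y is comparable to Y >= T, at the cost of the factor
    e^2. *)
Lemma optimise (T X Y m C : R) : 0 <= T -> 0 <= X -> X <= Y -> T <= Y -> 0 < m -> 1 <= C ->
  (forall be : R, 2 <= be -> T <= C * (expR (be * m) * X + expR (- be) * Y)) ->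
  T <= 2 * expR 2 * C * X `^ (m + 1)^-1 * Y `^ (1 - (m + 1)^-1).
Proof.
move=> T0 X0 XY TY m0 C1 H; set tau := (m + 1)^-1.
have m10 : 0 < m + 1 by lra.
have tau0 : 0 < tau by rewrite invr_gt0.
have tau1 : tau < 1 by rewrite invf_lt1//; lra.
have Y0 : 0 <= Y by exact: le_trans XY.
have RHS0 : 0 <= 2 * expR 2 * C * X `^ tau * Y `^ (1 - tau).
  by rewrite !mulr_ge0 ?powR_ge0 ?expR_ge0//; lra.
(* If X = 0, letting be grow forces T = 0: for T > 0 the value 2 + C Y / T contradicts the
   hypothesis, through e^be >= 1 + be. *)
move: X0; rewrite le_eqVlt => /orP[/eqP X0|X0].
  suff : T <= 0 by move=> h; exact: le_trans RHS0.
  rewrite leNgt; apply/negP => Tp.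
  have q0 : 0 <= C * Y / T by rewrite divr_ge0// mulr_ge0//; lra.
  have := H (2 + C * Y / T); rewrite -X0 mulr0 add0r expRN => /(_ _)/wrap[]; first by lra.
  have e1 : 1 + (2 + C * Y / T) <= expR (2 + C * Y / T) by exact: expR_ge1Dx.
  have e0 : 0 < expR (2 + C * Y / T) by exact: expR_gt0.
  rewrite mulrCA mulrC ler_pdivlMr// leNgt => /negP; apply.
  have : T * (1 + (2 + C * Y / T)) <= T * expR (2 + C * Y / T) by rewrite ler_pM2l.
  have -> : T * (1 + (2 + C * Y / T)) = 3 * T + C * Y by field; exact: lt0r_neq0.
  lra.
have Yp : 0 < Y by exact: lt_le_trans XY.
pose be := tau * (ln Y - ln X).
have XE a : X `^ a = expR (a * ln X) by rewrite /powR (negbTE (lt0r_neq0 X0)).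
have YE a : Y `^ a = expR (a * ln Y) by rewrite /powR (negbTE (lt0r_neq0 Yp)).
have XX : X = expR (ln X) by rewrite lnK.
have YY : Y = expR (ln Y) by rewrite lnK.
have E : X `^ tau * Y `^ (1 - tau) = expR (- be) * Y.
  by rewrite XE YE [in RHS]YY -!expRD; congr expR; rewrite /be; ring.
rewrite -!mulrA E !mulrA.
have [be2|be2] := leP 2 be.
  apply: le_trans (H _ be2) _.
  have -> : expR (be * m) * X = expR (- be) * Y.
    rewrite [in LHS]XX [in RHS]YY -!expRD; congr expR; rewrite /be /tau.
    by field; exact: lt0r_neq0.
  have h1 : 1 <= expR 2 :> R by apply: le_trans (expR_ge1Dx 2); lra.
  have h2 : 0 <= 2 * (C * (expR (- be) * Y)) by rewrite !mulr_ge0 ?expR_ge0//; lra.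
  rewrite [leLHS](_ : _ = 2 * (C * (expR (- be) * Y))); last by ring.
  rewrite [leRHS](_ : _ = expR 2 * (2 * (C * (expR (- be) * Y)))); last by ring.
  exact: ler_peMl.
apply: (le_trans TY).
have h1 : 1 <= expR 2 * expR (- be) by rewrite -expRD; apply: (le_trans _ (expR_ge1Dx _)); lra.
have h2 : 1 <= 2 * C by lra.
have -> : 2 * expR 2 * C * expR (- be) * Y = ((2 * C) * (expR 2 * expR (- be))) * Y by ring.
by apply: ler_peMl => //; apply: (mulr_ege1 h2 h1).
Qed.

(** [l1], [l2], [l4] stand for ln (R3 / r) at r = R1, R2, R4. As l4 >= 4, the logarithms cost at
    most a quarter of the gap l2 - l4 >= 2, so the outer term decays like e^(- 3 be), of which e^(2
    be) pays for be^2. In 8 l1, one half comes from the weight and one half from the polynomial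
    factor be^2 (l1 + ln 4)^2. *)
Lemma carleman_exponents (l1 l2 l4 be K X Y Z : R) : 4 <= l4 -> l4 + 2 <= l2 -> l2 <= l1 -> 2 <= be ->
  0 <= K -> 0 <= X -> 0 <= Y ->
  l2 ^- 2 * expR (2 * be * (l2 - ln l2)) * Z <=
  K * be ^+ 2 * ((l1 + ln 4) ^+ 2 * expR (2 * be * (l1 + ln 4)) * X + l4 ^+ 2 * expR (2 * be * (l4 - ln l4)) * Y) ->
  Z <= K * l2 ^+ 2 * (1 + l4 ^+ 2) * (expR (be * (8 * l1)) * X + expR (- be) * Y).
Proof.
move=> l40 l42 l21 be2 K0 X0 Y0 H.
have l20 : 0 < l2 by lra.
pose e2 := expR (- (2 * be * (l2 - ln l2))).
have H1 : Z <= l2 ^+ 2 * e2 * (K * be ^+ 2 * ((l1 + ln 4) ^+ 2 * expR (2 * be * (l1 + ln 4)) * X + l4 ^+ 2 * expR (2 * be * (l4 - ln l4)) * Y)).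
  have c0 : 0 < l2 ^+ 2 * e2 by rewrite mulr_gt0 ?exprn_gt0 ?expR_gt0.
  rewrite -(ler_pM2l c0) in H; apply: le_trans H.
  rewrite /e2 expRN le_eqVlt; apply/orP; left; apply/eqP; field.
  by rewrite !lt0r_neq0// expR_gt0.
apply: (le_trans H1).
have ln4 : ln 4 <= 2 :> R.
  have -> : 4 = (1 + 1) * (1 + 1) :> R by ring.
  have h : ln (1 + 1) <= 1 :> R by apply: le_ln1Dx; lra.
  by rewrite lnM ?posrE; lra.
have ln40 : 0 <= ln 4 :> R by apply: ln_ge0; lra.
have lnl2 : ln l2 <= l2 - 1.
  have -> : ln l2 = ln (1 + (l2 - 1)) by congr ln; ring.
  by apply: le_ln1Dx; lra.
have be0 : 0 <= be by lra.
have A1 : be ^+ 2 * ((l1 + ln 4) ^+ 2 * (e2 * expR (2 * be * (l1 + ln 4)))) <= expR (be * (8 * l1)).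
  have a1 : e2 * expR (2 * be * (l1 + ln 4)) <= expR (4 * be * l1).
    by rewrite -expRD ler_expR; nra.
  have a2 : be ^+ 2 * (l1 + ln 4) ^+ 2 <= expR (4 * be * l1).
    have b0 : 0 <= be * (l1 + ln 4) by apply: mulr_ge0 => //; lra.
    rewrite -exprMn; apply: (le_trans (sqr_le_expR b0)); rewrite ler_expR; nra.
  have -> : be * (8 * l1) = 4 * be * l1 + 4 * be * l1 by ring.
  rewrite expRD mulrA; apply: ler_pM => //; first by rewrite mulr_ge0 ?sqr_ge0.
  by rewrite mulr_ge0 ?expR_ge0.
have A2 : be ^+ 2 * (e2 * expR (2 * be * (l4 - ln l4))) <= expR (- be).
  have d1 : ln l2 - ln l4 <= (l2 - l4) / l4 by apply: ln_diff; lra.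
  have d2 : (l2 - l4) / l4 <= (l2 - l4) / 4 by apply: ler_wpM2l; [lra|rewrite lef_pV2 ?posrE; lra].
  have a1 : e2 * expR (2 * be * (l4 - ln l4)) <= expR (- (3 * be)).
    by rewrite -expRD ler_expR; nra.
  have -> : - be = 2 * be + (- (3 * be)) by ring.
  rewrite expRD; apply: ler_pM => //; [exact: sqr_ge0|by rewrite mulr_ge0 ?expR_ge0|exact: sqr_le_expR].
have q0 : 0 <= K * l2 ^+ 2 by rewrite mulr_ge0 ?sqr_ge0.
rewrite [leLHS](_ : _ = K * l2 ^+ 2 * (be ^+ 2 * ((l1 + ln 4) ^+ 2 * (e2 * expR (2 * be * (l1 + ln 4)))) * X +
  l4 ^+ 2 * (be ^+ 2 * (e2 * expR (2 * be * (l4 - ln l4)))) * Y)); last by ring.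
rewrite -[leRHS]mulrA; apply: ler_wpM2l => //.
have B1 := ler_wpM2r X0 A1.
have B2 : l4 ^+ 2 * (be ^+ 2 * (e2 * expR (2 * be * (l4 - ln l4)))) * Y <= l4 ^+ 2 * (expR (- be) * Y).
  by rewrite -mulrA; apply: ler_wpM2l; [exact: sqr_ge0|exact: ler_wpM2r].
have p1 : 0 <= expR (be * (8 * l1)) * X by rewrite mulr_ge0 ?expR_ge0.
have p2 : 0 <= expR (- be) * Y by rewrite mulr_ge0 ?expR_ge0.
have p3 := sqr_ge0 l4.
apply: (le_trans (lerD B1 B2)); move: p1 p2 p3.
by move: (expR _ * X) (expR _ * Y) (l4 ^+ 2) => x y w; nra.
Qed.

(** R1 < e^-1 R3^2 means - ln R1 > 1 - 2 ln R3, whence 4 (- ln R1) <= 8 ln (R3 / R1) + 1 <= 9 (- ln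
    R1). *)
Lemma tau_asymptotics (R2 R3 : R) : 0 < R2 -> R2 < R3 -> R3 <= 1 ->
  exists c1 c2 r : R, [/\ 0 < c1, 0 < c2, 0 < r &
    forall R1, 0 < R1 -> R1 < R2 -> R1 < r ->
      c1 / - ln R1 <= (8 * (- ln (R1 / R3)) + 1)^-1 <= c2 / - ln R1].
Proof.
move=> R20 R23 R31; have R30 : 0 < R3 by lra.
exists 9^-1, 4^-1, (expR (- 1) * R3 ^+ 2); split; [lra|lra|by rewrite mulr_gt0 ?expR_gt0 ?exprn_gt0|].
move=> R1 R10 R12 R1r.
have h3 : ln R3 <= 0 by apply: ln_le0; lra.
have h1 : ln R1 <= - 1 + 2 * ln R3.
  have -> : - 1 + 2 * ln R3 = ln (expR (- 1) * R3 ^+ 2).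
    by rewrite lnM ?posrE ?expR_gt0 ?exprn_gt0// expRK lnXn// mulr_natl.
  by rewrite ler_ln ?posrE ?ltW// mulr_gt0 ?expR_gt0 ?exprn_gt0.
rewrite ln_div//.
have d0 : 0 < 8 * - (ln R1 - ln R3) + 1 by lra.
have p0 : 0 < - ln R1 by lra.
apply/andP; split.
  by rewrite -invfM lef_pV2 ?posrE ?mulr_gt0//; lra.
by rewrite -invfM lef_pV2 ?posrE ?mulr_gt0//; lra.
Qed.

End optimisation.

Section three_balls.
Context {R : realType} {n : nat}.
Local Notation mu := (@lebesgue_rV R n).
Local Notation sq := (@sq R n).
Local Notation carleman_cst := (@carleman_cst R n).

Lemma ln_outer_ratio (C : R) : 0 < C -> 4 <= - ln (outer_ratio C).
Proof.
move=> C0; rewrite /outer_ratio ln_div ?posrE ?expR_gt0// expRK.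
have : 0 <= ln 2 :> R by apply: ln_ge0; lra.
lra.
Qed.

(** The factor e^-2 is the gap of 2 between ln (R3 / R2) and ln (R3 / R4) that [carleman_exponents]
    asks for. *)
Definition inner_ratio (C : R) := expR (- 2) * outer_ratio C.

Lemma inner_ratio_itv (C : R) : 0 < C -> 0 < inner_ratio C < 1.
Proof.
move=> C0; rewrite /inner_ratio mulr_gt0 ?expR_gt0 ?outer_ratio_gt0//=.
rewrite -(lnK (outer_ratio_gt0 C)) -expRD -[ltRHS]expR0 ltr_expR.
have := ln_outer_ratio C0; lra.
Qed.

Lemma carleman_cst_mul_ge0 (C Cs l m : R) : 0 <= carleman_cst C Cs * l ^+ 2 * (1 + m ^+ 2).
Proof.
exact: (mulr_ge0 (mulr_ge0 (@carleman_cst_ge0 R n C Cs) (sqr_ge0 l)) (addr_ge0 ler01 (sqr_ge0 m))).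
Qed.

(** 2 e^2 comes from [optimise], the summand 1 from the part of the middle ball inside the small
    one, the rest from [carleman_exponents]; t is R2 / R3. *)
Definition three_balls_cst (C Cs t : R) :=
  2 * expR 2 * (1 + carleman_cst C Cs * (- ln t) ^+ 2 * (1 + (- ln (outer_ratio C)) ^+ 2)).

Lemma three_balls_cst_gt0 (C Cs t : R) : 0 < three_balls_cst C Cs t.
Proof.
rewrite mulr_gt0 ?mulr_gt0 ?expR_gt0// ltr_pwDl//; exact: carleman_cst_mul_ge0.
Qed.

Lemma indic_le_integr (A B : set 'rV[R]_n) f : A `<=` B -> (forall x, 0 <= f x) ->
  integr (fun x => \1_A x * f x) -> integr (fun x => \1_B x * f x) ->
  \int[mu]_x (\1_A x * f x) <= \int[mu]_x (\1_B x * f x).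
Proof.
move=> AB f0 iA iB; apply: le_Rintegral => // x _; apply: ler_wpM2r => //.
rewrite !indicE; have [/set_mem /AB h|_] := boolP (x \in A); last by case: (_ \in _).
by rewrite mem_set.
Qed.

Context (C0 Cs r0 : R) (C00 : 0 < C0) (Cs0 : 0 < Cs) (HCs : forall t, `|(@step R)^`()%classic t| <= Cs)
  (r00 : 0 < r0) (r01 : r0 <= 1).
Context (a U : 'I_n -> 'rV[R]_n -> R) (V : 'I_n -> 'I_n -> 'rV[R]_n -> R) (P : 'rV[R]_n -> R) (Q : 'I_n -> 'rV[R]_n -> R).
Hypotheses (ma : forall j, measurable_fun [set: 'rV[R]_n] (a j))
  (sU : forall i, sqint (fun x => \1_(sball r0) x * U i x)) (sV : forall i j, sqint (fun x => \1_(sball r0) x * V i j x))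
  (sP : sqint (fun x => \1_(sball r0) x * P x)) (sQ : forall j, sqint (fun x => \1_(sball r0) x * Q j x))
  (HS : weak_stokes (sball r0) U V (fun i x => \sum_j a j x * V i j x) P Q)
  (Ha : {ae mu, forall x, sball r0 x -> x != 0 -> enorm x != 1 ->
     \sum_j a j x ^+ 2 <= (C0 * `|ln (enorm x)| ^- 3 * (enorm x)^-1) ^+ 2}).

Local Notation ball_energy r := (\int[mu]_x (\1_(sball r) x * total_energy U P Q x)).

Lemma three_balls_real (R1 R2 R3 : R) : 0 < R1 -> R1 < R2 -> R2 < R3 -> R3 <= r0 -> R2 / R3 < inner_ratio C0 ->
  ball_energy R2 <= three_balls_cst C0 Cs (R2 / R3) * ball_energy R1 `^ (8 * (- ln (R1 / R3)) + 1)^-1 *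
    ball_energy R3 `^ (1 - (8 * (- ln (R1 / R3)) + 1)^-1).
Proof.
move=> R10 R12 R23 R3r t1; have c0 := C00.
have R20 : 0 < R2 by lra.
have R30 : 0 < R3 by lra.
have or0 := outer_ratio_gt0 C0.
have W0 x : 0 <= total_energy U P Q x by exact: total_energy_ge0.
have iW A : measurable A -> A `<=` sball r0 -> integr (fun x => \1_A x * total_energy U P Q x).
  exact: total_energy_integr sU sP sQ A.
have iB r : 0 < r -> r <= r0 -> integr (fun x => \1_(sball r) x * total_energy U P Q x).
  by move=> r_gt0 rr; apply: iW; [exact: measurable_sball|apply: sub_sball => //; exact: ltW].
have B0 r : 0 <= ball_energy r by apply: Rintegral_ge0 => x _; rewrite mulr_ge0// indicE.
have Bm r s : 0 < r -> r <= s -> s <= r0 -> ball_energy r <= ball_energy s.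
  move=> r_gt0 rs sr; apply: indic_le_integr => //; [by apply: sub_sball => //; exact: ltW| |].
    by apply: iB => //; exact: le_trans sr.
  by apply: iB => //; exact: lt_le_trans rs.
have R2r : R2 <= r0 by lra.
have R1r : R1 <= r0 by lra.
have R12sqr : (R1 / 2) ^+ 2 <= R1 ^+ 2 by nra.
have R2sqr : R2 ^+ 2 < r0 ^+ 2 by rewrite ltr_pXn2r ?nnegrE//; lra.
have l1E : - ln (R1 / R3) = ln R3 - ln R1 by rewrite ln_div//; ring.
have l2E : - ln (R2 / R3) = ln R3 - ln R2 by rewrite ln_div//; ring.
have R24 : R2 < expR (- 2) * (outer_ratio C0 * R3) by rewrite mulrA -ltr_pdivrMr.
have o3 : 0 < outer_ratio C0 * R3 by exact: mulr_gt0.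
have e2 : expR (- 2) <= 1 :> R by rewrite -[leRHS]expR0 ler_expR; lra.
have R24' : R2 <= outer_ratio C0 * R3 by nra.
have l4E : ln R3 - ln (outer_ratio C0 * R3) = - ln (outer_ratio C0) by rewrite lnM//; ring.
have l4 := ln_outer_ratio C00.
have l42 : - ln (outer_ratio C0) + 2 <= - ln (R2 / R3).
  have : ln R2 <= ln (expR (- 2) * (outer_ratio C0 * R3)) by rewrite ler_ln ?posrE ?mulr_gt0 ?expR_gt0 ?ltW.
  rewrite lnM ?posrE ?expR_gt0// expRK l2E; lra.
have l21 : - ln (R2 / R3) <= - ln (R1 / R3).
  by rewrite lerN2 ler_ln ?posrE ?divr_gt0// ler_pM2r ?invr_gt0// ltW.
rewrite l1E; apply: optimise => //.
- by apply: Bm => //; lra.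
- by apply: Bm => //; lra.
- by rewrite -l1E; lra.
- by rewrite lerDl; exact: carleman_cst_mul_ge0.
move=> be be2.
have exp_ge0 : 0 <= be * (8 * - ln (R1 / R3)) by apply: mulr_ge0; lra.
pose Z := \int[mu]_x (\1_(cannulus ((R1 / 2) ^+ 2) (R2 ^+ 2)) x * total_energy U P Q x).
have iZ : integr (fun x => \1_(cannulus ((R1 / 2) ^+ 2) (R2 ^+ 2)) x * total_energy U P Q x).
  apply: iW; first exact: measurable_cannulus.
  by move=> x /andP[_ h]; exact: le_lt_trans h _.
have := carleman_stokes C00 Cs0 HCs r00 r01 ma sU sV sP sQ HS Ha R10 R12 R24' (le_trans (ltW R12) R24') R3r be2.
rewrite /= -/Z l4E -l2E.
have -> : ln R3 - ln (R1 / 4) = (ln R3 - ln R1) + ln 4 by rewrite (ln_div R10 (ltr0Sn R 3)) opprB addrA addrAC.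
rewrite -l1E => H.
have hZ := carleman_exponents l4 l42 l21 be2 (@carleman_cst_ge0 R n C0 Cs) (B0 R1) (B0 R3) H.
(* The Carleman estimate covers R1/2 <= |x| <= R2; the rest of the ball lies in the ball of radius
   R1. *)
have TZ : ball_energy R2 <= ball_energy R1 + Z.
  rewrite /Z -RintegralD//; last exact: iB.
  apply: le_Rintegral => //; [exact: iB|by apply: integrD => //; exact: iB|] => x _.
  rewrite -mulrDl; apply: ler_wpM2r => //; rewrite !indicE.
  have [/set_mem h2|_] := boolP (x \in sball R2); last by rewrite addr_ge0.
  have [_|h1] := boolP (x \in sball R1); first by rewrite lerDl.
  suff h : cannulus ((R1 / 2) ^+ 2) (R2 ^+ 2) x by rewrite (mem_set h) lerDr.
  have h3 : R1 ^+ 2 <= sq x by rewrite leNgt; apply/negP => h3; move/negP: h1; apply; exact: mem_set.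
  by apply/andP; split; [exact: le_trans h3|exact: ltW].
apply: (le_trans TZ).
set K := carleman_cst C0 Cs * _ * _ in hZ *.
have K0 : 0 <= K by exact: carleman_cst_mul_ge0.
have b0 : 0 <= ball_energy R1 := B0 R1.
have x1 : ball_energy R1 <= expR (be * (8 * - ln (R1 / R3))) * ball_energy R1.
  by apply: ler_peMl => //; rewrite -[leLHS]expR0 ler_expR.
have y1 : 0 <= expR (- be) * ball_energy R3 by rewrite mulr_ge0 ?expR_ge0.
rewrite mulrDl mul1r; apply: lerD => //.
by apply: (le_trans x1); rewrite lerDl.
Qed.

End three_balls.

(** * From representatives back to the integrals of the statement *)

Section stokes_energy.
Context {R : realType} {n : nat}.
Local Notation mu := (@lebesgue_rV R n).

Lemma stokesU_sqr (u : 'rV[R]_n -> 'rV[R]_n) p Dp x : `|stokesU u p Dp x| ^+ 2 =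
  total_energy (fun i y => u y ord0 i) p (fun i y => Dp y ord0 i) x.
Proof.
rewrite real_normK ?num_real// /stokesU sqr_sqrtr.
  rewrite !enorm_sqr real_normK ?num_real// /total_energy (_ : enorm x ^+ 4 = sq x ^+ 2); first by rewrite addrC addrA addrAC.
  by rewrite -enorm_sqr -exprM.
by rewrite addr_ge0 ?sqr_ge0// addr_ge0// mulr_ge0 ?sqr_ge0 ?exprn_ge0 ?enorm_ge0.
Qed.

Lemma integral_ball_energy (r : R) f (g : 'rV[R]_n -> R) : 0 < r -> integr (fun x => \1_(sball r) x * g x) ->
  {ae mu, forall x, sball r x -> f x = g x} ->
  (\int[mu]_(x in eball r) (f x)%:E = (\int[mu]_x (\1_(sball r) x * g x)%R)%:E)%E.
Proof.
move=> r0 ig fg; rewrite eballE//.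
rewrite (@ae_integral _ _ _ _ _ _ (EFin \o g)); last first.
  by move: fg; apply: filterS => x H /H /= ->.
rewrite integral_mkcond /Rintegral fineK; last exact: integrable_fin_num ig.
apply: eq_integral => x _; rewrite patchE /= indicE; case: (_ \in _); first by rewrite mul1r.
by rewrite mul0r.
Qed.

End stokes_energy.
Theorem theorem1p1 (R : realType) (n : nat) (C0 : R) (hn : (2 <= n)%N)
    (hC0 : 0 < C0) :
  exists (Rt : R) (C : R -> R) (tau : R -> R -> R),
  [/\ 0 < Rt < 1,
      (forall t, 0 < t < Rt -> 0 < C t),
      (forall s t, 0 < s -> s < t < Rt -> 0 < tau s t < 1),
      (forall (Omega : set 'rV[R]_n) (A : 'rV[R]_n -> 'rV[R]_n) (R0 : R),
        open Omega -> connected Omega -> Omega 0 ->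
        0 < R0 <= 1 -> eball R0 `<=` Omega ->
        (forall i, lebesgue_measurable Omega (fun x => A x ord0 i)) ->
        (* the bound is void at |x| = 0 and |x| = 1, where it reads +oo *)
        (forall x, Omega x -> x != 0 -> enorm x != 1 ->
          enorm (A x) <= C0 * `|ln (enorm x)| ^- 3 * (enorm x)^-1) ->
        forall R1 R2 R3 : R, 0 < R1 -> R1 < R2 -> R2 < R3 -> R3 <= R0 ->
        R1 / R3 < R2 / R3 < Rt ->
        forall (u : 'rV[R]_n -> 'rV[R]_n) (p : 'rV[R]_n -> R),
        (forall i, H1 (eball R0) (fun x => u x ord0 i)) ->
        H1 (eball R0) p ->
        stokes (eball R0) A u p ->
        forall Dp : 'rV[R]_n -> 'rV[R]_n, weak_gradient (eball R0) p Dp ->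
        let U := stokesU u p Dp in
        let c := C (R2 / R3) in
        let theta := tau (R1 / R3) (R2 / R3) in
        (\int[lebesgue_rV n]_(x in eball R2) (`|U x| ^+ 2)%:E <=
         c%:E *
         (\int[lebesgue_rV n]_(x in eball R1) (`|U x| ^+ 2)%:E) `^ theta *
         (\int[lebesgue_rV n]_(x in eball R3) (`|U x| ^+ 2)%:E)
           `^ (1 - theta))%E) &
      (forall R2 R3 : R, 0 < R2 -> R2 < R3 -> R3 <= 1 -> R2 / R3 < Rt ->
        exists c1 c2 r : R, [/\ 0 < c1, 0 < c2, 0 < r &
          forall R1, 0 < R1 -> R1 < R2 -> R1 < r ->
            c1 / - ln R1 <= tau (R1 / R3) (R2 / R3) <= c2 / - ln R1])].
Proof.
(* A bound on the derivative of the fixed function [step], hence an absolute constant. *)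
have [Cs Cs0 HCs] := @dstep_bound R.
exists (inner_ratio C0), (@three_balls_cst R n C0 Cs), (fun s _ => (8 * (- ln s) + 1)^-1); split.
- exact: inner_ratio_itv.
- by move=> t _; exact: three_balls_cst_gt0.
- move=> s t s0 /andP[st tR]; have /andP[_ R1] := inner_ratio_itv hC0.
  have : ln s < 0 by rewrite -ln1 ltr_ln ?posrE//; lra.
  by move=> ls; rewrite invr_gt0 invf_lt1; [apply/andP; split; lra|lra].
- move=> Omega A R0 oO cO O0 /andP[R00 R01] BO mA hA R1 R2 R3 R10 R12 R23 R3R0 /andP[_ tR] u p hu hp st Dp wDp; cbv zeta.
  rewrite eballE// in BO hu hp st wDp.
  have mA' i : lebesgue_measurable (sball R0) (fun x => A x ord0 i) by exact: lebesgue_measurable_sub (mA i).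
  have [a [U' [V [P [Q [[ma mU mV mP mQ] [sU sV sP sQ] ae HS]]]]]] := stokes_rep R00 mA' hu hp st wDp.
  have Ha : {ae lebesgue_rV n, forall x, sball R0 x -> x != 0 -> enorm x != 1 ->
     \sum_j a j x ^+ 2 <= (C0 * `|ln (enorm x)| ^- 3 * (enorm x)^-1) ^+ 2}.
    move: ae; apply: filterS => x H Bx x0 x1; have [Aa _ _ _] := H Bx.
    under eq_bigr do rewrite -Aa; rewrite -/(sq (A x)) -enorm_sqr lerXn2r ?nnegrE ?enorm_ge0//.
      by rewrite !mulr_ge0 ?invr_ge0 ?exprn_ge0 ?enorm_ge0// ltW.
    by apply: hA => //; exact: BO.
  (* The three integrals are finite, so the inequality between extended reals becomes the real one
     of [three_balls_real]. *)
  have iE r : 0 < r -> r <= R0 -> (\int[lebesgue_rV n]_(x in eball r) (`|stokesU u p Dp x| ^+ 2)%:E =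
      (\int[lebesgue_rV n]_x (\1_(sball r) x * total_energy U' P Q x)%R)%:E)%E.
    move=> r0 rR; have BB : sball r `<=` (sball R0 : set 'rV[R]_n) by apply: sub_sball => //; exact: ltW.
    apply: integral_ball_energy => //.
      by apply: (total_energy_integr sU sP sQ) => //; exact: measurable_sball.
    move: ae; apply: filterS => x H /BB /H[_ hu' hp' hq']; rewrite stokesU_sqr /total_energy hp'.
    by congr (_ + _ + _ * _); apply: eq_bigr => i _; rewrite ?hu' ?hq'.
  rewrite (iE R1)// ?(iE R2)// ?(iE R3)//; first last.
  - by lra.
  - by lra.
  - by lra.
  - by lra.
  rewrite !poweR_EFin -!EFinM lee_fin.
  exact: (three_balls_real hC0 Cs0 HCs R00 R01 ma sU sV sP sQ HS Ha).
- by move=> R2 R3 R20 R23 R31 _; exact: tau_asymptotics.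
Qed.
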